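(* Let $K$ be an $R$-ball convex body in $\mathbb{R}^n$. Let $f:K\to\mathbb{R}$ be a continuous function such that $f\ge c$ on $K$, where $c>0$ is a constant. Then $$\lim_{\delta\to0}\frac{\mathrm{vol}_n(K)-\mathrm{vol}_n(F_R(K,f,\delta))}{\delta^{\frac{2}{n+1}}}=c_n\int_{\partial K}(f(x))^{-\frac{2}{n+1}}\prod_{i=1}^{n-1}\left(\kappa_i(K,x)-\frac1R\right)^{\frac{1}{n+1}}d\mu_K(x),$$ where $c_n=\frac12\left(\frac{n+1}{\mathrm{vol}_{n-1}(B^{n-1}_2)}\right)^{\frac{2}{n+1}}$.
   Context: A convex body in $\mathbb{R}^n$ is a compact convex set with nonempty interior; $B^n_2$ is the closed Euclidean unit ball of $\mathbb{R}^n$. For $R>0$, a convex body $K$ is $R$-ball convex if $K=\bigcap_{K\subset RB^n_2+x}(RB^n_2+x)$, i.e. it is the intersection of all closed balls of radius $R$ containing it. For $x\in\partial K$, $\kappa_i(K,x)$, $1\le i\le n-1$, are the principal curvatures (which exist almost everywhere on $\partial K$), and $\mu_K$ is the surface area measure on $\partial K$. For $\delta\ge0$ and an integrable strictly positive $f:K\to\mathbb{R}$, the weighted $R$-ball floating body is $$F_R(K,f,\delta)=\bigcap_{\int_{K\setminus(RB^n_2+x)}f\,dm\le\delta}(RB^n_2+x),$$ the intersection over all $x\in\mathbb{R}^n$ satisfying the indicated condition, where $m$ is Lebesgue measure. The limit is taken as $\delta\to0$ with $\delta>0$. *)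

(* Defs.v *)
From HB Require Import structures.
From mathcomp Require Import all_boot all_order all_algebra.
From mathcomp Require Import all_classical all_reals all_analysis.

Set Implicit Arguments.
Unset Strict Implicit.
Unset Printing Implicit Defensive.

Import Order.TTheory GRing.Theory Num.Theory.
Import numFieldNormedType.Exports.

Local Open Scope classical_set_scope.
Local Open Scope ring_scope.

(* R^n is 'rV[R]_n. Its library norm is the sup norm, so the Euclidean norm
   is defined here; both induce the same topology. *)
Definition enorm (R : realType) n (x : 'rV[R]_n) : R :=
  Num.sqrt (\sum_(i < n) x 0 i ^+ 2).

Definition eball (R : realType) n (x : 'rV[R]_n) (r : R) : set 'rV[R]_n :=
  [set y | enorm (y - x) <= r].

Definition convex_body (R : realType) n (K : set 'rV[R]_n) : Prop :=
  [/\ compact K, convex_set K & K° !=set0].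

Definition boundary (T : topologicalType) (A : set T) : set T :=
  closure A `\` A°.

(* The library's mu_ext mu X is the infimum of \sum_k mu (A k) over the
   sequences of measurable sets A covering X. Declaring every set measurable
   makes arbitrary sets available for the coverings. *)
Definition discrete_type (T : Type) : Type := T.

HB.instance Definition _ (T : pointedType) := Pointed.on (discrete_type T).
HB.instance Definition _ (T : pointedType) :=
  @isMeasurable.Build default_measure_display (discrete_type T)
    discrete_measurable discrete_measurable0
    discrete_measurableC discrete_measurableU.

Section lebesgue.
Variables (R : realType) (n : nat).
Local Open Scope ereal_scope.

Definition box (a b : 'rV[R]_n) : set 'rV[R]_n :=
  [set x | forall i, (a 0 i <= x 0 i <= b 0 i)%R].

(* Volume of the smallest box containing A. The empty set is treated apart
   because in dimension 0 the only box is a point, of volume 1. *)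
Definition box_gauge (A : set 'rV[R]_n) : \bar R :=
  if A == set0 then 0 else
  ereal_inf [set (\prod_(i < n) (ab.2 0%R i - ab.1 0%R i))%R%:E
            | ab in [set ab : 'rV[R]_n * 'rV[R]_n | A `<=` box ab.1 ab.2]].

Lemma box_gauge0 : box_gauge set0 = 0.
Proof. by rewrite /box_gauge eqxx. Qed.

Lemma box_gauge_ge0 A : 0 <= box_gauge A.
Proof.
rewrite /box_gauge; case: ifPn => // /set0P[x Ax].
apply: le_ereal_inf_tmp => _ [[a b] /= Aab <-].
rewrite lee_fin; apply: prodr_ge0 => i _.
by have /andP[ax xb] := Aab _ Ax i; rewrite subr_ge0 (le_trans ax xb).
Qed.

Definition lebesgue_outer (X : set 'rV[R]_n) : \bar R :=
  @mu_ext _ (discrete_type 'rV[R]_n) R box_gauge X.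

Lemma lebesgue_outer0 : lebesgue_outer set0 = 0.
Proof.
exact: (@mu_ext0 _ (discrete_type _) _ _ box_gauge0 box_gauge_ge0).
Qed.

Lemma lebesgue_outer_ge0 X : 0 <= lebesgue_outer X.
Proof. exact: (@mu_ext_ge0 _ (discrete_type _) _ _ box_gauge_ge0). Qed.

Lemma le_lebesgue_outer : {homo lebesgue_outer : A B / A `<=` B >-> A <= B}.
Proof. exact: (@le_mu_ext _ (discrete_type _) _ box_gauge). Qed.

Lemma lebesgue_outer_sigma_subadditive : sigma_subadditive lebesgue_outer.
Proof.
exact: (@mu_ext_sigma_subadditive _ (discrete_type _) _ _ box_gauge_ge0).
Qed.

HB.instance Definition _ := isOuterMeasure.Build R _ lebesgue_outer
  lebesgue_outer0 lebesgue_outer_ge0 le_lebesgue_outer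
  lebesgue_outer_sigma_subadditive.

(* n-dimensional Lebesgue measure, on the Lebesgue-measurable sets. *)
Definition lebesgue_n (A : set (caratheodory_type lebesgue_outer)) : \bar R :=
  lebesgue_outer A.

HB.instance Definition _ := isMeasure.Build _ _ _ lebesgue_n
  (@caratheodory_measure0 _ _ lebesgue_outer)
  (@caratheodory_measure_ge0 _ _ lebesgue_outer)
  (@caratheodory_measure_sigma_additive _ _ lebesgue_outer).

End lebesgue.

Definition vol (R : realType) n (A : set 'rV[R]_n) : R :=
  fine (lebesgue_n A).

Section hausdorff.
Variables (R : realType) (n s : nat).
Local Open Scope ereal_scope.

Definition diam (A : set 'rV[R]_n) : \bar R :=
  ereal_sup [set (enorm (x - y))%:E | x in A & y in A].

Definition hausdorff_gauge (e : R) (A : set 'rV[R]_n) : \bar R :=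
  if A == set0 then 0
  else if diam A <= e%:E
       then (vol (@eball R s 0 1) * (fine (diam A) / 2) ^+ s)%R%:E
       else +oo.

Definition hausdorff_pre (e : R) (X : set 'rV[R]_n) : \bar R :=
  @mu_ext _ (discrete_type 'rV[R]_n) R (hausdorff_gauge e) X.

Definition hausdorff_outer (X : set 'rV[R]_n) : \bar R :=
  ereal_sup [set hausdorff_pre e X | e in [set e : R | (0 < e)%R]].

Lemma hausdorff_gauge0 e : hausdorff_gauge e set0 = 0.
Proof. by rewrite /hausdorff_gauge eqxx. Qed.

Lemma hausdorff_gauge_ge0 e A : 0 <= hausdorff_gauge e A.
Proof.
rewrite /hausdorff_gauge; case: ifPn => // /set0P[x Ax].
case: ifPn => // _; rewrite lee_fin mulr_ge0//.
  by rewrite fine_ge0//; exact: outer_measure_ge0.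
rewrite exprn_ge0// divr_ge0// fine_ge0//; apply: ereal_sup_ge.
exists (enorm (x - x))%:E; first by exists x => //; exists x.
by rewrite lee_fin sqrtr_ge0.
Qed.

Lemma hausdorff_outer0 : hausdorff_outer set0 = 0.
Proof.
rewrite /hausdorff_outer (_ : [set _ | _ in _] = [set 0]) ?ereal_sup1//.
have pre0 e : hausdorff_pre e set0 = 0.
  apply: (@mu_ext0 _ (discrete_type 'rV[R]_n)).
    exact: hausdorff_gauge0.
  exact: hausdorff_gauge_ge0.
apply/seteqP; split => [_ [e _ <-]|_ ->]; first exact: pre0.
by exists 1%R => /=; [exact: ltr01|exact: pre0].
Qed.

Lemma hausdorff_outer_ge0 X : 0 <= hausdorff_outer X.
Proof.
apply: ereal_sup_ge; exists (hausdorff_pre 1 X).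
  by exists 1%R => //=; exact: ltr01.
exact: (@mu_ext_ge0 _ (discrete_type _) _ _ (hausdorff_gauge_ge0 1)).
Qed.

Lemma le_hausdorff_outer :
  {homo hausdorff_outer : A B / A `<=` B >-> A <= B}.
Proof.
move=> A B AB; apply: ge_ereal_sup => _ [e e0 <-].
apply: ereal_sup_ge; exists (hausdorff_pre e B); first by exists e.
exact: (@le_mu_ext _ (discrete_type _) _ (hausdorff_gauge e)).
Qed.

Lemma hausdorff_outer_sigma_subadditive : sigma_subadditive hausdorff_outer.
Proof.
move=> F; apply: ge_ereal_sup => _ [e e0 <-].
apply: (@le_trans _ _ (\sum_(i <oo) hausdorff_pre e (F i))).
  exact: (@mu_ext_sigma_subadditive _ (discrete_type _) _ _
    (hausdorff_gauge_ge0 e)).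
apply: lee_nneseries => i _.
  move=> _.
  exact: (@mu_ext_ge0 _ (discrete_type _) _ _ (hausdorff_gauge_ge0 e)).
by apply: ereal_sup_ubound; exists e.
Qed.

HB.instance Definition _ := isOuterMeasure.Build R _ hausdorff_outer
  hausdorff_outer0 hausdorff_outer_ge0 le_hausdorff_outer
  hausdorff_outer_sigma_subadditive.

(* s-dimensional Hausdorff measure on R^n, normalised to agree with Lebesgue
   measure on R^s. The surface area measure of a body K in R^n is the
   restriction of hausdorff with s = n.-1 to the boundary of K. *)
Definition hausdorff (A : set (caratheodory_type hausdorff_outer)) : \bar R :=
  hausdorff_outer A.

HB.instance Definition _ := isMeasure.Build _ _ _ hausdorff
  (@caratheodory_measure0 _ _ hausdorff_outer)
  (@caratheodory_measure_ge0 _ _ hausdorff_outer)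
  (@caratheodory_measure_sigma_additive _ _ hausdorff_outer).

End hausdorff.

Section ball_bodies.
Variables (R : realType) (n : nat).
Implicit Types (K : set 'rV[R]_n) (r : R).

Definition ball_convex r K : Prop :=
  K = \bigcap_(x in [set x | K `<=` eball x r]) eball x r.

Definition floating_body r K (f : 'rV[R]_n -> R) (delta : R) : set 'rV[R]_n :=
  \bigcap_(x in [set x |
      (\int[@lebesgue_n R n]_(y in K `\` eball x r) (f y)%:E <= delta%:E)%E])
    eball x r.

(* Generalised principal curvatures at x: in an orthonormal frame made of an
   outer unit normal u and the rows of E, K is near x the region below (with
   respect to u) a graph over the tangent hyperplane, of depth
   g y = 1/2 y A y^T + o(|y|^2). The principal curvatures k are the eigenvalues
   of the second fundamental form A, with multiplicity; they are determined up
   to order. Almost every boundary point of a convex body is of this type. *)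
Definition is_principal_curvatures K (x : 'rV[R]_n) (k : 'rV[R]_n.-1) : Prop :=
  exists (u : 'rV[R]_n) (E : 'M[R]_(n.-1, n)) (A : 'M[R]_n.-1)
         (g : 'rV[R]_n.-1 -> R),
    [/\ [/\ u *m u^T = 1%:M, E *m E^T = 1%:M & E *m u^T = 0],
        exists2 e : R, 0 < e & forall (y : 'rV[R]_n.-1) (t : R),
          enorm y < e -> `|t| < e -> K (x + y *m E - t *: u) <-> g y <= t,
        forall e : R, 0 < e -> \forall y \near (0 : 'rV[R]_n.-1),
          `|g y - 2^-1 * (y *m A *m y^T) 0 0| <= e * enorm y ^+ 2,
        A^T = A
      & char_poly A = \prod_(i < n.-1) ('X - (k 0 i)%:P)].

(* An arbitrary ordering is chosen; the value is 0 at the (negligible) boundary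
   points without principal curvatures. *)
Definition principal_curvatures K (x : 'rV[R]_n) : 'rV[R]_n.-1 :=
  xget 0 [set k | is_principal_curvatures K x k].

End ball_bodies.

(* Main.v *)
(* Translate an interior point of K to the origin and let j, jF be the gauges of
   K and of its floating body F.  In polar form
     vol K - vol F = \int_{j <= 1} (1 - (j / jF)^n),
   and 1 - 1 / jF(X) is the relative depth at which F is met on the ray through
   the boundary point X.

   By Alexandrov's theorem j has a second-order expansion almost everywhere.  Let
   goods c be the closed set of points where a paraboloid of opening c touches j
   from above.  The gradient of j is Lipschitz on goods c, so Rademacher's theorem
   for a Lipschitz extension differentiates it.  If y maximises j y - c |y - v|^2
   then y is in goods c and v is within O(1 / c) of y; since y determines v by a
   contraction, goods c omits from a ball only a set of measure O(1 / c).  At a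
   point with a second-order expansion, K lies between two osculating
   paraboloids; a ball of radius r missing a point q removes from K a cap between
   two paraboloid slices of principal curvatures k_i - 1/r, whose volume gives
   the limit of the depth divided by delta^(2/(n+1)).

   If X admits a paraboloid of opening c the rescaled depth is at most
   C c^((n-1)/(n+1)), which is integrable since goods omits only O(1 / c), so
   dominated convergence applies.  Finally the cone formula
     \int_{boundary K} g dH = n \int_{j <= 1} g(y / j y) |grad j| dy
   turns the limit into the surface integral. *)
From HB Require Import structures.
Require Import Defs.
From mathcomp Require Import all_boot all_order all_algebra.
From mathcomp Require Import all_classical all_reals all_analysis measurable_realfun.
From mathcomp Require Import ring lra.

Set Implicit Arguments.
Unset Strict Implicit.
Unset Printing Implicit Defensive.

Import Order.TTheory GRing.Theory Num.Theory.
Import numFieldNormedType.Exports.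

Local Open Scope classical_set_scope.
Local Open Scope ring_scope.

(** * Lebesgue measure and Borel sets *)

(** The delicate object is the removed cap. A point belongs to the floating body when every ball of
    radius r missing it removes weight more than delta, and such a ball may meet the normal at any
    angle; tilting is harmless only after the fibres over y and - y are added ([half],
    [tilted_cap]). For the opposite bound one ball suffices, the touching one pushed inwards, but
    ball convexity must exclude that it also removes far points of K ([arc_strict], [far_excluded]).
    Writing delta = d^(n+1) makes depths of order d^2, and comparing squares of volumes keeps the
    eigenvalues rational, so that no roots are perturbed. The exponent (n-1)/(n+1) of the opening is
    below 1, which is exactly what an O(1/c) bound on the exceptional sets can integrate. All
    measures come from coverings, so the normalisation of Hausdorff measure has to be earned: in top
    dimension it equals Lebesgue measure by the isodiametric inequality. Curvatures are picked by
    choice; the measurability of the integrand comes only from almost everywhere equality with an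
    upper limit of Borel functions, and completeness. *)

Section borel.
Context {R : realType}.
Local Open Scope ereal_scope.

Lemma box_gauge_le n (A : set 'rV[R]_n) a b :
  A `<=` box a b -> (forall i, (a 0%R i <= b 0%R i)%R) ->
  box_gauge A <= (\prod_(i < n) (b 0%R i - a 0%R i))%R%:E.
Proof.
move=> Aab ab; rewrite /box_gauge; case: ifPn => A0.
  by rewrite lee_fin prodr_ge0// => i _; rewrite subr_ge0.
by apply: ereal_inf_lbound; exists (a, b).
Qed.

(** Cutting a box by the hyperplane [x 0 i = c] gives two boxes whose volumes add up. [H] may be any
    set between the open and the closed half-space, so strict and large inequalities are treated at
    once. *)
Lemma box_gauge_split n (A H : set 'rV[R]_n) i c :
  (forall x, H x -> (x 0 i <= c)%R) -> (forall x, ~ H x -> (c <= x 0 i)%R) ->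
  box_gauge (A `&` H) + box_gauge (A `&` ~` H) <= box_gauge A.
Proof.
move=> H1 H2; have [->|/set0P A0] := eqVneq A set0.
  by rewrite !set0I box_gauge0 adde0.
rewrite [leRHS]/box_gauge; case: ifPn => [/eqP A00|_].
  by move: A0; rewrite A00 => -[].
apply: le_ereal_inf_tmp => _ [[a b] /= Aab <-].
have ab k : (a 0%R k <= b 0%R k)%R.
  by case: A0 => x /Aab/(_ k)/andP[]; exact: le_trans.
have [ca|ac] := ltP c (a 0%R i).
  rewrite (_ : A `&` H = set0) ?box_gauge0 ?add0e.
    by apply: box_gauge_le => // x [/Aab].
  apply/seteqP; split => // x [/Aab/(_ i)/andP[+ _] /H1 xc] => /le_trans/(_ xc).
  by rewrite leNgt ca.
have [bc|cb] := ltP (b 0%R i) c.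
  rewrite (_ : A `&` ~` H = set0) ?box_gauge0 ?adde0.
    by apply: box_gauge_le => // x [/Aab].
  apply/seteqP; split => // x [/Aab/(_ i)/andP[_ +] /H2 xc] => /(le_trans xc).
  by rewrite leNgt bc.
pose b' := \row_k (if k == i then c else b 0%R k).
pose a' := \row_k (if k == i then c else a 0%R k).
have h1 : box_gauge (A `&` H) <= (\prod_(k < n) (b' 0%R k - a 0%R k))%R%:E.
  apply: box_gauge_le => [x [/Aab xab /H1 xc] k|k]; rewrite mxE;
    case: eqP => // ->//.
  by have /andP[-> _] := xab i; rewrite xc.
have h2 : box_gauge (A `&` ~` H) <= (\prod_(k < n) (b 0%R k - a' 0%R k))%R%:E.
  apply: box_gauge_le => [x [/Aab xab /H2 xc] k|k]; rewrite mxE;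
    case: eqP => // ->//.
  by have /andP[_ ->] := xab i; rewrite xc.
apply: (le_trans (leeD h1 h2)); rewrite -EFinD lee_fin le_eqVlt.
apply/orP; left; apply/eqP; rewrite (bigD1 i)//= [X in (_ + X)%R](bigD1 i)//= [RHS](bigD1 i)//= !mxE eqxx.
have -> : (\prod_(k < n | k != i) (b' 0%R k - a 0%R k) =
    \prod_(k < n | k != i) (b 0%R k - a 0%R k))%R.
  by apply: eq_bigr => k ki; rewrite mxE (negbTE ki).
have -> : (\prod_(k < n | k != i) (b 0%R k - a' 0%R k) =
    \prod_(k < n | k != i) (b 0%R k - a 0%R k))%R.
  by apply: eq_bigr => k ki; rewrite mxE (negbTE ki).
by ring.
Qed.

Notation mu n := (@lebesgue_outer R n).

Lemma lebesgue_outer_le n (A : set 'rV[R]_n) (C : (set 'rV[R]_n)^nat) :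
  A `<=` \bigcup_k C k -> mu n A <= \sum_(k <oo) box_gauge (C k).
Proof. by move=> AC; apply: ereal_inf_lbound; exists C. Qed.

Lemma half_caratheodory n (H : set 'rV[R]_n) i c :
  (forall x, H x -> (x 0 i <= c)%R) -> (forall x, ~ H x -> (c <= x 0 i)%R) ->
  (mu n).-caratheodory H.
Proof.
move=> H1 H2; apply: le_caratheodory_measurable => X.
apply: le_ereal_inf_tmp => _ [C [_ XC] <-].
apply: (@le_trans _ _ (\sum_(k <oo) (box_gauge (C k `&` H) +
                                   box_gauge (C k `&` ~` H)))).
  rewrite nneseriesD//; try by move=> k _ _; exact: box_gauge_ge0.
  by apply: leeD; apply: lebesgue_outer_le; rewrite -setI_bigcupl;
    apply: setSI.
apply: lee_nneseries => k _ *; last exact: box_gauge_split H1 H2.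
by apply: adde_ge0; exact: box_gauge_ge0.
Qed.

Lemma box_caratheodory n (a b : 'rV[R]_n) : (mu n).-caratheodory (box a b).
Proof.
have -> : box a b = \bigcap_(i in [set: 'I_n])
    ([set x | (x 0 i <= b 0 i)%R] `&` ~` [set x | (x 0 i < a 0 i)%R]).
  apply/seteqP; split => [x xab i _|x h i].
    by have /andP[ax xb] := xab i; split => //=; apply/negP; rewrite -leNgt.
  by have [/= -> /negP] := h i Logic.I; rewrite -leNgt => ->.
apply: (@fin_bigcap_measurable _ (caratheodory_type (mu n))) => // i _.
apply: (@measurableI _ (caratheodory_type (mu n))).
  apply: (@half_caratheodory _ _ i (b 0%R i)) => x //=.
  by move=> /negP; rewrite -ltNge => /ltW.
apply: (@measurableC _ (caratheodory_type (mu n))).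
apply: (@half_caratheodory _ _ i (a 0%R i)) => x /=; first exact: ltW.
by move=> /negP; rewrite -leNgt.
Qed.

(** Countably many cubes, indexed by a rational centre and an inverse integer radius, which suffice
    to fill every open set. *)
Definition rcube n (p : 'rV[rat]_n * nat) : set 'rV[R]_n :=
  box (\row_i (ratr (p.1 0%R i) - p.2.+1%:R^-1))%R
      (\row_i (ratr (p.1 0%R i) + p.2.+1%:R^-1))%R.

Lemma nbhs_box n (x : 'rV[R]_n) (U : set 'rV[R]_n) : nbhs x U ->
  exists2 e : R, (0 < e)%R &
    forall y : 'rV[R]_n, (forall i, `|y 0%R i - x 0%R i| < e)%R -> U y.
Proof.
move=> /nbhs_ballP[e /= e0 xeU]; exists e => // y yx; apply: xeU.
by split => // i j; rewrite ord1 /ball /= distrC; exact: yx.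
Qed.

Lemma open_rcubeE n (U : set 'rV[R]_n) : open U ->
  U = \bigcup_(p in [set p | rcube p `<=` U]) rcube p.
Proof.
move=> oU; apply/seteqP; split; last by move=> x [p /= pU /pU].
move=> x Ux; have [e e0 xeU] := nbhs_box (open_nbhs_nbhs (conj oU Ux)).
have [k ke] : exists k, (k.+1%:R^-1 < e / 2 :> R)%R.
  have e2 : (0 < e / 2)%R by rewrite divr_gt0.
  exists (Num.truncn (e / 2)^-1); rewrite -[ltRHS]invrK ltf_pV2 ?posrE ?invr_gt0//.
  exact: truncnS_gt.
have k0 : (0 < k.+1%:R^-1 :> R)%R by rewrite invr_gt0.
have [d dE] : exists d : R, d = (k.+1%:R^-1)%R by exists (k.+1%:R^-1)%R.
rewrite -dE in ke k0.
have /choice[q xq] i : exists q : rat, (`|ratr q - x 0%R i| < d)%R.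
  have /rat_in_itvoo[q /[!in_itv]/= qx] :
    (x 0%R i - d < x 0%R i + d)%R by lra.
  by exists q; rewrite ltr_distlC; apply/andP; split; lra.
exists (\row_i q i, k) => [y /= yb|i] /=.
  apply: xeU => i; have := yb i; rewrite !mxE/= -dE.
  by move: (xq i); rewrite !ltr_distl => /andP[? ?] /andP[? ?]; apply/andP; split; lra.
by rewrite !mxE/= -dE; move: (xq i); rewrite ltr_distl => /andP[? ?]; apply/andP; split; lra.
Qed.

Lemma open_bigcup_rcube n (M : set (set 'rV[R]_n)) (U : set 'rV[R]_n) : open U ->
  sigma_algebra setT M -> (forall a b, M (box a b)) -> M U.
Proof.
move=> oU sM Mb; rewrite (open_rcubeE oU).
rewrite -(sigma_algebra_id sM).
rewrite bigcup_mkcond.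
apply: (@countable_bigcupT_measurable _ (g_sigma_algebraType M)) => // p.
case: ifP => _; last exact: (@measurable0 _ (g_sigma_algebraType M)).
by apply: sub_sigma_algebra; exact: Mb.
Qed.

(** Borel sets, rather than Caratheodory measurable ones, carry the product structures: continuous
    maps are measurable for them, and their sections are again Borel. *)
Definition borelRV n := g_sigma_algebraType (@open 'rV[R]_n).

Lemma borel_caratheodory n (A : set 'rV[R]_n) :
  measurable (A : set (borelRV n)) -> (mu n).-caratheodory A.
Proof.
move=> mA; have sM := @sigma_algebra_measurable _ (caratheodory_type (mu n)).
have : <<s @open 'rV[R]_n >> `<=` (mu n).-caratheodory; last exact.
apply: smallest_sub => // U oU.
apply: (open_bigcup_rcube oU sM) => a b; exact: box_caratheodory.
Qed.

Lemma measurable_box n (a b : 'rV[R]_n) : measurable (box a b : set (borelRV n)).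
Proof.
have -> : box a b = \bigcap_(i in [set: 'I_n])
    (~` [set x | (b 0 i < x 0 i)%R] `&` ~` [set x | (x 0 i < a 0 i)%R]).
  apply/seteqP; split => [x xab i _|x h i].
    by have /andP[ax xb] := xab i; split => /=; apply/negP; rewrite -leNgt.
  by have [/= /negP+ /negP] := h i Logic.I; rewrite -!leNgt => -> ->.
apply: (@fin_bigcap_measurable _ (borelRV n)) => // i _.
apply: measurableI; apply: measurableC; apply: sub_sigma_algebra.
  apply: (@open_comp _ _ (fun x : 'rV[R]_n => x 0%R i) [set y | (b 0 i < y)%R]).
    by move=> x _; exact: coord_continuous.
  exact: open_gt.
apply: (@open_comp _ _ (fun x : 'rV[R]_n => x 0%R i) [set y | (y < a 0 i)%R]).
  by move=> x _; exact: coord_continuous.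
exact: open_lt.
Qed.

Definition leb n : set (borelRV n) -> \bar R := mu n.

Lemma leb_sigma_additive n : semi_sigma_additive (@leb n).
Proof.
move=> F mF tF mUF.
apply: (@caratheodory_measure_sigma_additive _ _ (mu n)) => //.
  by move=> i; exact: borel_caratheodory.
exact: borel_caratheodory.
Qed.

HB.instance Definition _ n := isMeasure.Build _ (borelRV n) R (@leb n)
  (@lebesgue_outer0 R n) (@lebesgue_outer_ge0 R n) (@leb_sigma_additive n).

Lemma lebesgue_box_le n (a b : 'rV[R]_n) : (forall i, (a 0%R i <= b 0%R i)%R) ->
  mu n (box a b) <= (\prod_(i < n) (b 0%R i - a 0%R i))%R%:E.
Proof.
move=> ab; apply: le_trans (box_gauge_le (@subset_refl _ (box a b)) ab).
apply: le_trans (@lebesgue_outer_le _ _ (bigcup2 (box a b) set0) _) _.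
  by move=> x xb; exists 0%N.
rewrite (nneseries_split _ 1)//; last first.
  by move=> k _ ; exact: box_gauge_ge0.
rewrite add0n big_nat1 eseries0 ?adde0//.
by move=> [|[|i]] // _ _; exact: box_gauge0.
Qed.

Definition bigbox n (k : nat) : set 'rV[R]_n :=
  box (const_mx (- k%:R)%R) (const_mx k%:R).
Arguments bigbox n k : clear implicits.

Lemma bigcup_bigbox n : \bigcup_k bigbox n k = setT.
Proof.
apply/seteqP; split => // x _.
exists (Num.truncn `|x|).+1 => // i; rewrite !mxE -ler_norml.
apply: (@le_trans _ _ (`|x|)%R); last exact/ltW/truncnS_gt.
rewrite [leRHS]/Num.norm/= mx_normrE.
by apply/bigmax_geP; right => /=; exists (0%R, i).
Qed.

Lemma bigbox_lty n k : mu n (bigbox n k) < +oo.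
Proof.
apply: le_lt_trans (lebesgue_box_le _) (ltry _) => i.
by rewrite !mxE lerNl (@le_trans _ _ 0%R)// oppr_le0.
Qed.

Lemma leb_sigma_finite n : sigma_finite setT (@leb n).
Proof.
exists (bigbox n); first by rewrite bigcup_bigbox.
by move=> k; split; [exact: measurable_box|exact: bigbox_lty].
Qed.

HB.instance Definition _ n := Measure_isSigmaFinite.Build _ (borelRV n) R
  (@leb n) (@leb_sigma_finite n).

Definition ins m (i : 'I_m.+1) (y : 'rV[R]_m) (t : R) : 'rV[R]_m.+1 :=
  \row_j (if unlift i j is Some k then y 0%R k else t).

Definition del m (i : 'I_m.+1) (x : 'rV[R]_m.+1) : 'rV[R]_m :=
  \row_k x 0%R (lift i k).

Lemma ins_i m i (y : 'rV[R]_m) t : ins i y t 0%R i = t.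
Proof. by rewrite mxE unlift_none. Qed.

Lemma ins_lift m i (y : 'rV[R]_m) t k : ins i y t 0%R (lift i k) = y 0%R k.
Proof. by rewrite mxE liftK. Qed.

Lemma insE m i (x : 'rV[R]_m.+1) : ins i (del i x) (x 0%R i) = x.
Proof.
by apply/rowP => j; rewrite mxE; case: unliftP => [k ->|->//]; rewrite mxE.
Qed.

Lemma insK m i (y : 'rV[R]_m) t : del i (ins i y t) = y.
Proof. by apply/rowP => j; rewrite mxE ins_lift. Qed.

Lemma ins_preimage_box m i (a b : 'rV[R]_m.+1) :
  (fun yt : borelRV m * R => ins i yt.1 yt.2 : 'rV[R]_m.+1) @^-1` box a b =
  box (del i a) (del i b) `*` `[a 0%R i, b 0%R i]%classic.
Proof.
apply/seteqP; split => [[y t] /= h|[y t] /= [h1 h2] j].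
  split => [k|/=]; last by have := h i; rewrite ins_i in_itv.
  by have := h (lift i k); rewrite ins_lift !mxE.
case: (unliftP i j) => [k ->|->]; first by have := h1 k; rewrite ins_lift !mxE.
by rewrite ins_i; move: h2; rewrite in_itv.
Qed.

Lemma measurable_ins m (i : 'I_m.+1) : measurable_fun setT
  (fun yt : borelRV m * R => ins i yt.1 yt.2 : borelRV m.+1).
Proof.
apply: (@measurability _ _ _ (borelRV m.+1) setT _ (@open 'rV[R]_m.+1)) => //.
move=> _ [U oU <-]; rewrite setTI (open_rcubeE oU) preimage_bigcup bigcup_mkcond.
apply: countable_bigcupT_measurable => // p; case: ifP => _ //.
by rewrite ins_preimage_box; apply: measurableX; [exact: measurable_box|].
Qed.

Lemma box_set0 n (a b : 'rV[R]_n) i : (b 0%R i < a 0%R i)%R -> box a b = set0.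
Proof.
move=> ba; apply/seteqP; split => // x /(_ i)/andP[ax xb].
by move: ba; rewrite ltNge (le_trans ax xb).
Qed.

Lemma box_setI n (a b c d : 'rV[R]_n) : box a b `&` box c d =
  box (\row_i Num.max (a 0%R i) (c 0%R i)) (\row_i Num.min (b 0%R i) (d 0%R i)).
Proof.
apply/seteqP; split => [x [/= h1 h2] i|x /= h].
  have /andP[a1 b1] := h1 i; have /andP[a2 b2] := h2 i.
  by rewrite !mxE ge_max le_min a1 a2 b1 b2.
by split => i; have := h i; rewrite !mxE ge_max le_min;
  move=> /andP[/andP[? ?] /andP[? ?]]; apply/andP.
Qed.

Lemma borel_boxE n :
  @measurable _ (borelRV n) = <<s [set A | exists a b, A = @box R n a b] >>.
Proof.
apply/seteqP; split => [A|A].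
  move: A; apply: smallest_sub; first exact: smallest_sigma_algebra.
  move=> U oU; apply: (open_bigcup_rcube oU); first exact: smallest_sigma_algebra.
  by move=> a b; apply: sub_sigma_algebra; exists a, b.
move: A; apply: smallest_sub; first exact: sigma_algebra_measurable.
by move=> _ [a [b ->]]; exact: measurable_box.
Qed.

Section fubini_step.
Variables (m : nat) (i : 'I_m.+1).
Hypothesis boxm : forall a b : 'rV[R]_m, (forall j, (a 0%R j <= b 0%R j)%R) ->
  mu m (box a b) = (\prod_(j < m) (b 0%R j - a 0%R j))%R%:E.

Let nu : {measure set (borelRV m.+1) -> \bar R} :=
  measure_function_pushforward__canonical__measure_function_Measure
   (@leb m \x @lebesgue_measure R) (measurable_ins i).

Let nuE A : nu A = (@leb m \x @lebesgue_measure R)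
  ((fun yt : borelRV m * R => ins i yt.1 yt.2 : borelRV m.+1) @^-1` A).
Proof. by []. Qed.

Let nu_box (a b : 'rV[R]_m.+1) : (forall j, (a 0%R j <= b 0%R j)%R) ->
  nu (box a b) = (\prod_j (b 0%R j - a 0%R j))%R%:E.
Proof.
move=> ab; rewrite nuE ins_preimage_box product_measure1E//; last first.
  exact: measurable_box.
rewrite /= /leb boxm; last by move=> j; rewrite !mxE.
rewrite lebesgue_measure_itv/= lte_fin.
rewrite (bigD1_ord i)//= mulrC EFinM; congr (_ * _).
  by congr EFin; apply: eq_bigr => j _; rewrite !mxE.
case: ltP => //= ba; rewrite (_ : b 0%R i = a 0%R i) ?subrr//.
by apply/eqP; rewrite eq_le ba ab.
Qed.

Let nu_gauge (A : set 'rV[R]_m.+1) (e : R) : (0 < e)%R ->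
  exists2 C : set 'rV[R]_m.+1, measurable (C : set (borelRV m.+1)) /\ A `<=` C &
    nu C <= box_gauge A + e%:E.
Proof.
move=> e0; rewrite /box_gauge; case: ifPn => [/eqP ->|/set0P [x Ax]].
  exists set0; last by rewrite measure0 add0e lee_fin ltW.
  by split => //; exact: measurable0.
set X := ereal_inf _; have X0 : 0 <= X.
  apply: le_ereal_inf_tmp => _ [[a b] /= Aab <-].
  rewrite lee_fin prodr_ge0// => j _; rewrite subr_ge0.
  by have /andP[] := Aab _ Ax j; exact: le_trans.
(* No box contains an unbounded set; its gauge is infinite and the whole space will do. *)
have [Xoo|Xoo] := eqVneq X +oo.
  by exists setT; rewrite ?Xoo ?addye ?leey//; split => //; exact: measurableT.
have Xfin : X \is a fin_num by rewrite ge0_fin_numE// ltey.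
have [_ [[a b] /= Aab <-] Xab] := lb_ereal_inf_adherent e0 Xfin.
exists (box a b); first by split => //; exact: measurable_box.
rewrite nu_box ?ltW// => j.
by have /andP[] := Aab _ Ax j; exact: le_trans.
Qed.

(** Each covering set lies in a Borel set of product measure at most its gauge plus a small term,
    and subadditivity of [nu] sums these up. This is the lower bound for the outer measure of a box;
    the upper one comes from the cover by the box itself. *)
Let nu_le (A : set 'rV[R]_m.+1) : measurable (A : set (borelRV m.+1)) ->
  nu A <= mu m.+1 A.
Proof.
move=> mA; apply: le_ereal_inf_tmp => _ [C [_ AC] <-].
apply/lee_addgt0Pr => e e0.
apply: le_trans (epsilon_trick _ _ (ltW e0)); last first.
  by move=> n; exact: box_gauge_ge0.
have /choice[D HD] n : exists D : set 'rV[R]_m.+1,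
    [/\ measurable (D : set (borelRV m.+1)), C n `<=` D &
    nu D <= box_gauge (C n) + (e / (2 ^ n.+1)%:R)%:E].
  have [|D [? ?] ?] := @nu_gauge (C n) (e / (2 ^ n.+1)%:R)%R.
    by rewrite divr_gt0// ltr0n expn_gt0.
  by exists D.
apply: (@le_trans _ _ (nu (\bigcup_n D n))).
  apply: le_measure; rewrite ?inE//.
    by apply: bigcupT_measurable => n; have [] := HD n.
  by move=> x /AC[n _ Cx]; exists n => //; have [_ + _] := HD n; exact.
apply: (@le_trans _ _ (\sum_(n <oo) nu (D n))).
  apply: measure_sigma_subadditive => //.
    by move=> n; have [] := HD n.
  by apply: bigcupT_measurable => n; have [] := HD n.
apply: lee_nneseries => n _ *; first exact: measure_ge0.
by have [_ _] := HD n.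
Qed.

(** Both measures agree on the boxes, a family stable under intersection that generates the Borel
    sets, and big boxes exhaust the space. The hypothesis [boxm] is the volume of boxes one
    dimension lower, so the box formula and this product formula climb the dimension together. *)
Lemma leb_ins_product (A : set 'rV[R]_m.+1) : measurable (A : set (borelRV m.+1)) ->
  mu m.+1 A = (@leb m \x @lebesgue_measure R)
  ((fun yt : borelRV m * R => ins i yt.1 yt.2 : borelRV m.+1) @^-1` A).
Proof.
move=> mA; rewrite -nuE.
apply: (@measure_unique _ _ (borelRV m.+1)
  [set A | exists a b, A = @box R m.+1 a b] (bigbox m.+1)
  (borel_boxE m.+1) _ _ _ (@leb m.+1)) => //.
- move=> _ _ [a [b ->]] [c [d ->]]; rewrite box_setI.
  by eexists; eexists; reflexivity.
- by move=> k; eexists; eexists; reflexivity.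
- exact: bigcup_bigbox.
- move=> _ [a [b ->]].
  have [ab|/existsNP[j /negP]] := pselect (forall j, (a 0%R j <= b 0%R j)%R).
    apply/eqP; rewrite eq_le; apply/andP; split.
      by rewrite [leRHS]nu_box//; exact: lebesgue_box_le.
    by apply: nu_le; exact: measurable_box.
  by rewrite -ltNge => /box_set0 ->; rewrite !measure0.
- by move=> k; exact: bigbox_lty.
Qed.

Lemma lebesgue_box_step (a b : 'rV[R]_m.+1) : (forall j, (a 0%R j <= b 0%R j)%R) ->
  mu m.+1 (box a b) = (\prod_j (b 0%R j - a 0%R j))%R%:E.
Proof.
move=> ab; rewrite leb_ins_product; last exact: measurable_box.
by rewrite -nuE nu_box.
Qed.

End fubini_step.

Lemma lebesgue_outer_rV0 (A : set 'rV[R]_0) : A !=set0 -> mu 0 A = 1.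
Proof.
move=> [x Ax]; apply/eqP; rewrite eq_le; apply/andP; split.
  apply: (@le_trans _ _ (mu 0 (box x x))).
    by apply: le_lebesgue_outer => y _ [].
  by rewrite (le_trans (lebesgue_box_le _)) ?big_ord0//.
apply: le_ereal_inf_tmp => _ [C [_ AC] <-].
have [k _ Ckx] := AC _ Ax.
have g1 : box_gauge (C k) = 1.
  rewrite /box_gauge; case: ifPn => [/eqP C0|_]; first by rewrite C0 in Ckx.
  rewrite (_ : [set _ | _ in _] = [set 1]) ?ereal_inf1//.
  apply/seteqP; split => [_ [ab _ <-]|_ ->]; first by rewrite big_ord0.
  by exists (x, x); [move=> y _ []|rewrite big_ord0].
rewrite (@nneseriesD1 _ _ k)//; last by move=> *; exact: box_gauge_ge0.
by rewrite g1 leeDl// nneseries_ge0// => *; exact: box_gauge_ge0.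
Qed.

Lemma lebesgue_box n (a b : 'rV[R]_n) : (forall j, (a 0%R j <= b 0%R j)%R) ->
  mu n (box a b) = (\prod_j (b 0%R j - a 0%R j))%R%:E.
Proof.
elim: n a b => [|m IH] a b ab; last exact: (@lebesgue_box_step m ord0).
by rewrite big_ord0 lebesgue_outer_rV0//; exists a => -[].
Qed.

Lemma lebesgue_product m (i : 'I_m.+1) (A : set 'rV[R]_m.+1) :
  measurable (A : set (borelRV m.+1)) ->
  mu m.+1 A = (@leb m \x @lebesgue_measure R)
  ((fun yt : borelRV m * R => ins i yt.1 yt.2 : borelRV m.+1) @^-1` A).
Proof. exact/leb_ins_product/lebesgue_box. Qed.

Lemma lebesgue_fubini m (i : 'I_m.+1) (A : set 'rV[R]_m.+1) :
  measurable (A : set (borelRV m.+1)) ->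
  mu m.+1 A = \int[@leb m]_y @lebesgue_measure R [set t | A (ins i y t)].
Proof.
move=> mA; rewrite (lebesgue_product i)//=.
apply: eq_integral => y _; congr (lebesgue_measure _).
by apply/seteqP; split => t; rewrite /xsection/= inE.
Qed.

End borel.

(** * Euclidean geometry and invariance of the Lebesgue measure *)

Definition dotv (R : realType) n (x y : 'rV[R]_n) : R := (x *m y^T) 0 0.

Section euclid.
Context {R : realType} {n : nat}.
Implicit Types x y z v : 'rV[R]_n.

Lemma dotvE x y : dotv x y = \sum_i x 0 i * y 0 i.
Proof. by rewrite /dotv mxE; apply: eq_bigr => i _; rewrite mxE. Qed.

Lemma dotvC x y : dotv x y = dotv y x.
Proof. by rewrite !dotvE; apply: eq_bigr => i _; rewrite mulrC. Qed.

Lemma dotvDl x y z : dotv (x + y) z = dotv x z + dotv y z.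
Proof. by rewrite /dotv mulmxDl mxE. Qed.

Lemma dotvDr x y z : dotv x (y + z) = dotv x y + dotv x z.
Proof. by rewrite dotvC dotvDl ![dotv _ x]dotvC. Qed.

Lemma dotvNl x y : dotv (- x) y = - dotv x y.
Proof. by rewrite /dotv mulNmx mxE. Qed.

Lemma dotvNr x y : dotv x (- y) = - dotv x y.
Proof. by rewrite dotvC dotvNl dotvC. Qed.

Lemma dotvBl x y z : dotv (x - y) z = dotv x z - dotv y z.
Proof. by rewrite dotvDl dotvNl. Qed.

Lemma dotvBr x y z : dotv x (y - z) = dotv x y - dotv x z.
Proof. by rewrite dotvDr dotvNr. Qed.

Lemma dotvZl a x y : dotv (a *: x) y = a * dotv x y.
Proof. by rewrite /dotv -scalemxAl mxE. Qed.

Lemma dotvZr a x y : dotv x (a *: y) = a * dotv x y.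
Proof. by rewrite dotvC dotvZl dotvC. Qed.

Lemma dot0v x : dotv 0 x = 0. Proof. by rewrite /dotv mul0mx mxE. Qed.

Lemma dotv0 x : dotv x 0 = 0. Proof. by rewrite dotvC dot0v. Qed.

Lemma dotvv_ge0 x : 0 <= dotv x x.
Proof. by rewrite dotvE sumr_ge0// => i _; rewrite -expr2 sqr_ge0. Qed.

Lemma enormE x : enorm x = Num.sqrt (dotv x x).
Proof. by rewrite /enorm dotvE; congr Num.sqrt; apply: eq_bigr => i _; rewrite expr2. Qed.

Lemma enorm_ge0 x : 0 <= enorm x.
Proof. exact: sqrtr_ge0. Qed.
Hint Resolve enorm_ge0 : core.

Lemma sqr_enorm x : enorm x ^+ 2 = dotv x x.
Proof. by rewrite enormE sqr_sqrtr// dotvv_ge0. Qed.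

Lemma enorm_le x (a : R) : 0 <= a -> (enorm x <= a) = (dotv x x <= a ^+ 2).
Proof. by move=> a0; rewrite -sqr_enorm ler_sqr// nnegrE. Qed.

Lemma enorm0 : enorm (0 : 'rV[R]_n) = 0.
Proof. by rewrite enormE dot0v sqrtr0. Qed.

Lemma enorm_eq0 x : (enorm x == 0) = (x == 0).
Proof.
apply/eqP/eqP => [x0|->]; last exact: enorm0.
have : dotv x x = 0 by rewrite -sqr_enorm x0 expr0n.
move/eqP; rewrite dotvE psumr_eq0 => [/allP/= h|i _]; last by rewrite -expr2 sqr_ge0.
apply/rowP => i; rewrite mxE; apply/eqP.
by have := h i (mem_index_enum _); rewrite -expr2 sqrf_eq0.
Qed.

Lemma enorm_gt0 x : (0 < enorm x) = (x != 0).
Proof. by rewrite lt0r enorm_ge0 andbT enorm_eq0. Qed.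

Lemma dotvv_eq0 x : (dotv x x == 0) = (x == 0).
Proof. by rewrite -sqr_enorm sqrf_eq0 enorm_eq0. Qed.

Lemma enormZ a x : enorm (a *: x) = `|a| * enorm x.
Proof.
by rewrite !enormE dotvZl dotvZr mulrA -expr2 sqrtrM ?sqr_ge0// sqrtr_sqr.
Qed.

Lemma enormN x : enorm (- x) = enorm x.
Proof. by rewrite -scaleN1r enormZ normrN1 mul1r. Qed.

Lemma enormB x y : enorm (x - y) = enorm (y - x).
Proof. by rewrite -enormN opprB. Qed.

Lemma dotv_le x y : dotv x y <= enorm x * enorm y.
Proof.
have [->|x0] := eqVneq x 0; first by rewrite dot0v enorm0 mul0r.
have [->|y0] := eqVneq y 0; first by rewrite dotv0 enorm0 mulr0.
have X : 0 < enorm x by rewrite enorm_gt0.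
have Y : 0 < enorm y by rewrite enorm_gt0.
have := dotvv_ge0 (enorm y *: x - enorm x *: y).
rewrite !(dotvBl, dotvBr, dotvZl, dotvZr) -!sqr_enorm [dotv y x]dotvC.
have := mulr_gt0 X Y; set a := enorm x; set b := enorm y; set c := dotv x y.
by move=> ab h; rewrite -(ler_pM2l ab); nra.
Qed.

Lemma normr_dotv x y : `|dotv x y| <= enorm x * enorm y.
Proof. by rewrite ler_norml dotv_le lerNl -dotvNl -(enormN x) dotv_le. Qed.

Lemma ler_enormD x y : enorm (x + y) <= enorm x + enorm y.
Proof.
rewrite enorm_le ?addr_ge0// !(dotvDl, dotvDr) -!sqr_enorm [dotv y x]dotvC.
by have := dotv_le x y; nra.
Qed.

Lemma ler_enormB x y : enorm (x - y) <= enorm x + enorm y.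
Proof. by rewrite -(enormN y) ler_enormD. Qed.

Lemma ler_enorm_distD z x y : enorm (x - y) <= enorm (x - z) + enorm (z - y).
Proof. by have := ler_enormD (x - z) (z - y); rewrite addrA subrK. Qed.

Lemma lerB_enorm x y : enorm x - enorm y <= enorm (x - y).
Proof. by rewrite lerBlDr -{1}(subrK y x) ler_enormD. Qed.

Lemma ler_dist_enorm x y : `|enorm x - enorm y| <= enorm (x - y).
Proof. by rewrite ler_norml lerB_enorm andbT lerNl opprB enormB lerB_enorm. Qed.

Lemma coord_enorm x i : `|x 0 i| <= enorm x.
Proof.
rewrite -sqrtr_sqr ler_sqrt ?sumr_ge0// => [|j _]; last exact: sqr_ge0.
by rewrite (bigD1 i)//= lerDl sumr_ge0// => j _; exact: sqr_ge0.
Qed.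

Lemma norm_enorm x : `|x| <= enorm x.
Proof.
rewrite [leLHS]/Num.norm/= mx_normrE; apply/bigmax_leP; split => //= -[j i] _.
by rewrite /= ord1 coord_enorm.
Qed.

Lemma coord_norm x i : `|x 0 i| <= `|x|.
Proof.
rewrite [leRHS]/Num.norm/= mx_normrE.
by apply/bigmax_geP; right => /=; exists (ord0, i).
Qed.

Lemma enorm_le_norm x : enorm x <= n%:R * `|x|.
Proof.
rewrite enorm_le ?mulr_ge0// dotvE.
apply: (@le_trans _ _ (\sum_(i < n) `|x| ^+ 2)).
  apply: ler_sum => i _; rewrite -expr2 -real_normK ?num_real//.
  by rewrite ler_sqr ?nnegrE// coord_norm.
rewrite sumr_const card_ord -[leLHS]mulr_natl exprMn; apply: ler_wpM2r.
  exact: sqr_ge0.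
by rewrite -natrX ler_nat; case: n => // k; rewrite expnS expn1 leq_pmulr.
Qed.

(** Bridges the sup-norm topology and Euclidean balls, since the two norms bound each other up to
    the factor n. The n + 1 in the proof keeps a divisor positive in dimension 0. *)
Lemma near_enorm (P : set 'rV[R]_n) x :
  (exists2 e : R, 0 < e & forall y, enorm (y - x) < e -> P y) <-> nbhs x P.
Proof.
have n1 : 0 < n%:R + 1 :> R by rewrite ltr_wpDl.
split=> [[e e0 eP]|/nbhs_ballP[e /= e0 xP]].
  apply/nbhs_ballP; exists (e / (n%:R + 1)) => /=; first exact: divr_gt0.
  move=> y; rewrite mx_norm_ball /ball_ /= ltr_pdivlMr// distrC mulrC => yx.
  apply: eP; apply: le_lt_trans (enorm_le_norm _) _.
  by apply: le_lt_trans yx; rewrite ler_wpM2r// lerDl.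
exists e => // y yx; apply: xP.
rewrite mx_norm_ball /ball_ /= distrC; exact: le_lt_trans (norm_enorm _) _.
Qed.

Lemma enormB_continuous z : continuous (fun y => enorm (y - z)).
Proof.
move=> x A /nbhs_ballP[e e0 eA]; apply/near_enorm; exists e => // y yx.
apply: eA; rewrite /ball /= distrC; apply: le_lt_trans (ler_dist_enorm _ _) _.
by rewrite opprB addrA subrK.
Qed.

Lemma dotv_continuous z : continuous (dotv z).
Proof.
move=> x A /nbhs_ballP[e /= e0 eA]; apply/near_enorm.
have z1 : 0 < enorm z + 1 by rewrite ltr_wpDl.
exists (e / (enorm z + 1)); first exact: divr_gt0.
move=> y yx; apply: eA; rewrite /ball /= distrC -dotvBr.
apply: le_lt_trans (normr_dotv _ _) _; move: yx; rewrite ltr_pdivlMr// mulrC.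
by apply: le_lt_trans; rewrite ler_wpM2r// lerDl.
Qed.

Lemma closed_eball x r : closed (eball x r).
Proof.
rewrite (_ : eball x r = (fun y => enorm (y - x)) @^-1` [set t | t <= r])//.
apply: closed_comp; last exact: closed_le.
by move=> y _; exact: enormB_continuous.
Qed.

Lemma compact_closed_enorm (A : set 'rV[R]_n) (r : R) :
  closed A -> (forall x, A x -> enorm x <= r) -> compact A.
Proof.
move=> cA Ar; apply: bounded_closed_compact => //.
exists r; split; first exact: num_real.
by move=> M rM x /Ar xr; apply: le_trans (norm_enorm _) _; rewrite (le_trans xr)// ltW.
Qed.

Lemma compact_eball x r : compact (eball x r).
Proof.
apply: (@compact_closed_enorm _ (r + enorm x)); first exact: closed_eball.
move=> y; rewrite /eball/= => yx.
by rewrite -(subrK x y); apply: le_trans (ler_enormD _ _) _; rewrite lerD2r.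
Qed.

End euclid.
#[global] Hint Extern 0 (is_true (0 <= enorm _)) => apply: enorm_ge0 : core.

(** * Lebesgue measure under diagonal affine maps and translations *)

Notation lam n := (@lebesgue_outer _ n).

Section affine_diag.
Context {R : realType} {n : nat}.
Implicit Types (A : set 'rV[R]_n) (d t : 'rV[R]_n).

Definition daff d t (x : 'rV[R]_n) : 'rV[R]_n := \row_i (d 0 i * x 0 i + t 0 i).

Let daff_gauge d t A : (forall i, d 0 i != 0) ->
  (box_gauge (daff d t @` A) <= (\prod_i `|d 0 i|)%:E * box_gauge A)%E.
Proof.
move=> d0; have D0 : 0 < \prod_i `|d 0 i|.
  by apply: prodr_gt0 => i _; rewrite normr_gt0.
have [->|/set0P A0] := eqVneq A set0.
  by rewrite image_set0 !box_gauge0 mule0.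
rewrite -lee_pdivrMl// [leRHS]/box_gauge.
case: ifPn => [/eqP A00|_]; first by move: A0; rewrite A00 => -[].
apply: le_ereal_inf_tmp => _ [[a b] /= Aab <-]; rewrite lee_pdivrMl//.
have ab i : a 0 i <= b 0 i.
  by case: A0 => x /Aab/(_ i)/andP[]; exact: le_trans.
(* A negative factor [d 0 i] exchanges the two ends of the side. *)
apply: le_trans (box_gauge_le (a := \row_i (d 0 i * (if 0 < d 0 i then a else b) 0 i + t 0 i))
  (b := \row_i (d 0 i * (if 0 < d 0 i then b else a) 0 i + t 0 i)) _ _) _.
- move=> _ [x /Aab xab <-] i; rewrite !mxE; have /andP[ax xb] := xab i.
  rewrite !lerD2r; case: ltP => di.
    by rewrite !ler_pM2l// ax xb.
  by apply/andP; split; rewrite ler_wnM2l.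
- move=> i; rewrite !mxE lerD2r; case: ltP => di; first by rewrite ler_pM2l.
  by rewrite ler_wnM2l.
- rewrite -EFinM -big_split/= lee_fin le_eqVlt; apply/orP; left; apply/eqP.
  apply: eq_bigr => i _; rewrite !mxE opprD addrACA subrr addr0 -mulrBr.
  case: ltP => di; first by rewrite gtr0_norm.
  by rewrite ler0_norm// mulNr -mulrN opprB.
Qed.

Let daff_le d t A : (forall i, d 0 i != 0) ->
  (lam n (daff d t @` A) <= (\prod_i `|d 0 i|)%:E * lam n A)%E.
Proof.
move=> d0; have D0 : 0 < \prod_i `|d 0 i|.
  by apply: prodr_gt0 => i _; rewrite normr_gt0.
rewrite -lee_pdivrMl//; apply: le_ereal_inf_tmp => _ [C [_ AC] <-].
rewrite lee_pdivrMl// -nneseriesZl; last by move=> *; exact: box_gauge_ge0.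
apply: le_trans (lebesgue_outer_le (C := fun k => daff d t @` (C k)) _) _.
  by move=> _ [x /AC[k _ Ckx] <-]; exists k => //; exists x.
by apply: lee_nneseries => *; [exact: box_gauge_ge0|exact: daff_gauge].
Qed.

(** The reverse bound is [daff_le] for the inverse map, which is again diagonal affine. *)
Lemma lebesgue_daff d t A : (forall i, d 0 i != 0) ->
  lam n (daff d t @` A) = ((\prod_i `|d 0 i|)%:E * lam n A)%E.
Proof.
move=> d0; have D0 : 0 < \prod_i `|d 0 i|.
  by apply: prodr_gt0 => i _; rewrite normr_gt0.
apply/eqP; rewrite eq_le daff_le//= -lee_pdivlMl//.
pose d' := \row_i (d 0 i)^-1; pose t' := \row_i (- t 0 i / d 0 i) : 'rV[R]_n.
have d'0 i : d' 0 i != 0 by rewrite mxE invr_eq0.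
have := daff_le t' (daff d t @` A) d'0.
rewrite image_comp (_ : (daff d' t' \o daff d t) = id) ?image_id.
  congr (_ <= _%:E * _)%E; rewrite -prodfV; apply: eq_bigr => i _.
  by rewrite mxE normfV.
apply/funext => x; apply/rowP => i; rewrite !mxE mulrDr mulrA mulVf// mul1r.
by rewrite mulNr [t 0 i / _]mulrC addrK.
Qed.

Lemma lebesgueD A (v : 'rV[R]_n) : lam n ((fun x => x + v) @` A) = lam n A.
Proof.
have -> : (fun x => x + v) @` A = daff (const_mx 1) v @` A.
  by apply: eq_imagel => x _; apply/rowP => i; rewrite !mxE mul1r.
rewrite lebesgue_daff => [|i]; last by rewrite mxE oner_neq0.
by rewrite big1 ?mul1e// => i _; rewrite mxE normr1.
Qed.

Lemma lebesgueZ A (a : R) : a != 0 ->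
  lam n ((fun x => a *: x) @` A) = ((`|a| ^+ n)%:E * lam n A)%E.
Proof.
move=> a0; have -> : (fun x => a *: x) @` A = daff (const_mx a) 0 @` A.
  by apply: eq_imagel => x _; apply/rowP => i; rewrite !mxE addr0.
rewrite lebesgue_daff => [|i]; last by rewrite mxE.
congr (_%:E * _)%E.
by under eq_bigr do rewrite mxE; rewrite prodr_const card_ord.
Qed.

Lemma lebesgueN A : lam n ((fun x => - x) @` A) = lam n A.
Proof.
have -> : (fun x : 'rV[R]_n => - x) @` A = (fun x => -1 *: x) @` A.
  by apply: eq_imagel => x _; rewrite scaleN1r.
by rewrite lebesgueZ ?normrN1 ?expr1n ?mul1e// oppr_eq0 oner_neq0.
Qed.

Lemma lebesgue_preimageD A (v : 'rV[R]_n) :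
  lam n ((fun x => x + v) @^-1` A) = lam n A.
Proof.
rewrite -[RHS](lebesgueD _ (- v)); congr (lam n _).
apply/seteqP; split => [x /= Axv|_ [x Ax <-]/=]; last by rewrite subrK.
by exists (x + v) => //; rewrite addrK.
Qed.

End affine_diag.

Section borel_maps.
Context {R : realType}.

Lemma borel_open n (A : set 'rV[R]_n) : open A -> measurable (A : set (borelRV n)).
Proof. exact: sub_sigma_algebra. Qed.

Lemma borel_closed n (A : set 'rV[R]_n) : closed A -> measurable (A : set (borelRV n)).
Proof.
move=> cA; rewrite -(setCK A); apply: measurableC.
by apply: borel_open; exact: closed_openC.
Qed.

Lemma borel_continuous n m (f : 'rV[R]_n -> 'rV[R]_m) : continuous f ->
  measurable_fun setT (f : borelRV n -> borelRV m).
Proof.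
move=> cf; apply: (@measurability _ _ _ (borelRV m) setT _ (@open 'rV[R]_m)) => //.
move=> _ [U oU <-]; rewrite setTI; apply: borel_open.
by apply: open_comp => // x _; exact: cf.
Qed.

Lemma borel_continuousR n (f : 'rV[R]_n -> R) : continuous f ->
  measurable_fun setT (f : borelRV n -> R).
Proof.
move=> cf; apply: (measurability _ (RGenOpens.measurableE R)) => //.
move=> _ [_ [x [y ->] <-]]; rewrite setTI; apply: borel_open.
by apply: open_comp => // z _; exact: cf.
Qed.

Lemma borel_prod_open n m (W : set ('rV[R]_n * 'rV[R]_m)) : open W ->
  measurable (W : set (borelRV n * borelRV m)).
Proof.
move=> oW.
have -> : W = \bigcup_p \bigcup_q (if `[< @rcube R n p `*` @rcube R m q `<=` W >]
    then @rcube R n p `*` @rcube R m q else set0).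
  apply/seteqP; split => [[x y] Wxy|[x y] [p _ [q _]]]; last first.
    by case: ifPn => // /asboolP pqW; exact: pqW.
  have [[U V] [/= Ux Vy] UVW] := open_nbhs_nbhs (conj oW Wxy).
  have oU := @open_interior _ U; have oV := @open_interior _ V.
  have Ux' : U° x by []. have Vy' : V° y by [].
  move: (Ux') (Vy'); rewrite (open_rcubeE oU) (open_rcubeE oV).
  move=> [p /= pU px] [q /= qV qy]; exists p => //; exists q => //.
  rewrite ifT//; apply/asboolP => -[u v] /= [/pU Uu /qV Vv]; apply: UVW.
  by split => /=; exact: interior_subset.
apply: countable_bigcupT_measurable => // p.
apply: countable_bigcupT_measurable => // q.
by case: ifP => _ //; apply: measurableX; exact: measurable_box.
Qed.

Lemma borel_continuous2 n m k (f : 'rV[R]_n * 'rV[R]_m -> 'rV[R]_k) : continuous f ->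
  measurable_fun setT (f : borelRV n * borelRV m -> borelRV k).
Proof.
move=> cf; apply: (@measurability _ _ _ (borelRV k) setT _ (@open 'rV[R]_k)) => //.
move=> _ [U oU <-]; rewrite setTI; apply: borel_prod_open.
by apply: open_comp => // x _; exact: cf.
Qed.

Lemma borel_outer n (A : set 'rV[R]_n) (e : R) : 0 < e ->
  exists2 C : set 'rV[R]_n, measurable (C : set (borelRV n)) /\ A `<=` C &
    (lam n C <= lam n A + e%:E)%E.
Proof.
move=> e0; have [Aoo|Aoo] := eqVneq (lam n A) +oo%E.
  by exists setT; [split => //; exact: measurableT|rewrite Aoo addye// leey].
have Afin : lam n A \is a fin_num by rewrite ge0_fin_numE ?lebesgue_outer_ge0// ltey.
have e2 : 0 < e / 2 by rewrite divr_gt0.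
have [_ [C [_ AC] <-] hC] := lb_ereal_inf_adherent e2 Afin.
have /choice[D HD] k : exists D : set 'rV[R]_n,
    [/\ measurable (D : set (borelRV n)), C k `<=` D &
    (lam n D <= box_gauge (C k) + (e / 2 / (2 ^ k.+1)%:R)%:E)%E].
  have ek : 0 < e / 2 / (2 ^ k.+1)%:R by rewrite divr_gt0// ltr0n expn_gt0.
  rewrite /box_gauge; case: ifPn => [/eqP ->|/set0P [x Ax]].
    by exists set0; rewrite lebesgue_outer0 add0e lee_fin; split => //; exact: ltW.
  set X := ereal_inf _; have X0 : (0 <= X)%E.
    apply: le_ereal_inf_tmp => _ [[a b] /= Aab <-].
    rewrite lee_fin prodr_ge0// => j _; rewrite subr_ge0.
    by have /andP[] := Aab _ Ax j; exact: le_trans.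
  have [Xoo|Xoo] := eqVneq X +oo%E.
    by exists setT; rewrite ?Xoo ?addye ?leey//; split => //; exact: measurableT.
  have Xfin : X \is a fin_num by rewrite ge0_fin_numE// ltey.
  have [_ [[a b] /= Aab <-] Xab] := lb_ereal_inf_adherent ek Xfin.
  exists (box a b); split => //; first exact: measurable_box.
  rewrite lebesgue_box ?ltW// => j.
  by have /andP[] := Aab _ Ax j; exact: le_trans.
exists (\bigcup_k D k).
  split; first by apply: bigcupT_measurable => k; have [] := HD k.
  by move=> x /AC[k _ Cx]; exists k => //; have [_ + _] := HD k; exact.
apply: le_trans (lebesgue_outer_sigma_subadditive _) _.
apply: (@le_trans _ _ (\sum_(k <oo) (box_gauge (C k) + (e / 2 / (2 ^ k.+1)%:R)%:E))%E).
  by apply: lee_nneseries => k _ *; [exact: lebesgue_outer_ge0|have [] := HD k].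
apply: le_trans (epsilon_trick _ _ (ltW e2)) _ => [k|]; first exact: box_gauge_ge0.
by rewrite [e in leRHS]splitr EFinD addeA leeD2r// ltW.
Qed.

End borel_maps.

(** * Uniqueness of translation-invariant measures and orthogonal invariance *)

Section translation_invariant.
Context {R : realType} {n : nat}.
Variable m : {sigma_finite_measure set (@borelRV R n) -> \bar R}.
Hypothesis minv : forall (A : set 'rV[R]_n) v, measurable (A : set (@borelRV R n)) ->
  m ((fun x => x + v) @^-1` A) = m A.

Let addc : continuous (fun xy : 'rV[R]_n * 'rV[R]_n => xy.1 + xy.2).
Proof. exact: add_continuous. Qed.

Let subc : continuous (fun xy : 'rV[R]_n * 'rV[R]_n => xy.1 - xy.2).
Proof.
move=> xy; apply: cvgB; [exact: cvg_fst|exact: cvg_snd].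
Qed.

Let measurable_add (C : set 'rV[R]_n) : measurable (C : set (@borelRV R n)) ->
  measurable ((fun xy => xy.1 + xy.2) @^-1` C : set (@borelRV R n * @borelRV R n)).
Proof. by move=> mC; rewrite -[X in measurable X]setTI; apply: (borel_continuous2 addc). Qed.

Let measurable_sub (C : set 'rV[R]_n) : measurable (C : set (@borelRV R n)) ->
  measurable ((fun xy => xy.1 - xy.2) @^-1` C : set (@borelRV R n * @borelRV R n)).
Proof. by move=> mC; rewrite -[X in measurable X]setTI; apply: (borel_continuous2 subc). Qed.

Let setX_fst (A : set 'rV[R]_n) : measurable (A : set (@borelRV R n)) ->
  measurable (A `*` setT : set (@borelRV R n * @borelRV R n)).
Proof. by move=> mA; apply: measurableX. Qed.

Let prod_swap (S : set (@borelRV R n * @borelRV R n)) : measurable S ->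
  (\int[m]_x leb (xsection S x) = \int[@leb R n]_y m (ysection S y))%E.
Proof.
move=> mS; have mf : measurable_fun setT (\1_S : @borelRV R n * @borelRV R n -> R).
  exact: measurable_indic.
pose f : @borelRV R n * @borelRV R n -> \bar R := EFin \o \1_S.
have := @fubini_tonelli _ _ (@borelRV R n) (@borelRV R n) R m (@leb R n) f.
move=> /(_ _ _) h.
transitivity (\int[m]_x \int[@leb R n]_y f (x, y))%E.
  apply: eq_integral => x _; rewrite -[LHS]mul1e -integral_cst//; last first.
    exact: measurable_xsection.
  rewrite integral_mkcond; apply: eq_integral => y _.
  by rewrite /f /= indicE patchE mem_xsection; case: ifP.
rewrite h//; last first.
- by move=> x; rewrite /f lee_fin.
- exact/measurable_EFinP.
apply: eq_integral => y _; rewrite -[RHS]mul1e -integral_cst//; last first.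
  exact: measurable_ysection.
rewrite [RHS]integral_mkcond; apply: eq_integral => x _.
by rewrite /f /= indicE patchE mem_ysection; case: ifP.
Qed.

(** Tonelli in both orders. The set [S] of pairs with x in [A] and x + y in [B] has measure
    [m A * lam n B], and [S'] with x in [B] and x - y in [A] has measure [m B * lam n A]. For fixed
    y their sections in x are translates of each other, so the invariance of [m] equates the two. *)
Lemma translation_invariant_unique (A B : set 'rV[R]_n) :
  measurable (A : set (@borelRV R n)) -> measurable (B : set (@borelRV R n)) ->
  (m A * lam n B = m B * lam n A)%E.
Proof.
move=> mA mB.
pose S : set (@borelRV R n * @borelRV R n) :=
  (A `*` setT) `&` ((fun xy => xy.1 + xy.2) @^-1` B).
pose S' : set (@borelRV R n * @borelRV R n) :=
  (B `*` setT) `&` ((fun xy => xy.1 - xy.2) @^-1` A).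
have mS : measurable S by apply: measurableI; [exact: setX_fst|exact: measurable_add].
have mS' : measurable S' by apply: measurableI; [exact: setX_fst|exact: measurable_sub].
have e1 : (\int[m]_x leb (xsection S x) = m A * lam n B)%E.
  rewrite muleC -integral_cst//= [RHS]integral_mkcond; apply: eq_integral => x _.
  rewrite patchE; case: ifPn => [|]; rewrite (inE, notin_setE) => Ax.
    rewrite /leb -[RHS](lebesgue_preimageD _ x); congr (lam n _).
    apply/seteqP; split => y; rewrite /xsection/= inE /S/= addrC; first by case.
    by move=> ?; split.
  rewrite [X in leb X](_ : _ = set0) ?measure0//.
  by apply/seteqP; split => y //; rewrite /xsection/= inE => -[[]].
have e2 : (\int[m]_x leb (xsection S' x) = m B * lam n A)%E.
  rewrite muleC -integral_cst//= [RHS]integral_mkcond; apply: eq_integral => x _.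
  rewrite patchE; case: ifPn => [|]; rewrite (inE, notin_setE) => Bx.
    rewrite /leb -[RHS](lebesgue_preimageD _ x) -[RHS]lebesgueN; congr (lam n _).
    apply/seteqP; split => [y|_ [y /= Ayx <-]]; rewrite /xsection/= inE /S'/=.
      by move=> [_ Axy]; exists (- y); rewrite ?opprK//= addrC.
    by rewrite opprK addrC.
  rewrite [X in leb X](_ : _ = set0) ?measure0//.
  by apply/seteqP; split => y //; rewrite /xsection/= inE => -[[]].
rewrite -e1 -e2 prod_swap// prod_swap//; apply: eq_integral => y _.
rewrite -[RHS](minv y); last exact: measurable_ysection.
congr (m _); apply/seteqP; split => x; rewrite /ysection/= !inE /S /S'/=.
  by move=> [[Ax _] Bxy]; rewrite addrK.
by rewrite addrK => -[[Bx _] Axy].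
Qed.

End translation_invariant.

Section pack_sigma_finite.
Context {R : realType} {d} {T : measurableType d}.
Variable m : {measure set T -> \bar R}.

(** An alias of [m] indexed by a proof of sigma-finiteness, so that a measure found to be
    sigma-finite in the middle of a proof can be used as one. *)
Definition sfm (sf : sigma_finite setT m) : set T -> \bar R := m.

HB.instance Definition _ sf := Measure.on (sfm sf).
HB.instance Definition _ sf := Measure_isSigmaFinite.Build _ _ _ (sfm sf) sf.

End pack_sigma_finite.

Section orthogonal.
Context {R : realType} {n : nat}.

Lemma mulmx_continuous (m : nat) (T : 'M[R]_(n, m)) : continuous (fun x : 'rV[R]_n => x *m T).
Proof.
move=> x A [P nP PA]; have : nbhs x [set y | forall j, P 0 j ((y *m T) 0 j)].
  apply: (filter_forall (nbhs_filter (x : 'rV[R]_n))) => j.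
  have yE (y : 'rV[R]_n) : (y *m T) 0 j = dotv (\row_i T i j) y.
    by rewrite mxE dotvE; apply: eq_bigr => i _; rewrite mxE mulrC.
  have := nP 0 j; rewrite /= yE => /dotv_continuous.
  by apply: (@filterS _ _ (@nbhs_filter 'rV[R]_n x)) => y /=; rewrite yE.
by apply: (@filterS _ _ (@nbhs_filter 'rV[R]_n x)) => y Py; apply: PA => i j; rewrite ord1.
Qed.

Lemma dotv_mulmx (T : 'M[R]_n) (x y : 'rV[R]_n) : T *m T^T = 1%:M ->
  dotv (x *m T) (y *m T) = dotv x y.
Proof.
by move=> TT; rewrite /dotv trmx_mul mulmxA -(mulmxA x) TT mulmx1.
Qed.

Lemma enorm_mulmx (T : 'M[R]_n) (x : 'rV[R]_n) : T *m T^T = 1%:M ->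
  enorm (x *m T) = enorm x.
Proof. by move=> TT; rewrite !enormE dotv_mulmx. Qed.

Lemma borel_eball (x : 'rV[R]_n) r : measurable (eball x r : set (@borelRV R n)).
Proof. by apply: borel_closed; exact: closed_eball. Qed.

Lemma eball_lty (x : 'rV[R]_n) r : (lam n (eball x r) < +oo)%E.
Proof.
apply: le_lt_trans (@bigbox_lty R n (Num.truncn (enorm x + r)).+1).
apply: le_lebesgue_outer => y; rewrite /eball/= => yr i; rewrite !mxE -ler_norml.
apply: le_trans (ltW (truncnS_gt _)).
apply: le_trans (coord_enorm _ _) _; rewrite -(subrK x y) addrC.
by apply: le_trans (ler_enormD _ _) _; rewrite lerD2l.
Qed.

Lemma bounded_lty (A : set 'rV[R]_n) (r : R) :
  (forall x, A x -> enorm x <= r) -> (lam n A < +oo)%E.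
Proof.
move=> Ar; apply: le_lt_trans (@eball_lty 0 r); apply: le_lebesgue_outer => x /Ar.
by rewrite /eball/= subr0.
Qed.

Lemma eball_gt0 (x : 'rV[R]_n) r : 0 < r -> (0 < lam n (eball x r))%E.
Proof.
move=> r0; have n1 : 0 < n%:R + 1 :> R by rewrite ltr_wpDl.
have a0 : 0 < r / (n%:R + 1) by exact: divr_gt0.
apply: (@lt_le_trans _ _ (lam n (box x (x + const_mx (r / (n%:R + 1)))))).
  rewrite lebesgue_box => [|i]; last by rewrite !mxE lerDl ltW.
  by rewrite lte_fin prodr_gt0// => i _; rewrite !mxE [X in X - _]addrC addrK.
apply: le_lebesgue_outer => y yb; rewrite /eball/=.
apply: le_trans (enorm_le_norm _) _.
apply: (@le_trans _ _ ((n%:R + 1) * (r / (n%:R + 1)))); last first.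
  by rewrite mulrCA divff ?mulr1// gt_eqF.
apply: ler_pM => //; first by rewrite lerDl.
rewrite [leLHS]/Num.norm/= mx_normrE; apply/bigmax_leP; split; first exact: ltW.
move=> /= -[j i] _; rewrite /= ord1; have /andP[] := yb i; rewrite !mxE => xy yx.
by rewrite ger0_norm ?subr_ge0// lerBlDl.
Qed.

Let pm (T : 'M[R]_n) : {measure set (@borelRV R n) -> \bar R} :=
  measure_function_pushforward__canonical__measure_function_Measure
   (@leb R n) (borel_continuous (@mulmx_continuous n T)).

(** The image measure under an orthogonal map is translation invariant, hence proportional to
    Lebesgue measure, and it fixes the unit ball, so the factor is 1. This settles Borel sets;
    arbitrary sets follow by Borel outer approximation, applied to the map and to its inverse. *)
Lemma lebesgue_orth (T : 'M[R]_n) (A : set 'rV[R]_n) : T *m T^T = 1%:M ->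
  lam n ((fun x => x *m T) @` A) = lam n A.
Proof.
suff H (S : 'M[R]_n) (B : set 'rV[R]_n) : S *m S^T = 1%:M ->
    measurable (B : set (@borelRV R n)) -> lam n ((fun x => x *m S) @^-1` B) = lam n B.
  move=> TT; have TT' := mulmx1C TT.
  have imE (B : set 'rV[R]_n) (S : 'M[R]_n) : S *m S^T = 1%:M -> S^T *m S = 1%:M ->
      (fun x => x *m S) @` B = (fun x : 'rV[R]_n => x *m S^T) @^-1` B.
    move=> SS SS'; apply/seteqP; split => [_ [x Bx <-]/=|x /= Bx].
      by rewrite -mulmxA SS mulmx1.
    by exists (x *m S^T) => //; rewrite -mulmxA SS' mulmx1.
  have le1 (S : 'M[R]_n) B : S *m S^T = 1%:M -> (lam n ((fun x => x *m S) @` B) <= lam n B)%E.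
    move=> SS; have SS' := mulmx1C SS.
    apply/lee_addgt0Pr => e e0; have [C [mC BC] Ce] := borel_outer B e0.
    apply: le_trans Ce; rewrite -(@H S^T C) ?trmxK// -imE//.
    exact/le_lebesgue_outer/image_subset.
  apply/eqP; rewrite eq_le le1//=.
  have := le1 T^T ((fun x => x *m T) @` A); rewrite trmxK => /(_ TT').
  rewrite image_comp (_ : _ \o _ = id) ?image_id//.
  by apply/funext => x /=; rewrite -mulmxA TT mulmx1.
move=> SS mB; have SS' := mulmx1C SS.
have preball r : (fun x => x *m S) @^-1` eball 0 r = eball 0 r.
  by apply/seteqP; split => x; rewrite /eball/= !subr0 enorm_mulmx.
have sf : sigma_finite setT (pm S).
  exists (fun k => eball 0 k%:R).
    apply/seteqP; split => // x _; exists (Num.truncn (enorm x)).+1 => //.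
    by rewrite /eball/= subr0; exact/ltW/truncnS_gt.
  move=> k; split; first exact: borel_eball.
  by rewrite /= /pushforward preball; exact: eball_lty.
have := @translation_invariant_unique R n (sfm sf) _ B (eball 0 1).
rewrite /= /pushforward preball => H.
have b0 := @eball_gt0 0 1 ltr01; have bf := @eball_lty 0 1.
set B1 : set 'rV[R]_n := eball 0 1 in b0 bf H.
have bfin : lam n B1 \is a fin_num by rewrite ge0_fin_numE ?lebesgue_outer_ge0.
have f0 : 0 < fine (lam n B1) by rewrite fine_gt0// b0.
have {H} : (lam n B1 * lam n ((fun x => x *m S) @^-1` B) = lam n B1 * lam n B)%E.
  rewrite muleC H//; last exact: borel_eball.
  move=> C v mC; rewrite /leb -[RHS](lebesgue_preimageD _ (v *m S^T)); congr (lam n _).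
  by apply/seteqP; split => x /=; rewrite mulmxDl -mulmxA SS' mulmx1.
by move=> E; apply/le_anti/andP; split; rewrite -(lee_pmul2l bfin b0) E.
Qed.

End orthogonal.

(** * The isodiametric inequality *)

Lemma ler_of_sqr (R : realDomainType) (x y : R) : 0 <= y -> x ^+ 2 <= y ^+ 2 -> x <= y.
Proof.
move=> y0; rewrite -(real_normK (num_real x)) ler_sqr ?nnegrE//.
exact: le_trans (ler_norm _).
Qed.

Section eball_volume.
Context {R : realType} {n : nat}.

Lemma lebesgue_eball (x : 'rV[R]_n) (r : R) : 0 <= r ->
  lam n (eball x r) = ((r ^+ n)%:E * lam n (@eball R n 0 1))%E.
Proof.
rewrite le_eqVlt => /predU1P[<-|r0].
  (* A ball of radius 0 is a point: its measure is 0 except in dimension 0, where [0 ^+ 0 = 1] gives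
     the right value. *)
  have -> : eball x 0 = box x x.
    apply/seteqP; split => [y|y yx]; rewrite /eball/=.
      rewrite le_eqVlt ltNge enorm_ge0 orbF enorm_eq0 subr_eq0 => /eqP -> i.
      by rewrite !lexx.
    rewrite le_eqVlt enorm_eq0 subr_eq0; apply/orP; left; apply/eqP/rowP => i.
    by apply/eqP; rewrite eq_le andbC; exact: yx.
  rewrite lebesgue_box//; case: n x => [x|m x].
    rewrite big_ord0 expr0 mul1e lebesgue_outer_rV0//.
    by exists 0; rewrite /eball/= subr0 enorm0.
  by rewrite big_ord_recl subrr mul0r exprS mul0r mul0e.
have -> : eball x r = (fun y => y + x) @` ((fun y => r *: y) @` eball 0 1).
  apply/seteqP; split => [y|_ [_ [y /= y1 <-] <-]]; rewrite /eball/=.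
    move=> yx; exists (y - x); last by rewrite subrK.
    exists (r^-1 *: (y - x)); last by rewrite scalerA divff ?scale1r ?gt_eqF.
    by rewrite subr0 enormZ gtr0_norm ?invr_gt0// mulrC ler_pdivrMr// mul1r.
  rewrite addrK enormZ gtr0_norm//; move: y1; rewrite /eball/= subr0.
  by move=> y1; rewrite ger_pMr.
by rewrite lebesgueD lebesgueZ ?gt_eqF// gtr0_norm.
Qed.

Lemma vol_eballE (x : 'rV[R]_n) (r : R) : (vol (eball x r))%:E = lam n (eball x r).
Proof.
by rewrite fineK// ge0_fin_numE ?lebesgue_outer_ge0//; exact: eball_lty.
Qed.

End eball_volume.

Section steiner.
Context {R : realType} {m : nat} (i : 'I_m.+1).
Implicit Types A : set 'rV[R]_m.+1.

Definition flip n (k : 'I_n) (x : 'rV[R]_n) : 'rV[R]_n :=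
  \row_j (if j == k then - x 0 j else x 0 j).

Definition slice A (y : 'rV[R]_m) : set R := [set t | A (ins i y t)].

Definition slen A (y : 'rV[R]_m) : R := fine (@lebesgue_measure R (slice A y)).

(** Fibres of [A] of length zero are dropped instead of being replaced by a point, so every fibre of
    the symmetrised set comes from a nonempty fibre of [A]; the volume does not see the
    difference. *)
Definition steiner A : set 'rV[R]_m.+1 :=
  [set x | 0 < slen A (del i x) /\ `|x 0 i| <= slen A (del i x) / 2].

Lemma sqr_enorm_ins (y : 'rV[R]_m) (t : R) :
  enorm (ins i y t) ^+ 2 = enorm y ^+ 2 + t ^+ 2.
Proof.
rewrite !sqr_enorm !dotvE (bigD1_ord i)//= ins_i addrC expr2; congr (_ + _).
by apply: eq_bigr => k _; rewrite !ins_lift.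
Qed.

Lemma insB (y z : 'rV[R]_m) s t : ins i y s - ins i z t = ins i (y - z) (s - t).
Proof.
apply/rowP => j; rewrite !mxE; case: unliftP => [k _|_] //.
by rewrite !mxE.
Qed.

Lemma measurable_slice A y : measurable (A : set (@borelRV R m.+1)) ->
  measurable (slice A y).
Proof.
move=> mA; have := measurable_ins (R := R) i measurableT mA; rewrite setTI.
move=> mB; rewrite (_ : slice A y = xsection ((fun yt : @borelRV R m * R =>
  ins i yt.1 yt.2 : @borelRV R m.+1) @^-1` A) y); first exact: measurable_xsection.
by apply/seteqP; split => t; rewrite /xsection/= inE.
Qed.

Lemma measurable_del : measurable_fun setT
  (fun x : @borelRV R m.+1 => (del i x, x 0 i) : @borelRV R m * R).
Proof.
apply/measurable_fun_pair => /=.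
  apply: (borel_continuous (f := @del R m i)) => x A [P nP PA].
  suff : nbhs x [set y : 'rV[R]_m.+1 | forall k, P 0 k (y 0 (lift i k))].
    apply: (@filterS _ _ (@nbhs_filter 'rV[R]_m.+1 x)) => y Py; apply: PA => j k.
    by rewrite ord1 mxE.
  apply: (filter_forall (nbhs_filter (x : 'rV[R]_m.+1))) => k.
  by apply: coord_continuous; have := nP 0 k; rewrite mxE.
apply: (borel_continuousR (f := fun x : 'rV[R]_m.+1 => x 0 i)) => x.
exact: coord_continuous.
Qed.

Variables (A : set 'rV[R]_m.+1) (M d : R).
Hypothesis mA : measurable (A : set (@borelRV R m.+1)).
Hypothesis AM : forall x, A x -> enorm x <= M.
Hypothesis Ad : forall x y, A x -> A y -> enorm (x - y) <= d.

Let M0 x : A x -> 0 <= M.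
Proof. by move=> /AM; apply: le_trans; exact: enorm_ge0. Qed.

Lemma slice_bounded y t : slice A y t -> `|t| <= M /\ enorm y <= M.
Proof.
rewrite /slice/= => Ayt; have := AM Ayt; have m0 := M0 Ayt.
rewrite -ler_sqr ?nnegrE ?enorm_ge0// sqr_enorm_ins => h.
split; apply: ler_of_sqr => //; apply: le_trans h.
  by rewrite real_normK ?num_real// lerDr sqr_ge0.
by rewrite lerDl sqr_ge0.
Qed.

Lemma slice_lty y : (@lebesgue_measure R (slice A y) < +oo)%E.
Proof.
apply: (@le_lt_trans _ _ (@lebesgue_measure R `[- M, M]%classic)).
  apply: le_measure; rewrite ?inE//; first exact: measurable_slice.
  by move=> t /slice_bounded[tM _]; rewrite /= in_itv/= -ler_norml.
by rewrite lebesgue_measure_itv/=; case: ifP => _; rewrite ?ltry.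
Qed.

Lemma slenE y : (slen A y)%:E = @lebesgue_measure R (slice A y).
Proof. by rewrite fineK// ge0_fin_numE// slice_lty. Qed.

Lemma slen_ge0 y : 0 <= slen A y.
Proof. exact: fine_ge0. Qed.

Lemma slice_neq0 y : 0 < slen A y -> slice A y !=set0.
Proof.
move=> h; apply/set0P/negP => /eqP s0.
by move: h; rewrite /slen s0 measure0 ltxx.
Qed.

Lemma has_sup_slice y : 0 < slen A y -> has_sup (slice A y) /\ has_inf (slice A y).
Proof.
move=> /slice_neq0 h; split; split => //.
  by exists M => t /slice_bounded[]; rewrite ler_norml => /andP[].
by exists (- M) => t /slice_bounded[]; rewrite ler_norml => /andP[].
Qed.

Lemma slen_le_width y : 0 < slen A y -> slen A y <= sup (slice A y) - inf (slice A y).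
Proof.
move=> h; have [hs hi] := has_sup_slice h.
have [t0 t0A] := slice_neq0 h.
have le1 : inf (slice A y) <= sup (slice A y).
  by apply: (@le_trans _ _ t0); [exact: ge_inf hi.2 _ t0A|exact: ub_le_sup hs.2 _ t0A].
rewrite -lee_fin slenE.
apply: (@le_trans _ _ (@lebesgue_measure R `[inf (slice A y), sup (slice A y)]%classic)).
  apply: le_measure; rewrite ?inE//; first exact: measurable_slice.
  move=> t tA; rewrite /= in_itv/=; apply/andP; split.
    exact: ge_inf hi.2 _ tA.
  exact: ub_le_sup hs.2 _ tA.
rewrite lebesgue_measure_itv/= lte_fin; case: ltP => //= _.
by rewrite lee_fin subr_ge0.
Qed.

Lemma measurable_slen : measurable_fun setT (slen A : @borelRV R m -> R).
Proof.
apply: measurableT_comp => //.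
have mB := measurable_ins (R := R) i measurableT mA; rewrite setTI in mB.
have := measurable_fun_xsection (@lebesgue_measure R) mB.
congr measurable_fun; apply/funext => y; congr lebesgue_measure.
by apply/seteqP; split => t; rewrite /xsection/= inE.
Qed.

Lemma measurable_steiner : measurable (steiner A : set (@borelRV R m.+1)).
Proof.
have -> : steiner A = (fun x => (del i x, x 0 i)) @^-1`
   (((slen A \o fst) @^-1` `]0, +oo[%classic) `&`
    ((fun yt : 'rV[R]_m * R => slen A yt.1 / 2 - `|yt.2|) @^-1` `[0, +oo[%classic)).
  apply/seteqP; split => x; rewrite /steiner/= !in_itv/= !andbT subr_ge0//.
rewrite -[X in measurable X]setTI; apply: measurable_del => //.
have ms : measurable_fun setT (fun yt : @borelRV R m * R => slen A yt.1).
  by apply: measurableT_comp measurable_slen _.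
apply: measurableI; rewrite -[X in measurable X]setTI.
  exact: ms.
apply: (measurable_funB (f := fun yt : @borelRV R m * R => slen A yt.1 / 2)) => //.
  exact: measurable_funM.
by apply: measurableT_comp => //; exact: measurable_snd.
Qed.

Lemma lebesgue_steiner : lam m.+1 (steiner A) = lam m.+1 A.
Proof.
rewrite (lebesgue_fubini i measurable_steiner) (lebesgue_fubini i mA).
apply: eq_integral => y _; rewrite -[RHS]slenE.
have [L0|L0] := ltP 0 (slen A y); last first.
  rewrite (_ : [set _ | _] = set0); last first.
    by apply/seteqP; split => // t; rewrite /steiner/= insK => -[]; rewrite ltNge L0.
  by rewrite measure0; congr EFin; apply/eqP; rewrite eq_le L0 slen_ge0.
rewrite (_ : [set _ | _] = `[- (slen A y / 2), slen A y / 2]%classic); last first.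
  apply/seteqP; split => t; rewrite /steiner/= insK ins_i in_itv/= ler_norml//.
  by case.
rewrite lebesgue_measure_itv/= lte_fin ifT; last by rewrite gtrN ?divr_gt0.
by rewrite -EFinD opprK -splitr.
Qed.

(** Let w be the largest height difference that [d] allows between the fibres U over u and V over v.
    Both sup U - inf V and sup V - inf U are at most w; adding them, the two lengths sum to at most
    2 w, which bounds the height difference of points in the centred fibres by w. *)
Lemma steiner_diam x y : steiner A x -> steiner A y -> enorm (x - y) <= d.
Proof.
rewrite -(insE i x) -(insE i y); set u := del i x; set v := del i y.
rewrite /steiner/= !insK !ins_i; set s := x 0 i; set t := y 0 i.
move=> [Lu su] [Lv tv]; have [a Aa] := slice_neq0 Lu; have [b Ab] := slice_neq0 Lv.
have d0 : 0 <= d := le_trans (enorm_ge0 _) (Ad Aa Ab).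
have key p q : slice A u p -> slice A v q -> enorm (u - v) ^+ 2 + (p - q) ^+ 2 <= d ^+ 2.
  by move=> Ap Aq; rewrite -sqr_enorm_ins -insB ler_sqr ?nnegrE//; exact: Ad.
have q0 : 0 <= d ^+ 2 - enorm (u - v) ^+ 2.
  by have := key _ _ Aa Ab; have := sqr_ge0 (a - b); lra.
set w := Num.sqrt (d ^+ 2 - enorm (u - v) ^+ 2).
have kw p q : slice A u p -> slice A v q -> `|p - q| <= w.
  move=> Ap Aq; rewrite -ler_sqr ?nnegrE ?sqrtr_ge0// sqr_sqrtr//.
  by rewrite real_normK ?num_real//; have := key _ _ Ap Aq; lra.
have [hsu hiu] := has_sup_slice Lu; have [hsv hiv] := has_sup_slice Lv.
have h1 : sup (slice A u) - w <= inf (slice A v).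
  apply: lb_le_inf; first by exists b.
  move=> q Aq; rewrite lerBlDr; apply: ge_sup; first by exists a.
  by move=> p Ap; have := kw _ _ Ap Aq; rewrite ler_norml => /andP[_]; rewrite lerBlDl.
have h2 : sup (slice A v) - w <= inf (slice A u).
  apply: lb_le_inf; first by exists a.
  move=> p Ap; rewrite lerBlDr; apply: ge_sup; first by exists b.
  move=> q Aq; have := kw _ _ Ap Aq; rewrite distrC ler_norml => /andP[_].
  by rewrite lerBlDl.
have := slen_le_width Lu; have := slen_le_width Lv => wv wu.
have stw : `|s - t| <= w.
  apply: le_trans (ler_normB _ _) _; apply: (le_trans (lerD su tv)); lra.
rewrite -ler_sqr ?nnegrE// insB sqr_enorm_ins -lerBrDl.
rewrite -[leRHS]sqr_sqrtr// -/w -(real_normK (num_real (s - t))).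
by rewrite ler_sqr ?nnegrE ?sqrtr_ge0.
Qed.

Lemma steiner_bounded x : steiner A x -> enorm x <= 2 * M.
Proof.
rewrite -(insE i x) /steiner/= insK ins_i => -[L0 h].
have [t At] := slice_neq0 L0; have [_ yM] := slice_bounded At.
have m0 : 0 <= M by apply: le_trans yM; exact: enorm_ge0.
have LM : slen A (del i x) <= 2 * M.
  apply: le_trans (slen_le_width L0) _.
  have [hs hi] := has_sup_slice L0.
  rewrite lerBlDl; apply: ge_sup; first by exists t.
  move=> p Ap; rewrite -lerBlDr; apply: lb_le_inf; first by exists t.
  move=> q Aq; have [+ _] := slice_bounded Ap; have [+ _] := slice_bounded Aq.
  by rewrite !ler_norml => /andP[? ?] /andP[? ?]; lra.
apply: ler_of_sqr; first by rewrite mulr_ge0.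
rewrite sqr_enorm_ins -(real_normK (num_real (x 0 i))).
have := normr_ge0 (x 0 i); have : `|x 0 i| <= M by lra.
by have := enorm_ge0 (del i x); nra.
Qed.

Lemma steiner_flip_i x : steiner A x -> steiner A (flip i x).
Proof.
rewrite /steiner/= (_ : del i (flip i x) = del i x).
  by rewrite mxE eqxx normrN.
apply/rowP => k; rewrite !mxE; case: eqP => // /esym/eqP.
by rewrite (negbTE (neq_lift _ _)).
Qed.

(** Reflecting coordinate k maps fibres in direction i to fibres of the same length, so the
    symmetries acquired so far survive the next symmetrisation. *)
Lemma steiner_flip k x : k != i -> (forall y, A y -> A (flip k y)) ->
  steiner A x -> steiner A (flip k x).
Proof.
move=> ki Ak; rewrite /steiner/=.
have flipK y : flip k (flip k y) = y :> 'rV[R]_m.+1.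
  by apply/rowP => j; rewrite !mxE; case: eqP => // _; rewrite opprK.
have -> : slen A (del i (flip k x)) = slen A (del i x).
  have insf t : ins i (del i (flip k x)) t = flip k (ins i (del i x) t).
    apply/rowP => j; rewrite !mxE; case: unliftP => [l ->|->]; rewrite ?mxE//.
    by rewrite eq_sym (negbTE ki).
  congr fine; congr lebesgue_measure; apply/seteqP; split => t; rewrite /slice/= insf.
    by move=> /Ak; rewrite flipK.
  exact: Ak.
by rewrite mxE eq_sym (negbTE ki).
Qed.

End steiner.

Section isodiametric.
Context {R : realType}.

(** After symmetrisation in all coordinates the set is invariant under x -> - x, so the bound [d] on
    distances places it in the ball of radius d / 2. *)
Let isodiam_borel n (A : set 'rV[R]_n) (M d : R) : measurable (A : set (@borelRV R n)) ->
  0 <= d ->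
  (forall x, A x -> enorm x <= M) ->
  (forall x y, A x -> A y -> enorm (x - y) <= d) ->
  (lam n A <= lam n (@eball R n 0 (d / 2)))%E.
Proof.
move=> mA d0 AM Ad.
have step (k : nat) : (k <= n)%N -> exists (B : set 'rV[R]_n) (N : R),
    [/\ measurable (B : set (@borelRV R n)), lam n B = lam n A,
      forall x, B x -> enorm x <= N,
      forall x y, B x -> B y -> enorm (x - y) <= d &
      forall (j : 'I_n) x, (j < k)%N -> B x -> B (flip j x)].
  elim: k => [_|k IH kn]; first by exists A, M.
  have [B [N [mB BA BN Bd Bf]]] := IH (ltnW kn).
  case: n A M mA AM Ad kn IH B N mB BA BN Bd Bf => // m A M mA AM Ad kn IH B N mB BA BN Bd Bf.
  pose i := Ordinal kn; exists (steiner i B), (2 * N); split.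
  - exact: measurable_steiner.
  - by rewrite (lebesgue_steiner _ mB BN).
  - exact: steiner_bounded mB BN.
  - exact: steiner_diam mB BN Bd.
  - move=> j x; rewrite ltnS leq_eqVlt => /predU1P[jk|jk].
      have -> : j = i by apply: val_inj.
      exact: steiner_flip_i.
    apply: steiner_flip; first by apply/eqP => ji; move: jk; rewrite ji/= ltnn.
    by move=> y; exact: Bf.
have [B [N [mB <- BN Bd Bf]]] := step n (leqnn n).
apply: le_lebesgue_outer => x Bx; rewrite /eball/= subr0.
suff BNx : B (- x).
  have := Bd _ _ Bx BNx; rewrite opprK -mulr2n -scaler_nat enormZ ger0_norm//.
  by rewrite ler_pdivlMr// mulrC.
suff : forall k, (k <= n)%N -> B (\row_(j < n) (if (j < k)%N then - x 0 j else x 0 j)).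
  move=> /(_ n (leqnn n)); congr B; apply/rowP => j; rewrite !mxE ltn_ord//.
elim=> [_|k IH kn]; first by move: Bx; congr B; apply/rowP => j; rewrite mxE.
have := Bf (Ordinal kn) _ (ltn_ord _) (IH (ltnW kn)); congr B; apply/rowP => j.
rewrite !mxE; case: eqP => [->/=|jk]; first by rewrite ltnn ltnSn.
rewrite ltnS [in RHS]leq_eqVlt; case: eqP => //= jk'.
by exfalso; apply: jk; apply: val_inj.
Qed.

Lemma isodiametric n (A : set 'rV[R]_n) (d : R) : 0 <= d ->
  (forall x y, A x -> A y -> enorm (x - y) <= d) ->
  (lam n A <= (vol (@eball R n 0 1) * (d / 2) ^+ n)%:E)%E.
Proof.
move=> d0 Ad; have [->|/set0P[a Aa]] := eqVneq A set0.
  by rewrite lebesgue_outer0 lee_fin mulr_ge0 ?fine_ge0 ?lebesgue_outer_ge0// exprn_ge0// divr_ge0.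
rewrite mulrC EFinM vol_eballE -(lebesgue_eball (0 : 'rV[R]_n)) ?divr_ge0//.
(* The set is enlarged to a closed one with the same bound on distances: points of [C'] are within d
   of all points of [C], and [A] lies in both. *)
pose C := \bigcap_(x in A) eball x d; pose C' := \bigcap_(x in C) eball x d.
have cl (B : set 'rV[R]_n) : closed (\bigcap_(x in B) eball x d).
  by apply: closed_bigI => x _; exact: closed_eball.
apply: (@le_trans _ _ (lam n (C `&` C'))).
  apply: le_lebesgue_outer => x Ax; split => [y Ay|y Cy]; rewrite /eball/=.
    exact: Ad.
  by rewrite enormB; exact: Cy.
apply: (@isodiam_borel _ _ (d + enorm a)) => //.
- by apply: borel_closed; apply: closedI; exact: cl.
- move=> x [Cx _]; rewrite -(subrK a x); apply: le_trans (ler_enormD _ _) _.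
  by rewrite lerD2r; exact: Cx.
- by move=> x y [Cx C'x] [Cy C'y]; exact: C'x.
Qed.

End isodiametric.

(** * Hausdorff measure *)

Section hausdorff_basic.
Context {R : realType} {n : nat}.
Implicit Types A : set 'rV[R]_n.

Lemma diam_le A (d : R) :
  (diam A <= d%:E)%E <-> forall x y, A x -> A y -> enorm (x - y) <= d.
Proof.
split=> [h x y Ax Ay|h].
  by rewrite -lee_fin; apply: le_trans h; apply: ereal_sup_ubound; exists x => //; exists y.
by apply: ge_ereal_sup => _ [x Ax [y Ay <-]]; rewrite lee_fin; exact: h.
Qed.

Lemma diam_ge0 A : A !=set0 -> (0 <= diam A)%E.
Proof.
move=> [x Ax]; apply: ereal_sup_ge; exists (enorm (x - x))%:E.
  by exists x => //; exists x.
by rewrite lee_fin.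
Qed.

Variable s : nat.
Notation om := (vol (@eball R s 0 1)).

Lemma om_gt0 : 0 < om.
Proof. by rewrite -lte_fin vol_eballE; exact: eball_gt0. Qed.

Lemma hausdorff_gauge_le (e d : R) A : d <= e ->
  (forall x y, A x -> A y -> enorm (x - y) <= d) -> 0 <= d ->
  (hausdorff_gauge s e A <= (om * (d / 2) ^+ s)%:E)%E.
Proof.
move=> de Ad d0; rewrite /hausdorff_gauge; case: ifPn => [_|/set0P A0].
  by rewrite lee_fin mulr_ge0 ?(ltW om_gt0)// exprn_ge0// divr_ge0.
have dA : (diam A <= d%:E)%E by apply/diam_le.
rewrite ifT; last by apply: le_trans dA _; rewrite lee_fin.
have fdA : diam A \is a fin_num by rewrite ge0_fin_numE ?diam_ge0// (le_lt_trans dA)// ltry.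
rewrite lee_fin ler_wpM2l ?(ltW om_gt0)// lerXn2r ?nnegrE ?divr_ge0//.
  by rewrite fine_ge0// diam_ge0.
by rewrite ler_wpM2r// -lee_fin fineK.
Qed.

Lemma hausdorff_pre_cover (e : R) A (C : (set 'rV[R]_n)^nat) :
  A `<=` \bigcup_k C k ->
  (hausdorff_pre s e A <= \sum_(k <oo) hausdorff_gauge s e (C k))%E.
Proof. by move=> AC; apply: ereal_inf_lbound; exists C. Qed.

Lemma hausdorff_pre_ge0 (e : R) A : (0 <= hausdorff_pre s e A)%E.
Proof. exact: (@mu_ext_ge0 _ (discrete_type _) _ _ (hausdorff_gauge_ge0 s e)). Qed.

Lemma hausdorff_pre0 (e : R) : hausdorff_pre s e (set0 : set 'rV[R]_n) = 0%E.
Proof.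
exact: (@mu_ext0 _ (discrete_type _) _ _ (hausdorff_gauge0 n s e)
  (hausdorff_gauge_ge0 s e)).
Qed.

Lemma le_hausdorff_pre (e : R) :
  {homo @hausdorff_pre R n s e : A B / A `<=` B >-> (A <= B)%E}.
Proof. exact: (@le_mu_ext _ (discrete_type _)). Qed.

Lemma hausdorff_pre_sigma (e : R) (F : (set 'rV[R]_n)^nat) :
  (hausdorff_pre s e (\bigcup_k F k) <= \sum_(k <oo) hausdorff_pre s e (F k))%E.
Proof.
exact: (@mu_ext_sigma_subadditive _ (discrete_type _) _ _ (hausdorff_gauge_ge0 s e)).
Qed.

Lemma hausdorff_pre_gauge (e : R) A :
  (hausdorff_pre s e A <= hausdorff_gauge s e A)%E.
Proof.
apply: le_trans (@hausdorff_pre_cover e A (bigcup2 A set0) _) _.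
  by move=> x xb; exists 0%N.
rewrite (nneseries_split _ 1)//; last by move=> k _ ; exact: hausdorff_gauge_ge0.
rewrite add0n big_nat1 eseries0 ?adde0//.
by move=> [|[|i]] // _ _; exact: hausdorff_gauge0.
Qed.

Lemma hausdorff_pre_setU (e : R) A B :
  (hausdorff_pre s e (A `|` B) <= hausdorff_pre s e A + hausdorff_pre s e B)%E.
Proof.
rewrite -bigcup2E; apply: le_trans (hausdorff_pre_sigma _ _) _.
rewrite (nneseries_split _ 2)//; last by move=> k _ ; exact: hausdorff_pre_ge0.
rewrite add0n big_nat_recr//= big_nat1 eseries0 ?adde0//.
by move=> [|[|i]] // _ _; exact: hausdorff_pre0.
Qed.

Lemma hausdorff_pre_fin (e : R) (I : Type) (r : seq I) (F : I -> set 'rV[R]_n) :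
  (hausdorff_pre s e (\big[setU/set0]_(i <- r) F i) <=
   \sum_(i <- r) hausdorff_pre s e (F i))%E.
Proof.
elim: r => [|i r IH]; first by rewrite !big_nil hausdorff_pre0.
by rewrite !big_cons; apply: le_trans (hausdorff_pre_setU _ _ _) _; exact: leeD2l.
Qed.

Lemma hausdorff_outer_le (X : \bar R) A :
  (forall e : R, 0 < e -> (hausdorff_pre s e A <= X)%E) -> (hausdorff_outer s A <= X)%E.
Proof. by move=> h; apply: ge_ereal_sup => _ [e e0 <-]; exact: h. Qed.

Lemma hausdorff_pre_le_outer (e : R) A : 0 < e ->
  (hausdorff_pre s e A <= hausdorff_outer s A)%E.
Proof. by move=> e0; apply: ereal_sup_ubound; exists e. Qed.

End hausdorff_basic.

Section hausdorff_lipschitz.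
Context {R : realType} {a b s : nat} {I : Type}.

Let gauge_lip (e L : R) (u : I -> 'rV[R]_a) (v : I -> 'rV[R]_b) (D : set I) (C : set 'rV[R]_b) :
  0 < L -> (forall i j, D i -> D j -> enorm (u i - u j) <= L * enorm (v i - v j)) ->
  (hausdorff_gauge s (L * e) (u @` (D `&` v @^-1` C)) <=
   (L ^+ s)%:E * hausdorff_gauge s e C)%E.
Proof.
move=> L0 uv; have Ls : 0 < L ^+ s by exact: exprn_gt0.
rewrite [in leRHS]/hausdorff_gauge; case: ifPn => [/eqP ->|/set0P C0].
  by rewrite preimage_set0 setI0 image_set0 hausdorff_gauge0 mule0.
case: ifPn => [Ce|_]; last by rewrite gt0_muley ?lte_fin// leey.
have fC : diam C \is a fin_num by rewrite ge0_fin_numE ?diam_ge0// (le_lt_trans Ce)// ltry.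
have d0 : 0 <= fine (diam C) by rewrite fine_ge0// diam_ge0.
rewrite -EFinM mulrCA -exprMn mulrA; apply: hausdorff_gauge_le.
- by rewrite ler_pM2l// -lee_fin fineK.
- move=> _ _ [i [Di Ci] <-] [j [Dj Cj] <-]; apply: le_trans (uv _ _ Di Dj) _.
  rewrite ler_pM2l//; suff /diam_le : (diam C <= (fine (diam C))%:E)%E by apply.
  by rewrite fineK.
- by rewrite mulr_ge0// ltW.
Qed.

(** Stated for two parametrisations of the same index set, so that no map between the two images has
    to be defined: a covering of the image under [v] is pulled back to [D] and pushed forward by
    [u]. *)
Lemma hausdorff_lipschitz (L : R) (u : I -> 'rV[R]_a) (v : I -> 'rV[R]_b) (D : set I) :
  0 < L -> (forall i j, D i -> D j -> enorm (u i - u j) <= L * enorm (v i - v j)) ->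
  (hausdorff_outer s (u @` D) <= (L ^+ s)%:E * hausdorff_outer s (v @` D))%E.
Proof.
move=> L0 uv; have Ls : 0 < L ^+ s by exact: exprn_gt0.
apply: hausdorff_outer_le => e e0.
apply: (@le_trans _ _ ((L ^+ s)%:E * hausdorff_pre s (e / L) (v @` D))%E); last first.
  by rewrite lee_pmul2l ?lte_fin//; apply: hausdorff_pre_le_outer; exact: divr_gt0.
rewrite -lee_pdivrMl//; apply: le_ereal_inf_tmp => _ [C [_ DC] <-].
rewrite lee_pdivrMl// -nneseriesZl; last by move=> *; exact: hausdorff_gauge_ge0.
apply: le_trans (@hausdorff_pre_cover _ _ s e _ (fun k => u @` (D `&` v @^-1` (C k))) _) _.
  move=> _ [i Di <-]; have [|k _ Ck] := DC (v i); first by exists i.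
  by exists k => //; exists i.
apply: lee_nneseries => [k _ *|k _ *]; first exact: hausdorff_gauge_ge0.
rewrite (_ : e = L * (e / L)); last by rewrite mulrCA divff ?mulr1 ?gt_eqF.
rewrite [in leRHS]mulrCA divff ?mulr1 ?gt_eqF//.
exact: gauge_lip.
Qed.

End hausdorff_lipschitz.

(** * Hausdorff measure of top dimension is Lebesgue measure *)

Section hausdorff_lebesgue.
Context {R : realType} {n : nat}.
Implicit Types A : set 'rV[R]_n.
Notation om := (vol (@eball R n 0 1)).

Lemma lebesgue_le_hausdorff A : (lam n A <= hausdorff_outer n A)%E.
Proof.
apply: le_trans (hausdorff_pre_le_outer (e := 1) n A ltr01).
apply: le_ereal_inf_tmp => _ [C [_ AC] <-].
apply: (@le_trans _ _ (lam n (\bigcup_k C k))); first exact: le_lebesgue_outer.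
apply: le_trans (lebesgue_outer_sigma_subadditive _) _.
apply: lee_nneseries => k _ *; first exact: lebesgue_outer_ge0.
rewrite /hausdorff_gauge; case: ifPn => [/eqP ->|/set0P C0]; first by rewrite lebesgue_outer0.
case: ifPn => [Ce|_]; last exact: leey.
have fC : diam (C k) \is a fin_num by rewrite ge0_fin_numE ?diam_ge0// (le_lt_trans Ce)// ltry.
apply: isodiametric; first by rewrite fine_ge0// diam_ge0.
by apply/diam_le; rewrite fineK.
Qed.

Definition cube (x : 'rV[R]_n) (l : R) := box x (x + const_mx l).

(** The rate [k] at which small cubes can be covered; a rate for cubes becomes a rate for all sets,
    and the argument drives it down to 1. *)
Let small_cubes (k : R) := forall e, 0 < e -> exists2 l0, 0 < l0 &
  forall l x, 0 < l -> l <= l0 -> (hausdorff_pre n e (cube x l) <= (k * l ^+ n)%:E)%E.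

(** Cubes on a lattice of side [l] fill the box; their number along a side exceeds the quotient of
    lengths by at most 1, which produces the summand [l] in each factor. *)
Let grid (k e l : R) (c d : 'rV[R]_n) : 0 <= k -> 0 < l ->
  (forall i, c 0 i <= d 0 i) ->
  (forall x, (hausdorff_pre n e (cube x l) <= (k * l ^+ n)%:E)%E) ->
  (hausdorff_pre n e (box c d) <= (k * \prod_i (d 0 i - c 0 i + l))%:E)%E.
Proof.
move=> k0 l0 cd hl.
pose N i := (Num.truncn ((d 0 i - c 0 i) / l)).+1.
have q0 i : 0 <= (d 0 i - c 0 i) / l by rewrite divr_ge0 ?subr_ge0// ltW.
have [M NM] : exists M, forall i, (N i <= M)%N.
  by exists (\max_i N i)%N => i; exact: leq_bigmax.
(* A common bound [M] on the numbers of cubes lets the grid be indexed by functions; indices beyond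
   the box give the empty set. *)
pose F (f : {ffun 'I_n -> 'I_M}) := if [forall i, f i < N i]%N then
  cube (\row_i (c 0 i + (f i)%:R * l)) l else set0.
have sub : box c d `<=` \big[setU/set0]_(f <- index_enum _) F f.
  move=> x xcd.
  pose g i := Num.truncn ((x 0 i - c 0 i) / l).
  have x0 i : 0 <= (x 0 i - c 0 i) / l.
    by rewrite divr_ge0 ?(ltW l0)// subr_ge0; have /andP[] := xcd i.
  have gN i : (g i < N i)%N.
    rewrite ltnS /g; apply: le_truncn; rewrite ler_pM2r ?invr_gt0// lerD2r.
    by have /andP[] := xcd i.
  pose f := [ffun i => Ordinal (leq_trans (gN i) (NM i))].
  rewrite (bigD1 f)//=; left; rewrite /F ifT => [i|]; last first.
    by apply/forallP => i; rewrite /f ffunE; exact: gN.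
  rewrite !mxE /f ffunE /=; have /andP[g1 g2] := truncn_itv (x0 i).
  move: g1 g2; rewrite -/(g i) -natr1 ler_pdivlMr// ltr_pdivrMr// => g1 g2.
  by apply/andP; split; lra.
apply: (@le_trans _ _ (\sum_(f <- index_enum _) hausdorff_pre n e (F f))%E).
  by apply: le_trans (@le_hausdorff_pre _ _ _ _ _ _ sub) _; exact: hausdorff_pre_fin.
have Nl i : (N i)%:R * l <= d 0 i - c 0 i + l.
  rewrite /N -natr1 mulrDl mul1r lerD2r -ler_pdivlMr//.
  by rewrite truncn_le.
have key (f : {ffun 'I_n -> 'I_M}) : (hausdorff_pre n e (F f) <=
    (k * \prod_i (if (f i < N i)%N then l else 0))%:E)%E.
  rewrite /F; case: ifPn => [/forallP fN|_].
    apply: le_trans (hl _) _; rewrite lee_fin ler_wpM2l//.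
    rewrite (eq_bigr (fun=> l)) ?prodr_const ?card_ord// => i _.
    by rewrite fN.
  rewrite hausdorff_pre0 lee_fin mulr_ge0// prodr_ge0// => i _.
  by case: ifP => // _; exact: ltW.
apply: le_trans (lee_sum _ (fun f _ => key f)) _.
rewrite sumEFin lee_fin -mulr_sumr ler_wpM2l//.
rewrite -(bigA_distr_bigA (fun i (j : 'I_M) => if (j < N i)%N then l else 0)).
apply: ler_prod => i _; apply/andP; split.
  by apply: sumr_ge0 => j _; case: ifP => // _; exact: ltW.
apply: le_trans (Nl i).
rewrite -big_mkcond/= -(big_ord_widen _ (fun=> l) (NM i)) sumr_const card_ord.
by rewrite mulr_natl.
Qed.

Let box_bound (k e : R) (c d : 'rV[R]_n) : 0 <= k -> 0 < e -> small_cubes k ->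
  (forall i, c 0 i <= d 0 i) ->
  (hausdorff_pre n e (box c d) <= (k * \prod_i (d 0 i - c 0 i))%:E)%E.
Proof.
move=> k0 e0 hk cd; have [l0 l00 hl] := hk _ e0.
pose p := \prod_i ((d 0 i - c 0 i)%:P + 'X) : {poly R}.
have pE l : p.[l] = \prod_i (d 0 i - c 0 i + l).
  by rewrite horner_prod; apply: eq_bigr => i _; rewrite !hornerE.
have cp : (k * p.[l]) @[l --> 0^'+] --> k * p.[0].
  apply: cvgM; first exact: cvg_cst.
  by apply: cvg_at_right_filter; exact: continuous_horner.
have -> : \prod_i (d 0 i - c 0 i) = p.[0].
  by rewrite pE; apply: eq_bigr => i _; rewrite addr0.
have : forall t : R, 0 < t -> (hausdorff_pre n e (box c d) <= (k * p.[0] + t)%:E)%E.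
  move=> t t0; have /cvgrPdist_lt/(_ _ t0) H := cp.
  suff /filter_ex[] : \forall l \near (0 : R)^'+, (hausdorff_pre n e (box c d) <= (k * p.[0] + t)%:E)%E by [].
  near=> l; have lp : 0 < l by [].
  apply: (@le_trans _ _ (k * p.[l])%:E).
    rewrite pE; apply: grid => // x; apply: hl => //.
    by near: l; exact: nbhs_right_le.
  rewrite lee_fin -lerBlDl; apply: le_trans (ler_norm _) _; rewrite distrC ltW//.
  by near: l.
by move=> h; apply/lee_addgt0Pr => t t0; rewrite -EFinD; exact: h.
Unshelve. all: by end_near. Qed.

Let gauge_bound (k e : R) A : 0 < k -> 0 < e -> small_cubes k ->
  (hausdorff_pre n e A <= k%:E * box_gauge A)%E.
Proof.
move=> k0 e0 hk; rewrite /box_gauge; case: ifPn => [/eqP ->|/set0P[x Ax]].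
  by rewrite hausdorff_pre0 mule0.
rewrite -lee_pdivrMl//; apply: le_ereal_inf_tmp => _ [[c d] /= Acd <-].
rewrite lee_pdivrMl// -EFinM; apply: le_trans (@le_hausdorff_pre _ _ _ _ _ _ Acd) _.
apply: box_bound => //; first exact: ltW.
by move=> i; have /andP[] := Acd _ Ax i; exact: le_trans.
Qed.

Let outer_bound (k e : R) A : 0 < k -> 0 < e -> small_cubes k ->
  (hausdorff_pre n e A <= k%:E * lam n A)%E.
Proof.
move=> k0 e0 hk; rewrite -lee_pdivrMl//.
apply: le_ereal_inf_tmp => _ [C [_ AC] <-].
rewrite lee_pdivrMl// -nneseriesZl; last by move=> *; exact: box_gauge_ge0.
apply: le_trans (@le_hausdorff_pre _ _ _ _ _ _ AC) _; apply: le_trans (hausdorff_pre_sigma _ _ _) _.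
apply: lee_nneseries => j _ *; first exact: hausdorff_pre_ge0.
exact: gauge_bound.
Qed.

Let cube_diam x l : 0 <= l -> forall y z, cube x l y -> cube x l z ->
  enorm (y - z) <= n%:R * l.
Proof.
move=> l0 y z Cy Cz; apply: le_trans (enorm_le_norm _) _; rewrite ler_wpM2l//.
rewrite [leLHS]/Num.norm/= mx_normrE; apply/bigmax_leP; split => //= -[j i] _.
rewrite /= ord1; have := Cy i; have := Cz i; rewrite !mxE ler_norml.
by move=> /andP[? ?] /andP[? ?]; apply/andP; split; lra.
Qed.

Let small0 : exists2 k, 0 < k & small_cubes k.
Proof.
(* n + 1 instead of n keeps the divisor below positive in dimension 0. *)
exists (om * ((n%:R + 1) / 2) ^+ n).
  by rewrite mulr_gt0 ?om_gt0// exprn_gt0// divr_gt0// ltr_wpDl.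
move=> e e0; have n1 : 0 < n%:R + 1 :> R by rewrite ltr_wpDl.
exists (e / (n%:R + 1)); first exact: divr_gt0.
move=> l x l0 le; apply: le_trans (hausdorff_pre_gauge _ _ _) _.
rewrite -mulrA -exprMn mulrAC.
apply: hausdorff_gauge_le.
- by rewrite mulrC -ler_pdivlMr.
- move=> y z Cy Cz; apply: le_trans (cube_diam (ltW l0) Cy Cz) _.
  by rewrite ler_wpM2r ?(ltW l0)// lerDl.
- by rewrite mulr_ge0 ?ltW.
Qed.

(** The share of a cube filled by its inscribed ball. *)
Let be : R := om / 2 ^+ n.

Let lebesgue_ball_in_cube (x : 'rV[R]_n) (l : R) : 0 < l ->
  let B := eball (x + const_mx (l / 2)) (l / 2) in
  B `<=` cube x l /\ lam n B = (be * l ^+ n)%:E.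
Proof.
move=> l0 B; split.
  move=> y; rewrite /B /eball/= => yB i.
  have := le_trans (coord_enorm (y - (x + const_mx (l / 2))) i) yB; rewrite !mxE.
  by rewrite ler_norml => /andP[? ?]; apply/andP; split; lra.
rewrite /B lebesgue_eball ?divr_ge0 ?ltW// -vol_eballE -EFinM; congr EFin.
by rewrite /be exprMn exprVn mulrC mulrA mulrAC.
Qed.

(** The inscribed ball is covered by itself at the exact cost, and only the remaining share 1 - [be]
    of the cube is charged at the old rate [k]. Iteration contracts the excess of the rate over 1 by
    the factor 1 - [be]. *)
Let small_step k : 0 < k -> small_cubes k -> small_cubes (be + k * (1 - be)).
Proof.
move=> k0 hk e e0; exists e => // l x l0 le.
have [Bc Bl] := @lebesgue_ball_in_cube x l l0.
set B := eball _ _ in Bc Bl.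
have -> : cube x l = B `|` (cube x l `\` B) by rewrite setDUK.
apply: le_trans (hausdorff_pre_setU _ _ _ _) _.
have hB : (hausdorff_pre n e B <= (be * l ^+ n)%:E)%E.
  apply: le_trans (hausdorff_pre_gauge _ _ _) _.
  rewrite [be * _](_ : _ = om * (l / 2) ^+ n); last first.
    by rewrite /be exprMn exprVn mulrAC mulrA.
  apply: hausdorff_gauge_le => //; last exact: ltW.
  move=> y z; rewrite /B /eball/= => yB zB.
  apply: le_trans (ler_enorm_distD (x + const_mx (l / 2)) _ _) _.
  by rewrite [X in _ + X]enormB; lra.
have mB : measurable (B : set (@borelRV R n)) by exact: borel_eball.
have mc : measurable (cube x l : set (@borelRV R n)) by exact: measurable_box.
have lc : lam n (cube x l) = (l ^+ n)%:E.
  rewrite lebesgue_box => [|i]; last by rewrite !mxE lerDl ltW.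
  rewrite (eq_bigr (fun=> l)) ?prodr_const ?card_ord// => i _.
  by rewrite !mxE addrAC subrr add0r.
have hD : (hausdorff_pre n e (cube x l `\` B) <= (k * (l ^+ n - be * l ^+ n))%:E)%E.
  apply: le_trans (outer_bound _ k0 e0 hk) _; rewrite EFinM lee_pmul2l ?lte_fin//.
  have -> : lam n (cube x l `\` B) = (lam n (cube x l) - lam n (cube x l `&` B))%E.
    apply: (@measureD _ _ _ (@leb R n)) => //.
    by change (lam n (cube x l) < +oo)%E; rewrite lc ltry.
  rewrite lc (_ : cube x l `&` B = B) ?Bl//.
  exact/setIidPr.
apply: le_trans (leeD hB hD) _; rewrite -EFinD lee_fin le_eqVlt; apply/orP; left.
by apply/eqP; ring.
Qed.

Let be_itv : 0 < be <= 1.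
Proof.
apply/andP; split; first by rewrite divr_gt0 ?om_gt0// exprn_gt0.
have [Bc Bl] := @lebesgue_ball_in_cube 0 1 ltr01.
have := le_lebesgue_outer Bc; rewrite Bl expr1n mulr1.
rewrite lebesgue_box => [|i]; last by rewrite !mxE lerDl.
by rewrite big1 ?lee_fin// => i _; rewrite !mxE addrAC subrr add0r.
Qed.

Let small_seq : exists2 k, 0 < k & forall j : nat, small_cubes (1 + k * (1 - be) ^+ j).
Proof.
have [k k0 hk] := small0; exists k => //; have /andP[b0 b1] := be_itv; elim=> [|j IH].
  move=> e e0; have [l l0 hl] := hk _ e0; exists l => // t x t0 tl.
  apply: le_trans (hl _ _ t0 tl) _; rewrite lee_fin expr0 mulr1 ler_wpM2r ?lerDr//.
  by rewrite exprn_ge0// ltW.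
have : small_cubes (be + (1 + k * (1 - be) ^+ j) * (1 - be)).
  apply: small_step => //; apply: ltr_wpDr => //; apply: mulr_ge0; first exact: ltW.
  by apply: exprn_ge0; rewrite subr_ge0.
by congr small_cubes; rewrite exprS; ring.
Qed.

Lemma hausdorff_lebesgue A : hausdorff_outer n A = lam n A.
Proof.
apply/eqP; rewrite eq_le lebesgue_le_hausdorff andbT.
apply: hausdorff_outer_le => e e0.
have [->|Aoo] := eqVneq (lam n A) +oo%E; first exact: leey.
have Afin : lam n A \is a fin_num by rewrite ge0_fin_numE ?lebesgue_outer_ge0// ltey.
have [k k0 hk] := small_seq; have /andP[b0 b1] := be_itv.
have hj j : (hausdorff_pre n e A <= (1 + k * (1 - be) ^+ j)%:E * lam n A)%E.
  apply: outer_bound => //; apply: ltr_wpDr => //; apply: mulr_ge0; first exact: ltW.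
  by apply: exprn_ge0; rewrite subr_ge0.
have cj : ((1 + k * (1 - be) ^+ j) * fine (lam n A))%:E @[j --> \oo] --> (fine (lam n A))%:E.
  apply: cvg_EFin; first by near=> j.
  rewrite -[X in _ --> X]mul1r; apply: cvgM; last exact: cvg_cst.
  rewrite -[X in _ --> X]addr0; apply: cvgD; first exact: cvg_cst.
  rewrite -(mulr0 k); apply: cvgM; first exact: cvg_cst.
  by apply: cvg_expr; rewrite ger0_norm ?subr_ge0// gtrBl.
rewrite -(fineK Afin) -(cvg_lim _ cj)//; apply: lime_ge; first by apply/cvg_ex; eexists; exact: cj.
by near=> j; rewrite EFinM fineK.
Unshelve. all: by end_near. Qed.

(** Clear for Hausdorff measure, whose gauge depends on diameters only and which is defined on
    arbitrary images. *)
Lemma lebesgue_contraction (I : Type) (u v : I -> 'rV[R]_n) (D : set I) :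
  (forall i j, D i -> D j -> enorm (u i - u j) <= enorm (v i - v j)) ->
  (lam n (u @` D) <= lam n (v @` D))%E.
Proof.
move=> uv; rewrite -!hausdorff_lebesgue.
apply: le_trans (@hausdorff_lipschitz R n n n I 1 u v D ltr01 _) _.
  by move=> i j Di Dj; rewrite mul1r; exact: uv.
by rewrite expr1n mul1e.
Qed.

End hausdorff_lebesgue.

Section fubini_other.
Context {R : realType} {m : nat} (i : 'I_m.+1).

Lemma lebesgue_fubini_ord (A : set 'rV[R]_m.+1) :
  measurable (A : set (@borelRV R m.+1)) ->
  lam m.+1 A = (\int[@lebesgue_measure R]_t lam m [set y | A (ins i y t)])%E.
Proof.
move=> mA; rewrite (lebesgue_product i mA).
rewrite (product_measure_unique (m' := product_measure2 (@leb R m) (@lebesgue_measure R))); last first.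
- by rewrite -[X in measurable X]setTI; exact: measurable_ins.
- by move=> B C mB mC; exact: product_measure2E.
rewrite /= /product_measure2; apply: eq_integral => t _; congr (lam m _).
by apply/seteqP; split => y; rewrite /ysection/= inE.
Qed.

End fubini_other.

Lemma sum_double (R : realType) (f : nat -> \bar R) N :
  (\sum_(i < N.*2) f i = \sum_(i < N) f (i.*2 + 0)%N + \sum_(i < N) f (i.*2 + 1)%N)%E.
Proof.
elim: N => [|M IH]; first by rewrite !big_ord0 adde0.
rewrite doubleS !big_ord_recr/= IH addn0 addn1 -!addeA; congr (_ + _)%E.
by rewrite [RHS]addeCA.
Qed.

(** * Borel sets are measurable for Hausdorff measure *)

Section hausdorff_caratheodory.
Context {R : realType} {n s : nat}.
Implicit Types (A B X F : set 'rV[R]_n).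
Notation H := (@hausdorff_outer R n s).

Lemma hausdorff_gaugeS (e : R) A B : A `<=` B ->
  (hausdorff_gauge s e A <= hausdorff_gauge s e B)%E.
Proof.
move=> AB; rewrite [leRHS]/hausdorff_gauge.
case: ifPn => [/eqP B0|/set0P B0].
  by rewrite (_ : A = set0) ?hausdorff_gauge0//; apply/seteqP; split => // x /AB; rewrite B0.
case: ifPn => [Be|_]; last exact: leey.
have fB : diam B \is a fin_num by rewrite ge0_fin_numE ?diam_ge0// (le_lt_trans Be)// ltry.
apply: hausdorff_gauge_le; first by rewrite -lee_fin fineK.
  have /diam_le h : (diam B <= (fine (diam B))%:E)%E by rewrite fineK.
  by move=> x y /AB Bx /AB By; exact: h.
by rewrite fine_ge0// diam_ge0.
Qed.

(** A set of diameter at most [e] cannot meet both [A] and [B], so every admissible covering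
    splits. *)
Lemma hausdorff_pre_metric (e d : R) A B : e < d ->
  (forall x y, A x -> B y -> d <= enorm (x - y)) ->
  (hausdorff_pre s e A + hausdorff_pre s e B <= hausdorff_pre s e (A `|` B))%E.
Proof.
move=> ed AB; apply: le_ereal_inf_tmp => _ [C [_ ABC] <-].
have CA : A `<=` \bigcup_k (C k `&` A).
  by move=> x Ax; have [k _ Ck] := ABC _ (or_introl Ax); exists k.
have CB : B `<=` \bigcup_k (C k `&` B).
  by move=> x Bx; have [k _ Ck] := ABC _ (or_intror Bx); exists k.
apply: (le_trans (leeD (hausdorff_pre_cover s e CA) (hausdorff_pre_cover s e CB))).
rewrite -nneseriesD; try by move=> *; exact: hausdorff_gauge_ge0.
apply: lee_nneseries => [k _ *|k _ *].
  by apply: adde_ge0; exact: hausdorff_gauge_ge0.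
have [CA0|/set0P[x [Cx Ax]]] := eqVneq (C k `&` A) set0.
  by rewrite CA0 hausdorff_gauge0 add0e; apply: hausdorff_gaugeS; exact: subIsetl.
have [CB0|/set0P[y [Cy By]]] := eqVneq (C k `&` B) set0.
  by rewrite CB0 hausdorff_gauge0 adde0; apply: hausdorff_gaugeS; exact: subIsetl.
rewrite [leRHS]/hausdorff_gauge; case: ifPn => [/eqP C0|_]; first by rewrite C0 in Cx.
case: ifPn => [/diam_le/(_ _ _ Cx Cy)|_]; last exact: leey.
by rewrite leNgt (lt_le_trans ed)// AB.
Qed.

Lemma hausdorff_pre_anti (e e' : R) A : e <= e' ->
  (hausdorff_pre s e' A <= hausdorff_pre s e A)%E.
Proof.
move=> ee'; apply: le_ereal_inf_tmp => _ [C [_ AC] <-].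
apply: le_trans (hausdorff_pre_cover s e' AC) _.
apply: lee_nneseries => [k _ *|k _ *]; first exact: hausdorff_gauge_ge0.
rewrite /hausdorff_gauge; case: ifPn => // C0; case: ifPn => [h|h]; last first.
  by rewrite ifF ?leey//; apply: contraNF h => /le_trans; apply; rewrite lee_fin.
by case: ifPn => // _; exact: leey.
Qed.

Let ereal_sup_addr (D : set R) (f : R -> \bar R) (y X : \bar R) : (0 <= y)%E ->
  (exists2 e, D e & (0 <= f e)%E) -> (forall e, D e -> (f e + y <= X)%E) ->
  (ereal_sup [set f e | e in D] + y <= X)%E.
Proof.
move=> y0 [e0 De0 fe0] h; have [->|Xoo] := eqVneq X +oo%E; first exact: leey.
have yfin : y \is a fin_num.
  rewrite ge0_fin_numE// ltey; apply/eqP => yoo; have := h _ De0.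
  by rewrite yoo addey ?leye_eq ?(negbTE Xoo)// -ltNye (lt_le_trans _ fe0)// ltNy0.
rewrite -leeBrDr//; apply: ge_ereal_sup => _ [e De <-].
by rewrite leeBrDr//; exact: h.
Qed.

Lemma hausdorff_metric (d : R) A B : 0 < d ->
  (forall x y, A x -> B y -> d <= enorm (x - y)) -> (H A + H B <= H (A `|` B))%E.
Proof.
move=> d0 AB; apply: ereal_sup_addr; first exact: hausdorff_outer_ge0.
  by exists 1; [exact: ltr01|exact: hausdorff_pre_ge0].
move=> e /= e0; rewrite addeC; apply: ereal_sup_addr; first exact: hausdorff_pre_ge0.
  by exists 1; [exact: ltr01|exact: hausdorff_pre_ge0].
move=> e' /= e'0; rewrite addeC.
pose t := Num.min (Num.min e e') (d / 2).
have t0 : 0 < t by rewrite !lt_min e0 e'0 divr_gt0.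
apply: le_trans (hausdorff_pre_le_outer s (A `|` B) t0).
have td : t < d by rewrite /t gt_min; apply/orP; right; rewrite ltr_pdivrMr//; lra.
apply: le_trans (hausdorff_pre_metric td AB); apply: leeD; apply: hausdorff_pre_anti.
  by rewrite !ge_min lexx.
by rewrite !ge_min lexx orbT.
Qed.

Section closed.
Variables (F X : set 'rV[R]_n).
Hypotheses (cF : closed F) (Xlty : (H X < +oo)%E).

Let P (k : nat) := [set x | forall y, F y -> k.+1%:R^-1 <= enorm (x - y)].

Let PS k l : (k <= l)%N -> P k `<=` P l.
Proof.
move=> kl x Px y Fy; apply: le_trans (Px _ Fy).
by rewrite lef_pV2 ?posrE// ler_nat.
Qed.

Let bigP : ~` F = \bigcup_k P k.
Proof.
apply/seteqP; split => [x Fx|x [k _ Px] Fx]; last first.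
  by have := Px _ Fx; rewrite subrr enorm0 leNgt invr_gt0 ltr0n.
have : nbhs x (~` F) by apply: open_nbhs_nbhs; split => //; exact: closed_openC.
move=> /near_enorm[e e0 eF]; exists (Num.truncn e^-1) => // y Fy.
rewrite leNgt; apply/negP => h; apply: (eF y) => //.
rewrite enormB; apply: lt_trans h _; rewrite -[ltRHS]invrK ltf_pV2 ?posrE ?invr_gt0//.
exact: truncnS_gt.
Qed.

Let D (k : nat) := X `&` (P k.+1 `\` P k).

Let sep (k l : nat) x y : (k.+1 < l)%N -> P k x -> ~ P l.-1 y ->
  k.+1%:R^-1 - l%:R^-1 <= enorm (x - y).
Proof.
case: l => // l kl Px /= /existsNP[z /not_implyP[Fz /negP]]; rewrite -ltNge => yz.
have := Px _ Fz; have := ler_enorm_distD y x z; move: yz.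
move: (l.+1%:R^-1) (k.+1%:R^-1) (enorm (x - z)) (enorm (x - y)) (enorm (y - z)).
by move=> a b c d' e; lra.
Qed.

(** Layers whose indices have the same parity are separated by a whole layer, hence lie at positive
    distance, so their measures add up. *)
Let sumD (o N : nat) :
  (\sum_(i < N.+1) H (D (i.*2 + o)) <= H (X `&` P (N.*2 + o).+1))%E.
Proof.
elim: N => [|N IH].
  by rewrite big_ord1; apply: le_hausdorff_outer => x [Xx [Px _]].
rewrite big_ord_recr/=; apply: (le_trans (leeD2r _ IH)).
set k := (N.*2 + o).+1; have kE : (N.+1.*2 + o = k.+1)%N by rewrite doubleS.
rewrite kE; have d0 : 0 < k.+1%:R^-1 - k.+2%:R^-1 :> R.
  by rewrite subr_gt0 ltf_pV2 ?posrE// ltr_nat.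
apply: le_trans (hausdorff_metric d0 _) _.
  by move=> x y [_ Px] [_ [_ Py]]; exact: (@sep _ k.+2).
apply: le_hausdorff_outer => x [[Xx Px]|[Xx [Px _]]]; split => //.
by apply: PS Px; rewrite leqW.
Qed.

Let sumD_le (o N : nat) : (\sum_(i < N) H (D (i.*2 + o)) <= H X)%E.
Proof.
case: N => [|N]; first by rewrite big_ord0; exact: hausdorff_outer_ge0.
by apply: le_trans (sumD o N) _; apply: le_hausdorff_outer; exact: subIsetl.
Qed.

Let series_lty : (\sum_(k <oo) H (D k) < +oo)%E.
Proof.
apply: (@le_lt_trans _ _ (H X + H X)%E); last by rewrite lte_add_pinfty.
apply: lime_le; first by apply: is_cvg_nneseries => *; exact: hausdorff_outer_ge0.
near=> N; rewrite big_mkord.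
apply: (@le_trans _ _ (\sum_(i < N.*2) H (D i))%E).
  apply: (@lee_sum_nneg_ord R (fun i => H (D i)) xpredT) => //.
    by move=> *; exact: hausdorff_outer_ge0.
  by rewrite -addnn leq_addr.
rewrite (sum_double (fun i => H (D i))); apply: leeD; exact: sumD_le.
Unshelve. all: by end_near. Qed.

(** Caratheodory's criterion. The complement of [F] is exhausted by the sets [P k] at distance at
    least 1 / (k + 1) from [F]; what is left of X is a union of layers [D], whose measures form a
    convergent series because the even and the odd ones each sum to at most [H X]. *)
Lemma closed_caratheodory_fin : (H (X `&` F) + H (X `&` ~` F) <= H X)%E.
Proof.
have key k : (H (X `&` F) + H (X `&` ~` F) <= H X + \sum_(k <= j <oo) H (D j))%E.
  have h1 : (H (X `&` ~` F) <= H (X `&` P k) + \sum_(k <= j <oo) H (D j))%E.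
    have sub : X `&` ~` F `<=` (X `&` P k) `|` \bigcup_(j in [set j | (k <= j)%N]) D j.
      move=> x [Xx]; rewrite bigP => -[l _ Pl].
      have [lk|kl] := leqP l k; first by left; split => //; exact: PS Pl.
      have [Pk|nPk] := pselect (P k x); [by left|right].
      elim: l Pl kl => // l IH Pl; rewrite ltnS leq_eqVlt => /predU1P[kl|kl].
        by exists l; rewrite /= ?kl//; split => //; split => //; rewrite -kl.
      have [Pl'|nPl] := pselect (P l x); first exact: IH.
      by exists l => /=; [exact: ltnW|split].
    apply: le_trans (le_hausdorff_outer s sub) _.
    apply: le_trans (outer_measureU2 H _ _) _; apply: leeD2l.
    rewrite bigcup_mkcond; apply: le_trans (@hausdorff_outer_sigma_subadditive R n s _) _.
    rewrite [leLHS](nneseries_split _ k); last by move=> *; exact: hausdorff_outer_ge0.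
    rewrite add0n big1_seq ?add0e; last first.
      move=> j /andP[_]; rewrite mem_index_iota => /andP[_ jk].
      by rewrite ifF ?hausdorff_outer0//; apply/negP; rewrite inE/= leqNgt jk.
    rewrite -[leRHS](nneseries_addn k); last by move=> *; exact: hausdorff_outer_ge0.
    rewrite -[leLHS](nneseries_addn k); last by move=> *; exact: hausdorff_outer_ge0.
    apply: lee_nneseries => [j _ *|j _ *]; first exact: hausdorff_outer_ge0.
    by rewrite ifT// inE/= leq_addl.
  apply: le_trans (leeD2l _ h1) _; rewrite addeA; apply: leeD2r.
  have d0 : 0 < k.+1%:R^-1 :> R by rewrite invr_gt0.
  apply: le_trans (hausdorff_metric d0 _) _.
    by move=> x y [_ Fx] [_ Py]; rewrite enormB; exact: Py.
  by apply: le_hausdorff_outer => x [[]|[]].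
have := @nneseries_tail_cvg R (fun j => H (D j)) xpredT series_lty.
move=> /(_ (fun _ _ => hausdorff_outer_ge0 _ _)) tl.
have : (H X + \sum_(k <= j <oo) H (D j))%E @[k --> \oo] --> (H X + 0)%E.
  by apply: cvgeD => //; [rewrite fin_num_adde_defl|exact: cvg_cst].
rewrite adde0 => c; rewrite -[leRHS](cvg_lim _ c)//.
apply: lime_ge; first by apply/cvg_ex; eexists; exact: c.
by near=> k; exact: key.
Unshelve. all: by end_near. Qed.

End closed.

Lemma closed_caratheodory (F : set 'rV[R]_n) : closed F -> H.-caratheodory F.
Proof.
move=> cF; apply: le_caratheodory_measurable => X.
have [E|Xoo] := eqVneq (H X) +oo%E; first by rewrite [leRHS]E leey.
by apply: closed_caratheodory_fin => //; rewrite ltey.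
Qed.

Lemma borel_hausdorff_caratheodory (A : set 'rV[R]_n) :
  measurable (A : set (@borelRV R n)) -> H.-caratheodory A.
Proof.
move=> mA; have : <<s @open 'rV[R]_n >> `<=` H.-caratheodory; last exact.
apply: smallest_sub => [|U oU].
  exact: (@sigma_algebra_measurable _ (caratheodory_type H)).
rewrite -(setCK U); apply: (@measurableC _ (caratheodory_type H)).
by apply: closed_caratheodory; exact: open_closedC.
Qed.

End hausdorff_caratheodory.

(** * Orthogonal frames and cones over pieces of hyperplanes *)

Section householder.
Context {R : realType}.

(** The Householder reflection along u - e exchanges the unit vectors u and e; for u = e the
    identity serves. *)
Lemma orth_to_delta n (u : 'rV[R]_n) (i : 'I_n) : enorm u = 1 ->
  exists2 T : 'M[R]_n, T *m T^T = 1%:M & u *m T = delta_mx 0 i.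
Proof.
move=> u1; set e : 'rV[R]_n := delta_mx 0 i.
have eE x : dotv x e = x 0 i.
  by rewrite dotvE (bigD1 i)//= !mxE !eqxx mulr1 big1 ?addr0// => j ji;
     rewrite !mxE eqxx (negbTE ji) mulr0.
have uu : dotv u u = 1 by rewrite -sqr_enorm u1 expr1n.
have ee : dotv e e = 1 by rewrite eE !mxE !eqxx.
have [->|ue] := eqVneq u e; first by exists 1%:M; rewrite ?trmx1 ?mulmx1.
pose w := u - e; have w0 : dotv w w != 0 by rewrite dotvv_eq0 subr_eq0.
have wE : dotv w w = 2 * (1 - dotv u e).
  by rewrite /w !(dotvBl, dotvBr) uu ee (dotvC e u); ring.
have uwE : dotv u w = 1 - dotv u e by rewrite /w dotvBr uu.
have ww : w *m w^T = (dotv w w)%:M by rewrite [LHS]mx11_scalar.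
pose c := 2 / dotv w w; pose T : 'M[R]_n := 1%:M - c *: (w^T *m w).
have TE : T^T = T by rewrite /T linearB/= trmx1 linearZ/= trmx_mul trmxK.
exists T; last first.
  rewrite /T mulmxBr mulmx1 -scalemxAr mulmxA [u *m w^T]mx11_scalar mul_scalar_mx.
  rewrite -/(dotv u w) scalerA uwE /c wE.
  have h : 1 - dotv u e != 0 by move: w0; rewrite wE mulf_eq0 negb_or => /andP[].
  have -> : 2 / (2 * (1 - dotv u e)) * (1 - dotv u e) = 1 by field.
  by rewrite scale1r /w opprB addrC subrK.
rewrite TE /T mulmxBr mulmx1 mulmxBl mul1mx -scalemxAr -scalemxAl.
rewrite (_ : w^T *m w *m (w^T *m w) = dotv w w *: (w^T *m w)); last first.
  by rewrite mulmxA -(mulmxA w^T w w^T) ww mul_mx_scalar -scalemxAl.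
rewrite !scalerA (_ : c * c * dotv w w = c + c); last by rewrite /c; field.
by rewrite scalerDl opprB addrK subrK.
Qed.

End householder.

Lemma integral_monomial (R : realType) (m : nat) (c : R) : 0 < c ->
  (\int[@lebesgue_measure R]_(t in `]0%R, c]) ((t / c) ^+ m)%:E)%E = (c / m.+1%:R)%:E.
Proof.
move=> c0; have cE : c != 0 by rewrite gt_eqF.
have mE : m.+1%:R != 0 :> R by rewrite pnatr_eq0.
pose k := c / m.+1%:R * c^-1 ^+ m.+1; pose p : {poly R} := k *: 'X^(m.+1).
have pE t : p.[t] = k * t ^+ m.+1 by rewrite !hornerE.
have p'E t : p^`().[t] = (t / c) ^+ m.
  rewrite derivZ derivXn !hornerE hornerMn !hornerE -[_ *+ _]mulr_natr exprMn /k exprS.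
  rewrite /=; move: (m.+1%:R : R) mE => N mE.
  by field; rewrite mE cE.
rewrite integral_itv_obnd_cbnd; last first.
  apply/measurable_EFinP; apply: measurable_funTS; apply: measurable_funX.
  exact: measurable_funM.
rewrite (continuous_FTC2 (F := fun t => p.[t])) //.
- by rewrite -EFinB !pE expr0n /= mulr0 subr0 /k exprVn -mulrA mulVf ?mulr1// expf_neq0.
- rewrite (_ : (fun t => (t / c) ^+ m) = horner p^`()); last by apply/funext => t; rewrite p'E.
  by apply: continuous_subspaceT; exact: continuous_horner.
- split.
  + by move=> t _; apply: ex_derive.
  + by apply: cvg_at_right_filter; exact: continuous_horner.
  + by apply: cvg_at_left_filter; exact: continuous_horner.
- by move=> t _; rewrite -p'E derivE.
Qed.

Lemma borel_continuous_in (R : realType) n m (U : set 'rV[R]_n)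
    (f : 'rV[R]_n -> 'rV[R]_m) : open U ->
  (forall x, U x -> {for x, continuous f}) ->
  measurable_fun (U : set (@borelRV R n)) (f : @borelRV R n -> @borelRV R m).
Proof.
move=> oU cf; apply: (@measurability _ _ (@borelRV R n) (@borelRV R m) U _ (@open 'rV[R]_m)) => //.
move=> _ [V oV <-]; apply: borel_open; rewrite openE => x [Ux Vx].
have nU : nbhs x U by apply: open_nbhs_nbhs.
have nV : nbhs x (f @^-1` V) by apply: (cf _ Ux); exact: open_nbhs_nbhs.
exact: (@filterI _ _ (@nbhs_filter 'rV[R]_n x)).
Qed.

Lemma scale_continuous (R : realType) n (g : 'rV[R]_n -> R) (x : 'rV[R]_n) :
  {for x, continuous g} -> {for x, continuous (fun y => g y *: y)}.
Proof.
by move=> cg; apply: (@cvgZ R _ _ (nbhs x) (nbhs_filter x)) => //; exact: cvg_id.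
Qed.

Definition hcone (R : realType) n (p : 'rV[R]_n) (A : set 'rV[R]_n) : set 'rV[R]_n :=
  [set x | 0 < dotv p x <= 1 /\ A ((dotv p x)^-1 *: x)].

Section hyperplane.
Context {R : realType} {m : nat}.
Implicit Types (p : 'rV[R]_m.+1) (A : set 'rV[R]_m.+1).

Lemma open_dotv_gt0 n (p : 'rV[R]_n) : open [set x | 0 < dotv p x].
Proof.
apply: (@open_comp _ _ (dotv p) [set t | 0 < t]); last exact: open_gt.
by move=> x _; exact: dotv_continuous.
Qed.

Lemma measurable_hcone n (p : 'rV[R]_n) (A : set 'rV[R]_n) :
  measurable (A : set (@borelRV R n)) ->
  measurable (hcone p A : set (@borelRV R n)).
Proof.
move=> mA; rewrite (_ : hcone p A = ([set x | 0 < dotv p x] `&`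
   (fun x => (dotv p x)^-1 *: x) @^-1` A) `&` [set x | dotv p x <= 1]); last first.
  by apply/seteqP; split => x; rewrite /hcone/=; [case=> /andP[]|move=> [[-> ?] ->]].
have oU := @open_dotv_gt0 _ p.
apply: measurableI.
  apply: (borel_continuous_in oU _ (borel_open oU) mA) => x /= px.
  apply: scale_continuous; apply: cvgV; rewrite ?gt_eqF//.
    exact: (@nbhs_filter 'rV[R]_n x).
  exact: dotv_continuous.
apply: borel_closed; apply: (@closed_comp _ _ (dotv p) [set t | t <= 1]).
  by move=> x _; exact: dotv_continuous.
exact: closed_le.
Qed.

Lemma enorm_ins (y : 'rV[R]_m) (i : 'I_m.+1) : enorm (ins i y 0) = enorm y.
Proof. by rewrite !enormE -!sqr_enorm sqr_enorm_ins expr0n addr0. Qed.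

Lemma insZ (i : 'I_m.+1) (y : 'rV[R]_m) s t : s *: ins i y t = ins i (s *: y) (s * t).
Proof. by apply/rowP => j; rewrite !mxE; case: unliftP => // k; rewrite mxE. Qed.

(** A cone has volume base times height divided by the dimension, and the hyperplane is at distance
    c = 1 / [enorm p] from the apex. After a rotation the slice at height t is the base scaled by t
    / c, which integrates to the factor c / (m + 1). *)
Lemma hausdorff_hyperplane p A : p != 0 -> measurable (A : set (@borelRV R m.+1)) ->
  (forall x, A x -> dotv p x = 1) ->
  hausdorff_outer m A = ((enorm p * m.+1%:R)%:E * lam m.+1 (hcone p A))%E.
Proof.
move=> p0 mA Ap; have np : 0 < enorm p by rewrite enorm_gt0.
pose i : 'I_m.+1 := ord0; set c := (enorm p)^-1; have c0 : 0 < c by rewrite invr_gt0.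
have [|T TT pT] := @orth_to_delta R _ (c *: p) i.
  by rewrite enormZ gtr0_norm// mulVf// gt_eqF.
have TT' := mulmx1C TT.
have dE x : dotv x (delta_mx 0 i) = x 0 i.
  by rewrite dotvE (bigD1 i)//= !mxE !eqxx mulr1 big1 ?addr0// => j ji;
     rewrite !mxE eqxx (negbTE ji) mulr0.
have coord x : c * dotv p x = (x *m T) 0 i.
  by rewrite -dotvZl -(dotv_mulmx _ _ TT) pT dotvC dE.
have coord' z : dotv p (z *m T^T) = z 0 i / c.
  by rewrite -[LHS](mulKf (x := c)) ?gt_eqF// coord -mulmxA TT' mulmx1 mulrC.
pose u (y : 'rV[R]_m) := ins i y c *m T^T.
pose B := u @^-1` A.
have uB : u @` B = A.
  apply/seteqP; split => [_ [y By <-]//|x Ax].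
  have xc : (x *m T) 0 i = c by rewrite -coord Ap// mulr1.
  have ux : u (del i (x *m T)) = x by rewrite /u -[in LHS]xc insE -mulmxA TT mulmx1.
  by exists (del i (x *m T)); rewrite ?/B/= ?ux.
have uu y z : enorm (u y - u z) = enorm (y - z).
  by rewrite /u -mulmxBl enorm_mulmx ?trmxK// insB subrr enorm_ins.
have HA : hausdorff_outer m A = lam m B.
  rewrite -hausdorff_lebesgue; apply/eqP; rewrite eq_le; apply/andP; split.
    rewrite -uB -[X in (_ <= hausdorff_outer _ X)%E](image_id B).
    apply: le_trans (@hausdorff_lipschitz R _ _ m _ 1 u id B ltr01 _) _.
      by move=> y z _ _; rewrite mul1r uu.
    by rewrite expr1n mul1e.
  rewrite -[X in (hausdorff_outer _ X <= _)%E](image_id B) -uB.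
  apply: le_trans (@hausdorff_lipschitz R _ _ m _ 1 id u B ltr01 _) _.
    by move=> y z _ _; rewrite mul1r uu.
  by rewrite expr1n mul1e.
have cE : c != 0 by rewrite gt_eqF.
have mC := measurable_hcone p mA.
pose C' := (fun z => z *m T^T) @^-1` hcone p A.
have C'E : (fun z => z *m T) @` hcone p A = C'.
  apply/seteqP; split => [_ [x Cx <-]|z Cz]; rewrite /C'/=.
    by rewrite -mulmxA TT mulmx1.
  by exists (z *m T^T) => //; rewrite -mulmxA TT' mulmx1.
have mC' : measurable (C' : set (@borelRV R m.+1)).
  rewrite -[X in measurable X]setTI.
  by apply: (borel_continuous (@mulmx_continuous R m.+1 m.+1 T^T)).
rewrite -(lebesgue_orth (hcone p A) TT) C'E (lebesgue_fubini_ord i mC') HA.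
have sliceE t : lam m [set y | C' (ins i y t)] =
    (if t \in `]0%R, c] then ((t / c) ^+ m)%:E * lam m B else 0)%E.
  rewrite in_itv/=; case: ifPn => [/andP[t0 tc]|tn]; last first.
    rewrite (_ : [set _ | _] = set0) ?lebesgue_outer0//.
    apply/seteqP; split => // y; rewrite /C' /hcone/= coord' ins_i => -[+ _].
    rewrite ler_pdivrMr// mul1r pmulr_lgt0 ?invr_gt0// => h.
    by move: tn; rewrite h.
  have tc0 : t / c != 0 by rewrite mulf_neq0 ?invr_eq0// gt_eqF.
  have ptc : 0 < t / c by exact: divr_gt0.
  rewrite -[in RHS](gtr0_norm ptc) -lebesgueZ//; congr (lam m _).
  apply/seteqP; split => [y|_ [z Bz <-]]; rewrite /C' /hcone/= coord' ins_i.
    move=> [_ h]; exists ((t / c)^-1 *: y); last by rewrite scalerA divff ?scale1r.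
    rewrite /B/= /u; move: h; rewrite scalemxAl insZ; congr (A (ins i _ _ *m _)).
    by field; rewrite cE gt_eqF.
  split; first by rewrite ptc ler_pdivrMr// mul1r.
  rewrite scalemxAl insZ scalerA mulVf// scale1r; move: Bz; rewrite /B/= /u.
  by congr (A (ins i _ _ *m _)); field; rewrite cE gt_eqF.
transitivity ((enorm p * m.+1%:R)%:E *
    (\int[@lebesgue_measure R]_(t in `]0%R, c]) (((t / c) ^+ m)%:E * lam m B)))%E.
  rewrite ge0_integralZr//; last first.
  - exact: lebesgue_outer_ge0.
  - move=> t; rewrite /= in_itv/= lee_fin => /andP[t0 _].
    by rewrite exprn_ge0// divr_ge0// ltW.
  - apply/measurable_EFinP; apply: measurable_funTS; apply: measurable_funX.
    exact: measurable_funM.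
  rewrite integral_monomial// muleA -EFinM.
  rewrite (_ : enorm p * m.+1%:R * (c / m.+1%:R) = 1) ?mul1e//.
  by rewrite mulrACA /c divff ?gt_eqF// divff ?pnatr_eq0// mulr1.
congr (_ * _)%E; rewrite integral_mkcond; apply: eq_integral => t _.
by rewrite sliceE patchE mem_setE; case: ifP.
Qed.

End hyperplane.

(** * Rademacher's theorem *)

Section lipschitz_derivable.
Context {R : realType}.
Variables (f : R -> R) (L : R).
Hypotheses (L0 : 0 <= L) (fL : forall x y, `|f x - f y| <= L * `|x - y|).

(** Adding the slope [L] makes the function nondecreasing, so that it generates a Stieltjes measure,
    bounded by [2 * L + 1] times Lebesgue measure. *)
Definition lip_nd (x : R) : R := f x + L * x.

Let nd : {homo lip_nd : x y / x <= y}.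
Proof.
move=> x y xy; rewrite /lip_nd; have := fL x y.
by rewrite [`|x - y|]distrC [`|y - x|]ger0_norm ?subr_ge0// ler_norml => /andP[_]; lra.
Qed.

Let lip_le x y : x <= y -> lip_nd y - lip_nd x <= (2 * L) * (y - x).
Proof.
move=> xy; rewrite /lip_nd; have := fL y x.
by rewrite [`|y - x|]ger0_norm ?subr_ge0// ler_norml => /andP[_]; lra.
Qed.

Let lip_cont : continuous lip_nd.
Proof.
move=> x; apply/cvgrPdist_lt => e e0; have L1 : 0 < 2 * L + 1 by rewrite ltr_wpDl// mulr_ge0.
near=> y; have : `|x - y| < e / (2 * L + 1).
  by near: y; apply: cvgr_dist_lt => //; exact: divr_gt0.
rewrite ltr_pdivlMr// => h; apply: le_lt_trans h.
apply: (@le_trans _ _ (2 * L * `|x - y|)); last by rewrite mulrC ler_wpM2l// lerDl.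
have [xy|/ltW yx] := leP x y.
  rewrite distrC ger0_norm ?subr_ge0 ?nd// distrC ger0_norm ?subr_ge0//.
  exact: lip_le.
rewrite ger0_norm ?subr_ge0 ?nd// ger0_norm ?subr_ge0//; exact: lip_le.
Unshelve. all: by end_near. Qed.

HB.instance Definition _ := isCumulative.Build R _ R lip_nd nd (right_continuousW lip_cont).

Let muF := lebesgue_stieltjes_measure lip_nd.

Let muF_itv a b : a <= b -> muF `]a, b] = (lip_nd b - lip_nd a)%:E.
Proof.
move=> ab; rewrite /muF /lebesgue_stieltjes_measure /measure_extension.
by rewrite measurable_mu_extE/= ?wlength_itv_bnd//; exact: is_ocitv.
Qed.

Let muF_le (A : set R) : (muF A <= (2 * L + 1)%:E * @lebesgue_measure R A)%E.
Proof.
have L1 : 0 < 2 * L + 1 by rewrite ltr_wpDl// mulr_ge0.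
rewrite -lee_pdivrMl//; apply: le_ereal_inf_tmp => _ [C [mC AC] <-].
rewrite lee_pdivrMl// -nneseriesZl; last by move=> *; exact: wlength_ge0.
apply: (@le_trans _ _ (\sum_(k <oo) wlength lip_nd (C k))%E).
  by apply: ereal_inf_lbound; exists C.
apply: lee_nneseries => [k _ *|k _ *]; first exact: wlength_ge0.
have := mC k => /ocitvP[->|[[a b] /= ab ->]]; first by rewrite wlength0 mule_ge0 ?wlength_ge0// lee_fin ltW.
have -> : wlength idfun `]a, b]%classic = (b - a)%:E by rewrite wlength_itv_bnd// ltW.
have -> : wlength lip_nd `]a, b]%classic = (lip_nd b - lip_nd a)%:E by rewrite wlength_itv_bnd// ltW.
rewrite -EFinM lee_fin; apply: le_trans (lip_le (ltW ab)) _.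
by rewrite ler_wpM2r ?subr_ge0 ?(ltW ab)// lerDl.
Qed.

(** The Stieltjes measure on a bounded interval has a Radon-Nikodym density; [f] is the integral of
    this density plus an affine function, so the fundamental theorem of calculus for Lebesgue
    integrals differentiates it almost everywhere. *)
Lemma lipschitz_derivable_bounded (N : nat) :
  (@lebesgue_measure R).-negligible [set x | - N%:R < x < N%:R /\ ~ derivable f x 1].
Proof.
set I : set R := `]- N%:R, N%:R]%classic.
have mI : measurable (I : set (measurableTypeR R)) by exact: measurable_itv.
have Ioo : (muF I < +oo)%E.
  by rewrite /I muF_itv ?ltry// lerNl (@le_trans _ _ 0)// oppr_le0.
pose nu : {finite_measure set (measurableTypeR R) -> \bar R} := mfrestr mI Ioo.
have dom : nu `<< @lebesgue_measure R.
  move=> A nA B mB BA; rewrite /nu /mfrestr/= /mrestr.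
  apply/eqP; rewrite eq_le measure_ge0 andbT.
  apply: le_trans (muF_le _) _; rewrite (_ : lebesgue_measure _ = 0%E) ?mule0//.
  apply/eqP; rewrite eq_le measure_ge0 andbT -(nA _ mB BA).
  apply: le_measure; rewrite ?inE//; exact: measurableI.
have [h [h0 hfin hint hE]] := radon_nikodym_sigma_finite dom.
have intI y : (@lebesgue_measure R).-integrable
    [set` Interval (BRight (- N%:R)) (BRight y)] (EFin \o (fine \o h)).
  apply: (@integrableS _ _ _ _ setT) => //.
  by apply: eq_integrable hint => // x _; rewrite /= fineK.
have lint : locally_integrable [set: R] (fine \o h).
  split.
  - by apply: measurableT_comp => //; exact: measurable_int hint.
  - exact: openT.
  - move=> K _ cK.
    have /integrableP[_] : (@lebesgue_measure R).-integrable (K : set (measurableTypeR R)) h.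
      by apply: integrableS hint => //; exact: compact_measurable.
    by apply: le_lt_trans; rewrite le_eqVlt; apply/orP; left; apply/eqP/eq_integral => x _; rewrite /= -abse_EFin fineK.
have := @FTC1 R (fine \o h) (BRight (- N%:R)) intI lint.
set G := fun x : R => _; move=> H; apply: negligibleS H => x /= [/andP[Nx xN] nd'] H; apply: nd'.
have [dG _] := H Nx.
have GE y : - N%:R < y -> y < N%:R -> f y = G y + (lip_nd (- N%:R) - L * y).
  move=> Ny yN; have : nu `]- N%:R, y]%classic = (lip_nd y - lip_nd (- N%:R))%:E.
    change (muF (`]- N%:R, y]%classic `&` I) = (lip_nd y - lip_nd (- N%:R))%:E).
    rewrite (_ : _ `&` I = `]- N%:R, y]%classic) ?muF_itv ?ltW//.
    by apply/setIidPl => z; rewrite /I /= !in_itv/= => /andP[-> zy]; rewrite (le_trans zy) ?ltW.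
  rewrite hE// => e; rewrite /G /Rintegral.
  rewrite (eq_integral h) => [|z _]; last by rewrite /= fineK.
  by rewrite e /= /lip_nd; ring.
have dl : derivable (cst (lip_nd (- N%:R)) - (L *: @idfun R)) x 1.
  by apply: derivableB; [exact: derivable_cst|apply: derivableZ; exact: derivable_id].
have : derivable (G + (cst (lip_nd (- N%:R)) - (L *: @idfun R))) x 1.
  exact: (derivableD dG dl).
apply: near_eq_derivable => //.
near=> y; rewrite GE//; last first.
- by near: y; exact: lt_nbhsl.
- by near: y; exact: lt_nbhsr.
Unshelve. all: by end_near. Qed.

Lemma lipschitz_derivable : (@lebesgue_measure R).-negligible [set x | ~ derivable f x 1].
Proof.
apply: negligibleS (negligible_bigcup lipschitz_derivable_bounded) => x dx.
exists (Num.truncn `|x|).+1 => //; split => //.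
by rewrite -ltr_norml; exact: truncnS_gt.
Qed.

End lipschitz_derivable.

Section null.
Context {R : realType}.

Definition lnull n (A : set 'rV[R]_n) : Prop := lam n A = 0%E.

Lemma lnullS n (A B : set 'rV[R]_n) : A `<=` B -> lnull B -> lnull A.
Proof.
move=> AB B0; apply/eqP; rewrite eq_le outer_measure_ge0 andbT -B0.
exact: le_outer_measure.
Qed.

Lemma lnull_bigcup n (F : (set 'rV[R]_n)^nat) :
  (forall k, lnull (F k)) -> lnull (\bigcup_k F k).
Proof.
move=> F0; apply/eqP; rewrite eq_le outer_measure_ge0 andbT.
apply: le_trans (outer_measure_sigma_subadditive _ _) _.
by rewrite eseries0// => i _ _; exact: F0.
Qed.

Lemma lnull_bigcupT n (I : countType) (F : I -> set 'rV[R]_n) :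
  (forall i, lnull (F i)) -> lnull (\bigcup_i F i).
Proof.
move=> F0; pose G (k : nat) := if unpickle k is Some i then F i else set0.
apply: (@lnullS _ _ (\bigcup_k G k)) => [x [i _ Fix]|].
  by exists (pickle i) => //; rewrite /G pickleK.
apply: lnull_bigcup => k; rewrite /G; case: unpickle => [i|]; first exact: F0.
exact: outer_measure0.
Qed.

Lemma lnullU n (A B : set 'rV[R]_n) : lnull A -> lnull B -> lnull (A `|` B).
Proof.
move=> A0 B0; apply: (@lnullS _ _ (\bigcup_(b : bool) (if b then A else B))).
  by move=> x [Ax|Bx]; [exists true|exists false].
by apply: lnull_bigcupT => -[].
Qed.

(** The preimage of [N] under (y, t) -> y + t v is null by Fubini in t; its sections at fixed t are
    translates of [N], so Fubini in the other order makes [N] null. This avoids coordinates adapted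
    to [v]. *)
Lemma lnull_line m (N : set 'rV[R]_m) (v : 'rV[R]_m) :
  measurable (N : set (@borelRV R m)) ->
  (forall x, (@lebesgue_measure R).-negligible [set t | N (x + t *: v)]) -> lnull N.
Proof.
move=> mN N0.
pose g (z : 'rV[R]_m.+1) : 'rV[R]_m := z *m (\matrix_(i, j) if unlift ord0 i is Some k then (k == j)%:R else v 0 j).
have gE y t : g (ins ord0 y t) = y + t *: v.
  apply/rowP => j; rewrite !mxE big_ord_recl ins_i !mxE unlift_none addrC; congr (_ + _).
  rewrite (bigD1 j)//= big1 ?addr0 => [|k kj]; rewrite !mxE ?liftK.
    by rewrite eqxx mulr1.
  by rewrite (negbTE kj) mulr0.
pose M := g @^-1` N.
have mM : measurable (M : set (@borelRV R m.+1)).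
  rewrite -[X in measurable X]setTI; apply: (borel_continuous (@mulmx_continuous _ _ _ _)) => //.
have M0 : lam m.+1 M = 0%E.
  rewrite (lebesgue_fubini ord0)// integral0_eq// => y _.
  have -> : [set t | M (ins ord0 y t)] = [set t | N (y + t *: v)].
    by apply/seteqP; split => t; rewrite /M /= gE.
  apply: measure_negligible => //.
  have -> : [set t | N (y + t *: v)] = slice ord0 M y.
    by apply/seteqP; split => t; rewrite /slice /M /= gE.
  exact: measurable_slice.
move: M0; rewrite (lebesgue_fubini_ord ord0)//.
rewrite (eq_integral (cst (lam m N))) => [|t _]; last first.
  rewrite -(lebesgue_preimageD N (t *: v)); congr (lam m _).
  by apply/seteqP; split => y; rewrite /M /= gE.
have -> : [set: R] = `]-oo, +oo[%classic by rewrite set_itvE.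
by rewrite integral_cst//= lebesgue_measure_itv/= => /eqP; rewrite mule_eq0 => /orP[/eqP//|].
Qed.

Lemma lipschitz_enorm_continuous n (f : 'rV[R]_n -> R) (L : R) :
  (forall x y, `|f x - f y| <= L * enorm (x - y)) -> continuous f.
Proof.
move=> fL x A /nbhs_ballP[e e0 eA]; apply/near_enorm.
exists (e / (`|L| + 1)); first by rewrite divr_gt0// ltr_wpDl.
move=> y; rewrite ltr_pdivlMr ?ltr_wpDl// => yx; apply: eA; rewrite /ball/=.
rewrite distrC; apply: le_lt_trans (fL _ _) _; apply: le_lt_trans yx.
rewrite mulrC ler_wpM2l// (le_trans (ler_norm L))// lerDl//.
Qed.

Section dquot.
Variables (n : nat) (f : 'rV[R]_n -> R) (L : R).
Hypothesis fL : forall x y, `|f x - f y| <= L * enorm (x - y).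

(** A quantified directional derivative: these sets are closed, and rational [q] with inverse
    integers [e], [d] leave only countably many of them. *)
Definition dquot (v : 'rV[R]_n) (q e d : R) : set 'rV[R]_n :=
  [set x | forall t, `|t| < d -> `|f (x + t *: v) - f x - t * q| <= e * `|t|].

Lemma closed_dquot v q e d : closed (dquot v q e d).
Proof.
have -> : dquot v q e d = \bigcap_(t in [set t | `|t| < d])
    ((fun x => `|f (x + t *: v) - f x - t * q|) @^-1` [set y | y <= e * `|t|]).
  by apply/seteqP; split.
apply: closed_bigI => t _; apply: closed_comp; last exact: closed_le.
move=> x0 _; apply: (@lipschitz_enorm_continuous _ _ (2 * L)) => {x0} x y.
apply: le_trans (ler_dist_dist _ _) _.
rewrite (_ : _ - _ = (f (x + t *: v) - f (y + t *: v)) - (f x - f y)); last by ring.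
apply: le_trans (ler_normB _ _) _; have := fL x y; have := fL (x + t *: v) (y + t *: v).
rewrite opprD addrACA subrr addr0; lra.
Qed.

Lemma dquot_ae (v : 'rV[R]_n) (e : R) : 0 < e ->
  lnull (~` \bigcup_(p : rat * nat) dquot v (ratr p.1) e p.2.+1%:R^-1).
Proof.
move=> e0; apply: (@lnull_line _ _ v).
  apply: measurableC; apply: countable_bigcupT_measurable => // p.
  by apply: borel_closed; exact: closed_dquot.
move=> x; pose phi t := f (x + t *: v).
have L0 : 0 <= L * enorm v by have := fL (x + v) x; rewrite addrAC subrr add0r; exact: le_trans.
have phiL s t : `|phi s - phi t| <= (L * enorm v) * `|s - t|.
  apply: le_trans (fL _ _) _.
  by rewrite opprD addrACA subrr add0r -scalerBl enormZ -mulrA [`|_| * _]mulrC.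
apply: negligibleS (lipschitz_derivable L0 phiL) => t /= nt dt; apply: nt.
have e2 : 0 < e / 2 by rewrite divr_gt0.
move/cvg_ex: dt => -[D dt].
have [q qD] : exists q : rat, ratr q \in `]D - e / 2, D + e / 2[.
  by apply: rat_in_itvoo; lra.
have /cvgrPdist_lt /(_ _ e2) := dt.
rewrite /dnbhs /within /= => /nbhs_ballP[d d0 dP].
exists (q, Num.truncn d^-1) => //= s sd.
have [->|s0] := eqVneq s 0; first by rewrite scale0r addr0 subrr mul0r subr0 normr0 mulr0.
have sd' : `|s| < d.
  apply: lt_le_trans sd _; rewrite invf_ple ?posrE//; apply/ltW/truncnS_gt.
have := dP s; rewrite /ball/= sub0r normrN => /(_ sd' s0).
have -> : f (x + t *: v + s *: v) - f (x + t *: v) - s * ratr q =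
  s * (s^-1 * (f (x + t *: v + s *: v) - f (x + t *: v)) - ratr q).
  by rewrite [in RHS]mulrBr mulVKf.
rewrite normrM [leRHS]mulrC => h; apply: ler_wpM2l => //.
have -> : f (x + t *: v + s *: v) - f (x + t *: v) = phi (s *: 1 + t) - phi t.
  by rewrite /phi -addrA -scalerDl [s *: 1]mulr1 [t + s]addrC.
move: h; rewrite ltr_distl => /andP[h1 h2]; rewrite ler_distl.
move: qD; rewrite in_itv/= => /andP[q1 q2]; move: h1 h2; set X := s^-1 *: _ => h1 h2.
change (s^-1 * _) with X; apply/andP; split; lra.
Qed.

End dquot.

(** * Nonporous points of a set *)

Section nonporous.
Variables (n : nat) (E : set 'rV[R]_n).

Definition edist (x : 'rV[R]_n) : R := inf [set enorm (x - y) | y in E].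

Hypothesis E0 : E !=set0.

Lemma edist_has_inf x : has_inf [set enorm (x - y) | y in E].
Proof.
split; first by have [y Ey] := E0; exists (enorm (x - y)); exists y.
by exists 0 => _ [y _ <-].
Qed.

Lemma edist_le x y : E y -> edist x <= enorm (x - y).
Proof. by move=> Ey; apply: ge_inf; [exact: (edist_has_inf x).2|exists y]. Qed.

Lemma edist_ge0 x : 0 <= edist x.
Proof. by apply: lb_le_inf; [exact: (edist_has_inf x).1|move=> _ [y _ <-]]. Qed.

Lemma edist_lt x (c : R) : edist x < c -> exists2 y, E y & enorm (x - y) < c.
Proof. by move=> /(inf_lt (edist_has_inf x).1) [_ [y Ey <-] yc]; exists y. Qed.

Lemma edist_lip x y : `|edist x - edist y| <= 1 * enorm (x - y).
Proof.
have H z w : edist z <= edist w + enorm (z - w).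
  rewrite -lerBlDr; apply: lb_le_inf; first exact: (edist_has_inf w).1.
  move=> _ [u Eu <-]; rewrite lerBlDr addrC; apply: le_trans (edist_le z Eu) _.
  exact: ler_enorm_distD.
have := H x y; have := H y x; rewrite [enorm (y - x)]enormB mul1r ler_norml; lra.
Qed.

(** The opposite of a porosity point: [E] has no relatively large holes near x. Lipschitz
    information valid on [E] alone can then be transported to all small increments h. *)
Definition nonporous (x : 'rV[R]_n) : Prop := forall e : R, 0 < e ->
  exists2 d : R, 0 < d & forall h, enorm h < d ->
    exists2 y, E y & enorm (x + h - y) <= e * enorm h.

(** Grid points of mesh 1 / N in the cube [-1, 1]^n, a finite net of directions. *)
Let gv (N : nat) (c : {ffun 'I_n -> 'I_(N.*2.+1)}) : 'rV[R]_n :=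
  \row_i ((c i)%:R / N%:R - 1).

Let gv_net (N : nat) (w : 'rV[R]_n) : (0 < N)%N -> enorm w <= 1 ->
  exists c : {ffun 'I_n -> 'I_(N.*2.+1)}, enorm (w - gv c) <= n%:R / N%:R.
Proof.
move=> N0 w1; have N0' : (0 : R) < N%:R by rewrite ltr0n.
have wi i : `|w 0 i| <= 1 by apply: le_trans (coord_enorm _ _) w1.
pose c i := Num.truncn ((w 0 i + 1) * N%:R).
have cP i : (c i)%:R <= (w 0 i + 1) * N%:R < (c i).+1%:R.
  by apply: truncn_itv; rewrite mulr_ge0//; have := wi i; rewrite ler_norml; lra.
have cN i : (c i < N.*2.+1)%N.
  rewrite ltnS -(ler_nat R); have /andP[h _] := cP i; apply: le_trans h _.
  by rewrite -muln2 natrM mulrC ler_wpM2l//; have := wi i; rewrite ler_norml; lra.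
exists [ffun i => Ordinal (cN i)]; apply: le_trans (enorm_le_norm _) _.
rewrite ler_wpM2l// [leLHS]/Num.norm/= mx_normrE; apply/bigmax_leP; split => /=.
  by rewrite invr_ge0.
move=> [j i] _; rewrite /= ord1 !mxE ffunE/= -[leRHS]mul1r ler_pdivlMr//.
rewrite -[X in _ * X]gtr0_norm// -normrM opprB addrA [_ + 1]addrC.
have -> : (1 + w 0 i - (c i)%:R / N%:R) * N%:R = (w 0 i + 1) * N%:R - (c i)%:R.
  by rewrite mulrBl mulfVK ?gt_eqF// [1 + _]addrC.
by have := cP i; rewrite -natr1 ler_norml; lra.
Qed.

Let good_dir (e : R) (v x : 'rV[R]_n) (k : nat) := forall t, `|t| < k.+1%:R^-1 ->
  edist (x + t *: v) <= e * `|t|.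

(** At a point of [E] the distance to [E] has its minimum 0; comparing t = d / 2 with t = - d / 2
    forces the slope [q] to be at most [e] in absolute value. *)
Let good_dirP (e q d : R) (v x : 'rV[R]_n) : 0 < e -> 0 < d -> E x ->
  dquot edist v q e d x ->
  forall t, `|t| < d -> edist (x + t *: v) <= 2 * e * `|t|.
Proof.
move=> e0 d0 Ex H.
have dx : edist x = 0.
  by apply/eqP; rewrite eq_le edist_ge0 andbT; apply: le_trans (edist_le _ Ex) _; rewrite subrr enorm0.
have qe : `|q| <= e.
  have d2 : 0 < d / 2 by rewrite divr_gt0.
  have nd2 : `|d / 2| = d / 2 by rewrite gtr0_norm.
  have := H (d / 2); have := H (- (d / 2)); rewrite dx !subr0 !normrN nd2.
  have := edist_ge0 (x + (d / 2) *: v); have := edist_ge0 (x + - (d / 2) *: v).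
  move=> h1 h2 /(_ ltac:(lra)) + /(_ ltac:(lra)); rewrite !ler_norml => /andP[a b] /andP[a' b'].
  move: a b a' b' h1 h2; move: (edist _) => A; move: (edist _) => B; move: (d / 2) d2 => c c0 *.
  by apply/andP; split; rewrite -(ler_pM2r c0); lra.
move=> t td; have := H t td; rewrite dx subr0 ler_norml => /andP[_ h].
have : t * q <= e * `|t|.
  by apply: le_trans (ler_norm _) _; rewrite normrM mulrC ler_wpM2r.
lra.
Qed.

(** The distance to [E] is Lipschitz, so almost everywhere its difference quotients settle along
    each of the countably many grid directions; on [E] the slopes are negligible, and finitely many
    directions approximate every h up to a small fraction of |h|. Hence the distance from x + h to
    [E] is o(|h|). *)
Lemma nonporous_ae : lnull (E `\` nonporous).
Proof.
pose I : countType := ({N : nat & {ffun 'I_n -> 'I_(N.*2.+1)}} * nat)%type.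
apply: (@lnullS _ _ (\bigcup_(i : I) ~` \bigcup_(p : rat * nat)
   dquot edist (gv (projT2 i.1)) (ratr p.1) i.2.+1%:R^-1 p.2.+1%:R^-1)); last first.
  by apply: lnull_bigcupT => i; apply: (@dquot_ae _ _ 1) => //; exact: edist_lip.
move=> x [Ex]; apply: contra_notP => H e e0.
have G (N j : nat) (c : {ffun 'I_n -> 'I_(N.*2.+1)}) :
    exists k, good_dir (2 * j.+1%:R^-1) (gv c) x k.
  have [[q k] _ /= qk] : (\bigcup_(p : rat * nat)
      dquot edist (gv c) (ratr p.1) j.+1%:R^-1 p.2.+1%:R^-1) x.
    apply: contrapT => nh; apply: H.
    by exists (existT (fun N : nat => {ffun 'I_n -> 'I_(N.*2.+1)}) N c, j).
  by exists k; apply: good_dirP qk => //; rewrite invr_gt0.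
pose j := Num.truncn (8 / e).
have je : 2 * j.+1%:R^-1 <= e / 4 :> R.
  have j8 : 8 / e < j.+1%:R :> R by exact: truncnS_gt.
  have j0 : (0 : R) < j.+1%:R by [].
  by rewrite -(ler_pM2r j0) mulfVK ?gt_eqF//; move: j8; rewrite ltr_pdivrMr//; lra.
pose N := (Num.truncn (4 * n%:R / e)).+1.
have Ne : n%:R / N%:R <= e / 4 :> R.
  have N4 : 4 * n%:R / e < N%:R :> R by exact: truncnS_gt.
  have N0 : (0 : R) < N%:R by [].
  by rewrite ler_pdivrMr//; move: N4; rewrite ltr_pdivrMr//; lra.
have [k kP] := fin_all_exists (G N j).
pose k0 := (\max_c k c)%N.
exists k0.+1%:R^-1 => [|h hk]; first by rewrite invr_gt0.
have [->|h0] := eqVneq h 0; first by exists x => //; rewrite addr0 subrr enorm0 mulr0.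
have hn : 0 < enorm h by rewrite enorm_gt0.
pose w := (enorm h)^-1 *: h.
have hE : h = enorm h *: w by rewrite scalerA divff ?gt_eqF// scale1r.
have [c cw] : exists c : {ffun 'I_n -> 'I_(N.*2.+1)}, enorm (w - gv c) <= n%:R / N%:R.
  by apply: gv_net => //; rewrite enormZ gtr0_norm ?invr_gt0// mulVf ?gt_eqF.
have : edist (x + h) < e * enorm h.
  have := edist_lip (x + h) (x + enorm h *: gv c).
  have hw : h - enorm h *: gv c = enorm h *: (w - gv c) by rewrite scalerBr -hE.
  rewrite opprD addrACA subrr add0r hw enormZ [`|enorm h|]gtr0_norm// mul1r ler_norml => /andP[_ h1].
  have h2 : edist (x + enorm h *: gv c) <= 2 * j.+1%:R^-1 * enorm h.
    have := kP c (enorm h); rewrite gtr0_norm//; apply; apply: lt_le_trans hk _.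
    rewrite lef_pV2 ?posrE// ler_nat ltnS; exact: leq_bigmax.
  have h3 : enorm h * enorm (w - gv c) <= enorm h * (e / 4).
    by rewrite ler_wpM2l//; apply: le_trans cw Ne.
  have h4 : 2 * j.+1%:R^-1 * enorm h <= e / 4 * enorm h by rewrite ler_wpM2r.
  have h5 : 0 < e * enorm h by rewrite mulr_gt0.
  have := le_trans h2 h4; clear -h1 h3 h5; lra.
by move=> /edist_lt[y Ey yh]; exists y => //; exact: ltW.
Qed.

End nonporous.

Definition diff_at n (f : 'rV[R]_n -> R) (x q : 'rV[R]_n) : Prop :=
  forall e : R, 0 < e -> exists2 d : R, 0 < d &
    forall h, enorm h < d -> `|f (x + h) - f x - dotv q h| <= e * enorm h.

Section rademacher.
Variables (n : nat) (f : 'rV[R]_n -> R) (L : R).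
Hypotheses (L0 : 0 <= L) (fL : forall x y, `|f x - f y| <= L * enorm (x - y)).

Let Pre (i : nat) (h : 'rV[R]_n) : 'rV[R]_n := \row_l (if (l < i)%N then h 0 l else 0).

Let enorm_Pre i h : enorm (Pre i h) <= enorm h.
Proof.
rewrite ler_sqrt ?sumr_ge0// => [|j _]; last exact: sqr_ge0.
by apply: ler_sum => j _; rewrite mxE; case: ifP => // _; rewrite expr0n/= sqr_ge0.
Qed.

Let PreS (i : 'I_n) h : Pre i.+1 h = Pre i h + h 0 i *: delta_mx 0 i.
Proof.
apply/rowP => l; rewrite !mxE eqxx/= ltnS leq_eqVlt -val_eqE/=.
case: (eqVneq l i) => [->|]; first by rewrite ltnn eqxx mulr1 add0r.
by rewrite -val_eqE/= => /negbTE->; rewrite mulr0 addr0.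
Qed.

(** The increment h is followed one coordinate at a time. Each corner x + [Pre i h] is replaced by a
    nearby point of [E], where the i-th difference quotients are controlled on a common scale; the
    replacement costs the Lipschitz constant times a small fraction of |h|. *)
Let rad_path (q : 'I_n -> R) (e d : R) (x : 'rV[R]_n) (E : set 'rV[R]_n) : 0 < e -> 0 < d ->
  (forall y i, E y -> dquot f (delta_mx 0 i) (q i) e d y) -> nonporous E x ->
  exists2 d' : R, 0 < d' & forall h, enorm h < d' ->
    `|f (x + h) - f x - dotv (\row_i q i) h| <= n%:R * (2 * e) * enorm h.
Proof.
move=> e0 d0 EP np.
have L1 : 0 < 2 * L + 1 by rewrite ltr_wpDl// mulr_ge0.
(* Each coordinate step uses the Lipschitz bound twice, at a cost of at most e / 2 each, and the
   difference quotient once, at a cost of e. *)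
have [d1 d10 d1P] := np (e / (2 * L + 1)) (divr_gt0 e0 L1).
exists (Num.min d d1) => [|h]; first by rewrite lt_min d0.
rewrite lt_min => /andP[hd hd1].
have H i : (i <= n)%N -> `|f (x + Pre i h) - f x - dotv (\row_i q i) (Pre i h)| <= i%:R * (2 * e) * enorm h.
  elim: i => [_|i IH ilt].
    have -> : Pre 0 h = 0 by apply/rowP => l; rewrite !mxE.
    by rewrite addr0 dotv0 !subrr normr0 mul0r mul0r.
  have := IH (ltnW ilt); rewrite (PreS (Ordinal ilt))/=.
  set p := Pre i h; set t := h 0 _; set u := delta_mx _ _.
  have [y Ey yx] := d1P p (le_lt_trans (enorm_Pre _ _) hd1).
  have th : `|t| <= enorm h := coord_enorm _ _.
  have := EP y (Ordinal ilt) Ey t (le_lt_trans th hd).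
  rewrite dotvDr dotvZr.
  have -> : dotv (\row_i q i) u = q (Ordinal ilt).
    rewrite dotvE (bigD1 (Ordinal ilt))//= big1 ?addr0 => [|l li]; rewrite !mxE ?eqxx ?mulr1//.
    by rewrite (negbTE li) mulr0.
  set qi := q _; rewrite -/u => h1 h2.
  have h3 : L * enorm (x + p - y) <= e / 2 * enorm h.
    have : L * enorm (x + p - y) <= L * (e / (2 * L + 1) * enorm h).
      rewrite ler_wpM2l//; apply: le_trans yx _; rewrite ler_wpM2l ?enorm_Pre//.
      exact/ltW/divr_gt0.
    move=> /le_trans; apply; rewrite mulrA ler_wpM2r// mulrA ler_pdivrMr//; nra.
  have := fL (x + (p + t *: u)) (y + t *: u); have := fL (x + p) y.
  have -> : x + (p + t *: u) - (y + t *: u) = x + p - y by rewrite opprD !addrA [x + p + _ - y]addrAC addrK.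
  move=> h4 h5.
  have h6 : e * `|t| <= e * enorm h by rewrite ler_wpM2l// ltW.
  rewrite -natr1; move: h1 h2 h4 h5 h3 h6.
  move: (f _) (f _) (f _) (f _) (f _) (t * qi) (dotv _ _) (L * _) (e * `|t|) (i%:R) (enorm h).
  clear => a b c c' g s dd A B C D; rewrite !ler_norml => /andP[? ?] /andP[? ?] /andP[? ?] /andP[? ?] ? ?.
  apply/andP; split; lra.
have := H n (leqnn n); have -> // : Pre n h = h.
by apply/rowP => l; rewrite mxE ltn_ord.
Qed.

(** Gradients fitting up to 1 / (j + 1) differ coordinatewise by at most the sum of their
    tolerances, so the intervals around their coordinates have a common point: the supremum of the
    left ends. *)
Let diff_of_approx (x : 'rV[R]_n) :
  (forall e : R, 0 < e -> exists q, exists2 d : R, 0 < d & forall h, enorm h < d ->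
    `|f (x + h) - f x - dotv q h| <= e * enorm h) -> exists q, diff_at f x q.
Proof.
move=> H; have /choice[Q QP] : forall j : nat, exists Q : 'rV[R]_n, exists2 d : R, 0 < d & forall h, enorm h < d ->
    `|f (x + h) - f x - dotv Q h| <= j.+1%:R^-1 * enorm h.
  by move=> j; apply: H; rewrite invr_gt0.
pose w (j : nat) : R := j.+1%:R^-1.
have w0 j : 0 < w j by rewrite /w invr_gt0.
have QQ i j l : Q j 0 i - w j <= Q l 0 i + w l.
  have [d d0 dP] := QP j; have [d' d0' dP'] := QP l.
  pose t := Num.min d d' / 2.
  have t0 : 0 < t by rewrite divr_gt0// lt_min d0.
  pose h : 'rV[R]_n := t *: delta_mx 0 i.
  have hE (v : 'rV[R]_n) : dotv v h = v 0 i * t.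
    rewrite dotvE (bigD1 i)//= big1 ?addr0 => [|k ki]; rewrite !mxE ?eqxx ?mulr1//.
    by rewrite (negbTE ki) !mulr0.
  have hn : enorm h = t.
    by rewrite enormE hE !mxE !eqxx mulr1 -expr2 sqrtr_sqr gtr0_norm.
  have td : t < d /\ t < d'.
    have : t < Num.min d d' by rewrite /t ltr_pdivrMr// ltr_pMr ?ltr1n// lt_min d0.
    by rewrite lt_min => /andP.
  have := dP h; have := dP' h; rewrite hn !hE => /(_ td.2) + /(_ td.1).
  move=> a b; rewrite -(ler_pM2r t0); move: a b.
  rewrite -!/(w _) !ler_norml => /andP[? ?] /andP[? ?]; lra.
pose q : 'rV[R]_n := \row_i sup [set Q j 0 i - w j | j in setT].
have qQ i j : `|q 0 i - Q j 0 i| <= w j.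
  have ub : has_sup [set Q j 0 i - w j | j in setT].
    split; first by exists (Q 0%N 0 i - w 0%N); exists 0%N.
    by exists (Q 0%N 0 i + w 0%N) => _ [l _ <-]; exact: QQ.
  have h1 : Q j 0 i - w j <= q 0 i by rewrite mxE; apply: ub_le_sup ub.2 _ _; exists j.
  have h2 : q 0 i <= Q j 0 i + w j.
    by rewrite mxE; apply: ge_sup ub.1 _ => _ [l _ <-]; exact: QQ.
  by rewrite ler_norml; lra.
exists q => e e0; pose j := Num.truncn ((n.+1)%:R / e).
have [d d0 dP] := QP j; exists d => // h hd; have := dP h hd; rewrite -/(w j).
have h1 : `|dotv (q - Q j) h| <= n%:R * w j * enorm h.
  apply: le_trans (normr_dotv _ _) _; rewrite ler_wpM2r//.
  apply: le_trans (enorm_le_norm _) _; rewrite ler_wpM2l//.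
  rewrite [leLHS]/Num.norm/= mx_normrE; apply/bigmax_leP; split => /=; first exact: ltW.
  by move=> [k i] _; rewrite /= ord1; have := qQ i j; rewrite [(q - Q j) 0 i]mxE [(- Q j) 0 i]mxE.
have h2 : n.+1%:R * w j <= e.
  by rewrite /w ler_pdivrMr// mulrC -ler_pdivrMr//; exact/ltW/truncnS_gt.
have h3 : n.+1%:R * w j * enorm h <= e * enorm h by rewrite ler_wpM2r.
have nS : n.+1%:R = n%:R + 1 :> R by rewrite -natr1.
move: h1 h3; rewrite dotvBl nS !ler_norml; clear; move=> /andP[? ?] ? /andP[? ?].
apply/andP; split; lra.
Qed.

(** On [E p] all partial difference quotients are close to one rational vector on one common scale.
    For each tolerance almost every point lies in such a set and is a nonporous point of it, so
    [rad_path] applies. *)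
Lemma rademacher : lnull [set x | ~ exists q, diff_at f x q].
Proof.
pose u i : 'rV[R]_n := delta_mx 0 i.
pose E (p : nat * 'rV[rat]_n * nat) : set 'rV[R]_n :=
  \bigcap_(i in setT) dquot f (u i) (ratr (p.1.2 0 i)) p.1.1.+1%:R^-1 p.2.+1%:R^-1.
pose B1 := \bigcup_(ij : 'I_n * nat) ~` \bigcup_(p : rat * nat)
    dquot f (u ij.1) (ratr p.1) ij.2.+1%:R^-1 p.2.+1%:R^-1.
pose B2 := \bigcup_(p : nat * 'rV[rat]_n * nat) (E p `\` nonporous (E p)).
apply: (@lnullS _ _ (B1 `|` B2)); last first.
  apply: lnullU.
    by apply: lnull_bigcupT => -[i j]; apply: (dquot_ae fL); rewrite invr_gt0.
  apply: lnull_bigcupT => p; have [->|/set0P E0] := eqVneq (E p) set0.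
    by rewrite set0D; exact: outer_measure0.
  exact: nonporous_ae.
move=> x nx; apply: contrapT => /not_orP[nB1 nB2]; apply: nx.
apply: diff_of_approx => e e0.
pose j := Num.truncn ((n%:R * 2) / e).
have je : n%:R * (2 * j.+1%:R^-1) <= e :> R.
  by rewrite mulrA ler_pdivrMr// [e * _]mulrC -ler_pdivrMr//; exact/ltW/truncnS_gt.
have /choice[Q QP] : forall i, exists Q : rat * nat, dquot f (u i) (ratr Q.1) j.+1%:R^-1 Q.2.+1%:R^-1 x.
  move=> i; apply: contrapT => nQ; apply: nB1; exists (i, j) => //= -[p _ pP].
  by apply: nQ; exists p.
pose K := (\max_i (Q i).2)%N; pose p := (j, \row_i (Q i).1, K).
have Epx : E p x.
  move=> i _ t tK; rewrite mxE; apply: QP; apply: lt_le_trans tK _.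
  by rewrite lef_pV2 ?posrE// ler_nat ltnS; exact: (leq_bigmax i).
have npx : nonporous (E p) x by apply: contrapT => np; apply: nB2; exists p.
have [d d0 dP] := @rad_path (fun i => ratr (p.1.2 0 i)) j.+1%:R^-1 K.+1%:R^-1 x (E p)
  ltac:(by rewrite invr_gt0) ltac:(by rewrite invr_gt0) (fun y i Ey => Ey i I) npx.
exists (\row_i ratr (p.1.2 0 i)); exists d => // h hd; apply: le_trans (dP h hd) _.
by rewrite ler_wpM2r.
Qed.

End rademacher.
End null.

(** * Alexandrov's theorem *)

Section gauge.
Context {R : realType} {n : nat}.
Variables (S : set 'rV[R]_n) (r0 r1 : R).
Hypotheses (r0_gt0 : 0 < r0) (S_closed : closed S)
  (S_conv : forall x y t, 0 <= t <= 1 -> S x -> S y -> S ((1 - t) *: x + t *: y))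
  (S_in : eball 0 r0 `<=` S) (S_out : S `<=` eball 0 r1).

Definition gauge (y : 'rV[R]_n) : R := inf [set l | 0 < l /\ S (l^-1 *: y)].

Let S0 : S 0.
Proof. by apply: S_in; rewrite /eball/= subrr enorm0 ltW. Qed.

Let Sscale x t : 0 <= t <= 1 -> S x -> S (t *: x).
Proof. by move=> t01 Sx; have := S_conv t01 S0 Sx; rewrite scaler0 add0r. Qed.

Let Sball y (l : R) : 0 < l -> enorm y <= r0 * l -> S (l^-1 *: y).
Proof.
move=> l0 yl; apply: S_in; rewrite /eball/= subr0 enormZ gtr0_norm ?invr_gt0//.
by rewrite mulrC ler_pdivrMr.
Qed.

Let gauge_inf y : has_inf [set l | 0 < l /\ S (l^-1 *: y)].
Proof.
split; last by exists 0 => l [/ltW].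
exists (enorm y / r0 + 1); split; first by rewrite ltr_wpDl// divr_ge0// ltW.
apply: Sball; first by rewrite ltr_wpDl// divr_ge0// ltW.
by rewrite mulrC mulrDl mulfVK ?gt_eqF// lerDl mulr_ge0// ltW.
Qed.

(** Closedness of [S] makes the infimum attained: the points k^-1 y with k > l lie in [S] and tend
    to l^-1 y. *)
Lemma gauge_le y l : 0 < l -> (gauge y <= l <-> S (l^-1 *: y)).
Proof.
move=> l0; split => [gl|Sl]; last by apply: ge_inf; [exact: (gauge_inf y).2|].
have H k : l < k -> S (k^-1 *: y).
  move=> lk; have /(inf_lt (gauge_inf y).1) [k' [k'0 Sk'] k'k] : gauge y < k by exact: le_lt_trans lk.
  have k0 : 0 < k := lt_trans l0 lk.
  have -> : k^-1 *: y = (k' / k) *: (k'^-1 *: y) by rewrite scalerA mulrAC divff ?gt_eqF// mul1r.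
  by apply: Sscale => //; apply/andP; split; [exact/ltW/divr_gt0|rewrite ler_pdivrMr// mul1r ltW].
apply: S_closed => B /near_enorm[e e0 eB].
have y1 : 0 < enorm y + 1 by rewrite ltr_wpDl.
pose s := Num.min (e / (enorm y + 1)) (l^-1 / 2).
have s0 : 0 < s by rewrite lt_min !divr_gt0 ?invr_gt0.
have sl : s < l^-1.
  by rewrite gt_min; apply/orP; right; rewrite ltr_pdivrMr// ltr_pMr ?ltr1n ?invr_gt0.
have ls : 0 < l^-1 - s by rewrite subr_gt0.
exists ((l^-1 - s) *: y); split.
  have := H (l^-1 - s)^-1; rewrite invrK; apply.
  by rewrite -[ltLHS]invrK ltf_pV2 ?posrE ?invr_gt0// gtrBl.
apply: eB; rewrite -scalerBl addrAC subrr add0r enormZ normrN gtr0_norm//.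
apply: (@le_lt_trans _ _ (e / (enorm y + 1) * enorm y)).
  by rewrite ler_wpM2r// ge_min lexx.
by rewrite mulrAC ltr_pdivrMr// mulrDr mulr1 ltrDl.
Qed.

Lemma gauge_le1 y : gauge y <= 1 <-> S y.
Proof. by have := gauge_le y (@ltr01 R); rewrite invr1 scale1r. Qed.

Lemma gauge_ge0 y : 0 <= gauge y.
Proof. by apply: lb_le_inf; [exact: (gauge_inf y).1|move=> l [/ltW]]. Qed.

Lemma gaugeZ a y : 0 < a -> gauge (a *: y) = a * gauge y.
Proof.
move=> a0; have H b z : 0 < b -> gauge (b *: z) <= b * gauge z.
  move=> b0; rewrite mulrC -ler_pdivrMr//.
  apply/ler_addgt0Pr => e e0; rewrite ler_pdivrMr//.
  have l0 : 0 < gauge z + e by rewrite ltr_wpDl// gauge_ge0.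
  apply/gauge_le; first exact: mulr_gt0.
  rewrite invfM scalerA mulrAC -mulrA divff ?gt_eqF// mulr1.
  by apply/gauge_le => //; rewrite lerDl ltW.
apply/eqP; rewrite eq_le H//=; rewrite mulrC -ler_pdivlMr//.
have := H a^-1 (a *: y); rewrite invr_gt0 scalerA mulVf ?gt_eqF// scale1r => /(_ a0).
by rewrite mulrC.
Qed.

Lemma gauge0 : gauge 0 = 0.
Proof.
apply/eqP; rewrite eq_le gauge_ge0 andbT; apply/ler_addgt0Pr => e e0; rewrite add0r.
by apply/gauge_le => //; rewrite scaler0.
Qed.

Lemma gaugeD x y : gauge (x + y) <= gauge x + gauge y.
Proof.
apply/ler_addgt0Pr => e e0.
have e2 : 0 < e / 2 by rewrite divr_gt0.
pose a := gauge x + e / 2; pose b := gauge y + e / 2.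
have a0 : 0 < a by rewrite ltr_wpDl// gauge_ge0.
have b0 : 0 < b by rewrite ltr_wpDl// gauge_ge0.
have ab : 0 < a + b by rewrite addr_gt0.
have -> : gauge x + gauge y + e = a + b by rewrite /a /b; lra.
apply/gauge_le => //.
have Sx : S (a^-1 *: x) by apply/gauge_le => //; rewrite lerDl ltW.
have Sy : S (b^-1 *: y) by apply/gauge_le => //; rewrite lerDl ltW.
have t01 : 0 <= b / (a + b) <= 1.
  by apply/andP; split; [exact/ltW/divr_gt0|rewrite ler_pdivrMr// mul1r lerDr ltW].
have := S_conv t01 Sx Sy; rewrite !scalerA.
have -> : (1 - b / (a + b)) / a = (a + b)^-1 by field; rewrite !gt_eqF.
have -> : b / (a + b) / b = (a + b)^-1 by field; rewrite !gt_eqF.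
by rewrite -scalerDr.
Qed.

Lemma gauge_enorm y : gauge y <= enorm y / r0.
Proof.
apply/ler_addgt0Pr => e e0.
have h : 0 < enorm y / r0 + e by rewrite ltr_wpDl// divr_ge0// ltW.
apply/gauge_le => //; apply: Sball => //.
by rewrite mulrDr mulrCA divff ?gt_eqF// mulr1 lerDl mulr_ge0// ltW.
Qed.

Lemma gauge_lip x y : `|gauge x - gauge y| <= r0^-1 * enorm (x - y).
Proof.
have H z w : gauge z <= gauge w + r0^-1 * enorm (z - w).
  rewrite mulrC -lerBlDl; apply: le_trans (gauge_enorm _); rewrite lerBlDl.
  by apply: le_trans (gaugeD _ _); rewrite addrC subrK.
by have := H x y; have := H y x; rewrite [enorm (y - x)]enormB ler_norml; lra.
Qed.

Lemma gauge_convex x y t : 0 <= t <= 1 ->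
  gauge ((1 - t) *: x + t *: y) <= (1 - t) * gauge x + t * gauge y.
Proof.
move=> /andP[]; rewrite le_eqVlt => /predU1P[<- _|t0].
  by rewrite subr0 scale0r mul0r scale1r mul1r !addr0.
rewrite le_eqVlt => /predU1P[->|t1].
  by rewrite subrr scale0r mul0r scale1r mul1r !add0r.
by apply: le_trans (gaugeD _ _) _; rewrite !gaugeZ// subr_gt0.
Qed.

Lemma enorm_gauge y : enorm y <= r1 * gauge y.
Proof.
have r10 : 0 <= r1 by have := S_out S0; rewrite /eball/= subrr enorm0.
apply/ler_addgt0Pr => e e0.
have r11 : 0 < r1 + 1 by rewrite ltr_wpDl.
have l0 : 0 < gauge y + e / (r1 + 1) by rewrite ltr_wpDl ?gauge_ge0// divr_gt0.
have /S_out : S ((gauge y + e / (r1 + 1))^-1 *: y).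
  by apply/gauge_le => //; rewrite lerDl ltW// divr_gt0.
rewrite /eball/= subr0 enormZ gtr0_norm ?invr_gt0// mulrC ler_pdivrMr// => /le_trans; apply.
rewrite mulrDr lerD2l mulrA ler_pdivrMr// mulrC mulrDr mulr1 lerDl; exact: ltW.
Qed.

End gauge.

(** * Touching paraboloids and second-order expansions *)

Section alexandrov.
Context {R : realType} {n : nat}.
Implicit Types x y p h : 'rV[R]_n.

Definition good (j : 'rV[R]_n -> R) (c : R) (p y : 'rV[R]_n) : Prop :=
  forall h, j (y + h) <= j y + dotv p h + c * dotv h h.

Lemma mulmx_enorm_le (A : 'M[R]_n) :
  exists2 M : R, 0 <= M & forall h, enorm (h *m A) <= M * enorm h.
Proof.
pose S := \sum_i \sum_j `|A i j|; have S0 : 0 <= S by rewrite !sumr_ge0// => i _; rewrite sumr_ge0.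
exists (n%:R * S) => [|h]; first by rewrite mulr_ge0.
apply: le_trans (enorm_le_norm _) _; rewrite -mulrA ler_wpM2l//.
rewrite [leLHS]/Num.norm/= mx_normrE; apply/bigmax_leP; split => /= [|[k l] _]; first by rewrite mulr_ge0.
rewrite /= ord1 mxE; apply: le_trans (ler_norm_sum _ _ _) _.
rewrite mulr_suml; apply: ler_sum => i _; rewrite normrM mulrC ler_pM// ?coord_enorm//.
by rewrite (bigD1 l)//= lerDl sumr_ge0.
Qed.

(** McShane's extension, the infimum of [f y + L * enorm (x - y)] over [E]; the empty set is treated
    apart because the infimum needs a value. *)
Lemma lipschitz_extension (E : set 'rV[R]_n) (f : 'rV[R]_n -> R) (L : R) : 0 <= L ->
  (forall x y, E x -> E y -> `|f x - f y| <= L * enorm (x - y)) ->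
  exists F : 'rV[R]_n -> R, (forall x, E x -> F x = f x) /\
    (forall x y, `|F x - F y| <= L * enorm (x - y)).
Proof.
move=> L0 fL; have [E0|/set0P[z Ez]] := eqVneq E set0.
  by exists (cst 0); split => [x|x y]; rewrite ?E0// subrr normr0 mulr_ge0.
pose V x := [set f y + L * enorm (x - y) | y in E].
have V0 x : has_inf (V x).
  split; first by exists (f z + L * enorm (x - z)); exists z.
  exists (f z - L * enorm (x - z)) => _ [y Ey <-].
  have := fL z y Ez Ey; have : L * enorm (z - y) <= L * enorm (x - z) + L * enorm (x - y).
    by rewrite -mulrDr ler_wpM2l//; apply: le_trans (ler_enorm_distD x _ _) _; rewrite [enorm (z - x)]enormB.
  by rewrite ler_norml => ? /andP[? ?]; lra.
exists (fun x => inf (V x)); split => [x Ex|].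
  apply/eqP; rewrite eq_le; apply/andP; split.
    by apply: ge_inf; [exact: (V0 x).2|exists x => //; rewrite subrr enorm0 mulr0 addr0].
  apply: lb_le_inf; first exact: (V0 x).1.
  by move=> _ [y Ey <-]; have := fL x y Ex Ey; rewrite ler_norml => /andP[_]; lra.
have H x y : inf (V x) <= inf (V y) + L * enorm (x - y).
  rewrite -lerBlDr; apply: lb_le_inf; first exact: (V0 y).1.
  move=> _ [w Ew <-]; rewrite lerBlDr.
  have : inf (V x) <= f w + L * enorm (x - w) by apply: ge_inf; [exact: (V0 x).2|exists w].
  have : L * enorm (x - w) <= L * enorm (x - y) + L * enorm (y - w).
    by rewrite -mulrDr ler_wpM2l// ler_enorm_distD.
  lra.
by move=> x y; have := H x y; have := H y x; rewrite [enorm (y - x)]enormB ler_norml; lra.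
Qed.

Variables (j : 'rV[R]_n -> R) (L : R).
Hypotheses (L0 : 0 <= L) (jL : forall x y, `|j x - j y| <= L * enorm (x - y))
  (jconv : forall x y t, 0 <= t <= 1 ->
    j ((1 - t) *: x + t *: y) <= (1 - t) * j x + t * j y).

(** The touching paraboloid bounds [j] from above at y - s h; by convexity the values at y - s h and
    y + h control j y, and small s makes [p] a subgradient. *)
Lemma good_sub c p y h : 0 <= c -> good j c p y -> j y + dotv p h <= j (y + h).
Proof.
move=> c0 g; apply/ler_addgt0Pr => e e0.
pose B := c * dotv h h + 1.
have B0 : 0 < B by rewrite ltr_wpDl// mulr_ge0// dotvv_ge0.
pose s := e / B; have s0 : 0 < s by rewrite divr_gt0.
have s1 : 0 < 1 + s by rewrite addr_gt0.
have := g (- (s *: h)); rewrite dotvNr dotvNl !dotvZr dotvNr dotvZl dotvZr opprK => h1.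
have t01 : 0 <= s / (1 + s) <= 1.
  by apply/andP; split; [exact/ltW/divr_gt0|rewrite ler_pdivrMr// mul1r lerDr].
have := jconv (y - s *: h) (y + h) t01.
have -> : (1 - s / (1 + s)) *: (y - s *: h) + (s / (1 + s)) *: (y + h) = y.
  have -> : 1 - s / (1 + s) = (1 + s)^-1 by field; rewrite gt_eqF.
  rewrite scalerBr scalerDr scalerA addrACA -scalerDl [_ * s]mulrC.
  by rewrite addNr addr0 -[X in X + _]mul1r -mulrDl divff ?gt_eqF// scale1r.
have -> : 1 - s / (1 + s) = (1 + s)^-1 by field; rewrite gt_eqF.
move=> h2; have h3 : (1 + s) * j y <= j (y - s *: h) + s * j (y + h).
  have := ler_wpM2l (ltW s1) h2; move/le_trans; apply.
  rewrite mulrDr mulrA divff ?gt_eqF// mul1r mulrA (_ : (1 + s) * (s / (1 + s)) = s)//.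
  by rewrite mulrC mulfVK// gt_eqF.
have sB : s * (c * dotv h h) <= e.
  by rewrite /s mulrAC ler_pdivrMr// ler_wpM2l ?(ltW e0)// /B lerDl.
rewrite -(ler_pM2l s0); move: sB h1 h3; set D := dotv h h; set P := dotv p h; nra.
Qed.

Lemma good_norm c p y : 0 <= c -> good j c p y -> enorm p <= L.
Proof.
move=> c0 g; have [->|p0] := eqVneq p 0; first by rewrite enorm0.
have pp : 0 < enorm p by rewrite enorm_gt0.
rewrite -(ler_pM2r pp) -expr2 sqr_enorm.
have := good_sub p c0 g; have := jL (y + p) y.
by rewrite addrAC subrr add0r ler_norml => /andP[? ?]; lra.
Qed.

(** Cocoercivity of gradients, as in the theorem of Baillon and Haddad: the paraboloid at y1 is
    compared with the supporting affine function at y2 in the displaced point y1 + h, where h = - q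
    / (2 c) is the best choice. *)
Lemma good_coco c p1 p2 y1 y2 : 0 < c -> good j c p1 y1 -> good j c p2 y2 ->
  dotv (p1 - p2) (p1 - p2) <= 4 * c * dotv (p1 - p2) (y1 - y2).
Proof.
move=> c0 g1 g2; set q := p1 - p2; set s := (2 * c)^-1; set h := - (s *: q).
have c2 : 0 < 2 * c by rewrite mulr_gt0.
have := g1 h; have := good_sub (y2 - y1) (ltW c0) g1.
have := good_sub (y1 + h - y2) (ltW c0) g2.
rewrite [y2 + (_ - y2)]addrC subrK [y1 + (y2 - y1)]addrC subrK => a1 a2 a3.
have : 0 <= dotv q (h + y1 - y2) + c * dotv h h.
  rewrite /q dotvBl !(dotvDr, dotvNr) in a1 a2 a3 *.
  move: a1 a2 a3; rewrite !(dotvDl, dotvNl, dotvDr, dotvNr); lra.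
set D := dotv q q; set P := dotv q (y1 - y2); rewrite -addrA; move=> H0.
have {H0}H : 0 <= - (s * D) + P + c * (s * (s * D)).
  move: H0; rewrite dotvDr -/P {1 2 3}/h dotvNr dotvNl dotvNr opprK !dotvZr dotvZl.
  by rewrite -/D.
have cs : c * s = 2^-1 by rewrite /s; field; rewrite gt_eqF.
have : c * (s * (s * D)) = 2^-1 * (s * D) by rewrite [LHS]mulrA cs.
move: H => /[swap] -> H; have s0 : 0 < s by rewrite invr_gt0.
rewrite -(ler_pM2l s0).
have -> : s * (4 * c * P) = 2 * P by rewrite -!mulrA mulrCA [s * _]mulrA [s * c]mulrC cs; field.
lra.
Qed.

Lemma good_lip c p1 p2 y1 y2 : 0 < c -> good j c p1 y1 -> good j c p2 y2 ->
  enorm (p1 - p2) <= 4 * c * enorm (y1 - y2).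
Proof.
move=> c0 g1 g2; have := good_coco c0 g1 g2.
have [->|q0] := eqVneq (p1 - p2) 0; first by rewrite enorm0 !mulr_ge0// ltW.
have qq : 0 < enorm (p1 - p2) by rewrite enorm_gt0.
move=> H; rewrite -(ler_pM2r qq) -expr2 sqr_enorm; apply: le_trans H _.
rewrite -!mulrA !ler_wpM2l ?(ltW c0)//; apply: le_trans (dotv_le _ _) _.
by rewrite mulrC.
Qed.

(** Completing the square identifies this with [good j c p y] for p = 2 c (y - v), so that y and p
    determine the centre [v]. *)
Let argm c (v y : 'rV[R]_n) :=
  forall z, j z - c * dotv (z - v) (z - v) <= j y - c * dotv (y - v) (y - v).

Let argm_good c v y : argm c v y -> good j c (2 * c *: (y - v)) y.
Proof.
move=> m h; have := m (y + h); rewrite addrAC dotvZl; move: (y - v) => w.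
by rewrite !dotvDl !dotvDr [dotv h w]dotvC; lra.
Qed.

Let good_argm c p y : 0 < c -> good j c p y -> argm c (y - (2 * c)^-1 *: p) y.
Proof.
move=> c0 g z; have := g (z - y); rewrite [y + _]addrC subrK.
have -> : z - (y - (2 * c)^-1 *: p) = (z - y) + (2 * c)^-1 *: p by rewrite opprB addrA addrAC.
rewrite opprB [y + _]addrC subrK; move: (z - y) => w.
rewrite !dotvDl !dotvDr !dotvZl !dotvZr [dotv p w]dotvC.
set P := dotv p p; set Q := dotv w p; set Z := dotv w w.
have -> : c * (Z + (2 * c)^-1 * Q + ((2 * c)^-1 * Q + (2 * c)^-1 * ((2 * c)^-1 * P))) =
  c * Z + Q + c * ((2 * c)^-1 * ((2 * c)^-1 * P)) by field; rewrite gt_eqF.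
lra.
Qed.

(** Outside the ball of radius L / c about [v] the quadratic penalty exceeds the Lipschitz gain, so
    a maximum over that ball is global. *)
Let argm_exists c v : 0 < c -> exists2 y, argm c v y & enorm (y - v) <= L / c.
Proof.
move=> c0; pose F z := j z - c * dotv (z - v) (z - v).
have Lc : 0 <= L / c by rewrite divr_ge0// ltW.
have cF : continuous F.
  move=> z; pose FF := @nbhs_filter 'rV[R]_n z.
  apply: (@cvgB _ _ _ (nbhs z) FF); first exact: (lipschitz_enorm_continuous jL).
  apply: (@cvgM _ _ (nbhs z) FF); first exact: (@cvg_cst _ _ _ (nbhs z) FF).
  rewrite (_ : (fun x => _) = (fun t => enorm (t - v) ^+ 2)); last first.
    by apply/funext => t; rewrite sqr_enorm.
  by rewrite -sqr_enorm; apply: (@cvgM _ _ (nbhs z) FF); exact: enormB_continuous.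
have vB : eball v (L / c) v by rewrite /eball/= subrr enorm0.
have [y yB yP] : exists2 y, y \in eball v (L / c) & forall t, t \in eball v (L / c) -> F t <= F y.
  apply: EVT_max_rV; [by exists v|exact: compact_eball|].
  by apply: continuous_subspaceT => z; exact: cF.
exists y; last by rewrite inE in yB.
move=> z; have [zB|zB] := leP (enorm (z - v)) (L / c); first by apply: yP; rewrite inE.
apply: le_trans (yP v _); last by rewrite inE.
rewrite /F subrr dot0v mulr0 subr0 -sqr_enorm.
have := jL z v; rewrite ler_norml => /andP[_ h].
have : L * enorm (z - v) <= c * enorm (z - v) ^+ 2.
  by rewrite expr2 mulrA ler_wpM2r// mulrC -ler_pdivrMr// ltW.
lra.
Qed.

Definition goods c := [set y | exists p, good j c p y].

(** Within a ball, [goods c] is the projection of the compact set of pairs (v, y) with y maximising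
    for the centre v; v stays bounded because |y - v| = |p| / (2 c) is at most L / (2 c). *)
Lemma closed_goods c : 0 < c -> closed (goods c).
Proof.
move=> c0; pose r := L / (2 * c).
have r0 : 0 <= r by rewrite divr_ge0// mulr_ge0// ltW.
pose D := [set vy : 'rV[R]_n * 'rV[R]_n | argm c vy.1 vy.2].
have cfst : continuous (fun vy : 'rV[R]_n * 'rV[R]_n => vy.1) by move=> a; exact: cvg_fst.
have csnd : continuous (fun vy : 'rV[R]_n * 'rV[R]_n => vy.2) by move=> a; exact: cvg_snd.
have cN (f : 'rV[R]_n * 'rV[R]_n -> 'rV[R]_n) : continuous f ->
    continuous (fun t => dotv (f t) (f t)).
  move=> cf a; rewrite (_ : (fun t => _) = (fun t => enorm (f t - 0) ^+ 2)); last first.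
    by apply/funext => b; rewrite subr0 sqr_enorm.
  have h : enorm (f b - 0) @[b --> a] --> enorm (f a - 0).
    by apply: (@continuous_comp _ _ _ f (fun z => enorm (z - 0))); [exact: cf|exact: enormB_continuous].
  by rewrite /continuous_at; apply: cvgM.
have cD : closed D.
  have -> : D = \bigcap_z ((fun vy : 'rV[R]_n * 'rV[R]_n => (j z - c * dotv (z - vy.1) (z - vy.1)) -
      (j vy.2 - c * dotv (vy.2 - vy.1) (vy.2 - vy.1))) @^-1` [set t | t <= 0]).
    apply/seteqP; split => [vy m z _|vy m z]; last by have := m z I; rewrite /= subr_le0.
    by rewrite /= subr_le0; exact: m.
  apply: closed_bigI => z _; apply: closed_comp; last exact: closed_le.
  move=> vy _; apply: cvgB; apply: cvgB; rewrite /=.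
  - exact: cvg_cst.
  - apply: cvgM; first exact: cvg_cst.
    by apply: (cN (fun vy => z - vy.1)) => a; apply: cvgB; [exact: cvg_cst|exact: cfst].
  - by apply: (@continuous_comp _ _ _ _ j); [exact: csnd|exact: (lipschitz_enorm_continuous jL)].
  - apply: cvgM; first exact: cvg_cst.
    by apply: (cN (fun vy => vy.2 - vy.1)) => a; apply: cvgB; [exact: csnd|exact: cfst].
have gE rho : goods c `&` eball 0 rho =
    snd @` (D `&` (eball 0 (rho + r) `*` eball 0 rho)).
  apply/seteqP; split => [y [[p gp] yr]|y [[v z] [/= m [/= vr zr]] <-]]; last first.
    by split => //; exists (2 * c *: (z - v)); exact: argm_good.
  exists (y - (2 * c)^-1 *: p, y) => //; split; first exact: good_argm.
  split => //; move: yr; rewrite /eball/= !subr0 => yr.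
  apply: le_trans (ler_enormB _ _) _; rewrite lerD// enormZ gtr0_norm ?invr_gt0 ?mulr_gt0//.
  by rewrite /r mulrC ler_wpM2r ?invr_ge0 ?mulr_ge0 ?(ltW c0)//; exact: (good_norm (ltW c0) gp).
have cg rho : closed (goods c `&` eball 0 rho).
  rewrite gE; apply: compact_closed; first exact: norm_hausdorff.
  apply: continuous_compact; first by apply: continuous_subspaceT => a; exact: csnd.
  have cc : compact (@eball R n 0 (rho + r) `*` @eball R n 0 rho).
    by apply: compact_setX; exact: compact_eball.
  by rewrite setIC; apply: compact_closedI.
move=> y yc; have [] : (goods c `&` eball 0 (enorm y + 1)) y => //.
apply: cg => B yB; have yB1 : nbhs y (eball 0 (enorm y + 1)).
  apply/near_enorm; exists 1 => // z zy; rewrite /eball/= subr0.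
  have -> : z = y + (z - y) by rewrite addrC subrK.
  by apply: le_trans (ler_enormD _ _) _; rewrite lerD2l ltW.
have [z [gz [zB zB1]]] := yc _ (@filterI _ _ (@nbhs_filter _ y) _ _ yB yB1).
by exists z.
Qed.

Lemma goods_volume (rho : R) : 0 < rho -> exists2 C : R, 0 <= C &
  forall c, 0 < c -> (lam n (eball 0 rho `\` goods c) <= (C / c)%:E)%E.
Proof.
move=> rho0; pose om := vol (@eball R n 0 1).
have om0 : 0 <= om by rewrite fine_ge0// outer_measure_ge0.
have omE (r : R) : 0 <= r -> lam n (@eball R n 0 r) = (r ^+ n * om)%:E.
  by move=> r0; rewrite lebesgue_eball// EFinM; congr (_ * _)%E; rewrite vol_eballE.
exists (om * rho ^+ n * n.+1%:R * L / rho).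
  by rewrite !mulr_ge0 ?exprn_ge0 ?invr_ge0// ltW.
move=> c c0; have Lc : 0 <= L / c by rewrite divr_ge0// ltW.
(* For c this small the bound exceeds the measure of the whole ball. *)
have [rL|rL] := leP rho (L / c).
  apply: (@le_trans _ _ (lam n (eball 0 rho))); first exact: le_outer_measure.
  rewrite omE ?(ltW rho0)// lee_fin.
  rewrite (_ : _ / c = (rho ^+ n * om) * (n.+1%:R * ((L / c) / rho))); last by field; rewrite !gt_eqF.
  rewrite ler_peMr ?mulr_ge0 ?exprn_ge0 ?(ltW rho0)//.
  have : 1 <= L / c / rho by rewrite ler_pdivlMr// mul1r.
  move=> h; apply: le_trans h _; rewrite ler_peMl ?ler1n//.
  by rewrite mulr_ge0// invr_ge0 ltW.
have mg : measurable (goods c : set (@borelRV R n)) by apply: borel_closed; exact: closed_goods.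
pose s := L / c; have s0 : 0 <= rho - s by rewrite subr_ge0 ltW.
have /choice[Y YP] : forall v, exists y, argm c v y /\ enorm (y - v) <= L / c.
  by move=> v; have [y] := argm_exists v c0; exists y.
have h1 : (lam n (eball 0 (rho - s)) <= lam n (eball 0 rho `&` goods c))%E.
  apply: (@le_trans _ _ (lam n (Y @` eball 0 (rho - s)))).
    (* Cocoercivity for the gradients 2 c (Y v - v) rearranges to |v - w| <= |Y v - Y w|. *)
    rewrite -[X in (lam n X <= _)%E]image_id; apply: lebesgue_contraction => v w _ _.
    have [mv _] := YP v; have [mw _] := YP w.
    have := good_coco c0 (argm_good mv) (argm_good mw); set P := _ - _.
    have PE : P = 2 * c *: ((Y v - Y w) - (v - w)).
      by rewrite /P -scalerBr; congr (_ *: _); rewrite !opprD addrACA.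
    move=> h; apply: ler_of_sqr => //; rewrite !sqr_enorm.
    move: h; rewrite PE !dotvZl !dotvZr; move: (Y v - Y w) (v - w) => a b.
    rewrite !dotvBl !dotvBr [dotv b a]dotvC => h.
    have c4 : 0 < 4 * c * c by rewrite !mulr_gt0.
    rewrite -(ler_pM2l c4); move: h; set A := dotv a a; set B := dotv b b; set G := dotv a b; nra.
  apply: le_outer_measure => _ [v vr <-]; have [mv vL] := YP v; split; last first.
    by exists (2 * c *: (Y v - v)); exact: argm_good.
  move: vr; rewrite /eball/= !subr0 => vr; have -> : Y v = v + (Y v - v) by rewrite addrC subrK.
  by apply: le_trans (ler_enormD _ _) _; rewrite /s in vr; lra.
have h2 : (lam n (eball 0 rho) = lam n (eball 0 rho `&` goods c) + lam n (eball 0 rho `\` goods c))%E.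
  exact: (borel_caratheodory mg).
have h3 : (lam n (eball 0 rho `\` goods c) = lam n (eball 0 rho) - lam n (eball 0 rho `&` goods c))%E.
  rewrite h2 addeAC subee ?add0e// ge0_fin_numE ?outer_measure_ge0//.
  apply: le_lt_trans (le_outer_measure (lam n) _ (eball 0 rho) _) _; first by move=> x [].
  exact: (@eball_lty R n 0 rho).
rewrite h3; apply: (@le_trans _ _ (lam n (eball 0 rho) - lam n (eball 0 (rho - s)))%E).
  by apply: leeB.
rewrite !omE ?(ltW rho0)// -EFinB lee_fin.
have t0 : 0 <= s / rho by rewrite divr_ge0// ltW.
have t1 : s / rho <= 1 by rewrite ler_pdivrMr// mul1r ltW.
have B k : 1 - k%:R * (s / rho) <= (1 - s / rho) ^+ k.
  elim: k => [|k IH]; first by rewrite mul0r subr0 expr0.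
  rewrite exprS -natr1; have := ler_wpM2l (_ : 0 <= 1 - s / rho) IH.
  rewrite subr_ge0 => /(_ t1); move: t0 t1 (ler0n R k); set t := s / rho; nra.
have h4 : 1 - (1 - s / rho) ^+ n <= n.+1%:R * (s / rho).
  by have := B n; rewrite -natr1 mulrDl mul1r; lra.
have -> : rho - s = rho * (1 - s / rho) by field; rewrite gt_eqF.
rewrite exprMn -mulrBl -{1}[rho ^+ n]mulr1 -mulrBr.
apply: le_trans (ler_wpM2r om0 (ler_wpM2l _ h4)) _; first by rewrite exprn_ge0// ltW.
by rewrite /s le_eqVlt; apply/orP; left; apply/eqP; field; rewrite !gt_eqF.
Qed.

Lemma goods_ae : lnull (~` \bigcup_k goods k.+1%:R).
Proof.
apply: (@lnullS _ _ _ (\bigcup_m (eball 0 m.+1%:R `\` \bigcup_k goods k.+1%:R))).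
  move=> y ny; exists (Num.truncn (enorm y)) => //; split => //.
  by rewrite /eball/= subr0; exact/ltW/truncnS_gt.
apply: lnull_bigcup => m; have [C C0 CP] := @goods_volume m.+1%:R ltac:(by []).
apply/eqP; rewrite eq_le outer_measure_ge0 andbT; apply/lee_addgt0Pr => e e0; rewrite add0e.
pose k := Num.truncn (C / e).
apply: le_trans (le_outer_measure (lam n) _ (eball 0 m.+1%:R `\` goods k.+1%:R) _) _.
  by move=> y [ym ny]; split => // gy; apply: ny; exists k.
apply: le_trans (CP _ _) _ => //; rewrite lee_fin ler_pdivrMr// mulrC -ler_pdivrMr//.
exact/ltW/truncnS_gt.
Qed.

(** [A] arises as the matrix of partial derivatives of the gradient and may be asymmetric; only its
    quadratic form enters, and it is symmetrised when curvatures are read off. *)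
Definition exp2 (x p : 'rV[R]_n) (A : 'M[R]_n) : Prop := forall e : R, 0 < e ->
  exists2 d : R, 0 < d & forall h, enorm h < d ->
    `|j (x + h) - j x - dotv p h - 2^-1 * dotv (h *m A) h| <= e * enorm h ^+ 2.

(** [j] lies between its supporting affine function and its paraboloid at the good point y near x +
    u; subtracting the estimates at x + u and x + v leaves only quadratic terms. *)
Let good_chord c p y (e : R) x u v : 0 < c -> good j c p y ->
  enorm (x + u - y) <= e * enorm u -> 0 <= e ->
  `|j (x + v) - j (x + u) - dotv p (v - u)| <= c * (enorm (v - u) + e * enorm u) ^+ 2.
Proof.
move=> c0 g yu e0; set w := x + u - y.
have e1 : y + w = x + u by rewrite /w addrC subrK.
have e2 : y + (w + (v - u)) = x + v by rewrite addrA e1 addrACA subrr addr0.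
have := g w; have := g (w + (v - u)); rewrite e1 e2.
have := good_sub w (ltW c0) g; have := good_sub (w + (v - u)) (ltW c0) g; rewrite e1 e2.
set s := v - u => a1 a2 a3 a4; have pw : dotv p (w + s) = dotv p w + dotv p s := dotvDr _ _ _.
have hw : 0 <= enorm w <= e * enorm u by rewrite enorm_ge0.
have b1 : c * dotv w w <= c * (enorm s + e * enorm u) ^+ 2.
  rewrite -sqr_enorm ler_wpM2l ?(ltW c0)// ler_pXn2r ?nnegrE ?addr_ge0 ?mulr_ge0//.
  by case/andP: hw => _ /le_trans; apply; rewrite lerDr.
have b2 : c * dotv (w + s) (w + s) <= c * (enorm s + e * enorm u) ^+ 2.
  rewrite -sqr_enorm ler_wpM2l ?(ltW c0)// ler_pXn2r ?nnegrE ?addr_ge0 ?mulr_ge0//.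
  by apply: le_trans (ler_enormD _ _) _; rewrite addrC lerD2l; case/andP: hw.
rewrite pw in a1 a3; rewrite ler_norml; apply/andP; split; move: a1 a2 a3 a4 b1 b2; clear; lra.
Qed.

(** The gradient is integrated along the segment from x to x + h by a Riemann sum of N steps: at a
    good point near x + [z i] it equals p + [z i] A up to a fraction of |h|, and all errors together
    are at most C |h|^2 / N. *)
Lemma alexandrov_at c p x (A : 'M[R]_n) : 0 < c -> good j c p x ->
  (forall e : R, 0 < e -> exists2 d : R, 0 < d & forall h, enorm h < d ->
     exists y q, [/\ good j c q y, enorm (x + h - y) <= e * enorm h &
       enorm (q - p - h *m A) <= e * enorm h]) -> exp2 x p A.
Proof.
move=> c0 gp H; have [M M0 MA] := mulmx_enorm_le A.
(* The terms pay for the error of the gradient, for the paraboloids, and for the gap between a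
   Riemann sum and its integral. *)
pose C := 1 + 4 * c + M; have C0 : 0 < C by rewrite /C; move: M0 c0; lra.
move=> e e0; pose N := (Num.truncn (C / e)).+1.
have N0 : (0 : R) < N%:R by [].
have CN : C / N%:R <= e by rewrite ler_pdivrMr// mulrC -ler_pdivrMr//; exact/ltW/truncnS_gt.
have [d d0 dP] := H N%:R^-1 ltac:(by rewrite invr_gt0).
exists d => // h hd; set q := dotv (h *m A) h.
pose D v := j (x + v) - j x - dotv p v.
pose z (i : nat) : 'rV[R]_n := (i%:R / N%:R) *: h.
set E := enorm h; pose W : R := N%:R^-1.
have W0 : 0 < W by rewrite /W invr_gt0.
have E0 : 0 <= E := enorm_ge0 _.
(* The factor i (i - 1) / 2 is the sum of the left endpoints 0, ..., i - 1. *)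
have step i : (i <= N)%N -> `|D (z i) - (i%:R * (i%:R - 1) / 2 * W ^+ 2) * q| <= i%:R * (1 + 4 * c) * W ^+ 2 * E ^+ 2.
  elim: i => [_|i IH iN].
    by rewrite /D /z !mul0r scale0r addr0 dotv0 subrr !subr0 normr0.
  have {}IH := IH (ltnW iN).
  have zi : enorm (z i) <= E.
    rewrite /z enormZ ger0_norm ?divr_ge0// -[leRHS]mul1r ler_wpM2r// ler_pdivrMr//.
    by rewrite mul1r ler_nat ltnW.
  have [y [qy [gy y1 y2]]] := dP (z i) (le_lt_trans zi hd).
  have zS : z i.+1 - z i = W *: h.
    by rewrite /z -scalerBl -mulrBl -natr1 addrAC subrr add0r mul1r.
  have := @good_chord c qy y W x (z i) (z i.+1) c0 gy y1 (ltW W0).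
  rewrite zS enormZ [`|W|]gtr0_norm// -/E => h1.
  have h2 : c * (W * E + W * enorm (z i)) ^+ 2 <= 4 * c * W ^+ 2 * E ^+ 2.
    rewrite (_ : 4 * c * W ^+ 2 * E ^+ 2 = c * (2 * (W * E)) ^+ 2); last by ring.
    rewrite ler_wpM2l ?(ltW c0)// ler_pXn2r ?nnegrE ?addr_ge0 ?mulr_ge0 ?(ltW W0)//.
    by have := ler_wpM2l (ltW W0) zi; lra.
  have h3 : `|dotv (qy - p - z i *m A) (W *: h)| <= W ^+ 2 * E ^+ 2.
    apply: le_trans (normr_dotv _ _) _; rewrite enormZ gtr0_norm// -/E.
    have : enorm (qy - p - z i *m A) <= W * E by apply: le_trans y2 _; rewrite ler_wpM2l// ltW.
    move=> H1; apply: le_trans (ler_wpM2r (mulr_ge0 (ltW W0) E0) H1) _.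
    by rewrite mulrACA -!expr2.
  have h4 : dotv (z i *m A) (W *: h) = i%:R * W ^+ 2 * q.
    by rewrite /z -scalemxAl dotvZl dotvZr -/q -/W; ring.
  have Dz : D (z i.+1) - D (z i) = j (x + z i.+1) - j (x + z i) - dotv p (W *: h).
    by rewrite -zS dotvBr /D; ring.
  move: h3; rewrite !dotvBl h4.
  move=> h3.
  have h5 := le_trans h1 h2; move: h5 h3 IH Dz; rewrite -[i.+1%:R]natr1.
  move: (j (x + z i.+1)) (j (x + z i)) (D (z i.+1)) (D (z i)) (dotv qy _) (dotv p _) (i%:R) (q).
  clear -c0 W0 E0; move=> j1 j0 D1 D0 P Q k qq h5 h3 IH Dz.
  move: h5 h3 IH; rewrite !ler_norml => /andP[a1 a2] /andP[b1 b2] /andP[f1 f2].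
  have k2 : (k + 1) * (k + 1 - 1) / 2 * W ^+ 2 * qq = k * (k - 1) / 2 * W ^+ 2 * qq + k * W ^+ 2 * qq by field.
  rewrite k2; have -> : D1 = D0 + (j1 - j0 - Q) by rewrite -Dz; ring.
  apply/andP; split; lra.
have := step N (leqnn N).
have zN : z N = h by rewrite /z divff ?gt_eqF// scale1r.
rewrite zN.
have -> : N%:R * (N%:R - 1) / 2 * W ^+ 2 * q = 2^-1 * q - 2^-1 * W * q by rewrite /W; field; rewrite gt_eqF.
have -> : N%:R * (1 + 4 * c) * W ^+ 2 * E ^+ 2 = (1 + 4 * c) * W * E ^+ 2 by rewrite /W; field; rewrite gt_eqF.
have qM : `|2^-1 * W * q| <= M * W * E ^+ 2.
  rewrite !normrM gtr0_norm ?invr_gt0// gtr0_norm// -mulrA [M * _]mulrC -mulrA mulrCA ler_wpM2l ?(ltW W0)//.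
  have h1 : `|q| <= M * E ^+ 2.
    by apply: le_trans (normr_dotv _ _) _; rewrite expr2 mulrA ler_wpM2r.
  have : 0 <= `|q| by []. lra.
have : C * W * E ^+ 2 <= e * E ^+ 2 by rewrite ler_wpM2r ?sqr_ge0.
rewrite /C /D; move: qM; rewrite !ler_norml => /andP[? ?] ? /andP[? ?].
by apply/andP; split; lra.
Qed.

(** Differentiability of the extensions says something about the gradient only at good points.
    Nonporosity supplies, for every small h, a good point within e |h| of x + h, where the
    extensions coincide with the true gradient; this is the input of [alexandrov_at]. *)
Lemma alexandrov : lnull [set x | ~ exists c p A, [/\ 0 < c, good j c p x & exp2 x p A]].
Proof.
have /choice[P PP] : forall cx : nat * 'rV[R]_n, exists p, goods cx.1.+1%:R cx.2 -> good j cx.1.+1%:R p cx.2.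
  by move=> [k x]; have [[p gp]|ng] := pselect (goods k.+1%:R x); [exists p|exists 0].
have kc (k : nat) : (0 : R) < k.+1%:R by [].
have /choice[F FP] : forall ki : nat * 'I_n, exists F : 'rV[R]_n -> R,
    (forall x, goods ki.1.+1%:R x -> F x = P (ki.1, x) 0 ki.2) /\
    (forall x y, `|F x - F y| <= 4 * ki.1.+1%:R * enorm (x - y)).
  move=> [k i]; apply: lipschitz_extension => [|x y gx gy]; first by rewrite mulr_ge0.
  apply: le_trans (good_lip (kc k) (PP (k, x) gx) (PP (k, y) gy)).
  by apply: le_trans (coord_enorm _ i); rewrite !mxE.
apply: (@lnullS _ _ _ (~` (\bigcup_k goods k.+1%:R) `|`
   \bigcup_k ((goods k.+1%:R `\` nonporous (goods k.+1%:R)) `|`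
   \bigcup_(i : 'I_n) [set x | ~ exists q, diff_at (F (k, i)) x q]))); last first.
  apply: lnullU; first exact: goods_ae.
  apply: lnull_bigcup => k; apply: lnullU.
    have [->|/set0P E0] := eqVneq (goods k.+1%:R) set0; last exact: nonporous_ae.
    by rewrite set0D; exact: outer_measure0.
  apply: lnull_bigcupT => i; apply: (rademacher (L := 4 * k.+1%:R)); first by rewrite mulr_ge0.
  exact: (FP (k, i)).2.
move=> x nx; apply: contrapT => /not_orP[/contrapT [k _ gk] nB]; apply: nx.
have gx := PP (k, x) gk.
have npx : nonporous (goods k.+1%:R) x.
  by apply: contrapT => np; apply: nB; exists k => //; left.
have /choice[Q QP] : forall i, exists q, diff_at (F (k, i)) x q.
  by move=> i; apply: contrapT => nq; apply: nB; exists k => //; right; exists i.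
pose A : 'M[R]_n := \matrix_(a, b) Q b 0 a.
exists k.+1%:R, (P (k, x)), A; split => //.
apply: (alexandrov_at (kc k) gx) => e e0.
have n0 : (0 : R) < n%:R * 2 + 1 by rewrite ltr_wpDl// mulr_ge0.
have [M M0 MA] := mulmx_enorm_le A.
pose e' := Num.min 1 (e / (n%:R * 2 + 1 + M)).
have nM : 0 < n%:R * 2 + 1 + M by rewrite ltr_wpDr.
have e'0 : 0 < e' by rewrite lt_min ltr01 divr_gt0.
have e'1 : e' <= 1 by rewrite ge_min lexx.
have e'e : (n%:R * 2 + 1 + M) * e' <= e by rewrite mulrC -ler_pdivlMr// ge_min lexx orbT.
have ne : 0 <= n%:R * 2 * e' by rewrite !mulr_ge0// ltW.
have Me : 0 <= M * e' by rewrite mulr_ge0// ltW.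
have e'le : e' <= e by move: e'e; rewrite !mulrDl mul1r; lra.
have [d d0 dP] := npx e' e'0.
have /fin_all_exists[D DP] : forall i : 'I_n, exists d : R, 0 < d /\ forall h, enorm h < d ->
    `|F (k, i) (x + h) - F (k, i) x - dotv (Q i) h| <= e' * enorm h.
  by move=> i; have [d' d'0 d'P] := QP i e' e'0; exists d'.
have [D0 D00 D0P] : exists2 D0 : R, 0 < D0 & forall i, D0 <= D i.
  exists (\big[Order.min/1]_i D i).
    by apply/bigmin_gtP; split => [|i _]; [exact: ltr01|case: (DP i)].
  by move=> i; apply: bigmin_le_cond.
exists (Num.min d (D0 / 2)) => [|h]; first by rewrite lt_min d0 divr_gt0.
rewrite lt_min ltr_pdivlMr// => /andP[hd hD].
have [y gy yh] := dP h hd.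
exists y, (P (k, y)); split => //; first exact: (PP (k, y) gy).
  by apply: le_trans yh _; rewrite ler_wpM2r.
set w := y - x; have wh : enorm (w - h) <= e' * enorm h.
  by rewrite /w enormB opprB addrA [h + x]addrC.
have w2 : enorm w <= 2 * enorm h.
  rewrite (_ : w = (w - h) + h); last by rewrite subrK.
  apply: le_trans (ler_enormD _ _) _; apply: le_trans (lerD wh (lexx _)) _.
  have : e' * enorm h <= 1 * enorm h by rewrite ler_wpM2r. lra.
have -> : P (k, y) - P (k, x) - h *m A = (P (k, y) - P (k, x) - w *m A) + (w - h) *m A.
  by rewrite [(w - h) *m A]mulmxBl addrA subrK.
apply: le_trans (ler_enormD _ _) _.
have h1 : enorm (P (k, y) - P (k, x) - w *m A) <= n%:R * (e' * enorm w).
  apply: le_trans (enorm_le_norm _) _; rewrite ler_wpM2l//.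
  rewrite [leLHS]/Num.norm/= mx_normrE; apply/bigmax_leP; split => /= [|[a i] _].
    by rewrite mulr_ge0// ltW.
  rewrite /= ord1; have := (DP i).2 w; rewrite {2 3}/w [x + _]addrC subrK.
  rewrite (FP (k, i)).1//= (FP (k, i)).1//= => /(_ ltac:(by apply: le_lt_trans w2 _; apply: lt_le_trans (D0P i); rewrite mulrC)).
  rewrite [(_ - w *m A) 0 i]mxE [(P _ - P _) 0 i]mxE [(- P _) 0 i]mxE [(- (w *m A)) 0 i]mxE.
  have -> // : (w *m A) 0 i = dotv (Q i) w.
  by rewrite [LHS]mxE dotvE; apply: eq_bigr => l _; rewrite [A l i]mxE mulrC.
have h2 := MA (w - h); have h3 : M * enorm (w - h) <= M * (e' * enorm h) by rewrite ler_wpM2l.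
have h4 : n%:R * (e' * enorm w) <= n%:R * (e' * (2 * enorm h)).
  by rewrite ler_wpM2l// ler_wpM2l// ltW.
have h5 : (n%:R * 2 + 1 + M) * e' * enorm h <= e * enorm h by rewrite ler_wpM2r.
have h6 : 0 <= e' * enorm h by rewrite mulr_ge0// ltW.
move: h1 h2 h3 h4 h5 h6; clear; lra.
Qed.

End alexandrov.

(** * The spectral theorem for real symmetric matrices *)

Section spectral.
Context {R : realType}.

(** A maximiser v of the quadratic form on the unit sphere is an eigenvector: moving it by t z with
    z = v A - l v would raise the Rayleigh quotient to first order unless z = 0. *)
Lemma sym_eigenvector m (A : 'M[R]_m.+1) : A^T = A ->
  exists v l, enorm v = 1 /\ v *m A = l *: v.
Proof.
move=> As; pose f (y : 'rV[R]_m.+1) := dotv (y *m A) y.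
have dA y z : dotv (y *m A) z = dotv y (z *m A).
  by rewrite /dotv trmx_mul As mulmxA.
have cf : continuous f.
  pose N (B : 'M[R]_m.+1) (y : 'rV[R]_m.+1) := enorm (y *m B - 0).
  have cN B : continuous (N B).
    have -> : N B = (fun z : 'rV[R]_m.+1 => enorm (z - 0)) \o (fun y : 'rV[R]_m.+1 => y *m B) by [].
    by move=> y; apply: continuous_comp; [exact: mulmx_continuous|exact: enormB_continuous].
  (* Polarisation reduces the continuity of the form to that of norms. *)
  move=> y; rewrite (_ : f = fun y => 4^-1 * (N (A + 1%:M) y * N (A + 1%:M) y - N (A - 1%:M) y * N (A - 1%:M) y)).
    pose FF := @nbhs_filter 'rV[R]_m.+1 y.
    apply: (@cvgM _ _ (nbhs y) FF); first exact: (@cvg_cst _ _ _ (nbhs y) FF).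
    by apply: (@cvgB _ _ _ (nbhs y) FF); apply: (@cvgM _ _ (nbhs y) FF); exact: cN.
  apply/funext => z; rewrite /N !subr0 -!expr2 !sqr_enorm mulmxDr mulmxBr mulmx1 /f.
  move: (z *m A) => w; rewrite !(dotvDl, dotvDr, dotvNl, dotvNr) [dotv z w]dotvC; lra.
pose S := [set y : 'rV[R]_m.+1 | enorm y = 1].
have cS : compact S.
  apply: (@compact_closed_enorm _ _ _ 1); last by move=> y ->.
  rewrite (_ : S = (fun y => enorm (y - 0)) @^-1` [set 1]); last first.
    by apply/seteqP; split => y; rewrite /S/= subr0.
  apply: closed_comp; last exact: closed_eq.
  by move=> y _; exact: enormB_continuous.
have S0 : S !=set0.
  exists (delta_mx 0 0); rewrite /S/= enormE dotvE (bigD1 0)//= big1 ?addr0 => [|i i0].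
    by rewrite !mxE mulr1 sqrtr1.
  by rewrite !mxE (negbTE i0) mul0r.
have [v vS vP] := EVT_max_rV S0 cS (continuous_subspaceT cf).
rewrite inE /S/= in vS; pose l := f v; exists v, l; split => //.
have fle y : f y <= l * dotv y y.
  have [->|y0] := eqVneq y 0; first by rewrite /f mul0mx !dot0v mulr0.
  have yy : 0 < enorm y by rewrite enorm_gt0.
  have := vP ((enorm y)^-1 *: y); rewrite inE /S/= enormZ gtr0_norm ?invr_gt0// mulVf ?gt_eqF// => /(_ erefl).
  rewrite {1}/f -scalemxAl dotvZl dotvZr -/(f y) -sqr_enorm mulrA -invfM -expr2 mulrC.
  by rewrite ler_pdivrMr// exprn_gt0.
apply/eqP; rewrite -subr_eq0 -dotvv_eq0; set z := _ - _.
have key t : 0 < t -> 2 * dotv z z <= t * (l * dotv z z - f z).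
  move=> t0; have := fle (v + t *: z).
  have -> : f (v + t *: z) = l + 2 * t * dotv (v *m A) z + t ^+ 2 * f z.
    move: (z) => w; rewrite /f mulmxDl -scalemxAl !dotvDl !dotvDr !dotvZl !dotvZr -/(f v) -/l -/(f w).
    by rewrite [dotv (w *m A) v]dA [dotv w (v *m A)]dotvC; ring.
  have -> : dotv (v + t *: z) (v + t *: z) = 1 + 2 * t * dotv v z + t ^+ 2 * dotv z z.
    move: (z) => w; rewrite !dotvDl !dotvDr !dotvZl !dotvZr -sqr_enorm vS [dotv w v]dotvC; ring.
  move=> h.
  have zz : dotv z z = dotv (v *m A) z - l * dotv v z by rewrite {1}/z dotvBl dotvZl.
  rewrite -(ler_pM2l t0); move: h; rewrite zz; lra.
rewrite eq_le dotvv_ge0 andbT; apply/ler_addgt0Pr => e e0; rewrite add0r.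
pose C := `|l * dotv z z - f z| + 1; have C0 : 0 < C by rewrite ltr_wpDl.
have := key (e / C) (divr_gt0 e0 C0).
have : e / C * (l * dotv z z - f z) <= e.
  rewrite mulrAC ler_pdivrMr// ler_wpM2l ?(ltW e0)//; apply: le_trans (ler_norm _) _.
  by rewrite /C lerDl.
by have := dotvv_ge0 z; lra.
Qed.

(** Deflation: a reflection moves an eigenvector to the first axis, symmetry then makes the matrix
    block diagonal, and the induction hypothesis treats the remaining block. *)
Lemma sym_spectral m (A : 'M[R]_m) : A^T = A ->
  exists (T : 'M[R]_m) (D : 'rV[R]_m), T *m T^T = 1%:M /\ A = T *m diag_mx D *m T^T.
Proof.
elim: m A => [|m IH] A As.
  by exists 1%:M, 0; split; apply/matrixP => -[].
have [v [l [v1 vl]]] := sym_eigenvector As.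
have [H HH vH] := orth_to_delta 0 v1.
have HH' : H^T *m H = 1%:M by apply: mulmx1C.
pose A1 : 'M[R]_(1 + m) := H^T *m A *m H.
have A1s : A1^T = A1 by rewrite /A1 !trmx_mul trmxK As mulmxA.
have r0 j : A1 0 j = l * (delta_mx 0 0 : 'rV[R]_m.+1) 0 j.
  have : delta_mx 0 0 *m A1 = l *: (delta_mx 0 0 : 'rV[R]_m.+1).
    by rewrite -vH /A1 -!mulmxA (mulmxA H H^T) HH mul1mx mulmxA vl scalemxAl.
  by move=> /rowP /(_ j); rewrite -rowE [RHS]mxE !mxE.
have r0' j : A1 j 0 = l * (delta_mx 0 0 : 'rV[R]_m.+1) 0 j by rewrite -r0 -{1}A1s mxE.
have A1E : A1 = block_mx (l%:M) 0 0 (drsubmx A1).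
  rewrite -{1}[A1]submxK; congr block_mx; apply/matrixP => i j; rewrite !mxE ?ord1.
  - by have := r0 0; rewrite !mxE/= mulr1 => h; rewrite (_ : lshift m 0 = 0) ?h//; apply: val_inj.
  - have := r0 (rshift 1 j); rewrite !mxE/= mulr0 => h.
    by rewrite (_ : lshift m 0 = 0) ?h//; apply: val_inj.
  - have := r0' (rshift 1 i); rewrite !mxE/= mulr0 => h.
    by rewrite (_ : lshift m 0 = 0) ?h//; apply: val_inj.
have [|T [D [TT AE]]] := IH (drsubmx A1); first by rewrite trmx_drsub A1s.
pose T1 : 'M[R]_(1 + m) := block_mx 1%:M 0 0 T.
have T1T : T1 *m T1^T = 1%:M.
  rewrite /T1 tr_block_mx mulmx_block !trmx0 trmx1 !mul0mx !mulmx0 mul1mx !addr0 add0r TT.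
  by rewrite -scalar_mx_block.
pose D1 : 'rV[R]_(1 + m) := row_mx (const_mx l) D.
have main : T1 *m diag_mx D1 *m T1^T = block_mx l%:M 0 0 (T *m diag_mx D *m T^T).
  rewrite /T1 /D1 tr_block_mx diag_mx_row !mulmx_block !trmx0 trmx1 !mul0mx !mulmx0 !mul1mx !mulmx1 !addr0 !add0r.
  by rewrite mul0mx diag_const_mx.
exists (H *m T1), D1; split.
  by rewrite trmx_mul -mulmxA (mulmxA T1) T1T mul1mx.
have -> : A = H *m A1 *m H^T by rewrite /A1 !mulmxA HH mul1mx -mulmxA HH mulmx1.
rewrite A1E AE -main trmx_mul !mulmxA.
by [].
Qed.

Lemma char_poly_spectral m (T : 'M[R]_m) (D : 'rV[R]_m) : T *m T^T = 1%:M ->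
  char_poly (T *m diag_mx D *m T^T) = \prod_i ('X - (D 0 i)%:P).
Proof.
move=> TT; have TT' : T^T *m T = 1%:M by apply: mulmx1C.
rewrite /char_poly /char_poly_mx.
have -> : 'X%:M - map_mx polyC (T *m diag_mx D *m T^T) =
  map_mx polyC T *m ('X%:M - map_mx polyC (diag_mx D)) *m map_mx polyC T^T.
  rewrite mulmxBr mulmxBl -!map_mxM/= -scalemx1 -scalemxAr mulmx1 -scalemxAl -map_mxM TT.
  by rewrite map_scalar_mx/= scalemx1.
rewrite !det_mulmx mulrAC -det_mulmx -map_mxM TT map_scalar_mx/= det1 mul1r.
have := @char_poly_trig _ _ (diag_mx D) (diag_mx_is_trig D).
rewrite /char_poly /char_poly_mx => ->; apply: eq_bigr => i _.
by rewrite mxE eqxx.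
Qed.

(** Both sides are the value of the characteristic polynomial at [c] up to the same sign, so the
    arbitrary order in which curvatures are listed is harmless. *)
Lemma prod_eigen m (k D : 'rV[R]_m) (c : R) :
  \prod_i ('X - (k 0 i)%:P) = \prod_i ('X - (D 0 i)%:P) :> {poly R} ->
  \prod_i (k 0 i - c) = \prod_i (D 0 i - c).
Proof.
move=> /(congr1 (fun p => p.[c])); rewrite !horner_prod.
have H (w : 'rV[R]_m) : \prod_i (w 0 i - c) = (-1) ^+ m * \prod_i ('X - (w 0 i)%:P).[c].
  have -> : (-1) ^+ m = \prod_(i < m) (-1 : R) by rewrite prodr_const card_ord.
  rewrite -big_split/=; apply: eq_bigr => i _.
  by rewrite !hornerE mulN1r opprB.
by rewrite !H => ->.
Qed.

Lemma eigen_mem m (k D : 'rV[R]_m) i :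
  \prod_i ('X - (k 0 i)%:P) = \prod_i ('X - (D 0 i)%:P) :> {poly R} ->
  exists l, k 0 i = D 0 l.
Proof.
move=> /(congr1 (fun p => p.[k 0 i])); rewrite !horner_prod (bigD1 i)//= !hornerE subrr mul0r.
move=> /esym/eqP; rewrite prodf_seq_eq0 => /hasP[l _]; rewrite !hornerE subr_eq0 => /eqP kl.
by exists l.
Qed.

End spectral.

Section paraboloid.
Context {R : realType}.

Lemma integral_sqrt (m : nat) :
  (\int[@lebesgue_measure R]_(t in `]0%R, 1%R]) ((Num.sqrt t) ^+ m)%:E)%E = (2 / m.+2%:R)%:E.
Proof.
have mE : m.+2%:R != 0 :> R by rewrite pnatr_eq0.
pose p : {poly R} := (2 / m.+2%:R) *: 'X^(m.+2).
pose F := horner p \o Num.sqrt.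
have cs : continuous (fun t : R => Num.sqrt t) by exact: sqrt_continuous.
have cX k : continuous (fun t : R => Num.sqrt t ^+ k).
  by move=> t; apply: (@continuous_comp _ _ _ Num.sqrt (fun s : R => s ^+ k)); [exact: cs|exact: exprn_continuous].
have cF : continuous F by move=> t; apply: continuous_comp; [exact: cs|exact: continuous_horner].
have p'E t : p^`().[t] = 2 * t ^+ m.+1.
  rewrite derivZ derivXn hornerZ hornerMn hornerXn -[t ^+ _ *+ _]mulr_natr /=.
  by move: (m.+2%:R : R) mE => N NE; field.
have dF (t : R) : 0 < t -> is_derive t 1 F (Num.sqrt t ^+ m).
  move=> t0; have st : 0 < Num.sqrt t by rewrite sqrtr_gt0.
  have := is_derive1_comp (is_derive_poly p (Num.sqrt t)) (is_derive1_sqrt t0).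
  by rewrite p'E exprS => H; apply: is_derive_eq H _; field; rewrite gt_eqF.
rewrite integral_itv_obnd_cbnd; last first.
  by apply/measurable_EFinP; apply: measurable_funTS; apply: continuous_measurable_fun; exact: cX.
rewrite (continuous_FTC2 (F := F)) //.
- by rewrite -EFinB /F /= sqrtr1 sqrtr0 /p !hornerZ !hornerXn expr1n expr0n/= mulr0 subr0 mulr1.
- by apply: continuous_subspaceT; exact: cX.
- split.
  + by move=> t; rewrite in_itv/= => /andP[t0 _]; have [] := dF t t0.
  + by apply: cvg_at_right_filter; exact: cF.
  + by apply: cvg_at_left_filter; exact: cF.
- by move=> t; rewrite in_itv/= => /andP[t0 _]; have H := dF t t0; rewrite derive1E derive_val.
Qed.

End paraboloid.

(** * Volumes of tilted caps of paraboloids *)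

Section paraboloid.
Context {R : realType} {m : nat}.
Implicit Types (x : 'rV[R]_m.+1) (B T : 'M[R]_m).

Definition parab B (H : R) : set 'rV[R]_m.+1 :=
  [set x : 'rV[R]_m.+1 | 0 <= x 0 ord0 /\ x 0 ord0 <= H - 2^-1 * dotv (del ord0 x *m B) (del ord0 x)].

Let pstd : set 'rV[R]_m.+1 := [set x | enorm (del ord0 x) ^+ 2 <= x 0 ord0 <= 1].

Lemma del_continuous : continuous (fun x : 'rV[R]_m.+1 => del ord0 x).
Proof.
rewrite (_ : (fun x => _) = (fun x : 'rV[R]_m.+1 => x *m \matrix_(i, j) (i == lift ord0 j)%:R)).
  exact: mulmx_continuous.
apply/funext => x; apply/rowP => j; rewrite !mxE (bigD1 (lift ord0 j))//= !mxE eqxx mulr1 big1 ?addr0// => i ij.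
by rewrite !mxE (negbTE ij) mulr0.
Qed.

Lemma quad_continuous (B : 'M[R]_m) : continuous (fun y : 'rV[R]_m => dotv (y *m B) y).
Proof.
pose N (B : 'M[R]_m) (y : 'rV[R]_m) := enorm (y *m B - 0).
have cN C : continuous (N C).
  have -> : N C = (fun z : 'rV[R]_m => enorm (z - 0)) \o (fun y : 'rV[R]_m => y *m C) by [].
  by move=> y; apply: continuous_comp; [exact: mulmx_continuous|exact: enormB_continuous].
move=> y; rewrite (_ : (fun y => _) = fun y => 4^-1 * (N (B + 1%:M) y * N (B + 1%:M) y - N (B - 1%:M) y * N (B - 1%:M) y)).
  pose FF := @nbhs_filter 'rV[R]_m y.
  apply: (@cvgM _ _ (nbhs y) FF); first exact: (@cvg_cst _ _ _ (nbhs y) FF).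
  by apply: (@cvgB _ _ _ (nbhs y) FF); apply: (@cvgM _ _ (nbhs y) FF); exact: cN.
apply/funext => z; rewrite /N !subr0 -!expr2 !sqr_enorm mulmxDr mulmxBr mulmx1.
move: (z *m B) => w; rewrite !(dotvDl, dotvDr, dotvNl, dotvNr) [dotv z w]dotvC; lra.
Qed.

Lemma measurable_parab B H : measurable (parab B H : set (@borelRV R m.+1)).
Proof.
apply: borel_closed.
have -> : parab B H = (fun x => x 0 ord0) @^-1` [set t | 0 <= t] `&`
   (fun x => x 0 ord0 - (H - 2^-1 * dotv (del ord0 x *m B) (del ord0 x))) @^-1` [set t | t <= 0].
  by apply/seteqP; split => x; rewrite /parab/= subr_le0.
apply: closedI; apply: closed_comp; try exact: closed_ge; try exact: closed_le.
  by move=> x _; exact: coord_continuous.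
move=> x _; pose FF := @nbhs_filter 'rV[R]_m.+1 x.
apply: (@cvgB _ _ _ (nbhs x) FF); first exact: coord_continuous.
apply: (@cvgB _ _ _ (nbhs x) FF); first exact: (@cvg_cst _ _ _ (nbhs x) FF).
apply: (@cvgM _ _ (nbhs x) FF); first exact: (@cvg_cst _ _ _ (nbhs x) FF).
by apply: (@continuous_comp _ _ _ (fun x => del ord0 x) (fun y => dotv (y *m B) y)); [exact: del_continuous|exact: quad_continuous].
Qed.

Let measurable_pstd : measurable (pstd : set (@borelRV R m.+1)).
Proof.
apply: borel_closed.
have -> : pstd = (fun x => enorm (del ord0 x - 0) * enorm (del ord0 x - 0) - x 0 ord0) @^-1` [set t | t <= 0] `&`
   (fun x => x 0 ord0) @^-1` [set t | t <= 1].
  apply/seteqP; split => x; rewrite /pstd/= subr0 -expr2 subr_le0; first by move=> /andP.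
  by move=> [-> ->].
apply: closedI; apply: closed_comp; try exact: closed_le; last first.
  by move=> x _; exact: coord_continuous.
move=> x _; pose FF := @nbhs_filter 'rV[R]_m.+1 x.
apply: (@cvgB _ _ _ (nbhs x) FF); last exact: coord_continuous.
have h : {for x, continuous (fun x => enorm (del ord0 x - 0))}.
  by apply: (@continuous_comp _ _ _ (fun x => del ord0 x) (fun y : 'rV[R]_m => enorm (y - 0))); [exact: del_continuous|exact: enormB_continuous].
exact: (@cvgM _ _ (nbhs x) FF).
Qed.

Let om := vol (@eball R m 0 1).

Let lebesgue_pstd : lam m.+1 pstd = (om * (2 / m.+2%:R))%:E.
Proof.
rewrite (lebesgue_fubini_ord ord0)//.
have omE (r : R) : 0 <= r -> lam m (@eball R m 0 r) = (r ^+ m * om)%:E.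
  by move=> r0; rewrite lebesgue_eball// EFinM; congr (_ * _)%E; rewrite vol_eballE.
have sliceE t : lam m [set y | pstd (ins ord0 y t)] =
    (if t \in `[0%R, 1%R] then (Num.sqrt t ^+ m)%:E * om%:E else 0)%E.
  rewrite in_itv/=; case: ifPn => [/andP[t0 t1]|tn].
    rewrite -EFinM -omE ?sqrtr_ge0//; congr (lam m _); apply/seteqP; split => y.
      rewrite /pstd/= ins_i insK t1 andbT /eball/= subr0 => h.
      apply: ler_of_sqr; first by rewrite sqrtr_ge0.
      by rewrite (sqr_sqrtr t0).
    rewrite /pstd/= ins_i insK t1 andbT /eball/= subr0 => h.
    by rewrite -(sqr_sqrtr t0) ler_pXn2r// nnegrE// sqrtr_ge0.
  rewrite (_ : [set _ | _] = set0) ?lebesgue_outer0//; apply/seteqP; split => // y.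
  rewrite /pstd/= ins_i => /andP[h1 h2]; move: tn; rewrite h2 andbT => /negP; apply.
  by apply: le_trans h1; rewrite exprn_ge0.
transitivity (\int[@lebesgue_measure R]_(t in `[0%R, 1%R]) ((Num.sqrt t ^+ m)%:E * om%:E))%E.
  rewrite [RHS]integral_mkcond; apply: eq_integral => t _.
  by rewrite sliceE patchE mem_setE; case: ifP.
have cX : continuous (fun t : R => Num.sqrt t ^+ m).
  by move=> t; apply: (@continuous_comp _ _ _ Num.sqrt (fun s : R => s ^+ m)); [exact: sqrt_continuous|exact: exprn_continuous].
have mX : measurable_fun setT (fun t : R => Num.sqrt t ^+ m) by exact: continuous_measurable_fun.
rewrite -integral_itv_obnd_cbnd; last first.
  by apply/measurable_EFinP; apply: measurable_funTS; exact: measurable_funM.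
rewrite ge0_integralZr//.
- by rewrite integral_sqrt -EFinM mulrC.
- by apply/measurable_EFinP; exact: measurable_funTS.
- by rewrite lee_fin fine_ge0// outer_measure_ge0.
Qed.

Let lft T : 'M[R]_m.+1 := \matrix_(i, j)
  match unlift ord0 i, unlift ord0 j with
  | Some a, Some b => T a b | None, None => 1 | _, _ => 0 end.

Let lftE T x : x *m lft T = ins ord0 (del ord0 x *m T) (x 0 ord0).
Proof.
apply/rowP => j; rewrite !mxE big_ord_recl !mxE unlift_none.
case: unliftP => [k ->|->]; last first.
  rewrite mulr1 big1 ?addr0// => i _; rewrite !mxE liftK; case: unliftP => // k.
  by rewrite mulr0.
by rewrite mulr0 add0r mxE; apply: eq_bigr => i _; rewrite !mxE !liftK.
Qed.

Let lft_orth T : T *m T^T = 1%:M -> lft T *m (lft T)^T = 1%:M.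
Proof.
move=> TT; have lT : (lft T)^T = lft T^T.
  apply/matrixP => i j; rewrite !mxE; case: unliftP => [a _|_]; case: unliftP => [b _|_] //.
  by rewrite mxE.
apply/row_matrixP => i; rewrite row_mul lT lftE row1 rowE lftE insK ins_i -mulmxA TT mulmx1.
by rewrite insE.
Qed.

(** In an eigenbasis the cap is the image of the standard paraboloid [pstd] under a diagonal affine
    map with factors sqrt (2 H / D i) across and - H along the axis; the sign turns it upside
    down. *)
Lemma lebesgue_parab T (D : 'rV[R]_m) (H : R) : T *m T^T = 1%:M -> 0 < H ->
  (forall i, 0 < D 0 i) ->
  lam m.+1 (parab (T *m diag_mx D *m T^T) H) =
  (H * (\prod_i Num.sqrt (2 * H / D 0 i)) * (om * (2 / m.+2%:R)))%:E.
Proof.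
move=> TT H0 D0; pose q i := Num.sqrt (2 * H / D 0 i).
have TT' : T^T *m T = 1%:M by apply: mulmx1C.
have qD i : 0 < 2 * H / D 0 i by rewrite divr_gt0// mulr_gt0.
have q0 i : 0 < q i by rewrite sqrtr_gt0.
pose d : 'rV[R]_m.+1 := ins ord0 (\row_i q i) (- H).
pose t : 'rV[R]_m.+1 := ins ord0 0 H.
have dn i : d 0 i != 0.
  rewrite mxE; case: unliftP => [k _|_]; first by rewrite mxE gt_eqF.
  by rewrite oppr_eq0 gt_eqF.
have PE : parab (T *m diag_mx D *m T^T) H = (fun x => x *m lft T^T) @` (daff d t @` pstd).
  have key x : parab (T *m diag_mx D *m T^T) H (daff d t x *m lft T^T) <-> pstd x.
    rewrite lftE /parab/= insK ins_i.
    have -> : daff d t x 0 ord0 = H - H * x 0 ord0 by rewrite mxE !ins_i; ring.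
    set y := del ord0 (daff d t x).
    have -> : dotv (y *m T^T *m (T *m diag_mx D *m T^T)) (y *m T^T) = 2 * H * enorm (del ord0 x) ^+ 2.
      rewrite -!mulmxA (mulmxA T^T T) TT' mul1mx mulmxA dotv_mulmx ?trmxK//.
      rewrite dotvE sqr_enorm dotvE mulr_sumr; apply: eq_bigr => i _.
      have yi : y 0 i = q i * x 0 (lift ord0 i) by rewrite mxE mxE /d /t !ins_lift !mxE addr0.
      rewrite mul_mx_diag [_ 0 i]mxE yi [del _ _ _ _]mxE.
      have -> : q i * x 0 (lift ord0 i) * D 0 i * (q i * x 0 (lift ord0 i)) =
        q i ^+ 2 * D 0 i * (x 0 (lift ord0 i) * x 0 (lift ord0 i)) by ring.
      by rewrite sqr_sqrtr ?(ltW (qD i))// mulfVK ?gt_eqF.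
    have -> : H - 2^-1 * (2 * H * enorm (del ord0 x) ^+ 2) = H - H * enorm (del ord0 x) ^+ 2 by field.
    rewrite /pstd/= lerD2l lerN2 ler_pM2l// subr_ge0 -{2}[H]mulr1 ler_pM2l//.
    by split => [[-> ->]|/andP[]].
  apply/seteqP; split => [x Px|_ [_ [x xs <-] <-]]; last by apply/key.
  pose x' := x *m lft T.
  have x'E : x' *m lft T^T = x.
    by rewrite /x' -mulmxA (_ : lft T *m lft T^T = 1%:M) ?mulmx1//; apply/row_matrixP => i;
       rewrite row_mul lftE row1 rowE lftE insK ins_i -mulmxA TT mulmx1 insE.
  pose z : 'rV[R]_m.+1 := \row_i ((x' 0 i - t 0 i) / d 0 i).
  have zx : daff d t z = x'.
    by apply/rowP => i; rewrite [LHS]mxE [z 0 i]mxE mulrC mulfVK// subrK.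
  exists x' => //; exists z => //.
  by apply/key; rewrite zx x'E.
rewrite PE lebesgue_orth; last by apply: lft_orth; rewrite trmxK.
rewrite lebesgue_daff// lebesgue_pstd -EFinM big_ord_recl /d ins_i normrN gtr0_norm//.
congr ((_ * _ * _)%:E); apply: eq_bigr => i _.
by rewrite ins_lift mxE gtr0_norm.
Qed.

End paraboloid.

Section ins_euclid.
Context {R : realType} {m : nat}.
Implicit Types y z : 'rV[R]_m.

Lemma dotv_ins y z (s t : R) :
  dotv (ins ord0 y s) (ins ord0 z t) = dotv y z + s * t.
Proof.
rewrite !dotvE big_ord_recl !ins_i addrC; congr (_ + _).
by apply: eq_bigr => i _; rewrite !ins_lift.
Qed.

Lemma insD y z (s t : R) :
  ins ord0 y s + ins ord0 z t = ins ord0 (y + z) (s + t).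
Proof. by apply/rowP => j; rewrite !mxE; case: unliftP => [k _|_]//; rewrite mxE. Qed.

End ins_euclid.

(** * The body near a boundary point with principal curvatures *)

Section normal_chart.
Context {R : realType} {m : nat}.
Variables (r : R) (K : set 'rV[R]_m.+1) (A : 'M[R]_m) (g : 'rV[R]_m -> R) (e : R).
Hypotheses (r0 : 0 < r) (cK : compact K)
  (bcK : forall w, ~ K w -> exists2 z, K `<=` eball z r & ~ eball z r w)
  (e0 : 0 < e)
  (chart : forall y t, enorm y < e -> `|t| < e -> K (ins ord0 y t) <-> g y <= t)
  (gA : forall c : R, 0 < c -> exists2 d : R, 0 < d & forall y, enorm y < d ->
     `|g y - 2^-1 * dotv (y *m A) y| <= c * enorm y ^+ 2).

Let g0 : g 0 = 0.
Proof.
have [d d0 dP] := gA ltr01; have := dP 0; rewrite enorm0 => /(_ d0).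
by rewrite mul0mx dot0v mulr0 subr0 expr0n/= mulr0 normr_le0 => /eqP.
Qed.

Let K0 : K 0.
Proof.
have -> : (0 : 'rV[R]_m.+1) = ins ord0 0 0 by apply/rowP => j; rewrite !mxE; case: unliftP => // k _; rewrite mxE.
by apply/chart; rewrite ?enorm0 ?normr0// g0.
Qed.

Let g_bound : exists M d : R, [/\ 0 <= M, 0 < d & forall y, enorm y < d -> `|g y| <= M * enorm y ^+ 2].
Proof.
have [M M0 MA] := mulmx_enorm_le A; have [d d0 dP] := gA ltr01.
exists (M + 1), d; split => [||y yd] //; first by rewrite addr_ge0.
have h1 := dP y yd; have h2 : `|dotv (y *m A) y| <= M * enorm y ^+ 2.
  by apply: le_trans (normr_dotv _ _) _; rewrite expr2 mulrA ler_wpM2r.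
have h3 : 0 <= enorm y ^+ 2 by rewrite sqr_ge0.
by move: h1 h2; rewrite !ler_norml => /andP[? ?] /andP[? ?]; apply/andP; split; lra.
Qed.

(** A ball containing [K] but missing a point (0, - t) just outside has a centre of norm at least r
    - t, so by compactness some ball of radius r containing [K] has 0 on its sphere. Its centre lies
    on the positive axis: a horizontal component [a] would leave points of the graph over - s a
    outside the ball, since the graph is flat to first order. *)
Lemma touching_ball : K `<=` eball (ins ord0 0 r) r.
Proof.
pose Z := [set z : 'rV[R]_m.+1 | K `<=` eball z r].
have ZZ z : Z z -> enorm z <= r.
  by move=> /(_ _ K0); rewrite /eball/= sub0r enormN.
have far t : 0 < t -> t < e -> exists2 z, Z z & r - t <= enorm z.
  move=> t0 te; have [z Zz nz] : exists2 z, Z z & ~ eball z r (ins ord0 0 (- t)).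
    apply: bcK => /chart; rewrite enorm0 normrN gtr0_norm// => /(_ e0 te).
    by rewrite g0 oppr_ge0 leNgt t0.
  exists z => //; move: nz; rewrite /eball/= => /negP; rewrite -ltNge => /ltW h.
  rewrite lerBlDr; apply: le_trans h _; apply: le_trans (ler_enormB _ _) _.
  rewrite addrC lerD2l enormE dotv_ins dot0v add0r -expr2 sqrtr_sqr normrN gtr0_norm//.
have cZ : compact Z.
  apply: (@compact_closed_enorm _ _ _ r) => //.
  have -> : Z = \bigcap_(k in K) (fun z => enorm (z - k)) @^-1` [set t | t <= r].
    apply/seteqP; split => [z Zz k Kk|z Zz k Kk]; first by rewrite /= enormB; exact: Zz.
    by have := Zz k Kk; rewrite /= enormB.
  apply: closed_bigI => k _; apply: closed_comp; last exact: closed_le.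
  by move=> z _; exact: enormB_continuous.
have e2 : 0 < e / 2 by rewrite divr_gt0.
have Z0 : Z !=set0 by have [z Zz _] := far (e / 2) e2 ltac:(by rewrite ltr_pdivrMr// ltr_pMr ?ltr1n); exists z.
have ce : continuous (fun z : 'rV[R]_m.+1 => enorm (z - 0)) by exact: enormB_continuous.
have [z zZ zP] := EVT_max_rV Z0 cZ (continuous_subspaceT ce).
rewrite inE in zZ.
have zr : enorm z = r.
  apply/eqP; rewrite eq_le ZZ//=; apply/ler_addgt0Pr => c c0.
  have t0 : 0 < Num.min c (e / 2) by rewrite lt_min c0.
  have te : Num.min c (e / 2) < e.
    by rewrite gt_min; apply/orP; right; rewrite ltr_pdivrMr// ltr_pMr ?ltr1n.
  have [w Zw wr] := far _ t0 te; have := zP w; rewrite inE !subr0 => /(_ Zw).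
  by rewrite -lerBlDr; apply: le_trans; apply: le_trans wr; rewrite lerB// ge_min lexx.
have zE := esym (insE ord0 z); set a := del ord0 z in zE; set b := z 0 ord0 in zE.
have key y t : enorm y < e -> `|t| < e -> g y <= t -> dotv y y + t ^+ 2 <= 2 * (dotv a y + b * t).
  move=> ye te gt; have /zZ : K (ins ord0 y t) by apply/chart.
  rewrite /eball/= => h; have : enorm (ins ord0 y t - z) ^+ 2 <= r ^+ 2.
    by rewrite ler_pXn2r ?nnegrE// ltW.
  have zz : dotv z z = r ^+ 2 by rewrite -sqr_enorm zr.
  rewrite sqr_enorm; move: zz; rewrite [in X in _ -> X]zE [in X in X -> _]zE.
  by rewrite !(dotvBl, dotvBr) !dotv_ins [dotv y a]dotvC; nra.
have a0 : a = 0.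
  apply: contrapT => /eqP na; have an : 0 < enorm a by rewrite enorm_gt0.
  have [M [d [M0 d0 gM]]] := g_bound.
  pose C := M * enorm a ^+ 2 + 1; have C0 : 0 < C by rewrite ltr_wpDl// mulr_ge0// sqr_ge0.
  (* Small enough for the chart to apply at height C s^2 and for the term of order s^2 to be beaten
     by s |a|^2. *)
  pose s := Num.min (Num.min ((e / 2) / enorm a) (d / 2 / enorm a)) (Num.min (Num.min 1 (e / 2 / C)) (enorm a ^+ 2 / (2 * ((`|b| + 1) * C)))).
  have bC : 0 < (`|b| + 1) * C by rewrite mulr_gt0// ltr_wpDl.
  have s0 : 0 < s.
    by rewrite !lt_min ltr01 /= !(divr_gt0, mulr_gt0, exprn_gt0).
  have [s1 s2 s3 s4 s5] : [/\ s <= e / 2 / enorm a, s <= d / 2 / enorm a, s <= 1, s <= e / 2 / C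
      & s <= enorm a ^+ 2 / (2 * ((`|b| + 1) * C))].
    by split; rewrite !ge_min lexx ?orbT.
  have sa : enorm (- (s *: a)) = s * enorm a by rewrite enormN enormZ gtr0_norm.
  have h1 : enorm (- (s *: a)) < e by rewrite sa; move: s1; rewrite ler_pdivlMr//; lra.
  have h2 : enorm (- (s *: a)) < d by rewrite sa; move: s2; rewrite ler_pdivlMr//; lra.
  have sC : 0 <= C * s ^+ 2 by rewrite mulr_ge0 ?sqr_ge0// ltW.
  have s22 : s ^+ 2 <= s by rewrite expr2 ler_piMl// ltW.
  have h3 : `|C * s ^+ 2| < e.
    rewrite ger0_norm//; move: s4; rewrite ler_pdivlMr// mulrC => h.
    have : C * s ^+ 2 <= C * s by rewrite ler_wpM2l// ltW.
    by lra.
  have h4 : g (- (s *: a)) <= C * s ^+ 2.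
    apply: le_trans (ler_norm _) _; apply: le_trans (gM _ h2) _.
    by rewrite sa /C exprMn; have := sqr_ge0 s; lra.
  have := key _ _ h1 h3 h4; rewrite -[dotv (- _) (- _)]sqr_enorm [dotv a (- _)]dotvNr dotvZr -[dotv a a]sqr_enorm.
  have h5 : 0 <= enorm (- (s *: a)) ^+ 2 + (C * s ^+ 2) ^+ 2 by rewrite addr_ge0 ?sqr_ge0.
  have h6 : b * (C * s ^+ 2) <= (`|b| + 1) * C * s ^+ 2.
    rewrite -mulrA ler_wpM2r//; apply: le_trans (ler_norm _) _; by rewrite lerDl.
  have h7 : (`|b| + 1) * C * s ^+ 2 <= 2^-1 * (s * enorm a ^+ 2).
    have -> : (`|b| + 1) * C * s ^+ 2 = s * (s * ((`|b| + 1) * C)) by ring.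
    have -> : 2^-1 * (s * enorm a ^+ 2) = s * (2^-1 * enorm a ^+ 2) by ring.
    rewrite ler_wpM2l ?(ltW s0)//.
    by move: s5; rewrite ler_pdivlMr ?mulr_gt0//; lra.
  have h8 : 0 < s * enorm a ^+ 2 by rewrite mulr_gt0// exprn_gt0.
  by move=> h9; lra.
have bb : b ^+ 2 = r ^+ 2.
  by rewrite -zr sqr_enorm zE dotv_ins a0 dot0v add0r -expr2.
(* The point (0, e / 2) belongs to [K], which fixes the sign of b. *)
have b0 : 0 <= b.
  have := key 0 (e / 2); rewrite enorm0 gtr0_norm// g0 => /(_ e0).
  move=> /(_ ltac:(by rewrite ltr_pdivrMr// ltr_pMr ?ltr1n) (ltW e2)).
  rewrite dot0v dotv0 !add0r => h; have := sqr_ge0 (e / 2) => h'.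
  have : 0 <= 2 * (b * (e / 2)) by apply: le_trans h.
  by rewrite pmulr_rge0// pmulr_lge0.
have br : b = r by apply/eqP; rewrite -(@eqrXn2 _ 2)// ?bb// ltW.
by move: zZ; rewrite /Z/= zE a0 br.
Qed.

(** [K] lies in the touching ball of radius r, so its boundary curves at least as much: |s y|^2 <= 2
    r g(s y), compared with the expansion of g for small s. *)
Lemma form_ge y : r^-1 * dotv y y <= dotv (y *m A) y.
Proof.
have [->|y0] := eqVneq y 0; first by rewrite mul0mx !dot0v mulr0.
have yn : 0 < enorm y by rewrite enorm_gt0.
apply/ler_addgt0Pr => c c0.
have [M [d [M0 d0 gM]]] := g_bound.
have cy : 0 < c / (2 * enorm y ^+ 2) by rewrite divr_gt0// mulr_gt0// exprn_gt0.
have [d' d'0 dP] := gA cy.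
have M1 : 0 < M + 1 by rewrite ltr_wpDl.
pose s := Num.min 1 (Num.min (Num.min (d / 2) (d' / 2)) (Num.min (e / 2) (e / 2 / (M + 1)))) / (enorm y + 1).
have y1 : 0 < enorm y + 1 by rewrite ltr_wpDl.
have s0 : 0 < s by rewrite divr_gt0// !lt_min !divr_gt0// ltr01.
have sy : enorm (s *: y) <= Num.min 1 (Num.min (Num.min (d / 2) (d' / 2)) (Num.min (e / 2) (e / 2 / (M + 1)))).
  rewrite enormZ gtr0_norm// /s mulrAC ler_pdivrMr// ler_wpM2l ?lerDl//.
  by rewrite !le_min !divr_ge0 ?ler01// ltW.
move: sy; rewrite !le_min => /and3P[sy1 /andP[sd sd'] /andP[se seM]].
have h1 : enorm (s *: y) < d by lra.
have h2 : enorm (s *: y) < d' by lra.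
have h3 : enorm (s *: y) < e.
  by apply: le_lt_trans se _; rewrite ltr_pdivrMr// ltr_pMr ?ltr1n.
have h4 := gM _ h1; have h5 := dP _ h2.
have ge : `|g (s *: y)| < e.
  have e2 : 0 < e / 2 by rewrite divr_gt0.
  apply: le_lt_trans h4 _; move: seM; rewrite ler_pdivlMr// => h.
  have : M * enorm (s *: y) ^+ 2 <= (M + 1) * enorm (s *: y).
    by rewrite ler_pM ?sqr_ge0// ?lerDl// expr2 ler_piMl.
  by lra.
have /touching_ball : K (ins ord0 (s *: y) (g (s *: y))) by apply/chart.
rewrite /eball/= => h; have : enorm (ins ord0 (s *: y) (g (s *: y)) - ins ord0 0 r) ^+ 2 <= r ^+ 2.
  by rewrite ler_pXn2r ?nnegrE// ltW.
rewrite insB subr0 sqr_enorm_ins => h6.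
have h7 : enorm (s *: y) ^+ 2 <= 2 * r * g (s *: y).
  by have := sqr_ge0 (g (s *: y)); move: h6; nra.
move: h5; rewrite ler_norml => /andP[_].
rewrite -scalemxAl dotvZl dotvZr => h8.
have yy : enorm (s *: y) ^+ 2 = s ^+ 2 * dotv y y by rewrite sqr_enorm dotvZl dotvZr expr2 mulrA.
have yp : 0 < dotv y y by rewrite -sqr_enorm exprn_gt0.
have h9 : c / (2 * enorm y ^+ 2) * enorm (s *: y) ^+ 2 = s ^+ 2 * (c / 2).
  by rewrite yy sqr_enorm; field; rewrite gt_eqF.
rewrite h9 in h8.
have h10 : r^-1 * enorm (s *: y) ^+ 2 <= 2 * g (s *: y).
  by rewrite mulrC ler_pdivrMr// mulrAC.
have s2 : 0 < s ^+ 2 by rewrite exprn_gt0.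
rewrite -(ler_pM2l s2); move: h10 h8; rewrite yy expr2; lra.
Qed.

(** If a second point of [K] lay on the touching sphere, ball convexity would put the short arc
    joining it to 0 into [K]; near 0 this arc has curvature exactly 1 / r, against the strict excess
    [b]. The bound on the height keeps w away from the antipode of 0. *)
Let arc_strict w : (forall y, y != 0 -> r^-1 * dotv y y < dotv (y *m A) y) ->
  (exists2 b : R, 0 < b & forall y, (r^-1 + b) * dotv y y <= dotv (y *m A) y) ->
  K w -> w != 0 -> w 0 ord0 <= 3 / 2 * r -> enorm (w - ins ord0 0 r) < r.
Proof.
move=> _ [b b0 Ab] Kw w0 wt; rewrite lt_neqAle touching_ball// andbT; apply/negP => /eqP wr.
pose X : 'rV[R]_m.+1 := ins ord0 0 (- r); have [W WE] : exists W, W = w - ins ord0 0 r by eexists.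
have XX : dotv X X = r ^+ 2 by rewrite dotv_ins dot0v add0r mulrNN.
have WW : dotv W W = r ^+ 2 by rewrite -sqr_enorm WE wr.
have WXl : dotv W X >= - (r ^+ 2) / 2.
  rewrite WE -[w](insE ord0) insB dotv_ins dotv0 add0r; have := ltW r0; move: wt.
  by set t := w 0 ord0 => t1 t2; nra.
have WX : dotv W X < r ^+ 2.
  have : 0 < dotv (W - X) (W - X).
    rewrite lt_neqAle dotvv_ge0 andbT eq_sym dotvv_eq0 subr_eq0; apply: contra_neq w0 => WX.
    by apply/eqP; rewrite -(subrK (ins ord0 0 r) w) -WE WX insD addNr; apply/eqP/rowP => j; rewrite !mxE; case: unliftP => // k _; rewrite addr0 mxE.
  by rewrite !(dotvBl, dotvBr) XX WW [dotv X W]dotvC; lra.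
(* K contains the short arc from 0 to w of the sphere of radius r touching it *)
have arc a c : 0 <= a -> 0 <= c -> dotv (a *: X + c *: W) (a *: X + c *: W) = r ^+ 2 ->
    K (ins ord0 0 r + (a *: X + c *: W)).
  move=> a0 c0 P2; apply: contrapT => nK; have [z Kz nz] := bcK nK.
  have [d dd'] : exists d, d = z - ins ord0 0 r by eexists.
  have dE v : dotv v v = r ^+ 2 -> enorm (ins ord0 0 r + v - z) <= r <-> dotv d d <= 2 * dotv v d.
    move=> vr; have -> : ins ord0 0 r + v - z = v - d by rewrite dd' opprB addrCA addrA.
    rewrite enorm_le ?(ltW r0)// !(dotvBl, dotvBr) vr [dotv d v]dotvC; split => h; lra.
  have hX : dotv d d <= 2 * dotv X d.
    apply/(dE _ XX); rewrite insD subrr addr0; have := Kz _ K0; rewrite /eball/= => h.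
    by rewrite (_ : ins ord0 0 0 = 0)//; apply/rowP => j; rewrite !mxE; case: unliftP => // k _; rewrite mxE.
  have hW : dotv d d <= 2 * dotv W d by apply/(dE _ WW); rewrite WE [_ + (w - _)]addrC subrK; exact: Kz.
  apply: nz; apply/(dE _ P2); rewrite dotvDl !dotvZl.
  have ac1 : 1 <= a + c.
    have : r ^+ 2 <= (a + c) ^+ 2 * r ^+ 2.
      rewrite -{1}P2 dotvDl !dotvDr !dotvZl !dotvZr XX WW [dotv X W]dotvC.
      have : a * c * dotv W X <= a * c * r ^+ 2 by rewrite ler_wpM2l ?mulr_ge0// ltW.
      lra.
    rewrite -{1}[r ^+ 2]mul1r ler_pM2r ?exprn_gt0// => h.
    by apply: ler_of_sqr; [rewrite addr_ge0|rewrite expr1n].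
  have dd := dotvv_ge0 d; have h1 := ler_wpM2l a0 hX; have h2 := ler_wpM2l c0 hW.
  have h3 : dotv d d <= (a + c) * dotv d d by rewrite ler_peMl.
  lra.
(* [q / r ^+ 2] is the cosine of the angle between the radii X and W, and Y is the part of W
   orthogonal to X, hence horizontal. *)
pose q := dotv W X; pose Y := W - (q / r ^+ 2) *: X.
have r2 : 0 < r ^+ 2 by rewrite exprn_gt0.
have q1 : - (1 / 2) <= q / r ^+ 2 by rewrite ler_pdivlMr// /q; move: WXl; lra.
have q2 : q / r ^+ 2 < 1 by rewrite ltr_pdivrMr// mul1r.
set p := q / r ^+ 2 in Y q1 q2.
have qE : q = p * r ^+ 2 by rewrite /p mulfVK// gt_eqF.
have [M [d [M0 d0 gM]]] := g_bound.
have [d' d'0 gd'] := gA (divr_gt0 b0 (@ltr0n R 4)).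
have YX : dotv Y X = 0 by rewrite /Y dotvBl dotvZl XX -/q qE; lra.
have YY : dotv Y Y = (1 - p ^+ 2) * r ^+ 2.
  by rewrite /Y !(dotvBl, dotvBr) !(dotvZl, dotvZr) WW XX [dotv X W]dotvC -/q qE; ring.
have Y0 : Y 0 ord0 = 0.
  move: YX; rewrite -[Y](insE ord0) dotv_ins dotv0 add0r => /eqP; rewrite mulf_eq0 oppr_eq0 (gt_eqF r0) orbF => /eqP.
  by rewrite ins_i.
set y := del ord0 Y; have yE : Y = ins ord0 y 0 by rewrite -Y0 insE.
have yy : enorm y ^+ 2 = (1 - p ^+ 2) * r ^+ 2 by rewrite -YY yE dotv_ins mul0r addr0 sqr_enorm.
have p1 : 0 < 1 - p ^+ 2 by nra.
have yn : 0 < enorm y by rewrite enorm_gt0 -dotvv_eq0 -sqr_enorm yy gt_eqF// mulr_gt0.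
(* points of the arc close to 0: v = (s y, r - sqrt (r^2 - s^2 |y|^2)) *)
pose t s := r - Num.sqrt (r ^+ 2 - s ^+ 2 * enorm y ^+ 2).
have Kst s : 0 < s -> s <= 1 / 2 -> K (ins ord0 (s *: y) (t s)).
  move=> s0 s1.
  have u0 : 0 <= 1 - s ^+ 2 * (1 - p ^+ 2) by have := sqr_ge0 p; nra.
  have ru : Num.sqrt (r ^+ 2 - s ^+ 2 * enorm y ^+ 2) = r * Num.sqrt (1 - s ^+ 2 * (1 - p ^+ 2)).
    rewrite yy (_ : r ^+ 2 - _ = r ^+ 2 * (1 - s ^+ 2 * (1 - p ^+ 2))); last by ring.
    by rewrite sqrtrM ?sqr_ge0// sqrtr_sqr gtr0_norm.
  have U2 : 1 / 2 <= Num.sqrt (1 - s ^+ 2 * (1 - p ^+ 2)).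
    rewrite -[leLHS](gtr0_norm (_ : 0 < 1 / 2)) ?divr_gt0// -sqrtr_sqr ler_sqrt//.
    by have := sqr_ge0 p; nra.
  set U := Num.sqrt (1 - s ^+ 2 * (1 - p ^+ 2)) in ru U2.
  have UU : U ^+ 2 = 1 - s ^+ 2 * (1 - p ^+ 2) by rewrite sqr_sqrtr.
  have -> : ins ord0 (s *: y) (t s) = ins ord0 0 r + ((U - s * p) *: X + s *: W).
    have -> : W = Y + p *: X by rewrite /Y subrK.
    rewrite scalerBl scalerDr scalerA addrACA addNr addr0 yE /X !insZ !insD scaler0 !add0r mulr0 addr0.
    by congr ins; rewrite /t ru; ring.
  apply: arc => //; first by nra.
  - exact: ltW.
  - by rewrite !(dotvDl, dotvDr) !(dotvZl, dotvZr) XX WW [dotv X W]dotvC -/q qE; rewrite (_ : _ + _ + _ = (U ^+ 2 + s ^+ 2 * (1 - p ^+ 2)) * r ^+ 2); [rewrite UU; ring|ring].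
pose C := enorm y / r.
have C0 : 0 < C by rewrite divr_gt0.
have tb s : 0 < s -> s <= 1 / 2 -> 0 <= t s /\ t s <= s ^+ 2 * enorm y ^+ 2 / r /\ 2 * r * t s = s ^+ 2 * enorm y ^+ 2 + t s ^+ 2.
  move=> s0 s1; have Q0 : 0 <= r ^+ 2 - s ^+ 2 * enorm y ^+ 2.
    rewrite yy (_ : _ - _ = r ^+ 2 * (1 - s ^+ 2 * (1 - p ^+ 2))); last by ring.
    by rewrite mulr_ge0 ?(ltW r2)//; have := sqr_ge0 p; nra.
  have Q1 : r ^+ 2 - s ^+ 2 * enorm y ^+ 2 <= r ^+ 2.
    by rewrite gerBl mulr_ge0 ?sqr_ge0.
  rewrite /t; set S := Num.sqrt _; have SS : S ^+ 2 = r ^+ 2 - s ^+ 2 * enorm y ^+ 2 by rewrite sqr_sqrtr.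
  have S0 : 0 <= S by rewrite sqrtr_ge0.
  have Sr : S <= r by apply: ler_of_sqr; [exact: ltW|rewrite SS].
  split; first by rewrite subr_ge0.
  have -> : s ^+ 2 * enorm y ^+ 2 = r ^+ 2 - S ^+ 2 by rewrite SS; ring.
  split; last by ring.
  by rewrite ler_pdivlMr//; nra.
(* Since [t s] is of order s^2, its square is negligible against s^2 |y|^2, and the arc point
   violates the curvature bound. *)
suff [s [s0 s1 hs]] : exists s, [/\ 0 < s, s <= 1 / 2 & b / 8 * r * (s ^+ 2 * enorm y ^+ 2) > t s ^+ 2 /\ [/\ s * enorm y < e, `|t s| < e & s * enorm y < d']].
  have [t0 [t1 t2]] := tb s s0 s1; have [h1 [h2 h3 h4]] := hs.
  have sy : enorm (s *: y) = s * enorm y by rewrite enormZ gtr0_norm.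
  have /chart : K (ins ord0 (s *: y) (t s)) by exact: Kst.
  rewrite sy => /(_ h2 h3) gt.
  have := gd' (s *: y); rewrite sy => /(_ h4); rewrite ler_norml => /andP[h5 _].
  have := Ab (s *: y); rewrite -sqr_enorm sy exprMn; set Z := s ^+ 2 * _ in h1 t2 h5 *.
  have Z0 : 0 < Z by rewrite mulr_gt0// exprn_gt0.
  move=> h6; have h7 : b / 4 * Z <= t s - r^-1 * Z / 2 by move: h5; rewrite exprMn -/Z; lra.
  have : r * (b / 4 * Z) <= t s ^+ 2 / 2.
    have -> : t s ^+ 2 / 2 = r * (t s - r^-1 * Z / 2).
      have -> : r * (t s - r^-1 * Z / 2) = (2 * r * t s - Z) / 2 by field; rewrite gt_eqF.
      by rewrite t2; ring.
    by rewrite ler_pM2l.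
  have : 0 < r * (b / 4 * Z) by rewrite !mulr_gt0// divr_gt0.
  lra.
pose s := Num.min (1 / 2) (Num.min (e / 2 / enorm y) (Num.min (d' / 2 / enorm y) (Num.min (e * r / 2 / enorm y ^+ 2) (Num.min 1 (b * r ^+ 3 / 16 / enorm y ^+ 2))))).
have s0 : 0 < s by rewrite !lt_min ltr01 /= !(divr_gt0, mulr_gt0, exprn_gt0).
have [s1 s2 s3] : [/\ s <= 1 / 2, s <= e / 2 / enorm y & s <= d' / 2 / enorm y].
  by split; rewrite !ge_min lexx ?orbT.
have [s4 s5 s6] : [/\ s <= e * r / 2 / enorm y ^+ 2, s <= 1 & s <= b * r ^+ 3 / 16 / enorm y ^+ 2].
  by split; rewrite !ge_min lexx ?orbT.
have y2 : 0 < enorm y ^+ 2 by rewrite exprn_gt0.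
have e2 : 0 < e / 2 by rewrite divr_gt0.
have d2 : 0 < d' / 2 by rewrite divr_gt0.
move: s2 s3 s4 s6; rewrite !ler_pdivlMr//.
have sy0 : 0 < s * enorm y by rewrite mulr_gt0.
have sy20 : 0 < s * enorm y ^+ 2 by rewrite mulr_gt0.
move=> s2 s3 s4 s6.
have [t0 [t1 t2]] := tb s s0 s1.
have ss : s ^+ 2 <= s by rewrite expr2 ler_piMl// ltW.
have sy2 : s ^+ 2 * enorm y ^+ 2 <= s * enorm y ^+ 2 by rewrite ler_wpM2r// ltW.
exists s; split => //; split; last first.
  have sy1 : s * enorm y < s * enorm y * 2 by rewrite ltr_pMr ?ltr1n.
  split; [exact: lt_le_trans s2| |exact: lt_le_trans s3]; rewrite ger0_norm//; apply: le_lt_trans t1 _.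
  by rewrite ltr_pdivrMr//; apply: le_lt_trans sy2 _; apply: lt_le_trans s4; lra.
have t3 : t s * r <= s ^+ 2 * enorm y ^+ 2 by rewrite -ler_pdivlMr.
have tr0 : 0 <= t s * r by rewrite mulr_ge0// ltW.
rewrite -(ltr_pM2r r2) -exprMn.
have h1 : (t s * r) ^+ 2 <= (s ^+ 2 * enorm y ^+ 2) ^+ 2 by rewrite ler_pXn2r// nnegrE// mulr_ge0// sqr_ge0.
apply: le_lt_trans h1 _.
rewrite [ltRHS]mulrAC [ltLHS]expr2 ltr_pM2r ?mulr_gt0 ?exprn_gt0//.
apply: le_lt_trans sy2 _; rewrite (_ : b / 8 * r * r ^+ 2 = b * r ^+ 3 / 8); last by ring.
by rewrite ltr_pdivlMr//; apply: lt_le_trans s6; lra.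
Qed.

(** Away from 0 and up to height 3 r / 2, [K] is compact and strictly inside the touching sphere, so
    a small shift of the ball still covers it; points above that height only come closer to the
    centre. *)
Lemma far_excluded (rho : R) : 0 < rho ->
  (exists2 b : R, 0 < b & forall y, (r^-1 + b) * dotv y y <= dotv (y *m A) y) ->
  exists2 D0 : R, 0 < D0 & forall D, 0 < D -> D < D0 -> forall w, K w ->
    ~ eball (ins ord0 0 (r + D)) r w -> enorm w < rho.
Proof.
move=> rho0 Ab.
have st w : K w -> w != 0 -> w 0 ord0 <= 3 / 2 * r -> enorm (w - ins ord0 0 r) < r.
  apply: arc_strict => // y y0; have [b b0 /(_ y)] := Ab; apply: lt_le_trans.
  by rewrite mulrDl ltrDl mulr_gt0// -sqr_enorm exprn_gt0// enorm_gt0.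
pose S := K `&` ((fun w => enorm (w - 0)) @^-1` [set t | rho <= t] `&` (fun w : 'rV[R]_m.+1 => w 0 ord0) @^-1` [set t | t <= 3 / 2 * r]).
have cS : compact S.
  apply: compact_closedI => //; apply: closedI; apply: closed_comp; try exact: closed_ge; try exact: closed_le.
    by move=> w _; exact: enormB_continuous.
  by move=> w _; exact: coord_continuous.
have [S0|/set0P S0] := eqVneq S set0.
  exists r => // D D0 Dr w Kw nw; rewrite ltNge; apply/negP => wr.
  have : S w; last by rewrite S0.
  split => //; split; rewrite /= ?subr0//.
  move: nw (touching_ball Kw); rewrite /eball/= => /negP; rewrite -ltNge => h1 h2.
  have a1 : r ^+ 2 < enorm (w - ins ord0 0 (r + D)) ^+ 2 by rewrite ltr_pXn2r ?nnegrE// ltW.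
  have a2 : enorm (w - ins ord0 0 r) ^+ 2 <= r ^+ 2 by rewrite ler_pXn2r ?nnegrE// ltW.
  move: a1 a2; rewrite -[w](insE ord0) !insB !sqr_enorm_ins ins_i; set t := w 0 ord0; nra.
have ce : continuous (fun w : 'rV[R]_m.+1 => enorm (w - ins ord0 0 r)) by exact: enormB_continuous.
have [v vS vP] := EVT_max_rV S0 cS (continuous_subspaceT ce).
rewrite inE in vS; have [Kv [v1 v2]] := vS.
have vr : enorm (v - ins ord0 0 r) < r.
  by apply: st => //; rewrite -enorm_gt0; apply: lt_le_trans rho0 _; rewrite /= subr0 in v1.
exists (Num.min r (r - enorm (v - ins ord0 0 r))) => [|D D0]; first by rewrite lt_min r0 subr_gt0.
rewrite lt_min => /andP[Dr Dv] w Kw nw; rewrite ltNge; apply/negP => wr.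
have Sw : S w.
  split => //; split; rewrite /= ?subr0//.
  move: nw (touching_ball Kw); rewrite /eball/= => /negP; rewrite -ltNge => h1 h2.
  have a1 : r ^+ 2 < enorm (w - ins ord0 0 (r + D)) ^+ 2 by rewrite ltr_pXn2r ?nnegrE// ltW.
  have a2 : enorm (w - ins ord0 0 r) ^+ 2 <= r ^+ 2 by rewrite ler_pXn2r ?nnegrE// ltW.
  move: a1 a2; rewrite -[w](insE ord0) !insB !sqr_enorm_ins ins_i; set t := w 0 ord0; nra.
apply: nw; rewrite /eball/=; apply: le_trans (ler_enorm_distD (ins ord0 0 r) _ _) _.
rewrite [X in _ + enorm X]insB subrr; have := vP w; rewrite inE => /(_ Sw).
have -> : enorm (ins ord0 (0 : 'rV[R]_m) (r - (r + D))) = D.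
  by rewrite enormE dotv_ins dot0v add0r -expr2 sqrtr_sqr opprD addrA subrr add0r normrN gtr0_norm.
lra.
Qed.

End normal_chart.

Section slices.
Context {R : realType} {m : nat}.

Lemma measurable_slice_measure (G : set 'rV[R]_m.+1) : measurable (G : set (@borelRV R m.+1)) ->
  measurable_fun setT (fun y : @borelRV R m => @lebesgue_measure R [set t | G (ins ord0 y t)]).
Proof.
move=> mG; have mB := measurable_ins (R := R) (ord0 : 'I_m.+1) measurableT mG; rewrite setTI in mB.
rewrite (_ : (fun y => _) = (fun y => @lebesgue_measure R (xsection ((fun yt : @borelRV R m * R =>
  ins ord0 yt.1 yt.2 : @borelRV R m.+1) @^-1` G) y))); first exact: measurable_fun_xsection.
by apply/funext => y; congr lebesgue_measure; apply/seteqP; split => t; rewrite /xsection/= inE.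
Qed.

Lemma lebesgue_slice_le (G H : set 'rV[R]_m.+1) : measurable (G : set (@borelRV R m.+1)) ->
  measurable (H : set (@borelRV R m.+1)) ->
  (forall y, (@lebesgue_measure R [set t | G (ins ord0 y t)] <= @lebesgue_measure R [set t | H (ins ord0 y t)])%E) ->
  (lam m.+1 G <= lam m.+1 H)%E.
Proof.
move=> mG mH GH; rewrite !(lebesgue_fubini ord0)//; apply: ge0_le_integral => //.
- exact: measurable_slice_measure.
- exact: measurable_slice_measure.
Qed.

Lemma lebesgue_measure_itvcc (a b : R) : @lebesgue_measure R `[a, b]%classic = (Num.max 0 (b - a))%:E.
Proof.
rewrite lebesgue_measure_itv/= lte_fin; case: ltP => ab; last first.
  by rewrite max_l// subr_le0.
by rewrite max_r ?subr_ge0 ?ltW.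
Qed.

Lemma lebesgue_itv_sub (S : set R) (a b : R) : S `<=` `[a, b]%classic -> measurable (S : set (measurableTypeR R)) ->
  (@lebesgue_measure R S <= (Num.max 0 (b - a))%:E)%E.
Proof. by move=> Sab mS; rewrite -lebesgue_measure_itvcc; apply: le_measure; rewrite ?inE. Qed.

Lemma lebesgue_itv_sup (S : set R) (a b : R) : (forall t, a <= t -> t <= b -> S t) -> measurable (S : set (measurableTypeR R)) ->
  ((Num.max 0 (b - a))%:E <= @lebesgue_measure R S)%E.
Proof.
move=> Sab mS; rewrite -lebesgue_measure_itvcc; apply: le_measure; rewrite ?inE//.
by move=> t; rewrite /= in_itv/= => /andP[]; exact: Sab.
Qed.

End slices.

Section tilted_caps.
Context {R : realType} {m : nat}.

Let slice_meas (G : set 'rV[R]_m.+1) y : measurable (G : set (@borelRV R m.+1)) ->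
  measurable ([set t | G (ins ord0 y t)] : set (measurableTypeR R)).
Proof. by move=> mG; exact: (measurable_slice ord0 y mG). Qed.

Lemma parab_slice (B : 'M[R]_m) H y :
  [set t | parab B H (ins ord0 y t)] = `[0, H - 2^-1 * dotv (y *m B) y]%classic.
Proof.
apply/seteqP; split => t; rewrite /parab/= insK ins_i in_itv/=; first by move=> [-> ->].
by move=> /andP[].
Qed.

Let flipt (q : 'rV[R]_m.+1) : 'rV[R]_m.+1 -> 'rV[R]_m.+1 := daff (ins ord0 (const_mx 1) (-1)) q.

Let fliptE y t q s : flipt (ins ord0 q s) (ins ord0 y t) = ins ord0 (q + y) (s - t).
Proof.
apply/rowP => j; rewrite !mxE; case: unliftP => [k _|_]; first by rewrite !mxE mul1r addrC.
by rewrite mulN1r addrC.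
Qed.

Let flipy : 'rV[R]_m.+1 -> 'rV[R]_m.+1 := daff (ins ord0 (const_mx (-1)) 1) 0.

Let flipyE y t : flipy (ins ord0 y t) = ins ord0 (- y) t.
Proof.
apply/rowP => j; rewrite !mxE; case: unliftP => [k _|_]; first by rewrite !mxE mulN1r addr0.
by rewrite mul1r addr0.
Qed.

Let daff_pre (d q : 'rV[R]_m.+1) (G : set 'rV[R]_m.+1) : (forall i, `|d 0 i| = 1) ->
  lam m.+1 (daff d q @^-1` G) = lam m.+1 G.
Proof.
move=> d1; have dn i : d 0 i != 0 by rewrite -normr_eq0 d1 oner_eq0.
rewrite -[RHS](_ : lam m.+1 (daff d q @` (daff d q @^-1` G)) = _).
  by rewrite lebesgue_daff// big1 ?mul1e// => i _; rewrite d1.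
congr (lam _ _); apply/seteqP; split => [_ [x Gx <-]//|x Gx].
have xE : daff d q (\row_i ((x 0 i - q 0 i) / d 0 i)) = x.
  by apply/rowP => i; rewrite !mxE mulrC mulfVK// subrK.
by exists (\row_i ((x 0 i - q 0 i) / d 0 i)); rewrite /= ?xE.
Qed.

Let daff_meas (d q : 'rV[R]_m.+1) (G : set 'rV[R]_m.+1) : measurable (G : set (@borelRV R m.+1)) ->
  measurable (daff d q @^-1` G : set (@borelRV R m.+1)).
Proof.
move=> mG; rewrite -[X in measurable X]setTI; apply: (borel_continuous _ measurableT mG).
rewrite (_ : daff d q = fun x => x *m diag_mx d + q); last first.
  by apply/funext => x; apply/rowP => i; rewrite mul_mx_diag !mxE mulrC.
move=> x; pose FF := @nbhs_filter 'rV[R]_m.+1 x.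
apply: (@cvgD _ _ _ (nbhs x) FF); first exact: mulmx_continuous.
exact: (@cvg_cst _ _ _ (nbhs x) FF).
Qed.

(* Up to sign, a ball missing q leaves near q a set bounded by a paraboloid of curvature 1/r
   whose axis may be tilted; the two slices over y and - y together are at least as long
   as in the upright position. *)
Let removed (r : R) (q z w : 'rV[R]_m.+1) : 0 < r -> r < enorm (q - z) -> enorm (w - q) <= r ->
  - (enorm (w - q) ^+ 2 / (2 * r)) <= dotv ((enorm (q - z))^-1 *: (q - z)) (w - q) -> ~ eball z r w.
Proof.
move=> r0 qz wq h wz; rewrite /eball/= in wz.
have N0 : 0 < enorm (q - z) by exact: lt_trans qz.
have : enorm (w - z) ^+ 2 <= r ^+ 2 by rewrite ler_pXn2r ?nnegrE// ltW.
have -> : w - z = (q - z) + (w - q) by rewrite [RHS]addrC addrA subrK.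
move: h; rewrite dotvZl => h.
have {h}h : - (enorm (q - z) * (enorm (w - q) ^+ 2 / (2 * r))) <= dotv (q - z) (w - q).
  by have := ler_wpM2l (ltW N0) h; rewrite mulrN mulVKf// gt_eqF.
move: h wq N0 qz; move: (q - z) (w - q) => P d h wq N0 qz.
rewrite sqr_enorm dotvDl !dotvDr [dotv d P]dotvC -!sqr_enorm => H.
have X0 : enorm d ^+ 2 / r <= r by rewrite ler_pdivrMr// -expr2 ler_pXn2r ?nnegrE// ltW.
have E1 : enorm d ^+ 2 / (2 * r) = enorm d ^+ 2 / r / 2 by field; rewrite gt_eqF.
have E2 : enorm d ^+ 2 = enorm d ^+ 2 / r * r by rewrite mulfVK// gt_eqF.
rewrite E1 in h; move: H; rewrite E2; move: h X0 qz.
move: (enorm d ^+ 2 / r) (enorm P) (dotv P d) => X n D h X0 qz H.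
have : (n - r) * (n + r - X) <= 0 by lra.
by rewrite leNgt mulr_gt0// ?subr_gt0//; lra.
Qed.

(** The tilt lengthens the fibre over y by l = [dotv a y / b] and shortens the one over - y by l, so
    p + l and p - l add up to 2 p. If l would exceed h it is cut off at h >= p, and the longer fibre
    alone suffices; if b <= 0 the fibre over y contains an interval of length 2 h. *)
Let half (r h p Y : R) (a y : 'rV[R]_m) (b : R) (S S' : set R) : 0 < h -> 0 < p -> p <= h ->
  0 <= Y -> b <= 1 -> 0 <= dotv a y ->
  measurable (S : set (measurableTypeR R)) -> measurable (S' : set (measurableTypeR R)) ->
  (forall t, - Y - 2 * h <= t -> t <= - Y + p -> - Y <= dotv a y + b * t -> S t) ->
  (forall t, - Y - 2 * h <= t -> t <= - Y + p -> - Y <= - dotv a y + b * t -> S' t) ->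
  ((2 * p)%:E <= @lebesgue_measure R S + @lebesgue_measure R S')%E.
Proof.
move=> h0 p0 ph Y0 b1 ay mS mS' inS inS'.
have [bneg|bpos] := leP b 0.
  apply: (@le_trans _ _ (@lebesgue_measure R S)); last by rewrite leeDl.
  apply: le_trans (@lebesgue_itv_sup _ S (- Y - 2 * h) (- Y) _ mS).
    by rewrite lee_fin le_max; apply/orP; right; lra.
  move=> t t1 t2; apply: inS => //; first by lra.
  have : 0 <= b * t by rewrite mulr_le0//; lra.
  lra.
pose l := Num.min (dotv a y / b) h.
have l0 : 0 <= l by rewrite le_min divr_ge0 ?(ltW bpos)//= ltW.
have lh : l <= h by rewrite ge_min lexx orbT.
have bl : b * l <= dotv a y by rewrite mulrC -ler_pdivlMr// ge_min lexx.
have bY : b * Y <= Y by rewrite ler_piMl.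
have s1 : ((p + l)%:E <= @lebesgue_measure R S)%E.
  apply: le_trans (@lebesgue_itv_sup _ S (- Y - l) (- Y + p) _ mS).
    by rewrite lee_fin le_max; apply/orP; right; lra.
  move=> t t1 t2; apply: inS => //; first by lra.
  have : b * (- Y - l) <= b * t by rewrite ler_wpM2l// ltW.
  lra.
have s2 : ((p - l)%:E <= @lebesgue_measure R S')%E.
  have [lE|lE] := leP (dotv a y / b) h; last first.
    have -> : l = h by rewrite /l min_r// ltW.
    by apply: (@le_trans _ _ 0%E) => //; rewrite lee_fin subr_le0.
  have bl' : b * l = dotv a y by rewrite /l min_l// mulrC mulfVK// gt_eqF.
  apply: le_trans (@lebesgue_itv_sup _ S' (- Y + l) (- Y + p) _ mS').
    by rewrite lee_fin le_max; apply/orP; right; lra.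
  move=> t t1 t2; apply: inS' => //; first by lra.
  have : b * (- Y + l) <= b * t by rewrite ler_wpM2l// ltW.
  lra.
apply: le_trans (leeD s1 s2); rewrite -EFinD lee_fin; lra.
Qed.

(** Coordinates are turned so that the missed point is the origin and t points outwards. The removed
    set and its mirror image in y have equal volume, and [half] compares the sum of their fibres
    with twice the fibre of the upright cap. *)
Lemma tilted_cap (r h H : R) (P : set 'rV[R]_m.+1) (q : 'rV[R]_m) (B : 'M[R]_m) (z : 'rV[R]_m.+1) :
  0 < r -> 0 < h -> measurable (P : set (@borelRV R m.+1)) ->
  (forall y, H - 2^-1 * dotv (y *m B) y <= h) -> ~ eball z r (ins ord0 q h) ->
  (forall y t, 0 < H - 2^-1 * dotv (y *m B) y -> - (enorm y ^+ 2 / (2 * r)) - 2 * h <= t ->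
     t <= - (enorm y ^+ 2 / (2 * r)) + (H - 2^-1 * dotv (y *m B) y) ->
     P (ins ord0 (q + y) (h - t)) /\ enorm (ins ord0 y (- t)) <= r) ->
  (lam m.+1 (parab B H) <= lam m.+1 (P `\` eball z r))%E.
Proof.
move=> r0 h0 mP ph nz Kin; pose p y := H - 2^-1 * dotv (y *m B) y.
pose Q : 'rV[R]_m.+1 := ins ord0 q h.
set G := P `\` eball z r.
have mG : measurable (G : set (@borelRV R m.+1)).
  by apply: measurableD => //; apply: borel_closed; exact: closed_eball.
pose G2 := flipt Q @^-1` G; pose G3 := flipy @^-1` G2.
have mG2 : measurable (G2 : set (@borelRV R m.+1)) by exact: daff_meas.
have mG3 : measurable (G3 : set (@borelRV R m.+1)) by exact: daff_meas.
have lG2 : lam m.+1 G2 = lam m.+1 G.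
  apply: daff_pre => i; rewrite mxE; case: unliftP => [j _|_]; first by rewrite mxE normr1.
  by rewrite normrN1.
have lG3 : lam m.+1 G3 = lam m.+1 G.
  rewrite -lG2; apply: daff_pre => i; rewrite mxE; case: unliftP => [j _|_]; last by rewrite normr1.
  by rewrite mxE normrN1.
have Nr : r < enorm (Q - z) by move: nz; rewrite /eball/= => /negP; rewrite -ltNge.
set nu := (enorm (Q - z))^-1 *: (Q - z).
have N0 : 0 < enorm (Q - z) by exact: lt_trans Nr.
have nu1 : enorm nu = 1 by rewrite enormZ gtr0_norm ?invr_gt0// mulVf// gt_eqF.
pose a := del ord0 nu; pose b := - nu 0 ord0.
have nuE : nu = ins ord0 a (- b) by rewrite /a /b opprK insE.
have b1 : b <= 1.
  by apply: le_trans (ler_norm _) _; rewrite normrN -nu1; exact: coord_enorm.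
have inG2 y t : 0 < p y -> - (enorm y ^+ 2 / (2 * r)) - 2 * h <= t -> t <= - (enorm y ^+ 2 / (2 * r)) + p y ->
    - (enorm y ^+ 2 / (2 * r)) <= dotv a y + b * t -> G2 (ins ord0 y t).
  move=> p0 t1 t2 at0; have [k1 k2] := Kin y t p0 t1 t2.
  rewrite /G2/= /Q fliptE; split => //.
  have wq : ins ord0 (q + y) (h - t) - Q = ins ord0 y (- t).
    by rewrite insB addrAC subrr add0r addrAC subrr add0r.
  apply: (removed r0 Nr); first by rewrite wq.
  rewrite wq -/nu nuE dotv_ins mulrNN sqr_enorm_ins sqrrN; apply: le_trans at0.
  by rewrite lerN2 ler_wpM2r ?invr_ge0 ?mulr_ge0 ?(ltW r0)// lerDl sqr_ge0.
have pN y : p (- y) = p y by rewrite /p mulNmx dotvNl dotvNr opprK.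
pose S y : set R := [set t | G2 (ins ord0 y t)].
have mS y : measurable (S y : set (measurableTypeR R)) by exact: slice_meas.
have half' y : 0 < p y -> 0 <= dotv a y -> ((2 * p y)%:E <= @lebesgue_measure R (S y) + @lebesgue_measure R (S (- y)%R))%E.
  move=> p0 ay; have Y0 : 0 <= enorm y ^+ 2 / (2 * r) by rewrite divr_ge0 ?sqr_ge0// mulr_ge0// ltW.
  apply: (half r h0 p0 (ph y) Y0 b1 ay (mS y) (mS (- y))) => t t1 t2 t3; first exact: inG2.
  by apply: inG2; rewrite ?pN ?enormN// dotvNr.
have full y : ((2%:E * @lebesgue_measure R [set t | parab B H (ins ord0 y t)])%E <=
    @lebesgue_measure R [set t | G2 (ins ord0 y t)] + @lebesgue_measure R [set t | G3 (ins ord0 y t)])%E.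
  rewrite parab_slice lebesgue_measure_itvcc subr0 -/(p y) -EFinM.
  have -> : [set t | G3 (ins ord0 y t)] = S (- y).
    by apply/seteqP; split => t; rewrite /G3 /S/= flipyE.
  rewrite -/(S y); have [p0|p0] := leP (p y) 0.
    by rewrite mulr0 adde_ge0.
  have [ay|/ltW ay] := leP 0 (dotv a y); first exact: half'.
  by have := half' (- y); rewrite pN opprK addeC; apply => //; rewrite dotvNr oppr_ge0.
have mf := @measurable_slice_measure R m.
have h5 : ((2%:E * lam m.+1 (parab B H))%E <= lam m.+1 G2 + lam m.+1 G3)%E.
  have mPB := @measurable_parab R m B H.
  rewrite !(lebesgue_fubini ord0)// -ge0_integralZl//; last exact: mf.
  rewrite -ge0_integralD//; [|exact: mf|exact: mf].
  apply: ge0_le_integral => //.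
  - by move=> y _; rewrite mule_ge0.
  - by apply: emeasurable_funM => //; exact: mf.
  - by apply: emeasurable_funD; exact: mf.
by move: h5; rewrite lG2 lG3 -mule2n -mule_natl lee_pmul2l.
Qed.

End tilted_caps.

Section volumes.
Context {R : realType} {m : nat}.
Variables (r : R) (K : set 'rV[R]_m.+1) (A : 'M[R]_m) (g : 'rV[R]_m -> R) (e : R).
Hypotheses (r0 : 0 < r) (cK : compact K)
  (bcK : forall w, ~ K w -> exists2 z, K `<=` eball z r & ~ eball z r w)
  (e0 : 0 < e)
  (chart : forall y t, enorm y < e -> `|t| < e -> K (ins ord0 y t) <-> g y <= t)
  (gA : forall c : R, 0 < c -> exists2 d : R, 0 < d & forall y, enorm y < d ->
     `|g y - 2^-1 * dotv (y *m A) y| <= c * enorm y ^+ 2).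

Let mK : measurable (K : set (@borelRV R m.+1)).
Proof. by apply: borel_closed; apply: compact_closed => //; exact: norm_hausdorff. Qed.

Let slice_meas (G : set 'rV[R]_m.+1) y : measurable (G : set (@borelRV R m.+1)) ->
  measurable ([set t | G (ins ord0 y t)] : set (measurableTypeR R)).
Proof. by move=> mG; exact: (measurable_slice ord0 y mG). Qed.

Let quadB (c : R) y : dotv (y *m (A + c%:M)) y = dotv (y *m A) y + c * enorm y ^+ 2.
Proof. by rewrite mulmxDr dotvDl mul_mx_scalar dotvZl sqr_enorm. Qed.

(** The touching ball pushed inwards by [D] misses the axis points of depth less than [D], and what
    it removes lies between the graph of the body and its sphere, a cap of height [D] governed by
    [A] minus 1 / r; [c] absorbs the terms of higher order. *)
Lemma lower_volume (c rho : R) : 0 < c -> 0 < rho ->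
  (exists2 b : R, 0 < b & forall y, (r^-1 + b) * dotv y y <= dotv (y *m A) y) ->
  exists2 D0 : R, 0 < D0 & forall D, 0 < D -> D < D0 ->
    (K `\` eball (ins ord0 0 (r + D)) r `<=` eball 0 rho) /\
    (lam m.+1 (K `\` eball (ins ord0 0 (r + D)) r) <= lam m.+1 (parab (A - (r^-1 + c)%:M) D))%E.
Proof.
move=> c0 rho0 Ab; have c4 : 0 < c / 4 by rewrite divr_gt0.
have [d d0 gd] := gA c4.
(* The last entry lets the quartic term of the sphere be absorbed into c |y|^2; the others confine
   the removed set to the chart and to the ball of radius [rho]. *)
pose k := Num.min (Num.min rho d) (Num.min (Num.min e (r / 2)) (Num.min 1 (r * (c / 4) / ((r^-1 + c) ^+ 2)))).
have rc0 : 0 < r^-1 + c by rewrite addr_gt0// invr_gt0.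
have k0 : 0 < k by rewrite !lt_min rho0 d0 e0 ltr01/= !(divr_gt0, mulr_gt0, exprn_gt0).
have [D0 D00 D0P] := far_excluded r0 cK bcK e0 chart gA k0 Ab.
exists (Num.min D0 (r / 4)) => [|D D1]; first by rewrite lt_min D00 divr_gt0.
rewrite lt_min => /andP[DD0 Dr].
have loc w : (K `\` eball (ins ord0 0 (r + D)) r) w -> enorm w < k by move=> [Kw nw]; exact: D0P nw.
split => [w /loc|].
  by rewrite /eball/= subr0 /k !lt_min => /andP[/andP[/ltW]].
have mX : measurable ((K `\` eball (ins ord0 0 (r + D)) r) : set (@borelRV R m.+1)).
  by apply: measurableD => //; apply: borel_closed; exact: closed_eball.
apply: lebesgue_slice_le => // [|y]; first exact: measurable_parab.
rewrite parab_slice lebesgue_measure_itvcc subr0.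
have -> : D - 2^-1 * dotv (y *m (A - (r^-1 + c)%:M)) y =
  (D + (r^-1 / 2 + c / 4) * enorm y ^+ 2) - (2^-1 * dotv (y *m A) y - c / 4 * enorm y ^+ 2).
  by rewrite -raddfN/= quadB; field; rewrite gt_eqF.
apply: lebesgue_itv_sub; last exact: slice_meas.
move=> t /= Xt; have := loc _ Xt; have [Kt nC] := Xt.
have n2 := sqr_enorm_ins ord0 y t => wk.
have yw : enorm y <= enorm (ins ord0 y t).
  by apply: ler_of_sqr => //; rewrite n2 lerDl sqr_ge0.
have tw : `|t| <= enorm (ins ord0 y t).
  by apply: ler_of_sqr => //; rewrite n2 real_normK ?num_real// lerDr sqr_ge0.
move: (le_lt_trans yw wk) (le_lt_trans tw wk).
rewrite /k !lt_min => /andP[/andP[_ yd] /andP[/andP[ye _] /andP[y1 yc]]] /andP[_ /andP[/andP[te tr] _]].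
have /chart : K (ins ord0 y t) by [].
move=> /(_ ye te) gt; have := gd y yd; rewrite ler_norml => /andP[gl _].
rewrite in_itv/=; apply/andP; split; first by move: gl gt; lra.
rewrite leNgt; apply/negP => tl; apply: nC; rewrite /eball/= insB subr0.
rewrite enorm_le ?(ltW r0)// -sqr_enorm sqr_enorm_ins.
set Y := enorm y ^+ 2 in gl tl *.
have Y0 : 0 <= Y by rewrite sqr_ge0.
pose s := r + D - t.
have s0 : 0 <= s by rewrite /s; have := ler_norm t; lra.
have sk : s <= r - (r^-1 / 2 + c / 4) * Y by rewrite /s; lra.
have -> : (t - (r + D)) ^+ 2 = s ^+ 2 by rewrite /s; ring.
have s2 : s ^+ 2 <= (r - (r^-1 / 2 + c / 4) * Y) ^+ 2.
  by rewrite ler_pXn2r// nnegrE//; exact: le_trans sk.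
apply: (@le_trans _ _ (Y + (r - (r^-1 / 2 + c / 4) * Y) ^+ 2)); first by rewrite lerD2l.
have Yc : (r^-1 + c) ^+ 2 * Y <= r * (c / 4).
  have Yy : Y <= enorm y by rewrite /Y expr2 ler_piMl// ltW.
  by move: yc; rewrite ltr_pdivlMr ?exprn_gt0// => /ltW h; rewrite mulrC; apply: le_trans h; rewrite ler_wpM2r// sqr_ge0.
have -> : Y + (r - (r^-1 / 2 + c / 4) * Y) ^+ 2 = r ^+ 2 - Y * (r * (c / 2) - (r^-1 / 2 + c / 4) ^+ 2 * Y).
  by field; rewrite gt_eqF.
have : (r^-1 / 2 + c / 4) ^+ 2 <= (r^-1 + c) ^+ 2.
  have ri : 0 < r^-1 by rewrite invr_gt0.
  move: (r^-1) ri => q q0; have q2 : 0 <= q / 2 + c / 4 by rewrite addr_ge0// divr_ge0// ltW.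
  have q3 : q / 2 + c / 4 <= q + c by apply: lerD; rewrite ler_pdivrMr// ler_peMr ?ler1n// ltW.
  by rewrite ler_pXn2r// nnegrE//; apply: le_trans q3.
move=> /(ler_wpM2r Y0) h; rewrite gerBl mulr_ge0// subr_ge0; apply: le_trans h _; apply: le_trans Yc _.
by rewrite ler_wpM2l ?(ltW r0)//; lra.
Qed.

(** The counterpart for an arbitrary ball missing the point at depth [h]. The offset [q], of order
    h, is there because the ray towards the interior point is in general oblique to the normal; the
    slack [c] pays for it. *)
Lemma upper_volume (c M rho : R) : 0 < c -> 0 <= M -> 0 < rho ->
  exists2 h0 : R, 0 < h0 & forall h, 0 < h -> h < h0 -> forall q : 'rV[R]_m, enorm q <= M * h ->
    forall z, ~ eball z r (ins ord0 q h) ->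
    (lam m.+1 (parab (A + (c - r^-1)%:M) ((1 - c) * h)) <= lam m.+1 ((K `&` eball 0 rho) `\` eball z r))%E.
Proof.
move=> c0 M0 rho0; have c1 : 0 < c / 6 by rewrite divr_gt0.
have [d d0 gd] := gA c1; have [MA MA0 MAP] := mulmx_enorm_le A.
have fge := form_ge r0 bcK e0 chart gA.
(* Young's inequality splits the mixed terms of the form into c / 6 |y|^2 and a multiple of |q|^2;
   [C2] collects the latter, which are O(h^2). *)
pose C2 := MA ^+ 2 / (4 * (c / 6)) + MA + 2 * (c / 6).
have C20 : 0 <= C2 by rewrite !addr_ge0// ?divr_ge0 ?sqr_ge0 ?mulr_ge0// ltW.
pose k := Num.min (Num.min rho d) (Num.min e r).
have k0 : 0 < k by rewrite !lt_min rho0 d0 e0 r0.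
have [krho kd ke kr] : [/\ k <= rho, k <= d, k <= e & k <= r] by split; rewrite !ge_min lexx ?orbT.
have cr : 0 < (c * r)^-1 by rewrite invr_gt0 mulr_gt0.
have CM : 0 < C2 * M ^+ 2 + 1 by rewrite ltr_wpDl// mulr_ge0// sqr_ge0.
pose h0 := Num.min (Num.min (k / 8 / (M + 1)) (c * k ^+ 2 / 128)) (Num.min (k / 16 / (3 + (c * r)^-1)) (c / (C2 * M ^+ 2 + 1))).
have M1 : 0 < M + 1 by rewrite ltr_wpDl.
have h00 : 0 < h0 by rewrite !lt_min !(divr_gt0, mulr_gt0, exprn_gt0)//= addr_gt0.
exists h0 => // h h_gt0 hh0 q qM z nz.
have [h1 h2 h3 h4] : [/\ h < k / 8 / (M + 1), h < c * k ^+ 2 / 128, h < k / 16 / (3 + (c * r)^-1) & h < c / (C2 * M ^+ 2 + 1)].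
  by move: hh0; rewrite !lt_min => /andP[/andP[-> ->] /andP[-> ->]].
have q8 : enorm q <= k / 8.
  apply: le_trans qM _; move: h1; rewrite ltr_pdivlMr// => h1; lra.
pose p y := (1 - c) * h - 2^-1 * dotv (y *m (A + (c - r^-1)%:M)) y.
have pE y : p y = (1 - c) * h - 2^-1 * dotv (y *m A) y - c / 2 * enorm y ^+ 2 + enorm y ^+ 2 / (2 * r).
  by rewrite /p quadB; field; rewrite gt_eqF.
(* [form_ge] cancels the summand |y|^2 / (2 r), so the cap has width of order sqrt h. *)
have ph y : p y <= h - c / 2 * enorm y ^+ 2.
  have := fge y; rewrite -sqr_enorm pE => H.
  have -> : enorm y ^+ 2 / (2 * r) = 2^-1 * (r^-1 * enorm y ^+ 2) by field; rewrite gt_eqF.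
  have : 0 <= c * h by rewrite mulr_ge0// ltW.
  lra.
have py y : 0 < p y -> enorm y ^+ 2 <= 2 * h / c /\ enorm y <= k / 8.
  move=> py0; have y2 : enorm y ^+ 2 <= 2 * h / c.
    by rewrite ler_pdivlMr//; have := ph y; lra.
  split=> //; apply: ler_of_sqr; first by rewrite divr_ge0// ltW.
  apply: le_trans y2 _; rewrite ler_pdivrMr//; move: h2; rewrite ltr_pdivlMr// exprMn; lra.
have gq y : enorm y <= k / 8 -> g (q + y) <= h - (p y - enorm y ^+ 2 / (2 * r)).
  move=> y8; have qy : enorm (q + y) < d.
    by apply: le_lt_trans (ler_enormD _ _) _; apply: lt_le_trans kd; lra.
  have := gd _ qy; rewrite ler_norml => /andP[_ gu].
  have a1 : dotv ((q + y) *m A) (q + y) = dotv (q *m A) q + dotv (q *m A) y + dotv (y *m A) q + dotv (y *m A) y.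
    by rewrite mulmxDl !dotvDl !dotvDr; ring.
  have b1 v w : dotv (v *m A) w <= MA * (enorm v * enorm w).
    by apply: le_trans (dotv_le _ _) _; rewrite mulrA ler_wpM2r.
  have a2 := b1 q q; have a3 := b1 q y; have a4 := b1 y q.
  have a5 : enorm (q + y) ^+ 2 <= 2 * enorm q ^+ 2 + 2 * enorm y ^+ 2.
    have : enorm (q + y) ^+ 2 <= (enorm q + enorm y) ^+ 2 by rewrite ler_pXn2r ?nnegrE ?addr_ge0// ler_enormD.
    by have := sqr_ge0 (enorm q - enorm y); lra.
  have a6 : MA * (enorm q * enorm y) <= c / 6 * enorm y ^+ 2 + MA ^+ 2 / (4 * (c / 6)) * enorm q ^+ 2.
    have c6 : c / 6 != 0 by rewrite gt_eqF.
    rewrite -subr_ge0 (_ : _ - _ = c / 6 * (enorm y - MA * enorm q / (2 * (c / 6))) ^+ 2); last by field; rewrite gt_eqF.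
    by rewrite mulr_ge0 ?sqr_ge0// ltW.
  have a7 : C2 * enorm q ^+ 2 <= c * h.
    have : enorm q ^+ 2 <= (M * h) ^+ 2 by rewrite ler_pXn2r ?nnegrE// mulr_ge0// ltW.
    move=> /(ler_wpM2l C20) /le_trans; apply.
    rewrite (_ : C2 * (M * h) ^+ 2 = C2 * M ^+ 2 * h * h); last by ring.
    rewrite ler_wpM2r ?(ltW h_gt0)//; move: h4; rewrite ltr_pdivlMr//; lra.
  have a8 : c / 6 * enorm (q + y) ^+ 2 <= c / 6 * (2 * enorm q ^+ 2 + 2 * enorm y ^+ 2) by rewrite ler_wpM2l// ltW.
  have a9 : C2 * enorm q ^+ 2 = MA ^+ 2 / (4 * (c / 6)) * enorm q ^+ 2 + MA * enorm q ^+ 2 + 2 * (c / 6) * enorm q ^+ 2.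
    by rewrite /C2; ring.
  have a10 : 0 <= MA * enorm q ^+ 2 by rewrite mulr_ge0// sqr_ge0.
  rewrite pE; move: gu a1 a2 a3 a4 a6 a7 a8 a9 a10; rewrite [enorm y * enorm q]mulrC -expr2.
  move: (MA ^+ 2 / _) (enorm q * enorm y) (enorm (q + y) ^+ 2) (enorm q ^+ 2) (enorm y ^+ 2) => u v w x y'.
  move: (dotv _ _) (dotv _ _) (dotv _ _) (dotv _ _) (dotv _ _) (g _) => z1 z2 z3 z4 z5 z6.
  move=> gu a1; rewrite a1 in gu; move: gu; lra.
have Kin y t : 0 < p y -> - (enorm y ^+ 2 / (2 * r)) - 2 * h <= t -> t <= - (enorm y ^+ 2 / (2 * r)) + p y ->
    (K `&` eball 0 rho) (ins ord0 (q + y) (h - t)) /\ enorm (ins ord0 y (- t)) <= r.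
  move=> p0 t1 t2; have [y2 y8] := py y p0.
  have yr : enorm y ^+ 2 / (2 * r) <= h * (c * r)^-1.
    rewrite ler_pdivrMr ?mulr_gt0// (_ : h / (c * r) * (2 * r) = 2 * h / c)//.
    by field; rewrite !gt_eqF.
  have yr0 : 0 <= enorm y ^+ 2 / (2 * r) by rewrite divr_ge0 ?sqr_ge0// mulr_ge0// ltW.
  have h5 : h * (3 + (c * r)^-1) < k / 16 by rewrite -ltr_pdivlMr// addr_gt0.
  have ph' : p y <= h.
    by apply: le_trans (ph y) _; rewrite gerBl mulr_ge0 ?sqr_ge0// divr_ge0// ltW.
  have tk : `|t| <= k / 8 by rewrite ler_norml; apply/andP; split; lra.
  have htk : `|h - t| <= k / 4 by move: tk; rewrite !ler_norml => /andP[? ?]; apply/andP; split; lra.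
  have qy : enorm (q + y) <= k / 4 by apply: le_trans (ler_enormD _ _) _; lra.
  have nin (y' : 'rV[R]_m) t' : enorm (ins ord0 y' t') <= enorm y' + `|t'|.
    apply: ler_of_sqr; first by rewrite addr_ge0.
    rewrite sqr_enorm_ins -[t' ^+ 2]real_normK ?num_real// sqrrD.
    by rewrite lerD2r lerDl mulrn_wge0// mulr_ge0.
  split; last by apply: le_trans (nin _ _) _; rewrite normrN; apply: le_trans kr; lra.
  split; last by rewrite /eball/= subr0; apply: le_trans (nin _ _) _; apply: le_trans krho; lra.
  apply/chart; [by apply: lt_le_trans ke; lra|by apply: lt_le_trans ke; lra|].
  by apply: le_trans (gq y y8) _; lra.
apply: (tilted_cap r0 h_gt0 _ _ nz Kin).
  by apply: measurableI => //; apply: borel_closed; exact: closed_eball.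
move=> y; apply: le_trans (ph y) _; by rewrite gerBl mulr_ge0 ?sqr_ge0// divr_ge0// ltW.
Qed.

End volumes.

(** * The depth of the floating body at a point *)

Section weighted.
Context {R : realType} {n : nat}.
Variables (K : set 'rV[R]_n) (f : 'rV[R]_n -> R).
Hypothesis fcont : {within K, continuous f}.

Notation CT := (caratheodory_type (@lebesgue_outer R n)).

Lemma borel_leb (A : set 'rV[R]_n) : measurable (A : set (@borelRV R n)) ->
  measurable (A : set CT).
Proof. exact: borel_caratheodory. Qed.

Lemma measurable_weight (S : set 'rV[R]_n) : measurable (S : set (@borelRV R n)) -> S `<=` K ->
  measurable_fun (S : set CT) (EFin \o f).
Proof.
move=> mS SK; apply/measurable_EFinP.
apply: (measurability _ (RGenOpens.measurableE R)).
move=> _ [_ [a [b ->] <-]]; apply: borel_leb.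
have oV : open (`]a, b[%classic : set R) by exact: interval_open.
move: (`]a, b[%classic : set R) oV => V oV.
have cf : continuous (f : subspace K -> R) := fcont.
move/continuousP in cf; have [U oU UK] := (@open_subspaceP _ K _).1 (cf V oV).
rewrite (_ : S `&` f @^-1` V = S `&` U); last first.
  apply/seteqP; split => y [Sy Vy]; split => //.
    have : ((f @^-1` V) `&` K) y by split => //; exact: SK.
    by rewrite -UK => -[].
  have : (U `&` K) y by split => //; exact: SK.
  by rewrite UK => -[].
by apply: measurableI => //; exact: borel_open.
Qed.

Lemma weight_ge (S G : set 'rV[R]_n) (c : R) : measurable (S : set (@borelRV R n)) ->
  measurable (G : set (@borelRV R n)) -> G `<=` S -> S `<=` K -> 0 <= c ->
  (forall y, S y -> 0 <= f y) -> (forall y, G y -> c <= f y) ->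
  (c%:E * lam n G <= \int[@lebesgue_n R n]_(y in S) (f y)%:E)%E.
Proof.
move=> mS mG GS SK c0 f0 fc.
have mS' := borel_leb mS; have mG' := borel_leb mG.
apply: (@le_trans _ _ (\int[@lebesgue_n R n]_(y in G) (f y)%:E)%E); last first.
  by apply: ge0_subset_integral => //; exact: measurable_weight.
rewrite -(integral_cst (@lebesgue_n R n) mG' c%:E); apply: ge0_le_integral => //.
- by apply: measurable_weight => //; exact: subset_trans SK.
Qed.

Lemma weight_le (S : set 'rV[R]_n) (c : R) : measurable (S : set (@borelRV R n)) ->
  S `<=` K -> (forall y, S y -> 0 <= f y) -> (forall y, S y -> f y <= c) ->
  (\int[@lebesgue_n R n]_(y in S) (f y)%:E <= c%:E * lam n S)%E.
Proof.
move=> mS SK f0 fc; have mS' := borel_leb mS.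
rewrite -(integral_cst (@lebesgue_n R n) mS' c%:E); apply: ge0_le_integral => //.
- exact: measurable_weight.
Qed.

End weighted.

Section isometry.
Context {R : realType} {n : nat}.

Lemma lebesgue_isometry (T : 'M[R]_n) (x : 'rV[R]_n) (G : set 'rV[R]_n) : T *m T^T = 1%:M ->
  lam n [set z | G (x + z *m T)] = lam n G.
Proof.
move=> TT; have TT' := mulmx1C TT.
rewrite -[RHS](lebesgue_preimageD G x) -[LHS](lebesgue_orth _ TT); congr (lam n _).
apply/seteqP; split => [_ [z Gz <-]|z Gz]; first by rewrite /= addrC.
by exists (z *m T^T); rewrite /= -mulmxA TT' mulmx1// addrC.
Qed.

End isometry.

Section parab_scaling.
Context {R : realType} {m : nat}.

(** The square of the volume is given because it is rational in the eigenvalues, which keeps later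
    perturbations free of roots. Height a d^2 means width of order d, hence volume of order d^(m +
    2). *)
Lemma lebesgue_parab_scaled (T : 'M[R]_m) (D : 'rV[R]_m) (a : R) : T *m T^T = 1%:M ->
  (forall i, 0 < D 0 i) -> 0 < a -> exists V : R, [/\ 0 <= V,
   V ^+ 2 * (m.+2%:R ^+ 2 * \prod_i D 0 i) = (2 * a) ^+ m.+2 * vol (@eball R m 0 1) ^+ 2 &
   forall d, 0 < d -> lam m.+1 (parab (T *m diag_mx D *m T^T) (a * d ^+ 2)) = (d ^+ m.+2 * V)%:E].
Proof.
move=> TT D0 a0; pose om := vol (@eball R m 0 1).
have om0 : 0 <= om by rewrite fine_ge0// outer_measure_ge0.
exists (a * (\prod_i Num.sqrt (2 * a / D 0 i)) * (om * (2 / m.+2%:R))); split.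
- rewrite mulr_ge0 ?mulr_ge0 ?divr_ge0//; first exact: ltW.
  by apply: prodr_ge0 => i _; rewrite sqrtr_ge0.
- rewrite !exprMn -prodrXl (eq_bigr (fun i => 2 * a / D 0 i)); last first.
    by move=> i _; rewrite sqr_sqrtr// divr_ge0 ?mulr_ge0// ltW.
  have P0 : \prod_i D 0 i != 0 by rewrite gt_eqF// prodr_gt0.
  rewrite prodf_div prodr_const card_ord exprVn.
  have -> : (2 * a) ^+ m = 2 ^+ m * a ^+ m by rewrite exprMn.
  rewrite -/om !exprS; move: (m.+2%:R : R) (pnatr_eq0 R m.+2) => N /= /negbT N0.
  by field; rewrite P0 N0.
- move=> d d0; rewrite lebesgue_parab ?mulr_gt0 ?exprn_gt0//; congr EFin.
  rewrite (eq_bigr (fun i => d * Num.sqrt (2 * a / D 0 i))); last first.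
    move=> i _; rewrite (_ : 2 * (a * d ^+ 2) / D 0 i = d ^+ 2 * (2 * a / D 0 i)); last by field; rewrite gt_eqF.
    by rewrite sqrtrM ?sqr_ge0// sqrtr_sqr gtr0_norm.
  rewrite big_split/= prodr_const card_ord -/om !exprS.
  by move: (\prod_i _) (d ^+ m) => p q; ring.
Qed.

Lemma spectral_shift (T : 'M[R]_m) (D : 'rV[R]_m) (c : R) : T *m T^T = 1%:M ->
  T *m diag_mx D *m T^T + c%:M = T *m diag_mx (D + const_mx c) *m T^T.
Proof.
move=> TT; rewrite raddfD/= mulmxDr mulmxDl; congr (_ + _).
by rewrite diag_const_mx mul_mx_scalar -scalemxAl TT scalemx1.
Qed.

End parab_scaling.

Section frame.
Context {R : realType} {m : nat}.

(** The first row is - u, so that the coordinate [ord0] measures depth along the inner normal. *)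
Definition frame_mx (u : 'rV[R]_m.+1) (E : 'M[R]_(m, m.+1)) : 'M[R]_m.+1 :=
  col_mx (- u : 'rV[R]_(1 + m)) E.

Lemma frame_orth u E : u *m u^T = 1%:M -> E *m E^T = 1%:M -> E *m u^T = 0 ->
  frame_mx u E *m (frame_mx u E)^T = 1%:M.
Proof.
move=> uu EE Eu.
have -> : frame_mx u E *m (frame_mx u E)^T =
  (col_mx (- u) E *m (col_mx (- u) E)^T : 'M[R]_(1 + m)) by [].
rewrite tr_col_mx mul_col_row !linearN/= !mulNmx opprK uu EE Eu.
have -> : u *m E^T = 0 by rewrite -[LHS]trmxK trmx_mul trmxK Eu trmx0.
by rewrite !oppr0 -scalar_mx_block.
Qed.

Lemma mul_frame u E (z : 'rV[R]_(1 + m)) : z *m frame_mx u E = del ord0 z *m E - z 0 ord0 *: u.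
Proof.
have -> : z *m frame_mx u E = z *m col_mx (- u) E by [].
rewrite -{1}[z]hsubmxK mul_row_col addrC; congr (_ *m _ + _).
  by apply/rowP => j; rewrite !mxE; congr (z _ _); apply: val_inj.
rewrite mulmxN -mul_scalar_mx; congr (- (_ *m _)).
by apply/matrixP => i j; rewrite !ord1 !mxE mulr1n; congr (z _ _); apply: val_inj.
Qed.

Lemma mul_frame_ins u E (y : 'rV[R]_m) t : ins ord0 y t *m frame_mx u E = y *m E - t *: u.
Proof. by rewrite mul_frame insK ins_i. Qed.

Lemma frame_coord u E (v : 'rV[R]_m.+1) : u *m u^T = 1%:M -> E *m E^T = 1%:M -> E *m u^T = 0 ->
  (v *m (frame_mx u E)^T) 0 ord0 = - dotv u v.
Proof.
move=> uu EE Eu; have TT := frame_orth uu EE Eu; have TT' := mulmx1C TT.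
set z := v *m _; have -> : v = z *m frame_mx u E by rewrite /z -mulmxA TT' mulmx1.
rewrite mul_frame dotvBr dotvZr.
have -> : dotv u u = 1 by rewrite /dotv uu mxE.
have -> : dotv u (del ord0 z *m E) = 0 by rewrite dotvC /dotv -mulmxA Eu mulmx0 mxE.
by ring.
Qed.

Lemma frame_del u E (v : 'rV[R]_m.+1) : del ord0 (v *m (frame_mx u E)^T) = v *m E^T.
Proof.
apply/rowP => j; rewrite !mxE; apply: eq_bigr => i _; congr (_ * _); rewrite [LHS]mxE [RHS]mxE.
have -> : lift ord0 j = rshift 1 j by apply: val_inj.
exact: (@col_mxEd _ 1 m m.+1 (- u) E).
Qed.

End frame.

Section pointwise.
Context {R : realType} {m : nat}.

Lemma prod_shift_continuous (D : 'rV[R]_m) (c : R) : continuous (fun e : R => \prod_i (D 0 i - c + e)).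
Proof.
have -> : (fun e : R => \prod_i (D 0 i - c + e)) = horner (\prod_i ('X + (D 0 i - c)%:P)).
  by apply/funext => e; rewrite horner_prod; apply: eq_bigr => i _; rewrite !(hornerM, horner_exp, hornerD, hornerN, hornerC, hornerX) addrC.
exact: continuous_horner.
Qed.

Lemma diag_form (T : 'M[R]_m) (D y : 'rV[R]_m) :
  dotv (y *m (T *m diag_mx D *m T^T)) y = \sum_i D 0 i * (y *m T) 0 i ^+ 2.
Proof.
have -> : dotv (y *m (T *m diag_mx D *m T^T)) y = dotv (y *m T *m diag_mx D) (y *m T).
  by rewrite /dotv trmx_mul !mulmxA.
by rewrite dotvE mul_mx_diag; apply: eq_bigr => i _; rewrite mxE expr2; ring.
Qed.

Lemma lower_finite (D : 'rV[R]_m) : (forall i, 0 < D 0 i) -> exists2 b, 0 < b & forall i, b <= D 0 i.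
Proof.
move=> D0; exists (\big[Num.min/1]_i D 0 i).
  by rewrite lt_bigmin// ltr01/=; apply/allP => i _; rewrite D0.
by move=> i; exact: bigmin_le.
Qed.

(* The two sides compare the values 1 and (f V)^2 at the perturbed eigenvalues. *)
Lemma perturb (D : 'rV[R]_m) (c a F w B : R) :
  let P e := m.+2%:R ^+ 2 * \prod_i (D 0 i - c + e) in
  let Q e := (2 * (a * (1 - e))) ^+ m.+2 * (w * (F - e)) ^+ 2 in
  0 < B -> (P 0 < Q 0 -> exists e, 0 < e /\ e < B /\ P e < Q e) /\
  (Q 0 < P 0 -> exists e, 0 < e /\ e < B /\ Q (- e) < P (- e)).
Proof.
move=> P Q B0.
have cP : continuous P by move=> x; apply: cvgM; [exact: cvg_cst|exact: prod_shift_continuous].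
have cQ : continuous Q.
  have -> : Q = horner (((2 * a)%:P * (1%:P - 'X)) ^+ m.+2 * (w%:P * (F%:P - 'X)) ^+ 2).
    by apply/funext => e; rewrite /Q hornerM !horner_exp !(hornerM, hornerD, hornerN, hornerC, hornerX) (mulrA 2).

  exact: continuous_horner.
have half (z : R) : 0 < z -> z / 2 < z by move=> z0; rewrite ltr_pdivrMr// ltr_pMr// ltr1n.
have cD : continuous (fun e => Q e - P e) by move=> x; apply: cvgB; [exact: cQ|exact: cP].
have [cDn] : (Q 0 - P 0 < 0 -> exists d, [/\ 0 < d, d < B & forall e, `|e| <= d -> Q e - P e < 0]) /\
  (0 < Q 0 - P 0 -> exists d, [/\ 0 < d, d < B & forall e, `|e| <= d -> 0 < Q e - P e]).
  split => h.
    have : \forall e \near (0:R), Q e - P e < 0 by move/cvgr_lt : (cD 0) => /(_ 0 h).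
    move=> /nbhs_ballP[d /= d0 dP]; exists (Num.min (d / 2) (B / 2)).
    split; [by rewrite lt_min !divr_gt0|by rewrite gt_min (half _ B0) orbT|].
    move=> e ed; apply: dP; rewrite /ball/= sub0r normrN; apply: le_lt_trans ed _.
    by rewrite gt_min (half _ d0).
  have : \forall e \near (0:R), 0 < Q e - P e by move/cvgr_gt : (cD 0) => /(_ 0 h).
  move=> /nbhs_ballP[d /= d0 dP]; exists (Num.min (d / 2) (B / 2)).
  split; [by rewrite lt_min !divr_gt0|by rewrite gt_min (half _ B0) orbT|].
  move=> e ed; apply: dP; rewrite /ball/= sub0r normrN; apply: le_lt_trans ed _.
  by rewrite gt_min (half _ d0).
move=> cDp; split => h.
  have [|d [d0 dB dP]] := cDp; first by rewrite subr_gt0.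
  by exists d; rewrite d0 dB -subr_gt0 dP// gtr0_norm.
have [|d [d0 dB dP]] := cDn; first by rewrite subr_lt0.
by exists d; rewrite d0 dB -subr_lt0 dP// normrN gtr0_norm.
Qed.

Variables (r : R) (K : set 'rV[R]_m.+1) (f : 'rV[R]_m.+1 -> R) (cf rb : R) (x0 x : 'rV[R]_m.+1).
Hypotheses (r0 : 0 < r) (cK : compact K) (Kball : ball_convex r K)
  (fcont : {within K, continuous f}) (cf0 : 0 < cf) (f_ge : forall y, K y -> cf <= f y)
  (rb0 : 0 < rb) (x0b : eball x0 rb `<=` K).

Notation om := (vol (@eball R m 0 1)).

Let mK : measurable (K : set (@borelRV R m.+1)).
Proof. by apply: borel_closed; apply: compact_closed => //; exact: norm_hausdorff. Qed.

Let f_near e : K x -> 0 < e -> exists2 rho, 0 < rho &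
  forall y, K y -> enorm (y - x) <= rho -> f x - e <= f y <= f x + e.
Proof.
move=> Kx e0; have cfx : f @ within K (nbhs x) --> f x.
  by move/subspace_continuousP : fcont => /(_ x Kx).
have : \forall y \near within K (nbhs x), `|f x - f y| < e by move/cvgr_dist_lt : cfx; exact.
rewrite near_withinE => /near_enorm[d d0 dP]; exists (d / 2); first by rewrite divr_gt0.
move=> y Ky yx; have := dP y; rewrite /= => /(_ _ Ky).
have yd : enorm (y - x) < d by apply: le_lt_trans yx _; rewrite ltr_pdivrMr// ltr_pMr// ltr1n.
by move=> /(_ yd); rewrite ltr_norml => /andP[? ?]; apply/andP; split; lra.
Qed.

Let om0 : 0 < om. Proof. exact: om_gt0. Qed.

Let sqr_excess (d s t : R) : 0 <= d -> 0 < s -> 0 < t -> s ^+ 2 < d + - (s + t) * - (s + t).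
Proof. by move=> d0 s0 t0; rewrite mulrNN -expr2 ltr_wpDl// ltr_pXn2r ?nnegrE ?ltW ?addr_gt0// ltrDl. Qed.

Section transfer.
Variables (T0 : 'M[R]_m.+1) (T : 'M[R]_m) (D : 'rV[R]_m) (g : 'rV[R]_m -> R) (e : R)
  (W E0 : R) (b : 'rV[R]_m).
Let Phi (z : 'rV[R]_m.+1) : 'rV[R]_m.+1 := x + z *m T0.
Let K' := Phi @^-1` K.
Let A := T *m diag_mx D *m T^T.
Hypotheses (TT : T0 *m T0^T = 1%:M) (TTm : T *m T^T = 1%:M) (cK' : compact K')
  (bcK : forall w, ~ K' w -> exists2 z, K' `<=` eball z r & ~ eball z r w)
  (e0 : 0 < e)
  (chart : forall y t, enorm y < e -> `|t| < e -> K' (ins ord0 y t) <-> g y <= t)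
  (gA : forall c : R, 0 < c -> exists2 d : R, 0 < d & forall y, enorm y < d ->
     `|g y - 2^-1 * dotv (y *m A) y| <= c * enorm y ^+ 2)
  (Dr : forall i, r^-1 <= D 0 i) (Kx : K x) (E00 : 0 < E0)
  (xs : forall s, x - s *: (x - x0) = Phi (ins ord0 (- s *: b) (s * E0)))
  (W0 : 0 <= W)
  (WE : (2 * W) ^+ m.+2 * (om * f x) ^+ 2 = m.+2%:R ^+ 2 * \prod_i (D 0 i - r^-1)).

Let f0 : 0 < f x. Proof. by apply: lt_le_trans (f_ge Kx). Qed.

Let Phi_eball z w s : eball (Phi w) s (Phi z) <-> eball w s z.
Proof. by rewrite /eball/= /Phi opprD addrACA subrr add0r -mulmxBl enorm_mulmx. Qed.

Let PhiK w : Phi ((w - x) *m T0^T) = w.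
Proof. by rewrite /Phi -mulmxA (mulmx1C TT) mulmx1 addrC subrK. Qed.

Let small_d (c h : R) : 0 < c -> 0 < h -> exists2 d0, 0 < d0 & forall d, 0 < d -> d < d0 -> c * d ^+ 2 < h.
Proof.
move=> c0 h0; exists (Num.min 1 (h / c)); first by rewrite lt_min ltr01 divr_gt0.
move=> d d0; rewrite lt_min => /andP[d1 dh]; rewrite mulrC -ltr_pdivlMr//.
by apply: le_lt_trans dh; rewrite expr2 ler_piMr// ltW.
Qed.

Let mD (w : 'rV[R]_m.+1) : measurable (K `\` eball w r : set (@borelRV R m.+1)).
Proof. by apply: measurableD => //; exact: borel_eball. Qed.

Let shiftE c : A + c%:M = T *m diag_mx (D + const_mx c) *m T^T.
Proof. exact: spectral_shift. Qed.

Let shift_prod c a V : V ^+ 2 * (m.+2%:R ^+ 2 * \prod_i (D + const_mx c) 0 i) = (2 * a) ^+ m.+2 * om ^+ 2 ->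
  V ^+ 2 * (m.+2%:R ^+ 2 * \prod_i (D 0 i - r^-1 + (c + r^-1))) = (2 * a) ^+ m.+2 * om ^+ 2.
Proof. by move=> <-; congr (_ * (_ * _)); apply: eq_bigr => i _; rewrite !mxE; ring. Qed.

Lemma floating_upper c : W < c * E0 -> exists2 d0, 0 < d0 & forall d, 0 < d -> d < d0 ->
       floating_body r K f (d ^+ m.+2) (x - (c * d ^+ 2) *: (x - x0)).
Proof.
move=> cW; have a0 : 0 < c * E0 by apply: le_lt_trans cW.
have c0 : 0 < c by move: a0; rewrite pmulr_lgt0.
(* The strict inequality leaves room to perturb the curvatures, the height and the density f by one
   common [ep]. *)
have [] := (perturb D r^-1 (c * E0) (f x) om (B := Num.min 1 (f x)) _).1.
- by rewrite lt_min ltr01 f0.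
- rewrite !subr0 mulr1 (eq_bigr (fun i => D 0 i - r^-1)); last by move=> i _; rewrite addr0.
  rewrite -WE ltr_pM2r; last by rewrite exprn_gt0// mulr_gt0.
  by rewrite ltr_pXn2r ?nnegrE ?(mulr_ge0 _ W0) ?(mulr_ge0 _ (ltW a0))// ltr_pM2l.
move=> ep [ep0 [+ PQ]]; rewrite lt_min => /andP[ep1 epf].
have [rho rho0 frho] := f_near Kx ep0.
have M0 : 0 <= enorm b / E0 by rewrite divr_ge0 ?enorm_ge0// ltW.
have [h0 h00 hP] := upper_volume r0 cK' bcK e0 chart gA ep0 M0 rho0.
have [d0 d00 dP] := small_d a0 h00; exists d0 => // d dgt dlt w /= wint.
have cd0 : 0 <= c * d ^+ 2 by rewrite mulr_ge0 ?sqr_ge0// ltW.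
have [//|nx] := pselect (eball w r (x - (c * d ^+ 2) *: (x - x0))); exfalso.
have hE : c * d ^+ 2 * E0 = c * E0 * d ^+ 2 by ring.
have := hP (c * d ^+ 2 * E0); rewrite hE => /(_ _ (dP _ dgt dlt)).
rewrite mulr_gt0 ?exprn_gt0// => /(_ isT (- (c * d ^+ 2) *: b)).
have -> : enorm (- (c * d ^+ 2) *: b) = enorm b / E0 * (c * E0 * d ^+ 2).
  by rewrite enormZ normrN ger0_norm//; field; rewrite gt_eqF.
have nz : ~ eball ((w - x) *m T0^T) r (ins ord0 (- (c * d ^+ 2) *: b) (c * E0 * d ^+ 2)).
  by rewrite -hE -Phi_eball -xs PhiK.
move=> /(_ (lexx _) _ nz).
have -> : (K' `&` eball 0 rho) `\` eball ((w - x) *m T0^T) r =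
  [set z | ((K `&` eball x rho) `\` eball w r) (x + z *m T0)].
  have x0E : x = Phi 0 by rewrite /Phi mul0mx addr0.
  apply/seteqP; split => z [[Kz zr] nzw]; split => //.
  - by split => //; rewrite {1}x0E; apply/Phi_eball.
  - by move=> /= h; apply: nzw; apply/Phi_eball; rewrite PhiK.
  - by split => //; move: zr; rewrite {1}x0E => /Phi_eball.
  - by move=> h; apply: nzw; move/Phi_eball : h; rewrite PhiK.
rewrite lebesgue_isometry//.
have D'0 i : 0 < (D + const_mx (ep - r^-1)) 0 i by rewrite !mxE addrCA ltr_wpDr ?subr_ge0.
have a1 : 0 < (1 - ep) * (c * E0) by rewrite mulr_gt0 ?subr_gt0.
have [V [V0 VE VP]] := lebesgue_parab_scaled TTm D'0 a1.
rewrite shiftE mulrA VP// => lamG.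
set G := _ `\` _ in lamG.
have mG : measurable (G : set (@borelRV R m.+1)).
  by apply: measurableD; [apply: measurableI => //; exact: borel_eball|exact: borel_eball].
have fe0 : 0 < f x - ep by rewrite subr_gt0.
have := weight_ge fcont (mD w) mG _ _ (ltW fe0).
have GS : G `<=` K `\` eball w r by move=> z [[? ?] ?].
have SK : K `\` eball w r `<=` K by move=> z [? ?].
move=> /(_ GS SK).
have h1 y : (K `\` eball w r) y -> 0 <= f y by move=> [/f_ge fz _]; apply: le_trans fz; exact: ltW.
have h2 y : G y -> f x - ep <= f y by move=> [[Kz /(frho _ Kz)/andP[]]].
move=> /(_ h1 h2).
move=> /le_trans/(_ wint).
have fe0' : (0 <= (f x - ep)%:E)%E by rewrite lee_fin ltW.
move=> /(le_trans (lee_wpmul2l fe0' lamG)).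
rewrite -EFinM lee_fin mulrCA -[leRHS]mulr1 ler_pM2l ?exprn_gt0// => fV.
have := shift_prod VE; rewrite subrK => {}VE.
suff : m.+2%:R ^+ 2 * \prod_i (D 0 i - r^-1 + ep) >= (2 * (c * E0 * (1 - ep))) ^+ m.+2 * (om * (f x - ep)) ^+ 2.
  by move/(lt_le_trans PQ); rewrite ltxx.
set M := m.+2%:R ^+ 2 * _ in VE *.
have -> : (2 * (c * E0 * (1 - ep))) ^+ m.+2 * (om * (f x - ep)) ^+ 2 = ((f x - ep) * V) ^+ 2 * M.
  by rewrite (mulrC _ (1 - ep)) (exprMn 2 om) mulrA -VE; ring.
rewrite ler_piMl//.
  rewrite mulr_ge0 ?sqr_ge0//; apply: prodr_ge0 => i _.
  by rewrite addr_ge0 ?subr_ge0// ltW.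
by rewrite expr_le1// mulr_ge0// ltW.
Qed.

(** One admissible ball missing the point is enough: the touching ball pushed inwards by [De],
    slightly more than the depth [h] of the point. *)
Lemma floating_lower c : 0 < c -> c * E0 < W -> exists2 d0, 0 < d0 & forall d, 0 < d -> d < d0 ->
       ~ floating_body r K f (d ^+ m.+2) (x - (c * d ^+ 2) *: (x - x0)).
Proof.
move=> c0 cW; have a0 : 0 < c * E0 by rewrite mulr_gt0.
have W00 : 0 < W by exact: lt_trans cW.
(* W > 0 makes the product nonzero, hence every eigenvalue strictly larger than 1 / r, as
   [lower_volume] requires. *)
have D0 i : 0 < (D - const_mx r^-1) 0 i.
  rewrite !mxE lt_neqAle subr_ge0 Dr andbT eq_sym; apply/eqP => Di0.
  have : (2 * W) ^+ m.+2 * (om * f x) ^+ 2 = 0 by rewrite WE (bigD1 i)//= Di0 mul0r mulr0.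
  by apply/eqP; rewrite gt_eqF// mulr_gt0// exprn_gt0// mulr_gt0.
have [bb bb0 bD] := lower_finite D0.
have [] := (perturb D r^-1 (c * E0) (f x) om bb0).2.
  rewrite !subr0 mulr1 (eq_bigr (fun i => D 0 i - r^-1)); last by move=> i _; rewrite addr0.
  rewrite -WE ltr_pM2r; last by rewrite exprn_gt0// mulr_gt0.
  by rewrite ltr_pXn2r ?nnegrE ?(mulr_ge0 _ W0) ?(mulr_ge0 _ (ltW a0))// ltr_pM2l.
move=> ep [ep0 [epb PQ]]; rewrite !opprK in PQ.
have [rho rho0 frho] := f_near Kx ep0.
have [|D1 D10 DP] := lower_volume r0 cK' bcK e0 chart gA ep0 rho0.
  exists bb => // y; rewrite /A diag_form -(dotv_mulmx y y TTm) dotvE mulr_sumr.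
  apply: ler_sum => i _; rewrite -expr2 ler_wpM2r ?sqr_ge0//.
  by have := bD i; rewrite !mxE lerBrDl.
have a1 : 0 < (1 + ep) * (c * E0) by rewrite mulr_gt0// addr_gt0.
have [d0 d00 dP] := small_d a1 D10; exists d0 => // d dgt dlt.
set h := c * E0 * d ^+ 2; have h0 : 0 < h by rewrite mulr_gt0// exprn_gt0.
have hE : c * d ^+ 2 * E0 = h by rewrite /h; ring.
set De := (1 + ep) * (c * E0) * d ^+ 2; have De0 : 0 < De by rewrite mulr_gt0// exprn_gt0.
have [Srho lamS] := DP _ De0 (dP _ dgt dlt).
set z0 := ins ord0 0 (r + De) in Srho lamS.
have SE : K' `\` eball z0 r = [set z | (K `\` eball (Phi z0) r) (x + z *m T0)].
  apply/seteqP; split => z [Kz nzw]; split => //; first by move=> /= h1; apply: nzw; apply/Phi_eball.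
  by move=> h1; apply: nzw; apply/Phi_eball.
have D'0 i : 0 < (D + const_mx (- (r^-1 + ep))) 0 i.
  by have := bD i; rewrite !mxE => bDi; rewrite opprD addrA subr_gt0; apply: lt_le_trans bDi.
have [V [V0 VE VP]] := lebesgue_parab_scaled TTm D'0 a1.
have sN : A - (r^-1 + ep)%:M = A + (- (r^-1 + ep))%:M by rewrite raddfN.
rewrite sN shiftE VP// SE lebesgue_isometry// in lamS.
have := shift_prod VE; rewrite (_ : - (r^-1 + ep) + r^-1 = - ep); last by ring.
move=> {}VE.
have fV : (f x + ep) * V <= 1.
  set M := m.+2%:R ^+ 2 * _ in VE PQ.
  have QE : (2 * (c * E0 * (1 + ep))) ^+ m.+2 * (om * (f x + ep)) ^+ 2 = ((f x + ep) * V) ^+ 2 * M.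
    by rewrite (mulrC _ (1 + ep)) (exprMn 2 om) mulrA -VE; ring.
  rewrite QE in PQ; have fV0 : 0 <= (f x + ep) * V by rewrite mulr_ge0// addr_ge0// ltW.
  have M0 : 0 < M.
    rewrite mulr_gt0 ?exprn_gt0 ?ltr0n// prodr_gt0// => i _.
    by have := bD i; rewrite !mxE => bDi; rewrite subr_gt0; apply: lt_le_trans bDi.
  by move: PQ; rewrite -[ltRHS]mul1r ltr_pM2r// expr_lt1// => /ltW.
have Hint : (\int[@lebesgue_n R m.+1]_(y in K `\` eball (Phi z0) r) (f y)%:E <= (d ^+ m.+2)%:E)%E.
  have SK : K `\` eball (Phi z0) r `<=` K by move=> z [].
  have h1 y : (K `\` eball (Phi z0) r) y -> 0 <= f y by move=> [/f_ge fz _]; apply: le_trans fz; exact: ltW.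
  have h2 y : (K `\` eball (Phi z0) r) y -> f y <= f x + ep.
    move=> [Ky nyw]; have : (K' `\` eball z0 r) ((y - x) *m T0^T).
      by rewrite SE /= -[x + _]/(Phi _) PhiK.
    have x0E : x = Phi 0 by rewrite /Phi mul0mx addr0.
    by move=> /Srho /Phi_eball; rewrite PhiK -x0E => /(frho _ Ky)/andP[].
  apply: le_trans (weight_le fcont (mD _) SK h1 h2) _.
  have fe0' : (0 <= (f x + ep)%:E)%E by rewrite lee_fin addr_ge0// ltW.
  apply: le_trans (lee_wpmul2l fe0' lamS) _.
  by rewrite -EFinM lee_fin mulrCA ler_piMr// exprn_ge0// ltW.
move=> /(_ (Phi z0) Hint); rewrite xs hE => /Phi_eball; rewrite /eball/= enorm_le ?(ltW r0)// insB subr0 dotv_ins.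
have -> : h - (r + De) = - (r + ep * h) by rewrite /De /h; ring.
by apply/negP; rewrite -ltNge sqr_excess ?dotvv_ge0// mulr_gt0.
Qed.

End transfer.

(** [W] is the normal depth in units of d^2: its equation says that a cap of height W d^2 has weight
    d^(m + 2) to leading order. A point of the ray towards [x0] has normal depth [dotv u (x - x0)]
    times its parameter. *)
Lemma pointwise_floating (k : 'rV[R]_m) : is_principal_curvatures K x k ->
  exists u : 'rV[R]_m.+1, [/\ dotv u u = 1, (forall i, r^-1 <= k 0 i),
    (forall w, K w -> dotv u (w - x) <= 0), 0 < dotv u (x - x0) &
    forall W, 0 <= W -> (2 * W) ^+ m.+2 * (om * f x) ^+ 2 = m.+2%:R ^+ 2 * \prod_i (k 0 i - r^-1) ->
    (forall c, W < c * dotv u (x - x0) -> exists2 d0, 0 < d0 & forall d, 0 < d -> d < d0 ->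
       floating_body r K f (d ^+ m.+2) (x - (c * d ^+ 2) *: (x - x0))) /\
    (forall c, 0 < c -> c * dotv u (x - x0) < W -> exists2 d0, 0 < d0 & forall d, 0 < d -> d < d0 ->
       ~ floating_body r K f (d ^+ m.+2) (x - (c * d ^+ 2) *: (x - x0)))].
Proof.
move=> [u [E [A [g [[uu EE Eu] [e e0 chart] gA At kA]]]]].
pose T0 := frame_mx u E; have TT : T0 *m T0^T = 1%:M by exact: frame_orth.
have TT' := mulmx1C TT.
pose Phi (z : 'rV[R]_m.+1) : 'rV[R]_m.+1 := x + z *m T0.
pose Psi (w : 'rV[R]_m.+1) : 'rV[R]_m.+1 := (w - x) *m T0^T.
have PhiK w : Phi (Psi w) = w by rewrite /Phi /Psi -mulmxA TT' mulmx1 addrC subrK.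
have PsiK z : Psi (Phi z) = z by rewrite /Phi /Psi addrAC subrr add0r -mulmxA TT mulmx1.
have PhiE z w : enorm (Phi z - Phi w) = enorm (z - w).
  by rewrite /Phi opprD addrACA subrr add0r -mulmxBl enorm_mulmx.
pose K' := Phi @^-1` K.
have Phic : continuous Phi.
  by move=> z; apply: (@cvgD _ _ _ (nbhs z) (@nbhs_filter 'rV[R]_m.+1 z)); [exact: (@cvg_cst _ _ _ (nbhs z) (@nbhs_filter 'rV[R]_m.+1 z))|exact: mulmx_continuous].
have cK' : compact K'.
  have -> : K' = Psi @` K.
    by apply/seteqP; split => [z Kz|_ [w Kw <-]]; [exists (Phi z) => //|rewrite /K'/= PhiK].
  apply: continuous_compact => //; apply: continuous_subspaceT => w.
  rewrite (_ : Psi = (fun z => z *m T0^T) \o (fun w => w - x))//.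
  apply: continuous_comp; last exact: mulmx_continuous.
  by apply: (@cvgB _ _ _ (nbhs w) (@nbhs_filter 'rV[R]_m.+1 w)); [exact: cvg_id|exact: (@cvg_cst _ _ _ (nbhs w) (@nbhs_filter 'rV[R]_m.+1 w))].
have eb z w : eball (Psi w) r z <-> eball w r (Phi z).
  by rewrite /eball/= -{2}(PhiK w) PhiE.
have bcK w : ~ K' w -> exists2 z, K' `<=` eball z r & ~ eball z r w.
  move=> nK; have : ~ (\bigcap_(x in [set x | K `<=` eball x r]) eball x r) (Phi w) by rewrite -Kball.
  move=> /existsNP[v /not_implyP[Kv nv]]; exists (Psi v); last by move/eb.
  by move=> z Kz; apply/eb; exact: Kv.
have chart' y t : enorm y < e -> `|t| < e -> K' (ins ord0 y t) <-> g y <= t.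
  by move=> ye te; rewrite /K' /Phi/= mul_frame_ins addrA; exact: chart.
have gA' (c : R) : 0 < c -> exists2 d : R, 0 < d & forall y, enorm y < d ->
     `|g y - 2^-1 * dotv (y *m A) y| <= c * enorm y ^+ 2.
  move=> c0; have /near_enorm[d d0 dP] := gA _ c0; exists d => // y yd.
  by apply: dP; rewrite /= subr0.
have [T [D [TTm AD]]] := sym_spectral At.
have kD : \prod_i ('X - (k 0 i)%:P) = \prod_i ('X - (D 0 i)%:P) :> {poly R}.
  by rewrite -kA AD char_poly_spectral.
have Dr i : r^-1 <= D 0 i.
  have := form_ge r0 bcK e0 chart' gA' ((delta_mx 0 i : 'rV[R]_m) *m T^T).
  rewrite AD /dotv trmx_mul trmxK !mulmxA -(mulmxA _ T^T T) (mulmx1C TTm) mulmx1.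
  rewrite -(mulmxA _ T^T T) (mulmx1C TTm) mulmx1.
  rewrite -[delta_mx 0 i *m _]rowE row_diag_mx -scalemxAl !trmx_delta mul_delta_mx !mxE !eqxx !mulr1.
  exact.
have kr i : r^-1 <= k 0 i by have [l ->] := eigen_mem i kD.
have Kx : K x.
  have := chart' 0 0; rewrite enorm0 normr0 => /(_ e0 e0)/iffRL.
  rewrite /K' /Phi/= mul_frame_ins mul0mx scale0r subrr addr0; apply.
  have [d d0 /(_ 0)] := gA' 1 ltr01; rewrite enorm0 mul0mx dot0v !mulr0 expr0n/= mulr0 subr0 => /(_ d0).
  by rewrite normr_le0 => /eqP ->.
have uu1 : dotv u u = 1 by rewrite /dotv uu mxE.
have Kh w : K w -> dotv u (w - x) <= 0.
  move=> Kw; have tb : K' `<=` eball (ins ord0 0 r) r := touching_ball r0 bcK e0 chart' gA'.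
  have := tb (Psi w); rewrite /K'/= PhiK => /(_ Kw); rewrite /eball/= enorm_le ?(ltW r0)//.
  rewrite -[Psi w](insE ord0) insB subr0 dotv_ins /Psi frame_coord// => h.
  apply: contraTT h; rewrite -!ltNge -opprD (addrC (dotv u _)); exact: sqr_excess (dotvv_ge0 _) r0.
pose E0 := dotv u (x - x0).
have E00 : 0 < E0.
  have := Kh (x0 + rb *: u); rewrite addrAC dotvDr dotvZr uu1 -[x0 - x]opprB dotvNr -/E0 => h.
  suff : K (x0 + rb *: u).
    by move/h; rewrite mulr1 addrC subr_le0; apply: lt_le_trans.
  by apply: x0b; rewrite /eball/= addrAC subrr add0r enormZ enormE uu1 sqrtr1 mulr1 gtr0_norm.
have f0 : 0 < f x by apply: lt_le_trans (f_ge Kx).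
have M0 : 0 <= enorm (x - x0) / E0 by rewrite divr_ge0 ?enorm_ge0// ltW.
exists u; split => // W W0 WE.
have PsiS s : Psi (x - s *: (x - x0)) = ins ord0 (- s *: ((x - x0) *m E^T)) (s * E0).
  rewrite -[LHS](insE ord0); congr (ins _ _ _).
    by rewrite /Psi addrAC subrr add0r -scaleNr frame_del scalemxAl.
  by rewrite /Psi addrAC subrr add0r -scaleNr -scalemxAl mxE frame_coord// -/E0; ring.
have xs s : x - s *: (x - x0) = Phi (ins ord0 (- s *: ((x - x0) *m E^T)) (s * E0)) by rewrite -PsiS PhiK.
have WE' : (2 * W) ^+ m.+2 * (om * f x) ^+ 2 = m.+2%:R ^+ 2 * \prod_i (D 0 i - r^-1).
  by rewrite WE (prod_eigen _ kD).
rewrite AD in gA'.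
split => [c cW|c c0 cW].
  exact: (floating_upper TT TTm cK' bcK e0 chart' gA' Dr Kx E00 xs W0 WE' cW).
exact: (floating_lower TT TTm cK' bcK e0 chart' gA' Dr Kx E00 xs W0 WE' c0 cW).
Qed.

End pointwise.

Section complement.
Context {R : realType} {m : nat}.

Lemma orthonormal_complement (u : 'rV[R]_m.+1) : enorm u = 1 ->
  exists2 E : 'M[R]_(m, m.+1), E *m E^T = 1%:M & E *m u^T = 0.
Proof.
move=> u1; have [T TT uT] := orth_to_delta ord0 u1; have TT' := mulmx1C TT.
exists (row' ord0 T^T).
  apply/matrixP => i j; have := congr1 (fun M : 'M[R]_m.+1 => M (lift ord0 i) (lift ord0 j)) TT'.
  rewrite !mxE (inj_eq lift_inj) => <-; apply: eq_bigr => l _; by rewrite !mxE.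
apply/matrixP => i j; have : (u *m T) 0 (lift ord0 i) = 0.
  by rewrite uT mxE eqxx eq_sym (negbTE (neq_lift _ _)).
move=> uT0; transitivity ((u *m T) 0 (lift ord0 i)); last by rewrite uT0 mxE.
by rewrite ord1 !mxE; apply: eq_bigr => l _; rewrite !mxE mulrC.
Qed.

End complement.

(** * Second-order expansions of the gauge yield principal curvatures *)

Section second_order_chart.
Context {R : realType} {m : nat}.
Variables (j : 'rV[R]_m.+1 -> R) (L c : R) (X p : 'rV[R]_m.+1) (B : 'M[R]_m.+1).
Hypotheses (L0 : 0 <= L) (jL : forall x y, `|j x - j y| <= L * enorm (x - y))
  (jconv : forall x y t, 0 <= t <= 1 ->
    j ((1 - t) *: x + t *: y) <= (1 - t) * j x + t * j y)
  (c0 : 0 < c) (jX : j X = 1) (gX : good j c p X) (eX : exp2 j X p B) (p0 : p != 0).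

Let quad_gen (C : 'M[R]_m.+1) a v t : dotv ((a - t *: v) *m C) (a - t *: v) =
  dotv (a *m C) a - t * dotv (a *m C) v - t * dotv (v *m C) a + t ^+ 2 * dotv (v *m C) v.
Proof. by rewrite mulmxBl -scalemxAl !(dotvBl, dotvBr, dotvZl, dotvZr); ring. Qed.

Let P := enorm p.
Let u := P^-1 *: p.
Let P0 : 0 < P. Proof. by rewrite enorm_gt0. Qed.

Let pE : p = P *: u.
Proof. by rewrite /u scalerA mulfV ?scale1r// gt_eqF. Qed.

Let u1 : enorm u = 1.
Proof. by rewrite /u enormZ gtr0_norm ?invr_gt0// mulVf// gt_eqF. Qed.

Let uu : dotv u u = 1. Proof. by rewrite -sqr_enorm u1 expr1n. Qed.

Variable (E : 'M[R]_(m, m.+1)).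
Hypotheses (EE : E *m E^T = 1%:M) (Eu : E *m u^T = 0).

Let hh (y : 'rV[R]_m) (t : R) : 'rV[R]_m.+1 := y *m E - t *: u.
Let ph (y : 'rV[R]_m) (t : R) := j (X + hh y t).

Let uE y : dotv (y *m E) u = 0.
Proof. by rewrite /dotv -mulmxA Eu mulmx0 mxE. Qed.

Let yEE y : dotv (y *m E) (y *m E) = dotv y y.
Proof. by rewrite /dotv trmx_mul mulmxA -(mulmxA y) EE mulmx1. Qed.

Let ph_hh y t : dotv p (hh y t) = - (P * t).
Proof. by rewrite pE dotvZl /hh dotvBr dotvZr uu dotvC uE sub0r mulr1 mulrN. Qed.

Let hh2 y t : dotv (hh y t) (hh y t) = dotv y y + t ^+ 2.
Proof.
have := quad_gen 1%:M (y *m E) u t; rewrite !mulmx1 -/(hh y t) => ->.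
by rewrite uu yEE uE (dotvC u) uE; ring.
Qed.

Let ph_ge y t : 1 - P * t <= ph y t.
Proof. by have := good_sub jconv (hh y t) (ltW c0) gX; rewrite jX ph_hh. Qed.

Let ph_conv y t1 t2 t : t1 <= t -> t <= t2 -> ph y t1 <= 1 -> ph y t2 <= 1 -> ph y t <= 1.
Proof.
move=> t1t tt2 h1 h2; have [t12|t12] := eqVneq t1 t2.
  by have -> : t = t1 by apply/eqP; rewrite eq_le t1t t12 tt2.
have d0 : 0 < t2 - t1 by rewrite subr_gt0 lt_neqAle t12 (le_trans t1t).
pose s := (t - t1) / (t2 - t1).
have s01 : 0 <= s <= 1.
  by rewrite divr_ge0 ?subr_ge0 ?(le_trans t1t)//= ler_pdivrMr// mul1r lerB.
have := jconv (X + hh y t1) (X + hh y t2) s01.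
have -> : (1 - s) *: (X + hh y t1) + s *: (X + hh y t2) = X + hh y t.
  have tE : t = (1 - s) * t1 + s * t2 by rewrite /s; field; rewrite gt_eqF.
  by rewrite {}tE; apply/rowP => i; rewrite /hh !mxE; ring.
move/le_trans; apply; have /andP[s0 s1] := s01.
rewrite -/(ph _ _) -/(ph _ _).
have : (1 - s) * ph y t1 <= (1 - s) * 1 by rewrite ler_wpM2l// subr_ge0.
have : s * ph y t2 <= s * 1 by rewrite ler_wpM2l.
by rewrite !mulr1 => ? ?; lra.
Qed.

(** Along the inner normal the paraboloid at X is 1 - P t + c t^2, least at [tau] with value 1 - P^2
    / (4 c). *)
Let tau := P / (2 * c).
Let tau0 : 0 < tau. Proof. by rewrite divr_gt0// mulr_gt0. Qed.

(** Over |y| < [eps] the Lipschitz bound cannot use up the margin P^2 / (4 c), so the point at depth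
    [tau] stays in the body. *)
Let eps := Num.min tau (P ^+ 2 / (4 * c * (L + 1))).
Let eps0 : 0 < eps.
Proof. by rewrite lt_min tau0 divr_gt0 ?exprn_gt0// !mulr_gt0// ltr_wpDl. Qed.

Let ph_tau y : enorm y < eps -> ph y tau <= 1.
Proof.
rewrite lt_min => /andP[_ ye].
have h0 : ph 0 tau <= 1 - P ^+ 2 / (4 * c).
  have := gX (hh 0 tau); rewrite jX ph_hh hh2 dot0v add0r => /le_trans; apply.
  by rewrite le_eqVlt; apply/orP; left; apply/eqP; rewrite /tau; field; rewrite gt_eqF.
have := jL (X + hh y tau) (X + hh 0 tau); rewrite -/(ph _ _) -/(ph _ _).
have -> : X + hh y tau - (X + hh 0 tau) = y *m E.
  by rewrite /hh mul0mx; apply/rowP => i; rewrite !mxE; ring.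
have -> : enorm (y *m E) = enorm y by rewrite !enormE yEE.
rewrite ler_norml => /andP[_].
have : L * enorm y <= P ^+ 2 / (4 * c).
  apply: le_trans (_ : (L + 1) * enorm y <= _); first by rewrite ler_wpM2r ?enorm_ge0// lerDl.
  move/ltW: ye; rewrite ler_pdivlMr ?mulr_gt0 ?ltr_wpDl// => h.
  by rewrite ler_pdivlMr ?mulr_gt0//; apply: le_trans h; rewrite le_eqVlt; apply/orP; left; apply/eqP; ring.
by move=> ? ?; lra.
Qed.

Let G (y : 'rV[R]_m) := [set t | ph y t <= 1].
(** By convexity the body meets the line over y in an interval; this is its outer end, the depth of
    the boundary. *)
Let g (y : 'rV[R]_m) : R := inf (G y).

Let G_ge y t : G y t -> 0 <= t.
Proof.
rewrite /G/= => /(le_trans (ph_ge y t)); rewrite gerBl pmulr_rge0//.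
Qed.

Let has_inf_G y : enorm y < eps -> has_inf (G y).
Proof. by move=> ye; split; [exists tau; exact: ph_tau|exists 0 => t /G_ge]. Qed.

Let g_le y t : G y t -> g y <= t.
Proof. by move=> Gt; apply: inf_lbound => //; exists 0 => s /G_ge. Qed.

Let g_ge y t : enorm y < eps -> t <= tau -> ~ G y t -> t <= g y.
Proof.
move=> ye tt nG; apply: lb_le_inf; first by case: (has_inf_G ye).
move=> s Gs; rewrite leNgt; apply/negP => st; apply: nG.
by apply: (ph_conv (ltW st) tt) => //; exact: ph_tau.
Qed.

Let g_chart y t : enorm y < eps -> `|t| < eps -> ph y t <= 1 <-> g y <= t.
Proof.
move=> ye te; split; first exact: g_le.
move=> gt; rewrite leNgt; apply/negP => pt.
have tt : t <= tau by apply/ltW/(le_lt_trans (ler_norm t)); apply: lt_le_trans te _; rewrite ge_min lexx.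
pose d := (ph y t - 1) / (L + 1).
have d0 : 0 < d by rewrite divr_gt0 ?subr_gt0// ltr_wpDl.
have : t + d <= g y.
  apply: lb_le_inf; first by case: (has_inf_G ye).
  move=> s Gs; have ts : t < s.
    rewrite ltNge; apply/negP => st.
    by have := ph_conv st tt Gs (ph_tau ye); rewrite leNgt pt.
  have := jL (X + hh y t) (X + hh y s); rewrite -/(ph _ _) -/(ph _ _).
  have -> : X + hh y t - (X + hh y s) = (s - t) *: u.
    by rewrite /hh; apply/rowP => i; rewrite !mxE; ring.
  rewrite enormZ u1 mulr1 (gtr0_norm (_ : 0 < s - t)) ?subr_gt0// => /ler_normlP[_ h].
  rewrite -lerBrDl /d ler_pdivrMr ?ltr_wpDl//.
  move: Gs; rewrite /G/= => Gs.
  have : 0 <= s - t by rewrite subr_ge0 ltW.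
  by move=> ? ; nra.
by move=> /le_trans/(_ gt); rewrite gerDl leNgt d0.
Qed.

(** The second fundamental form of a level set: the tangential part of the symmetrised Hessian
    divided by the length of the gradient. *)
Let S := P^-1 *: (2^-1 *: (E *m (B + B^T) *m E^T)).

Let quadS y : dotv (y *m S) y = P^-1 * dotv (y *m E *m B) (y *m E).
Proof.
rewrite /S -!scalemxAr !dotvZl; congr (_ * _).
have tB (z w : 'rV[R]_m.+1) : dotv (z *m B^T) w = dotv (w *m B) z.
  by rewrite dotvC /dotv trmx_mul trmxK mulmxA.
have -> : dotv (y *m (E *m (B + B^T) *m E^T)) y = dotv (y *m E *m (B + B^T)) (y *m E).
  by rewrite /dotv trmx_mul !mulmxA.
by rewrite mulmxDr dotvDl tB; field.
Qed.

Let quad_hh : exists2 M : R, 0 <= M & forall y t, `|t| <= enorm y ->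
  `|dotv (hh y t *m B) (hh y t) - dotv (y *m E *m B) (y *m E)| <= M * `|t| * enorm y.
Proof.
have [M M0 MP] := mulmx_enorm_le B; exists (3 * M); first by rewrite mulr_ge0.
move=> y t ty; rewrite /hh quad_gen.
set a := dotv _ _; set b := dotv (y *m E *m B) u; set d := dotv (u *m B) (y *m E).
set e := dotv (u *m B) u.
have yE : enorm (y *m E) = enorm y by rewrite !enormE yEE.
have bM : `|b| <= M * enorm y.
  by apply: le_trans (normr_dotv _ _) _; rewrite u1 mulr1 -yE MP.
have dM : `|d| <= M * enorm y.
  by apply: le_trans (normr_dotv _ _) _; rewrite yE ler_wpM2r ?enorm_ge0//; apply: le_trans (MP _) _; rewrite u1 mulr1.
have eM : `|e| <= M.
  by apply: le_trans (normr_dotv _ _) _; rewrite u1 mulr1; apply: le_trans (MP _) _; rewrite u1 mulr1.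
have -> : a - t * b - t * d + t ^+ 2 * e - a = t * (t * e - b - d) by ring.
rewrite normrM; have -> : 3 * M * `|t| * enorm y = `|t| * (3 * M * enorm y) by ring.
rewrite ler_wpM2l//; apply: le_trans (ler_normB _ _) _.
have : `|t * e - b| <= `|t * e| + `|b| by exact: ler_normB.
have : `|t * e| <= enorm y * M by rewrite normrM ler_pM.
by move=> ? ?; lra.
Qed.

(** The expansion of [j] is tested at the depths q + e |y|^2 and q - e |y|^2 around the predicted
    value q; the level 1 is crossed between them because P e |y|^2 outweighs all errors. *)
Let g_expand (e : R) : 0 < e -> exists2 d : R, 0 < d & forall y, enorm y < d ->
  `|g y - 2^-1 * dotv (y *m S) y| <= e * enorm y ^+ 2.
Proof.
move=> e0; have [M M0 MP] := quad_hh; have [M1 M10 M1P] := mulmx_enorm_le S.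
pose C := M1 + e; have C0 : 0 < C by rewrite ltr_wpDl.
have [|d d0 dP] := eX (e := P * e / 16); first by rewrite divr_gt0// mulr_gt0.
have [ee [ee0 eeps ee1]] : exists ee, [/\ 0 < ee, ee <= eps & ee <= 1].
  exists (Num.min eps 1); split; first by rewrite lt_min eps0 ltr01.
    by rewrite ge_min lexx.
  by rewrite ge_min lexx orbT.
have [tt [tt0 tt1 ttau]] : exists tt, [/\ 0 < tt, tt <= 1 & tt <= tau].
  exists (Num.min 1 tau); split; first by rewrite lt_min tau0 ltr01.
    by rewrite ge_min lexx.
  by rewrite ge_min lexx orbT.
pose dd := Num.min (Num.min (d / 2) ee) (Num.min (tt / C) (P * e / (2 * (M * C + 1)))).
have MC : 0 < M * C + 1 by rewrite ltr_wpDl// mulr_ge0// ltW.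
exists dd.
  by rewrite !lt_min ee0 !divr_gt0//= ?mulr_gt0.
move=> y; rewrite !lt_min => /andP[/andP[yd yee] /andP[yt yM]].
have ye : enorm y < eps by exact: lt_le_trans eeps.
have y1 : enorm y <= 1 by apply: le_trans ee1; exact: ltW.
set Y := enorm y in yd ye y1 yt yM *; have Y0 : 0 <= Y by exact: enorm_ge0.
have [Y00|Y00] := eqVneq Y 0.
  have y0 : y = 0 by apply/eqP; rewrite -enorm_eq0 -/Y Y00.
  have g0 : g y = 0.
    apply/eqP; rewrite eq_le g_le; last by rewrite /G/= /ph /hh y0 mul0mx scale0r subr0 addr0 jX.
    by apply: lb_le_inf => [|t /G_ge//]; case: (has_inf_G ye).
  by rewrite g0 y0 dotv0 mulr0 subr0 normr0 Y00 expr0n/= mulr0.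
have {Y00}Y00 : 0 < Y by rewrite lt_neqAle eq_sym Y00.
set q := 2^-1 * dotv _ y.
have qM : `|q| <= M1 * Y ^+ 2.
  rewrite /q normrM gtr0_norm ?invr_gt0//.
  have : `|dotv (y *m S) y| <= M1 * Y ^+ 2.
    apply: le_trans (normr_dotv _ _) _; rewrite expr2 mulrA ler_wpM2r//; exact: M1P.
  by move=> ?; have := normr_ge0 (dotv (y *m S) y); lra.
have main (s : R) : `|s| = e -> let t := q + s * Y ^+ 2 in
    `|ph y t - (1 - P * (s * Y ^+ 2))| <= 2^-1 * (P * (e * Y ^+ 2)) /\ t <= tau.
  move=> se t; have tC : `|t| <= C * Y ^+ 2.
    apply: le_trans (ler_normD _ _) _; rewrite (normrM s) se (ger0_norm (sqr_ge0 Y)) /C mulrDl.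
    by rewrite lerD2r.
  have CYt : C * Y <= tt by rewrite mulrC -ler_pdivlMr// ltW.
  have CY1 : C * Y <= 1 by exact: le_trans tt1.
  have tY : `|t| <= Y by apply: le_trans tC _; rewrite expr2 mulrA ler_piMl.
  have ttau' : t <= tau.
    apply: le_trans (ler_norm t) _; apply: le_trans tC _; apply: le_trans ttau.
    by apply: le_trans CYt; rewrite expr2 mulrA ler_piMr// mulr_ge0// ltW.
  split => //.
  have hY : enorm (hh y t) <= 2 * Y.
    rewrite enorm_le ?mulr_ge0// hh2 exprMn -sqr_enorm -/Y.
    have : t ^+ 2 <= Y ^+ 2 by rewrite -real_normK ?num_real// lerXn2r ?nnegrE.
    by move=> ?; have := sqr_ge0 Y; lra.
  have := dP (hh y t); rewrite jX ph_hh -/(ph y t).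
  have hd : enorm (hh y t) < d by apply: le_lt_trans hY _; rewrite mulrC -ltr_pdivlMr.
  move=> /(_ hd) h1; have h2 := MP y t tY.
  have h3 : enorm (hh y t) ^+ 2 <= 4 * Y ^+ 2.
    by rewrite (_ : 4 * Y ^+ 2 = (2 * Y) ^+ 2); [rewrite lerXn2r ?nnegrE ?mulr_ge0 ?enorm_ge0|ring].
  have h4 : M * `|t| * enorm y <= 2^-1 * (P * (e * Y ^+ 2)).
    rewrite -/Y; apply: le_trans (_ : (M * C * Y) * Y ^+ 2 <= _).
      rewrite -!mulrA ler_wpM2l// (_ : C * (Y * Y ^+ 2) = C * Y ^+ 2 * Y); last by ring.
      by rewrite ler_wpM2r.
    have : (M * C + 1) * Y <= P * e / 2.
      by move/ltW: yM; rewrite ler_pdivlMr ?mulr_gt0// ler_pdivlMr// => yM; apply: le_trans yM; rewrite le_eqVlt; apply/orP; left; apply/eqP; ring.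
    move=> h4; rewrite (_ : 2^-1 * _ = (P * e / 2) * Y ^+ 2); last by ring.
    rewrite ler_wpM2r ?sqr_ge0//; apply: le_trans h4; rewrite ler_wpM2r// lerDl//.
  have qE : dotv (y *m E *m B) (y *m E) = 2 * P * q.
    by rewrite /q quadS; field; rewrite gt_eqF.
  rewrite qE in h2; rewrite opprK in h1.
  have h5 := le_trans h2 h4.
  have h6 : P * e / 16 * enorm (hh y t) ^+ 2 <= 4^-1 * (P * (e * Y ^+ 2)).
    apply: le_trans (ler_wpM2l _ h3) _; first by rewrite divr_ge0// mulr_ge0// ltW.
    by rewrite le_eqVlt; apply/orP; left; apply/eqP; field.
  have h7 := le_trans h1 h6.
  have tE : P * t = P * q + P * (s * Y ^+ 2) by rewrite /t mulrDr.
  rewrite tE in h7; move: h5 h7.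
  move: (P * (s * Y ^+ 2)) (P * (e * Y ^+ 2)) (ph y t) (dotv _ _) => a1 a2 a3 a4.
  have -> : 2 * P * q = 2 * (P * q) by rewrite mulrA.
  move: (P * q) => a5; rewrite !ler_norml => /andP[? ?] /andP[? ?].
  by apply/andP; split; lra.
have eY0 : 0 < P * (e * Y ^+ 2) by rewrite !mulr_gt0.
have [h1 _] := main e (gtr0_norm e0).
have [h2 h2t] : `|ph y (q + - e * Y ^+ 2) - (1 - P * (- e * Y ^+ 2))| <= 2^-1 * (P * (e * Y ^+ 2)) /\
  q + - e * Y ^+ 2 <= tau by apply: main; rewrite normrN gtr0_norm.
have g1 : g y <= q + e * Y ^+ 2.
  apply: g_le; rewrite /G/=; move: h1; rewrite ler_norml => /andP[_ ?]; lra.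
have g2 : q + - e * Y ^+ 2 <= g y.
  apply: g_ge => //; rewrite /G/=; apply/negP; rewrite -ltNge.
  move: h2; rewrite mulNr mulrN opprK ler_norml => /andP[? _]; lra.
rewrite ler_norml; apply/andP; split; first by rewrite lerBrDl -mulNr.
by rewrite lerBlDl.
Qed.

Lemma chart_curvatures (K : set 'rV[R]_m.+1) (x0 : 'rV[R]_m.+1) :
  (forall w, K w <-> j (w - x0) <= 1) -> exists k, is_principal_curvatures K (x0 + X) k.
Proof.
move=> KE.
have St : S^T = S.
  rewrite /S !linearZ/= !trmx_mul trmxK raddfD/= trmxK (addrC B^T) mulmxA.
  by rewrite !scalerA mulrC.
have [T [D [TT SE]]] := sym_spectral St.
exists D; exists u, E, S, g; split => //.
- split => //; by rewrite [u *m u^T]mx11_scalar -/(dotv u u) uu.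
- exists eps => // y t ye te; rewrite KE; rewrite -(g_chart ye te) /ph /hh.
  by have -> : x0 + X + y *m E - t *: u - x0 = X + (y *m E - t *: u)
    by apply/rowP => i; rewrite !mxE; ring.
- move=> e e0; have [d d0 dP] := g_expand e0; apply/near_enorm; exists d => // y.
  by rewrite /= subr0 => /dP.
- by rewrite SE char_poly_spectral.
Qed.

End second_order_chart.

(** * The cone formula *)

Section measure_comparison.
Context {d : measure_display} {T : measurableType d} {R : realType}.
Implicit Types (mu nu : {measure set T -> \bar R}) (D : set T) (f : T -> \bar R).
Import HBNNSimple.
Local Open Scope ereal_scope.

Lemma le_measure_integral mu nu D f : (forall x, D x -> 0 <= f x) ->
  (forall A, measurable A -> A `<=` D -> mu A <= nu A) ->
  \int[mu]_(x in D) f x <= \int[nu]_(x in D) f x.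
Proof.
move=> f0 mn; rewrite !ge0_integralE//; apply: ge_ereal_sup => _ [h /= hf <-].
apply: ereal_sup_ge; exists (sintegral nu h); first by exists h.
rewrite !sintegralE; apply: lee_fsum => // x [t _ <-].
have [h0|h0] := eqVneq (h t) 0%R; first by rewrite h0 !mul0e.
rewrite lee_wpmul2l ?lee_fin//; apply: mn => // s /= hs.
have := hf s; rewrite patchE; case: ifPn => [/set_mem//|_].
by rewrite lee_fin hs le_eqVlt (negbTE h0)/= ltNge fun_ge0.
Qed.

Lemma le_measure_integralZ (c c' : R) mu nu D f : (0 <= c)%R -> (0 <= c')%R -> measurable D ->
  measurable_fun D f -> (forall x, D x -> 0 <= f x) ->
  (forall A, measurable A -> A `<=` D -> c%:E * mu A <= c'%:E * nu A) ->
  c%:E * \int[mu]_(x in D) f x <= c'%:E * \int[nu]_(x in D) f x.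
Proof.
move=> c0 c'0 mD mf f0 mn; have [C CE] : exists C : {nonneg R}, C%:num%R = c by exists (NngNum c0).
have [C' CE'] : exists C : {nonneg R}, C%:num%R = c' by exists (NngNum c'0).
rewrite -CE -CE' -!ge0_integral_mscale//; apply: le_measure_integral => // A mA AD.
change (C%:num%:E * mu A <= C'%:num%:E * nu A); rewrite CE CE'; exact: mn.
Qed.

(** On each piece of a countable cover w is almost a constant [p i], and mu almost [p i] times nu,
    both up to the factor r; the integrals then agree up to r^2, and r tends to 1. This replaces an
    explicit change of variables. *)
Lemma integral_density mu nu D (w : T -> R) f : measurable D ->
  (forall x, D x -> 0 < w x)%R -> measurable_fun D w ->
  measurable_fun D f -> (forall x, D x -> 0 <= f x) ->
  (forall r, (0 < r < 1)%R -> exists (C : (set T)^nat) (p : R^nat), [/\ D `<=` \bigcup_i C i,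
    (forall i, measurable (C i)), (forall i, (0 < p i)%R),
    (forall i x, D x -> C i x -> (r * w x <= p i)%R /\ (r * p i <= w x)%R) &
    (forall i A, measurable A -> A `<=` C i -> A `<=` D ->
       (r%:E * mu A <= (p i)%:E * nu A) /\ ((r * p i)%:E * nu A <= mu A))]) ->
  \int[mu]_(x in D) f x = \int[nu]_(x in D) (f x * (w x)%:E).
Proof.
move=> mD w0 mw mf f0 HC.
have mfw : measurable_fun D (fun x => f x * (w x)%:E).
  by apply: emeasurable_funM => //; exact/measurable_EFinP.
have fw0 x : D x -> 0 <= f x * (w x)%:E by move=> Dx; rewrite mule_ge0 ?f0// lee_fin ltW// w0.
have I0 : 0 <= \int[mu]_(x in D) f x by exact: integral_ge0.
have J0 : 0 <= \int[nu]_(x in D) (f x * (w x)%:E) by exact: integral_ge0.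
have main r : (0 < r < 1)%R ->
    (r * r)%:E * \int[mu]_(x in D) f x <= \int[nu]_(x in D) (f x * (w x)%:E) /\
    (r * r)%:E * \int[nu]_(x in D) (f x * (w x)%:E) <= \int[mu]_(x in D) f x.
  move=> r01; have /andP[r0 r1] := r01; have rr0 : (0 <= r * r)%R by rewrite mulr_ge0// ltW.
  have [C [p [DC mC p0 wp muC]]] := HC _ r01.
  pose F i := D `&` seqDU C i.
  have mF i : measurable (F i) by apply: measurableI => //; exact: seqDU_measurable.
  have FD i : F i `<=` D by move=> x [].
  have FC i : F i `<=` C i by move=> x [_ []].
  have DF : D = \bigcup_i F i.
    rewrite -setI_bigcupr -seqDU_bigcup_eq; apply/esym/setIidPl; exact: DC.
  have tF : trivIset setT F by apply: trivIset_setIl; exact: trivIset_seqDU.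
  have mD' : measurable_fun (\bigcup_i F i) f by rewrite -DF.
  have mDw : measurable_fun (\bigcup_i F i) (fun x => f x * (w x)%:E) by rewrite -DF.
  have f0' x : (\bigcup_i F i) x -> 0 <= f x by rewrite -DF; exact: f0.
  have fw0' x : (\bigcup_i F i) x -> 0 <= f x * (w x)%:E by rewrite -DF; exact: fw0.
  have fi0 i x : F i x -> 0 <= f x by move=> /FD; exact: f0.
  have fwi0 i x : F i x -> 0 <= f x * (w x)%:E by move=> /FD; exact: fw0.
  have mfi i : measurable_fun (F i) f by exact: measurable_funS mf.
  have mfwi i : measurable_fun (F i) (fun x => f x * (w x)%:E) by exact: measurable_funS mfw.
  have rE i : (r * r)%:E * \int[mu]_(x in F i) f x <= \int[nu]_(x in F i) (f x * (w x)%:E).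
    rewrite EFinM -muleA.
    apply: (@le_trans _ _ (r%:E * ((p i)%:E * \int[nu]_(x in F i) f x))).
      rewrite lee_wpmul2l ?lee_fin ?(ltW r0)//; apply: le_measure_integralZ => //.
      - exact: ltW.
      - exact: ltW.
      - move=> x; exact: fi0.
      - by move=> A mA AF; have [] := muC i A mA (subset_trans AF (FC i)) (subset_trans AF (FD i)).
    rewrite muleA -EFinM -ge0_integralZl//; last 2 first.
      - move=> x; exact: fi0.
      - by rewrite lee_fin mulr_ge0// ltW.
    apply: ge0_le_integral => //.
    - by move=> x Fx; rewrite mule_ge0 ?lee_fin ?mulr_ge0 ?(ltW r0) ?(ltW (p0 i))//; exact: fi0 Fx.
    - exact: measurable_funeM.
    - move=> x Fx; rewrite muleC lee_wpmul2l ?(fi0 _ _ Fx)// lee_fin.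
      by have [] := wp i x (FD _ _ Fx) (FC _ _ Fx).
  have lE i : (r * r)%:E * \int[nu]_(x in F i) (f x * (w x)%:E) <= \int[mu]_(x in F i) f x.
    rewrite -[leRHS]mul1e.
    apply: (@le_trans _ _ ((r * p i)%:E * \int[nu]_(x in F i) f x)); last first.
      apply: le_measure_integralZ => //.
      - by rewrite mulr_ge0 ?ltW.
      - move=> x; exact: fi0.
      - by move=> A mA AF; rewrite mul1e; have [] := muC i A mA (subset_trans AF (FC i)) (subset_trans AF (FD i)).
    have rp0 : 0 <= (r * p i)%:E by rewrite lee_fin mulr_ge0// ltW.
    rewrite -(ge0_integralZl _ (mF i) (mfi i) (fi0 i) rp0).
    rewrite -(ge0_integralZl _ (mF i) (mfwi i) (fwi0 i))//.
    apply: ge0_le_integral => //.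
    - by move=> x Fx; rewrite mule_ge0 ?lee_fin//; exact: fwi0 Fx.
    - exact: measurable_funeM.
    - exact: measurable_funeM.
    - move=> x Fx; rewrite muleCA muleC lee_wpmul2r ?(fi0 _ _ Fx)// -EFinM lee_fin -mulrA ler_wpM2l ?(ltW r0)//.
      by have [] := wp i x (FD _ _ Fx) (FC _ _ Fx).
  rewrite DF !ge0_integral_bigcup//; split.
    rewrite -nneseriesZl; last by move=> i _; apply: integral_ge0 => x; exact: fi0.
    apply: lee_nneseries => // i _ _; rewrite mule_ge0 ?lee_fin//.
    by apply: integral_ge0 => x; exact: fi0.
  rewrite -nneseriesZl; last by move=> i _; apply: integral_ge0 => x; exact: fwi0.
  apply: lee_nneseries => // i _ _; rewrite mule_ge0 ?lee_fin//.
  by apply: integral_ge0 => x; exact: fwi0.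
have sq (r : R) : (0 < r < 1)%R -> exists2 s : R, (0 < s < 1)%R & (r = s * s)%R.
  move=> /andP[r0 r1]; exists (Num.sqrt r); last by rewrite -expr2 sqr_sqrtr// ltW.
  by rewrite sqrtr_gt0 r0/= -[ltRHS]sqrtr1 ltr_sqrt.
apply/eqP; rewrite eq_le; apply/andP; split; apply/lee_mul01Pr => // r /sq[s s01 ->].
  exact: (main s s01).1.
exact: (main s s01).2.
Qed.

End measure_comparison.

Lemma bernoulli_le (R : realType) (e : R) (N : nat) : 0 <= e <= 1 -> 1 - N%:R * e <= (1 - e) ^+ N.
Proof.
move=> /andP[e0 e1]; elim: N => [|N IH]; first by rewrite mul0r subr0 expr0.
have [h|h] := lerP 0 (1 - N%:R * e).
  rewrite exprS; apply: le_trans (ler_wpM2l _ IH); last by rewrite subr_ge0.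
  rewrite -natr1; have : 0 <= N%:R * e * e by rewrite !mulr_ge0.
  by move=> ?; lra.
apply: le_trans (exprn_ge0 _ _); last by rewrite subr_ge0.
rewrite -natr1 mulrDl mul1r; lra.
Qed.

Lemma countable_net (R : realType) (n : nat) (e : R) : 0 < e ->
  exists c : nat -> 'rV[R]_n, forall x, exists i, enorm (x - c i) <= e.
Proof.
move=> e0; pose s := e / n.+1%:R; have s0 : 0 < s by rewrite divr_gt0.
exists (fun i => if unpickle i is Some z then s *: map_mx (fun k : int => k%:~R) (z : 'rV[int]_n) else 0) => x.
exists (pickle (map_mx (fun t => Num.floor (t / s)) x : 'rV[int]_n)); rewrite pickleK.
apply: le_trans (enorm_le_norm _) _; apply: (@le_trans _ _ (n%:R * s)); last first.
  by rewrite /s mulrCA ler_piMr ?(ltW e0)// ler_pdivrMr// mul1r ler_nat.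
rewrite ler_wpM2l//; rewrite [leLHS]/Num.norm/= mx_normrE; apply/bigmax_leP; split; first exact: ltW.
move=> /= -[j i] _ /=; rewrite !mxE ord1; set y := x 0 i / s.
have -> : x 0 i = s * y by rewrite /y mulrC divfK// gt_eqF.
rewrite -mulrBr normrM gtr0_norm// ler_piMr ?(ltW s0)//.
have /andP[h1 h2] := floor_itv y; rewrite intrD in h2; rewrite ler_norml; apply/andP; split; lra.
Qed.

Section null_hyperplane.
Context {R : realType} {m : nat}.

Lemma null_hull (n : nat) (A : set 'rV[R]_n) : lnull A ->
  exists Z : set 'rV[R]_n, [/\ measurable (Z : set (@borelRV R n)), A `<=` Z & lam n Z = 0%E].
Proof.
move=> A0; have /choice[C CP] : forall k : nat, exists C : set 'rV[R]_n,
    [/\ measurable (C : set (@borelRV R n)), A `<=` C & (lam n C <= (k.+1%:R^-1)%:E)%E].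
  move=> k; have [|C [mC AC] lC] := @borel_outer R n A k.+1%:R^-1; first by rewrite invr_gt0.
  by exists C; split => //; rewrite A0 add0e in lC.
exists (\bigcap_k C k); split.
- by apply: bigcapT_measurable => k; case: (CP k).
- by move=> x Ax k _; have [_ h _] := CP k; exact: h.
apply/eqP; rewrite eq_le outer_measure_ge0 andbT; apply/lee_addgt0Pr => e e0; rewrite add0e.
have /ltr_add_invr[k] : 0 < e := e0; rewrite add0r => ke.
have [_ _ lC] := CP k; apply: (@le_trans _ _ (lam n (C k))).
  by apply: le_outer_measure => x; apply.
by apply: le_trans lC _; rewrite lee_fin ltW.
Qed.

(** [A] is arbitrary here, so the formula for Borel pieces is not at hand. A Borel null set
    containing the rotated cone has fibres at heights in [b / 2, b] that contain scaled copies of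
    the projection of [A]; a projection of positive measure would contradict Fubini. *)
Lemma hausdorff_hyperplane_null (p : 'rV[R]_m.+1) (A : set 'rV[R]_m.+1) : p != 0 ->
  (forall x, A x -> dotv p x = 1) -> lnull (hcone p A) -> hausdorff_outer m A = 0%E.
Proof.
move=> p0 Ap N0; have P0 : 0 < enorm p by rewrite enorm_gt0.
pose b := (enorm p)^-1; have b0 : 0 < b by rewrite invr_gt0.
have [|T TT pT] := @orth_to_delta R _ (b *: p) ord0.
  by rewrite enormZ gtr0_norm// mulVf// gt_eqF.
have dE (x : 'rV[R]_m.+1) : dotv x (delta_mx 0 ord0) = x 0 ord0.
  by rewrite dotvE (bigD1 ord0)//= !mxE !eqxx mulr1 big1 ?addr0// => j j0;
     rewrite !mxE eqxx (negbTE j0) mulr0.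
have coord x : b * dotv p x = (x *m T) 0 ord0.
  by rewrite -dotvZl -(dotv_mulmx _ _ TT) pT dotvC dE.
pose v (x : 'rV[R]_m.+1) := del ord0 (x *m T).
have zE x : A x -> x *m T = ins ord0 (v x) b.
  by move=> Ax; rewrite -[LHS](insE ord0) -coord Ap// mulr1.
have HA : (hausdorff_outer m A <= lam m (v @` A))%E.
  rewrite -hausdorff_lebesgue -{1}(image_id A).
  have := @hausdorff_lipschitz _ _ _ m _ 1 id v A ltr01; rewrite expr1n mul1e; apply => x y Ax Ay.
  by rewrite mul1r -(enorm_mulmx _ TT) mulmxBl !zE// insB subrr enorm_ins.
suff v0 : lam m (v @` A) = 0%E by apply/eqP; rewrite eq_le outer_measure_ge0 andbT -v0.
have CT0 : lnull [set x *m T | x in hcone p A] by rewrite /lnull lebesgue_orth.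
have [Z [mZ CZ Z0]] := null_hull CT0.
have mS : measurable_fun setT (fun t : R => lam m [set y | Z (ins ord0 y t)]).
  have mB := measurable_ins (R := R) (ord0 : 'I_m.+1) measurableT mZ; rewrite setTI in mB.
  rewrite (_ : (fun t => _) = (fun t => @leb R m (ysection ((fun yt : @borelRV R m * R =>
    ins ord0 yt.1 yt.2 : @borelRV R m.+1) @^-1` Z) t))); first exact: measurable_fun_ysection.
  by apply/funext => t; congr (lam m _); apply/seteqP; split => y; rewrite /ysection/= inE.
have slice t : b / 2 <= t -> t <= b -> ((2^-1 ^+ m)%:E * lam m (v @` A) <= lam m [set y | Z (ins ord0 y t)])%E.
  move=> bt tb; have t0 : 0 < t by apply: lt_le_trans bt; rewrite divr_gt0.
  pose s := t / b; have s0 : 0 < s by rewrite divr_gt0.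
  apply: (@le_trans _ _ ((s ^+ m)%:E * lam m (v @` A))%E).
    rewrite lee_wpmul2r ?outer_measure_ge0// lee_fin lerXn2r ?nnegrE ?(ltW s0)//.
    by rewrite /s ler_pdivlMr// mulrC.
  rewrite -{1}(gtr0_norm s0) -lebesgueZ ?gt_eqF//; apply: le_outer_measure => _ [_ [x Ax <-] <-] /=.
  apply: CZ; exists (s *: x).
    rewrite /hcone/= dotvZr Ap// mulr1 s0 /s ler_pdivrMr// mul1r tb; split => //.
    by rewrite scalerA mulVf ?scale1r// gt_eqF.
  by rewrite -scalemxAl zE// insZ /s divfK// gt_eqF.
have := lebesgue_fubini_ord ord0 mZ; rewrite Z0 => /esym I0.
have I1 : (\int[@lebesgue_measure R]_(t in `[(b / 2)%R, b]%classic) cst ((2^-1 ^+ m)%:E * lam m (v @` A)) t <= 0)%E.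
  rewrite -I0; apply: (@le_trans _ _ (\int[@lebesgue_measure R]_(t in `[(b / 2)%R, b]%classic) lam m [set y | Z (ins ord0 y t)])%E).
    apply: ge0_le_integral => //.
    - by move=> t _; rewrite mule_ge0 ?outer_measure_ge0// lee_fin exprn_ge0// invr_ge0.
    - exact: measurable_funTS.
    - by move=> t; rewrite /= in_itv/= => /andP[h1 h2]; exact: slice.
  by apply: ge0_subset_integral => // t _; exact: outer_measure_ge0.
rewrite integral_cst// in I1.
have e := lebesgue_measure_itvcc (b / 2) b.
have {}I1 : ((2^-1 ^+ m)%:E * lam m (v @` A) * (b / 2)%:E <= 0)%E.
  apply: le_trans I1; apply: lee_wpmul2l.
    by rewrite mule_ge0 ?outer_measure_ge0// lee_fin exprn_ge0// invr_ge0.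
  apply: le_trans (_ : (Num.max 0 (b - b / 2))%:E <= _)%E; last by rewrite -e.
  by rewrite lee_fin le_max; apply/orP; right; lra.
apply/eqP; rewrite eq_le outer_measure_ge0 andbT leNgt; apply/negP => h.
by move: I1; rewrite leNgt mule_gt0// ?lte_fin ?divr_gt0// mule_gt0// lte_fin exprn_gt0// invr_gt0.
Qed.

End null_hyperplane.

(** * Radial projection onto the boundary of the body *)

Section radial.
Context {R : realType} {m : nat}.
Variables (j : 'rV[R]_m.+1 -> R) (L M : R).
Hypotheses (L0 : 0 < L) (jL : forall x y, `|j x - j y| <= L * enorm (x - y))
  (jconv : forall x y t, 0 <= t <= 1 ->
    j ((1 - t) *: x + t *: y) <= (1 - t) * j x + t * j y)
  (jZ : forall a y, 0 < a -> j (a *: y) = a * j y) (j0 : j 0 = 0)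
  (M0 : 0 < M) (jM : forall y, enorm y <= M * j y).

Notation H := (@hausdorff_outer R m.+1 m).
Notation B := (@borelRV R m.+1).
Notation n := (m.+1%:R : R).

Lemma radial_le y : j y <= L * enorm y.
Proof. by have := jL y 0; rewrite j0 !subr0; apply: le_trans; exact: ler_norm. Qed.

Lemma radial_ge0 y : 0 <= j y.
Proof. by rewrite -(pmulr_rge0 _ M0); apply: le_trans (jM y); exact: enorm_ge0. Qed.

Lemma radial_gt0 y : (0 < j y) = (y != 0).
Proof.
apply/idP/idP => [jy|y0]; first by apply: contraTneq jy => ->; rewrite j0 ltxx.
by rewrite -(pmulr_rgt0 _ M0); apply: lt_le_trans (jM y); rewrite enorm_gt0.
Qed.

Lemma radial_continuous : continuous j.
Proof. exact: lipschitz_enorm_continuous jL. Qed.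

(* The value 0 outside the body keeps the preimages of subsets of {j = 1} inside it. *)
Definition radial (y : 'rV[R]_m.+1) : 'rV[R]_m.+1 := if 0 < j y <= 1 then (j y)^-1 *: y else 0.

Definition jcone (A : set 'rV[R]_m.+1) : set 'rV[R]_m.+1 := [set y | 0 < j y <= 1 /\ A ((j y)^-1 *: y)].

Lemma radial_preimage A : ~ A 0 -> radial @^-1` A = jcone A.
Proof.
move=> A0; apply/seteqP; split => y; rewrite /jcone/radial/=; case: ifPn => h //.
- by case.
- by case.
Qed.

Lemma radial_scale_in y : 0 < j y <= 1 -> radial y = (j y)^-1 *: y.
Proof. by rewrite /radial => ->. Qed.

Let open_nz : open [set y : 'rV[R]_m.+1 | 0 < j y].
Proof.
apply: (@open_comp _ _ j [set t : R | 0 < t]); last exact: open_gt.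
by move=> y _; exact: radial_continuous.
Qed.

Let measurable_ray (A : set 'rV[R]_m.+1) : measurable (A : set B) ->
  measurable ([set y | 0 < j y] `&` (fun y => (j y)^-1 *: y) @^-1` A : set B).
Proof.
move=> mA; pose h (y : 'rV[R]_m.+1) : 'rV[R]_m.+1 := (j y)^-1 *: y.
have cr (x : 'rV[R]_m.+1) : 0 < j x -> {for x, continuous h}.
  move=> jx; apply: (@scale_continuous R m.+1 (fun y => (j y)^-1) x); apply: (@continuous_comp _ _ _ j (fun t : R => t^-1)).
    exact: radial_continuous.
  by apply: inv_continuous; rewrite gt_eqF.
have := @borel_continuous_in R m.+1 m.+1 [set y | 0 < j y] _ open_nz cr.
by move=> /(_ (borel_open open_nz) A mA).
Qed.

Lemma measurable_jcone (A : set 'rV[R]_m.+1) : measurable (A : set B) -> measurable (jcone A : set B).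
Proof.
move=> mA; have -> : jcone A = [set y | j y <= 1] `&`
    ([set y | 0 < j y] `&` (fun y => (j y)^-1 *: y) @^-1` A).
  by apply/seteqP; split => [y [/andP[? ?] ?]|y [? [? ?]]] //; split => //; apply/andP.
apply: measurableI.
  by apply: borel_closed; apply: (@closed_comp _ _ j [set t : R | t <= 1]) => [y _|];
    [exact: radial_continuous|exact: closed_le].
exact: measurable_ray.
Qed.

Lemma measurable_radial : measurable_fun setT (radial : B -> B).
Proof.
move=> _ A mA; rewrite setTI.
have -> : radial @^-1` A = jcone A `|` (~` jcone setT `&` [set _ | A 0]).
  apply/seteqP; split => y; rewrite /jcone/radial/=; case: ifPn => h.
  - by move=> Ay; left.
  - by move=> A0; right; split => // -[].
  - by case=> [[_ //]|[nh _]]; exfalso; apply: nh.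
  - by case=> [[]|[_ //]].
apply: measurableU; first exact: measurable_jcone.
apply: measurableI; first by apply: measurableC; apply: measurable_jcone.
have [A0|A0] := pselect (A 0).
  by rewrite (_ : [set _ | A 0] = setT)//; apply/seteqP; split.
by rewrite (_ : [set _ | A 0] = set0)//; apply/seteqP; split.
Qed.

Lemma jcone_scale (A : set 'rV[R]_m.+1) s y : 0 < s -> jcone A y -> s * j y <= 1 -> jcone A (s *: y).
Proof.
move=> s0 [/andP[jy _] Ay] sj; split; rewrite jZ//; first by rewrite mulr_gt0.
by rewrite scalerA invfM mulrAC mulVf ?mul1r// gt_eqF.
Qed.

Section chart.
Variables (p : 'rV[R]_m.+1) (A : set 'rV[R]_m.+1) (l : R).
Hypotheses (mA : measurable (A : set B)) (A1 : forall y, A y -> j y = 1)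
  (pA : forall y, A y -> 0 < dotv p y) (p0 : p != 0) (l0 : 0 < l).

(** Radial projection to a hyperplane, where the relation between Hausdorff measure and cone volume
    is exact. *)
Let pr (y : 'rV[R]_m.+1) := (dotv p y)^-1 *: y.

Let prA := [set z | dotv p z = 1 /\ A ((j z)^-1 *: z)].

Let jpr y : A y -> j (pr y) = (dotv p y)^-1.
Proof. by move=> Ay; rewrite /pr jZ ?invr_gt0 ?pA// A1// mulr1. Qed.

Let prAE : prA = pr @` A.
Proof.
apply/seteqP; split => [z [pz Az]|_ [y Ay <-]]; rewrite /prA/=.
  have z0 : z != 0 by apply: contra_eq_neq pz => ->; rewrite dotv0 eq_sym oner_neq0.
  exists ((j z)^-1 *: z) => //; rewrite /pr dotvZr pz mulr1 invrK scalerA mulfV ?scale1r//.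
  by rewrite gt_eqF// radial_gt0.
split; first by rewrite /pr dotvZr mulVf// gt_eqF// pA.
by rewrite jpr// invrK /pr scalerA mulfV ?scale1r// gt_eqF// pA.
Qed.

Let mprA : measurable (prA : set B).
Proof.
have -> : prA = [set z | dotv p z = 1] `&` ([set z | 0 < j z] `&` (fun z => (j z)^-1 *: z) @^-1` A).
  apply/seteqP; split => [z [pz Az]|z [pz [_ Az]]] //; split => //; split => //=.
  by rewrite radial_gt0; apply: contra_eq_neq pz => ->; rewrite dotv0 eq_sym oner_neq0.
apply: measurableI.
  by apply: borel_closed; apply: (@closed_comp _ _ (dotv p) [set t : R | t = 1]) => [z _|];
    [exact: dotv_continuous|exact: closed_eq].
exact: measurable_ray.
Qed.

Let HprA : H (pr @` A) = ((enorm p * n)%:E * lam m.+1 (hcone p prA))%E.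
Proof. by rewrite -prAE; apply: hausdorff_hyperplane => // x []. Qed.

Let hcone_le : (forall y, A y -> l <= dotv p y) ->
  ((l ^+ m.+1)%:E * lam m.+1 (hcone p prA) <= lam m.+1 (jcone A))%E.
Proof.
move=> lp; rewrite -{1}(gtr0_norm l0) -lebesgueZ ?gt_eqF//; apply: le_outer_measure => _ [y [py Ay] <-].
have [pz Az] := Ay; have /andP[s0 s1] := py.
have yE : y = dotv p y *: ((dotv p y)^-1 *: y) by rewrite scalerA mulfV ?scale1r// gt_eqF.
rewrite [in l *: y]yE; move: (dotv p y) ((dotv p y)^-1 *: y) pz Az s0 s1 => s z pz Az s0 s1.
have jz : 0 < j z by rewrite radial_gt0; apply: contra_eq_neq pz => ->; rewrite dotv0 eq_sym oner_neq0.
have lj : l * j z <= 1.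
  have := lp _ Az; rewrite dotvZr pz mulr1 => h.
  by rewrite -(mulVf (lt0r_neq0 jz)) ler_wpM2r// ltW.
rewrite scalerA; split; rewrite jZ ?mulr_gt0//.
  by rewrite /= mulrAC mulr_ile1// ?mulr_ge0 ?(ltW l0) ?(ltW jz) ?(ltW s0).
by rewrite scalerA (_ : (l * s * j z)^-1 * (l * s) = (j z)^-1)//; field; rewrite !gt_eqF.
Qed.

Lemma hausdorff_chart_null : (forall y z, A y -> A z -> l * enorm (y - z) <= enorm (pr y - pr z)) ->
  (forall y, A y -> l <= dotv p y) -> lam m.+1 (jcone A) = 0%E -> H A = 0%E.
Proof.
move=> lpr lp A0; have lV : 0 < l^-1 by rewrite invr_gt0.
have h1 : (H (id @` A) <= ((l^-1) ^+ m)%:E * H (pr @` A))%E.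
  apply: hausdorff_lipschitz => // y z Ay Az; rewrite ler_pdivlMl//; exact: lpr.
have lm : 0 < l ^+ m.+1 by rewrite exprn_gt0.
have p00 : lnull (hcone p prA).
  apply/eqP; rewrite eq_le outer_measure_ge0 andbT leNgt; apply/negP => h.
  by have := hcone_le lp; rewrite A0 leNgt mule_gt0// lte_fin.
apply/eqP; rewrite eq_le outer_measure_ge0 andbT; move: h1.
by rewrite image_id -prAE (hausdorff_hyperplane_null p0 _ p00) ?mule0// => x [].
Qed.

(** A factor l^m comes from the Lipschitz constant of the inverse of [pr], a factor l^(m + 1) from
    fitting the scaled cone over the flat piece into the cone over [A]. *)
Lemma hausdorff_chart_le : (forall y z, A y -> A z -> l * enorm (y - z) <= enorm (pr y - pr z)) ->
  (forall y, A y -> l <= dotv p y) ->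
  ((l ^+ (m + m.+1))%:E * H A <= (enorm p * n)%:E * lam m.+1 (jcone A))%E.
Proof.
move=> lpr lp; have lV : 0 < l^-1 by rewrite invr_gt0.
have h1 : (H (id @` A) <= ((l^-1) ^+ m)%:E * H (pr @` A))%E.
  apply: hausdorff_lipschitz => // y z Ay Az; rewrite ler_pdivlMl//; exact: lpr.
rewrite image_id HprA in h1.
have h2 := hcone_le lp.
have h3 : ((l ^+ m)%:E * H A <= (enorm p * n)%:E * lam m.+1 (hcone p prA))%E.
  have lm : 0 < l ^+ m by rewrite exprn_gt0.
  apply: le_trans (lee_wpmul2l _ h1) _; first by rewrite lee_fin ltW.
  by rewrite muleA -EFinM -exprMn mulfV ?gt_eqF// expr1n mul1e.
rewrite exprD EFinM muleAC; apply: (@le_trans _ _ ((l ^+ m.+1)%:E * ((enorm p * n)%:E * lam m.+1 (hcone p prA)))%E).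
  rewrite muleC lee_wpmul2l//; last by rewrite lee_fin exprn_ge0// ltW.
rewrite muleCA lee_wpmul2l// lee_fin mulr_ge0 ?enorm_ge0//.
Qed.

Lemma hausdorff_chart_ge : (forall y z, A y -> A z -> l * enorm (pr y - pr z) <= enorm (y - z)) ->
  (forall y, A y -> l * dotv p y <= 1) ->
  ((l ^+ (m + m.+1))%:E * ((enorm p * n)%:E * lam m.+1 (jcone A)) <= H A)%E.
Proof.
move=> lpr lp; have lV : 0 < l^-1 by rewrite invr_gt0.
have h1 : (H (pr @` A) <= ((l^-1) ^+ m)%:E * H (id @` A))%E.
  apply: hausdorff_lipschitz => // y z Ay Az; rewrite ler_pdivlMl//; exact: lpr.
rewrite image_id HprA in h1.
have h2 : ((l ^+ m.+1)%:E * lam m.+1 (jcone A) <= lam m.+1 (hcone p prA))%E.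
  rewrite -{1}(gtr0_norm l0) -lebesgueZ ?gt_eqF//; apply: le_outer_measure => _ [y [/andP[jy jy1] Ay] <-].
  have yE : y = j y *: ((j y)^-1 *: y) by rewrite scalerA mulfV ?scale1r// gt_eqF.
  have py : dotv p y = j y * dotv p ((j y)^-1 *: y) by rewrite {1}yE dotvZr.
  have py0 : 0 < dotv p y by rewrite py mulr_gt0// pA.
  split; rewrite dotvZr.
    rewrite mulr_gt0//= py mulrCA; apply: le_trans jy1; rewrite ler_piMr// ?(ltW jy)//.
    exact: lp.
  have -> : (l * dotv p y)^-1 *: (l *: y) = (dotv p y)^-1 *: y.
    by rewrite scalerA (_ : (l * dotv p y)^-1 * l = (dotv p y)^-1)//; field; rewrite !gt_eqF.
  split; first by rewrite dotvZr mulVf// gt_eqF.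
  rewrite jZ ?invr_gt0// scalerA (_ : ((dotv p y)^-1 * j y)^-1 / dotv p y = (j y)^-1)//.
  by field; rewrite !gt_eqF.
have lm : 0 < l ^+ m by rewrite exprn_gt0.
have h3 : ((l ^+ m)%:E * ((enorm p * n)%:E * lam m.+1 (hcone p prA)) <= H A)%E.
  apply: le_trans (lee_wpmul2l _ h1) _; first by rewrite lee_fin ltW.
  by rewrite muleA -EFinM -exprMn mulfV ?gt_eqF// expr1n mul1e.
apply: le_trans h3; rewrite exprD EFinM -muleA lee_wpmul2l//; first by rewrite lee_fin ltW.
by rewrite muleCA lee_wpmul2l// lee_fin mulr_ge0 ?enorm_ge0.
Qed.

End chart.

End radial.

Lemma measurable_translation (R : realType) (m : nat) (x0 : 'rV[R]_m.+1) :
  measurable_fun setT ((fun x => x - x0) : caratheodory_type (@hausdorff_outer R m.+1 m) -> @borelRV R m.+1).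
Proof.
move=> _ A mA; rewrite setTI; apply: borel_hausdorff_caratheodory.
have : measurable_fun setT ((fun x => x - x0) : @borelRV R m.+1 -> @borelRV R m.+1).
  apply: borel_continuous => x.
  by apply: (@cvgB _ _ _ (nbhs x) (@nbhs_filter 'rV[R]_m.+1 x)); [exact: cvg_id|exact: (@cvg_cst _ _ _ (nbhs x) (@nbhs_filter 'rV[R]_m.+1 x))].
by move=> /(_ measurableT A mA); rewrite setTI.
Qed.

Lemma hausdorff_translation (R : realType) (m : nat) (x0 : 'rV[R]_m.+1) A :
  hausdorff_outer m ((fun x => x - x0) @^-1` A) = hausdorff_outer m A.
Proof.
have -> : (fun x => x - x0) @^-1` A = (fun x => x + x0) @` A.
  by apply/seteqP; split => [x Ax|_ [x Ax <-]]; [exists (x - x0); rewrite ?subrK|rewrite /= addrK].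
have tr (x y : 'rV[R]_m.+1) : enorm (x + x0 - (y + x0)) = enorm (x - y).
  by congr enorm; rewrite opprD addrACA subrr addr0.
apply/eqP; rewrite eq_le -{2 3}(image_id A).
have h1 := @hausdorff_lipschitz _ _ _ m _ 1 (fun x : 'rV[R]_m.+1 => x + x0) id A ltr01.
have h2 := @hausdorff_lipschitz _ _ _ m _ 1 id (fun x : 'rV[R]_m.+1 => x + x0) A ltr01.
rewrite expr1n !mul1e in h1 h2; apply/andP; split; [apply: h1|apply: h2] => x y _ _.
  by rewrite mul1r tr.
by rewrite mul1r tr.
Qed.

Section cone_formula.
Context {R : realType} {m : nat}.
Variables (j : 'rV[R]_m.+1 -> R) (L M : R).
Hypotheses (L0 : 0 < L) (jL : forall x y, `|j x - j y| <= L * enorm (x - y))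
  (jconv : forall x y t, 0 <= t <= 1 ->
    j ((1 - t) *: x + t *: y) <= (1 - t) * j x + t * j y)
  (jZ : forall a y, 0 < a -> j (a *: y) = a * j y) (j0 : j 0 = 0)
  (M0 : 0 < M) (jM : forall y, enorm y <= M * j y).

Notation H := (@hausdorff_outer R m.+1 m).
Notation B := (@borelRV R m.+1).
Notation n := (m.+1%:R : R).

(** Arithmetic behind the near-isometry of the radial projection: s and t are the values of [dotv p]
    at two points, v and w their distances before and after projecting. *)
Let radial_chart (th s t K v w : R) : 0 < th -> th <= 1 -> K <= th / 4 ->
  `|s - 1| <= th / 4 -> `|t - 1| <= th / 4 -> 0 <= v ->
  w <= s^-1 * v + K * v / (s * t) -> s^-1 * v <= w + K * v / (s * t) ->
  (1 - th) * w <= v /\ (1 - th) * v <= w.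
Proof.
move=> th0 th1 Kt /ler_normlP[s1 s2] /ler_normlP[t1 t2] v0 wv vw.
have s0 : 0 < s by lra. have t0 : 0 < t by lra.
have st0 : 0 < s * t by rewrite mulr_gt0.
have wv' : w * (s * t) <= (t + K) * v.
  move: wv; rewrite -(ler_pM2r st0); congr (_ <= _); field; rewrite !gt_eqF//.
have vw' : (t - K) * v <= w * (s * t).
  move: vw; rewrite -(ler_pM2r st0) mulrDl -lerBlDr; congr (_ <= _); field; rewrite !gt_eqF//.
split; rewrite -(ler_pM2r st0) -mulrA.
  apply: le_trans (ler_wpM2l _ wv') _; first by lra.
  rewrite mulrA mulrC ler_wpM2l//.
  have : (1 - th) * (t + K) <= (1 - th) * (t + th / 4) by rewrite ler_wpM2l//; lra.
  have : (1 - th / 4) * t <= s * t by rewrite ler_wpM2r//; lra.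
  have : 0 <= th * (3 * t - (1 - th)) by rewrite mulr_ge0//; lra.
  by move=> ? ? ?; lra.
apply: le_trans vw'; rewrite mulrCA [leRHS]mulrC ler_wpM2l//.
have : (1 - th) * (s * t) <= (1 - th) * ((1 + th / 4) * t).
  by rewrite ler_wpM2l//; [lra|rewrite ler_wpM2r//; lra].
have : 0 <= th * (t - 3^-1) by rewrite mulr_ge0//; lra.
have : 0 <= th ^+ 2 * t by rewrite mulr_ge0// ?sqr_ge0// ltW.
by move=> ? ? ?; lra.
Qed.

(** Euler's identity for a function homogeneous of degree 1: the subgradient inequality is tested
    with the increments y and - y. *)
Lemma good_euler c p y : 0 <= c -> good j c p y -> dotv p y = j y.
Proof.
move=> c0 g; apply/eqP; rewrite eq_le; apply/andP; split.
  have := good_sub jconv y c0 g; have -> : y + y = 2 *: y by rewrite scaler_nat mulr2n.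
  by rewrite jZ//; lra.
by have := good_sub jconv (- y) c0 g; rewrite subrr j0 dotvNr; lra.
Qed.

Lemma good_le c c' p y : c <= c' -> good j c p y -> good j c' p y.
Proof. by move=> cc g h; apply: le_trans (g h) _; rewrite lerD2l ler_wpM2r// dotvv_ge0. Qed.

Lemma good_scale c p y t : 0 < t -> good j c p y -> good j (c / t) p (t *: y).
Proof.
move=> t0 g h; have := g (t^-1 *: h); rewrite -(ler_pM2l t0) -jZ// scalerDr scalerA.
rewrite mulfV ?gt_eqF// scale1r => /le_trans; apply.
rewrite (jZ y t0) 2!mulrDr -!addrA lerD2l !dotvZr dotvZl; rewrite le_eqVlt; apply/orP; left; apply/eqP.
by field; rewrite gt_eqF.
Qed.

Lemma goods_scale (k : nat) y t : 1 <= t -> goods j k.+1%:R y -> goods j k.+1%:R (t *: y).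
Proof.
move=> t1 [p g]; exists p; have t0 : 0 < t by apply: lt_le_trans t1.
apply: good_le (good_scale t0 g); by rewrite ler_pdivrMr// ler_peMr.
Qed.

Let hausdorff_null_chart p N b : p != 0 -> (forall y, N y -> j y = 1) ->
  0 < b -> (forall y, N y -> b <= dotv p y) -> lam m.+1 (jcone j N) = 0%E -> H N = 0%E.
Proof.
move=> p0 N1 b0 Nb N0; have P0 : 0 < enorm p by rewrite enorm_gt0.
have pN y : N y -> 0 < dotv p y by move=> /Nb; apply: lt_le_trans.
have NM y : N y -> enorm y <= M by move=> /N1 jy; rewrite -[leRHS]mulr1 -jy.
pose C := enorm p * M * (1 + M * L).
have C0 : 0 < C by rewrite mulr_gt0 ?mulr_gt0// addr_gt0// mulr_gt0.
have [l [l0 lb lC]] : exists l, [/\ 0 < l, l <= b & l <= C^-1].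
  exists (Num.min b C^-1); split; first by rewrite lt_min b0 invr_gt0.
    by rewrite ge_min lexx.
  by rewrite ge_min lexx orbT.
have c1 y z : N y -> N z -> l * enorm (y - z) <= enorm ((dotv p y)^-1 *: y - (dotv p z)^-1 *: z).
  move=> Ny Nz; set s := dotv p y; set t := dotv p z.
  have s0 : 0 < s by exact: pN. have t0 : 0 < t by exact: pN.
  have sP : s <= enorm p * M.
    by apply: le_trans (dotv_le _ _) _; rewrite ler_wpM2l ?enorm_ge0// NM.
  set w := s^-1 *: y - t^-1 *: z.
  have jst : `|s^-1 - t^-1| <= L * enorm w.
    have -> : s^-1 - t^-1 = j (s^-1 *: y) - j (t^-1 *: z).
      by rewrite !jZ ?invr_gt0// !N1// !mulr1.
    exact: jL.
  have yz : y - z = s *: (w - (s^-1 - t^-1) *: z).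
    apply/rowP => i; rewrite /w !mxE; field; rewrite !gt_eqF//.
  have : enorm (y - z) <= C * enorm w.
    rewrite yz enormZ gtr0_norm//; apply: (@le_trans _ _ (s * ((1 + M * L) * enorm w))).
      rewrite ler_wpM2l ?(ltW s0)//; apply: le_trans (ler_enormB _ _) _.
      rewrite mulrDl mul1r lerD2l enormZ -mulrA mulrC; apply: ler_pM; rewrite ?enorm_ge0 ?NM//.
    by rewrite mulrA ler_wpM2r ?enorm_ge0// ler_wpM2r// addr_ge0// mulr_ge0// ltW.
  move=> h; apply: (@le_trans _ _ (C^-1 * enorm (y - z))); first by rewrite ler_wpM2r ?enorm_ge0.
  by rewrite ler_pdivrMl.
have c2 y : N y -> l <= dotv p y by move=> /Nb; exact: le_trans.
exact: (hausdorff_chart_null jZ j0 M0 jM N1 pN p0 l0 c1 c2 N0).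
Qed.

(** Finitely many pieces cover the surface, on each of which some signed coordinate is bounded
    below; there the radial projection to a hyperplane has a Lipschitz inverse, and
    [hausdorff_hyperplane_null] applies. *)
Lemma hausdorff_radial_null N : (forall y, N y -> j y = 1) ->
  lam m.+1 (jcone j N) = 0%E -> H N = 0%E.
Proof.
(* On j = 1 the norm is at least 1 / L, so one coordinate is at least 1 / (L n) in absolute
   value. *)
move=> N1 N0; pose b := (L * n)^-1.
have n0 : 0 < n by rewrite ltr0n.
have b0 : 0 < b by rewrite invr_gt0 mulr_gt0.
pose F (si : bool * 'I_m.+1) := N `&` [set y | b <= (-1) ^+ si.1 * y 0 si.2].
have NF : N `<=` \bigcup_si F si.
  move=> y Ny; have : exists i, b <= `|y 0 i|.
    apply: contrapT => /forallNP h.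
    have : enorm y < L^-1.
      apply: le_lt_trans (enorm_le_norm _) _; rewrite mulrC -ltr_pdivlMr//.
      have -> : L^-1 / n = b by rewrite /b invfM.
      rewrite [ltLHS]/Num.norm/= mx_normrE; apply/bigmax_ltP; split => //= -[i k] _ /=.
      by rewrite ord1 ltNge; apply/negP; exact: h.
    rewrite ltNge -(ler_pM2l L0) mulfV ?gt_eqF// -(N1 _ Ny); move/negP; apply.
    exact: radial_le jL j0 _.
  move=> [i bi]; exists (y 0 i < 0, i) => //; split => //=.
  by case: ltP bi => yi; rewrite ?expr1 ?expr0 ?mulN1r ?mul1r; [rewrite ltr0_norm|rewrite ger0_norm].
have F0 si : H (F si) = 0%E.
  pose p : 'rV[R]_m.+1 := (-1) ^+ si.1 *: delta_mx 0 si.2.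
  have pE y : dotv p y = (-1) ^+ si.1 * y 0 si.2.
    rewrite dotvZl dotvE (bigD1 si.2)//= mxE !eqxx mul1r big1 ?addr0// => i ii.
    by rewrite mxE eqxx (negbTE ii) mul0r.
  apply: (hausdorff_null_chart (p := p) (b := b)) => //.
  - have := congr1 (fun M : 'rV[R]_m.+1 => M 0 si.2); apply: contraPneq => p0 /(_ _ _ p0).
    by rewrite !mxE !eqxx mulr1 => /eqP; rewrite signr_eq0.
  - by move=> y [/N1].
  - by move=> y [_] /=; rewrite pE.
  - apply/eqP; rewrite eq_le outer_measure_ge0 andbT -N0; apply: le_outer_measure => y [? []].
    by move=> *; split.
apply/eqP; rewrite eq_le outer_measure_ge0 andbT.
apply: le_trans (le_outer_measure _ _ _ NF) _.
have -> : \bigcup_si F si = \bigcup_k (if unpickle k is Some si then F si else set0).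
  apply/seteqP; split => [y [si _ Fy]|y [k _]].
    by exists (pickle si) => //; rewrite pickleK.
  by case: unpickle => // si Fy; exists si.
apply: le_trans (outer_measure_sigma_subadditive _ _) _.
by rewrite eseries0// => k _ _; case: unpickle => [si|]; [exact: F0|exact: outer_measure0].
Qed.

Variable (a : 'rV[R]_m.+1 -> 'rV[R]_m.+1).
Hypothesis aP : forall k y, goods j k.+1%:R y -> good j k.+1%:R (a y) y.

Let piece (k : nat) := [set y | j y = 1 /\ goods j k.+1%:R y].

Let piece_euler k y : piece k y -> dotv (a y) y = 1.
Proof. by move=> [jy /aP g]; rewrite (good_euler _ g). Qed.

Let pieceM k y : piece k y -> enorm y <= M.
Proof. by move=> [jy _]; rewrite -[leRHS]mulr1 -jy. Qed.

(** Near X in a piece the gradient varies little, and chords of the surface are almost orthogonal to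
    it; so the radial projection to the tangent hyperplane at X is nearly isometric, and the flat
    cone formula holds up to the factor q. *)
Let piece_local (q : R) (k : nat) : 0 < q < 1 -> exists2 d : R, 0 < d &
  forall X, piece k X -> (forall y, piece k y -> enorm (y - X) <= d ->
    q * enorm (a y) <= enorm (a X) /\ q * enorm (a X) <= enorm (a y)) /\
  (forall A : set 'rV[R]_m.+1, measurable (A : set B) -> A `<=` piece k `&` eball X d ->
    (q%:E * H A <= (enorm (a X) * n)%:E * lam m.+1 (jcone j A))%E /\
    (q%:E * ((enorm (a X) * n)%:E * lam m.+1 (jcone j A)) <= H A)%E).
Proof.
move=> /andP[q0 q1]; pose N := (m + m.+1)%N.
have N0 : 0 < N%:R :> R by rewrite ltr0n /N addnS.
(* By Bernoulli's inequality 2 m + 1 factors 1 - [th] multiply to at least q. *)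
pose th := (1 - q) / N%:R.
have th0 : 0 < th by rewrite divr_gt0// subr_gt0.
have th1 : th <= 1 - q.
  by rewrite /th ler_piMr ?subr_ge0 ?(ltW q1)// invf_le1// ler1n /N addnS.
have th11 : th <= 1 by lra.
have ql : q <= (1 - th) ^+ N.
  have := @bernoulli_le R th N; rewrite (ltW th0) th11 => /(_ isT).
  by rewrite /th mulrC divfK ?gt_eqF//; lra.
pose eta := th / (4 * (M + 1)).
have M1 : 0 < M + 1 by rewrite addr_gt0.
have eta0 : 0 < eta by rewrite divr_gt0// mulr_gt0.
have etaM : eta * (M + 1) = th / 4 by rewrite /eta; field; rewrite gt_eqF.
have eth : eta <= th / 4 by rewrite -etaM ler_peMr ?(ltW eta0)// lerDr ltW.
have eMth : eta * M <= th / 4 by rewrite -etaM ler_wpM2l ?(ltW eta0)// lerDl.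
pose c : R := k.+1%:R; have c0 : 0 < c by rewrite ltr0n.
(* 4 c d bounds the change of the gradient over a distance d, and 2 c d the paraboloid term over a
   distance 2 d. *)
have [d [d0 d1 dc]] : exists d, [/\ 0 < d, d <= 1 & 6 * c * d <= eta].
  exists (Num.min 1 (eta / (6 * c))); split.
  - by rewrite lt_min ltr01 divr_gt0// mulr_gt0.
  - by rewrite ge_min lexx.
  - by rewrite mulrC -ler_pdivlMr ?mulr_gt0// ge_min lexx orbT.
exists d => // X GX; set p := a X.
have gX : good j c p X by case: GX => _ /aP.
have pX : dotv p X = 1 by exact: piece_euler GX.
have P0 : 0 < enorm p.
  by rewrite enorm_gt0; apply: contra_eq_neq pX => ->; rewrite dot0v eq_sym oner_neq0.
have PM : 1 <= enorm p * M.
  by rewrite -pX; apply: le_trans (dotv_le _ _) _; rewrite ler_wpM2l ?enorm_ge0// (pieceM GX).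
have ap y : piece k y -> enorm (y - X) <= d -> enorm (p - a y) <= 4 * c * d.
  move=> Gy yX; have gy : good j c (a y) y by case: Gy => _ /aP.
  apply: le_trans (good_lip jconv c0 gX gy) _; rewrite enormB ler_wpM2l// mulr_ge0// ltW.
have slope y z : piece k y -> piece k z -> enorm (y - X) <= d -> enorm (z - X) <= d ->
    `|dotv p (y - z)| <= eta * enorm (y - z).
  move=> Gy Gz yX zX; have gz : good j c (a z) z by case: Gz => _ /aP.
  have [jy _] := Gy; have [jz _] := Gz.
  have zyz : z + (y - z) = y by rewrite addrC subrK.
  have h1 := gz (y - z); rewrite zyz jy jz -sqr_enorm in h1.
  have h2 := good_sub jconv (y - z) (ltW c0) gz; rewrite zyz jy jz in h2.
  have yz : enorm (y - z) <= 2 * d.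
    apply: le_trans (ler_enorm_distD X _ _) _; rewrite (enormB X z); lra.
  have h3 : `|dotv (p - a z) (y - z)| <= 4 * c * d * enorm (y - z).
    by apply: le_trans (normr_dotv _ _) _; rewrite ler_wpM2r ?enorm_ge0// ap.
  have h4 : c * enorm (y - z) ^+ 2 <= 2 * c * d * enorm (y - z).
    by rewrite expr2 mulrA ler_wpM2r ?enorm_ge0// (mulrC 2) -mulrA ler_wpM2l// ltW.
  have h5 : 6 * c * d * enorm (y - z) <= eta * enorm (y - z) by rewrite ler_wpM2r ?enorm_ge0.
  move: h3; rewrite dotvBl ler_norml => /andP[h31 h32]; rewrite ler_norml.
  by apply/andP; split; lra.
have near1 y : piece k y -> enorm (y - X) <= d -> `|dotv p y - 1| <= eta.
  move=> Gy yX; rewrite -pX -dotvBr; apply: le_trans (slope _ _ Gy GX yX _) _.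
    by rewrite subrr enorm0 ltW.
  by rewrite ler_piMr ?(ltW eta0)//; exact: le_trans d1.
split.
  move=> y Gy yX; have := ap y Gy yX; have := lerB_enorm p (a y); have := lerB_enorm (a y) p.
  rewrite (enormB (a y)) => h1 h2 h3.
  have cd0 : 0 <= c * d by rewrite mulr_ge0// ltW.
  have h4 : 4 * c * d <= eta by lra.
  have h5 : eta <= th * enorm p.
    rewrite /eta ler_pdivrMr ?mulr_gt0// -mulrA ler_peMr ?(ltW th0)//; nra.
  have h6 : eta <= (1 - q) * enorm p.
    by apply: le_trans h5 _; rewrite ler_wpM2r ?enorm_ge0.
  have : q * enorm (a y) <= q * (enorm p + eta) by rewrite ler_wpM2l ?(ltW q0)//; lra.
  have : q * eta <= eta by rewrite ler_piMl ?(ltW eta0) ?(ltW q1).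
  by move=> ? ?; split; lra.
move=> A mA AG.
have AP y : A y -> piece k y by move=> /AG[].
have Ad y : A y -> enorm (y - X) <= d by move=> /AG[].
have A1 y : A y -> j y = 1 by move=> /AP[].
have s1 y : A y -> `|dotv p y - 1| <= th / 4.
  by move=> Ay; apply: le_trans eth; apply: near1; [exact: AP|exact: Ad].
have pA y : A y -> 0 < dotv p y by move=> /s1/ler_normlP[? ?]; lra.
have p0 : p != 0 by rewrite -enorm_gt0.
have key y z : A y -> A z ->
    (1 - th) * enorm ((dotv p y)^-1 *: y - (dotv p z)^-1 *: z) <= enorm (y - z) /\
    (1 - th) * enorm (y - z) <= enorm ((dotv p y)^-1 *: y - (dotv p z)^-1 *: z).
  move=> Ay Az; have := slope y z (AP _ Ay) (AP _ Az) (Ad _ Ay) (Ad _ Az).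
  have := s1 _ Ay; have := s1 _ Az; have := pA _ Ay; have := pA _ Az.
  rewrite dotvBr; move: (dotv p y) (dotv p z) => s t t0 s0 t1' s1' st.
  have wE : s^-1 *: y - t^-1 *: z = s^-1 *: (y - z) + (s^-1 - t^-1) *: z.
    by apply/rowP => i; rewrite !mxE; ring.
  have r1 : enorm ((s^-1 - t^-1) *: z) <= eta * M * enorm (y - z) / (s * t).
    rewrite enormZ (_ : s^-1 - t^-1 = (t - s) / (s * t)); last by field; rewrite !gt_eqF.
    rewrite normrM (gtr0_norm (x := (s * t)^-1)) ?invr_gt0 ?mulr_gt0//.
    rewrite mulrAC ler_wpM2r ?invr_ge0 ?mulr_ge0 ?(ltW s0) ?(ltW t0)// distrC mulrAC.
    by apply: ler_pM; rewrite ?enorm_ge0// (pieceM (AP _ Az)).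
  apply: (radial_chart (s := s) (t := t) (K := eta * M)) => //; rewrite ?enorm_ge0//.
    rewrite wE; apply: le_trans (ler_enormD _ _) _.
    by rewrite enormZ gtr0_norm ?invr_gt0// lerD2l.
  have -> : s^-1 * enorm (y - z) = enorm (s^-1 *: (y - z)) by rewrite enormZ gtr0_norm ?invr_gt0.
  rewrite (_ : s^-1 *: (y - z) = (s^-1 *: y - t^-1 *: z) - (s^-1 - t^-1) *: z); last first.
    by rewrite wE addrK.
  by apply: le_trans (ler_enormB _ _) _; rewrite lerD2l.
have l0 : 0 < 1 - th by lra.
have HA0 : (0 <= H A)%E by exact: outer_measure_ge0.
have la0 : (0 <= (enorm p * n)%:E * lam m.+1 (jcone j A))%E.
  by rewrite mule_ge0 ?outer_measure_ge0// lee_fin mulr_ge0 ?enorm_ge0.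
split.
  apply: le_trans (lee_wpmul2r HA0 (_ : (_ <= ((1 - th) ^+ N)%:E)%E)) _; first by rewrite lee_fin.
  apply: (hausdorff_chart_le jL jZ j0 M0 jM mA A1 pA p0 l0) => [y z Ay Az|y Ay].
    exact: (key y z Ay Az).2.
  by have /ler_normlP[? ?] := s1 _ Ay; lra.
apply: le_trans (lee_wpmul2r la0 (_ : (_ <= ((1 - th) ^+ N)%:E)%E)) _; first by rewrite lee_fin.
apply: (hausdorff_chart_ge jL jZ j0 M0 jM mA A1 pA p0 l0) => [y z Ay Az|y Ay].
  exact: (key y z Ay Az).1.
have /ler_normlP[h1 h2] := s1 _ Ay.
apply: (@le_trans _ _ ((1 - th) * (1 + th / 4))); first by rewrite ler_wpM2l ?(ltW l0)//; lra.
have : 0 <= th ^+ 2 by exact: sqr_ge0.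
by move=> ?; lra.
Qed.

Definition smooth_sphere := [set y : 'rV[R]_m.+1 | j y = 1 /\ exists k, goods j k.+1%:R y].
Notation D := smooth_sphere.

Let DE : D = \bigcup_k piece k.
Proof. by apply/seteqP; split => [y [jy [k gy]]|y [k _ [jy gy]]]; [exists k|split => //; exists k]. Qed.

Let mpiece k : measurable (piece k : set B).
Proof.
have -> : piece k = j @^-1` [set t | t = 1] `&` goods j k.+1%:R by [].
have cj : continuous j by exact: lipschitz_enorm_continuous jL.
apply: borel_closed; apply: closedI.
  by apply: (@closed_comp _ _ j [set t : R | t = 1]) => [y _|]; [exact: cj|exact: closed_eq].
exact: (closed_goods (ltW L0) jL jconv).
Qed.

Lemma measurable_smooth_sphere : measurable (D : set B).
Proof. by rewrite DE; apply: bigcup_measurable => k _; exact: mpiece. Qed.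

Lemma measurable_gradient_norm : measurable_fun (D : set B) (fun y => enorm (a y)).
Proof.
rewrite DE; apply/measurable_fun_bigcup => k; first exact: mpiece.
have c0 : 0 < k.+1%:R :> R by rewrite ltr0n.
have Llip y z : piece k y -> piece k z -> `|enorm (a y) - enorm (a z)| <= 4 * k.+1%:R * enorm (y - z).
  move=> [_ /aP gy] [_ /aP gz]; apply: le_trans (ler_dist_enorm _ _) _.
  by have := good_lip jconv c0 gy gz; apply.
have [F [FE Flip]] := lipschitz_extension (mulr_ge0 (ler0n R 4) (ltW c0)) Llip.
apply: (eq_measurable_fun (F : B -> R)); first by move=> y /set_mem /FE.
apply: measurable_funTS; apply: borel_continuousR; exact: lipschitz_enorm_continuous Flip.
Qed.

(** [integral_density] for Hausdorff measure against the image of Lebesgue measure under [radial].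
    Its pieces are small balls around a countable net, cut with each [piece k], and [piece_local]
    compares the measures there. *)
Lemma cone_formula (x0 : 'rV[R]_m.+1) (f : 'rV[R]_m.+1 -> \bar R) :
  measurable_fun (D : set B) f -> (forall y, D y -> (0 <= f y)%E) ->
  (\int[@hausdorff R m.+1 m]_(x in [set x | D (x - x0)%R]) f (x - x0)%R =
   \int[@leb R m.+1]_(y in jcone j D) (f ((j y)^-1 *: y)%R * (n * enorm (a ((j y)^-1 *: y)))%:E))%E.
Proof.
move=> mf f0; have mtr := measurable_translation x0.
pose mu : {measure set B -> \bar R} :=
  measure_function_pushforward__canonical__measure_function_Measure (@hausdorff R m.+1 m) mtr.
pose nu : {measure set B -> \bar R} :=
  measure_function_pushforward__canonical__measure_function_Measure (@leb R m.+1)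
    (measurable_radial jL).
have muE A : mu A = H A by exact: (hausdorff_translation x0).
have nuE A : A `<=` D -> nu A = lam m.+1 (jcone j A).
  move=> AD; have -> : nu A = lam m.+1 (radial j @^-1` A) by [].
  rewrite radial_preimage// => /AD[]; rewrite j0 => /eqP; by rewrite eq_sym oner_eq0.
have mD := measurable_smooth_sphere.
have w0 y : D y -> 0 < n * enorm (a y).
  move=> [jy [k gy]]; rewrite mulr_gt0 ?ltr0n// enorm_gt0.
  have : dotv (a y) y = 1 by apply: (@piece_euler k).
  by apply: contra_eq_neq => ->; rewrite dot0v eq_sym oner_neq0.
have mw : measurable_fun (D : set B) (fun y => n * enorm (a y)).
  by apply: measurable_funM => //; exact: measurable_gradient_norm.
have f0' : {in D, forall y, (0 <= f y)%E} by move=> y /set_mem; exact: f0.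
have := @integral_density _ B R mu nu D (fun y => n * enorm (a y)) f mD w0 mw mf f0.
rewrite (@ge0_integral_pushforward _ _ _ _ _ _ mtr (@hausdorff R m.+1 m) D f mD mf f0').
have mfw : measurable_fun (D : set B) (fun y => (f y * (n * enorm (a y))%:E)%E).
  by apply: emeasurable_funM => //; exact/measurable_EFinP.
have fw0 : {in D, forall y, (0 <= f y * (n * enorm (a y))%:E)%E}.
  by move=> y /set_mem Dy; rewrite mule_ge0 ?f0// lee_fin ltW// w0.
rewrite (@ge0_integral_pushforward _ _ _ _ _ _ (measurable_radial jL) (@leb R m.+1) D _ mD mfw fw0).
have nD0 : ~ D 0 by move=> []; rewrite j0 => /eqP; rewrite eq_sym oner_eq0.
rewrite radial_preimage// => ->; first by apply: eq_integral => y /set_mem[jy _] /=; rewrite radial_scale_in.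
move=> q q01; have /andP[q0 q1] := q01.
have /choice[d dP] : forall k, exists d, 0 < d /\ forall X, piece k X ->
  (forall y, piece k y -> enorm (y - X) <= d ->
    q * enorm (a y) <= enorm (a X) /\ q * enorm (a X) <= enorm (a y)) /\
  (forall A : set 'rV[R]_m.+1, measurable (A : set B) -> A `<=` piece k `&` eball X d ->
    (q%:E * H A <= (enorm (a X) * n)%:E * lam m.+1 (jcone j A))%E /\
    (q%:E * ((enorm (a X) * n)%:E * lam m.+1 (jcone j A)) <= H A)%E).
  by move=> k; have [d d0 dP] := piece_local k q01; exists d.
have /choice[c cP] : forall k, exists c : nat -> 'rV[R]_m.+1, forall x, exists i, enorm (x - c i) <= d k / 2.
  by move=> k; apply: countable_net; rewrite divr_gt0//; case: (dP k).
pose P (kl : nat * nat) := piece kl.1 `&` eball (c kl.1 kl.2) (d kl.1 / 2).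
pose C i := if unpickle i is Some kl then P kl else set0.
have mP kl : measurable (P kl : set B) by apply: measurableI => //; exact: borel_eball.
have /choice[p pP] : forall i, exists p, [/\ 0 < p,
    (forall y, D y -> C i y -> q * (n * enorm (a y)) <= p /\ q * p <= n * enorm (a y)) &
    (forall A, measurable (A : set B) -> A `<=` C i -> A `<=` D ->
       (q%:E * mu A <= p%:E * nu A)%E /\ ((q * p)%:E * nu A <= mu A)%E)].
  move=> i; have [C0|/set0P[X CX]] := eqVneq (C i) set0.
    exists 1; split => // [y _|A _]; first by rewrite C0.
    by rewrite C0 subset0 => -> _; rewrite !measure0 !mule0.
  move: CX; rewrite /C; case: unpickle => // -[k l] [GX Xc]; rewrite /= in GX Xc.
  have [dk0 /(_ _ GX)[h1 h2]] := dP k.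
  have near y : P (k, l) y -> piece k y /\ enorm (y - X) <= d k.
    move=> [Gy yc]; split => //; apply: le_trans (ler_enorm_distD (c k l) _ _) _.
    by rewrite (enormB (c k l)); move: yc Xc; rewrite /eball/=; lra.
  exists (n * enorm (a X)); split.
  - by apply: w0; case: GX => jX gX; split => //; exists k.
  - move=> y _ /near[Gy yX]; have [h3 h4] := h1 y Gy yX.
    by rewrite !(mulrCA q) !ler_wpM2l.
  - move=> A mA AP AD; have [|h3 h4] := h2 A mA; first by move=> y /AP/near[].
    by rewrite muE nuE// (mulrC n) (EFinM q) -muleA; split.
exists C, p; split => //.
- move=> y [jy [k gy]]; have [l cl] := cP k y; exists (pickle (k, l)) => //.
  by rewrite /C pickleK.
- by move=> i; rewrite /C; case: unpickle => [kl|//]; exact: mP.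
- by move=> i; case: (pP i).
- by move=> i y Dy Cy; have [_ h _] := pP i; exact: h.
- by move=> i A mA AC AD; have [_ _ h] := pP i; exact: h.
Qed.

End cone_formula.

(** * Volume and uniform depth of the floating body *)

Section star_volume.
Context {R : realType} {m : nat}.
Variables (j jF : 'rV[R]_m.+1 -> R) (L LF : R).
Hypotheses (jL : forall x y, `|j x - j y| <= L * enorm (x - y))
  (jFL : forall x y, `|jF x - jF y| <= LF * enorm (x - y))
  (jZ : forall a y, 0 < a -> j (a *: y) = a * j y) (j0 : j 0 = 0)
  (jFZ : forall a y, 0 < a -> jF (a *: y) = a * jF y)
  (jF_ge : forall y, j y <= jF y).

Notation B := (@borelRV R m.+1).

Let cj : continuous j. Proof. exact: lipschitz_enorm_continuous jL. Qed.
Let cjF : continuous jF. Proof. exact: lipschitz_enorm_continuous jFL. Qed.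

Lemma power_bracket (q s : R) : 0 < q -> q < 1 -> 0 < s -> s <= 1 -> exists i, q ^+ i.+1 < s <= q ^+ i.
Proof.
move=> q0 q1 s0 s1; have [i qi] : exists i, q ^+ i.+1 < s.
  have q11 : `|q| < 1 by rewrite gtr0_norm.
  have /cvgr_lt/(_ s s0) := cvg_expr q11.
  by move=> [N _ /(_ N.+1 (leqnSn N))] h; exists N.
pose k := ex_minn (ex_intro (fun i => q ^+ i.+1 < s) i qi).
exists k; rewrite /k; case: ex_minnP => -[|k'] -> mk; first by rewrite expr0.
by rewrite leNgt; apply/negP => /mk; rewrite ltnn.
Qed.

(** Where [jF] on the surface lies between consecutive powers of 1 / q, the smaller body is squeezed
    in the cone between two dilates. So the image on the surface of Lebesgue measure restricted to
    it has density jF^-(m + 1) against that of the whole body. *)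
Lemma star_volume : lam m.+1 [set y | 0 < jF y <= 1 /\ 0 < j y] =
  (\int[@leb R m.+1]_(y in jcone j [set y | j y = 1%R]) ((j y / jF y) ^+ m.+1)%:E)%E.
Proof.
pose D : set B := [set y | j y = 1].
have mD : measurable D.
  apply: borel_closed; by apply: (@closed_comp _ _ j [set t : R | t = 1]) => [y _|]; [exact: cj|exact: closed_eq].
pose SF : set B := [set y | 0 < jF y <= 1 /\ 0 < j y].
have mSF : measurable SF.
  have -> : SF = ([set y | 0 < jF y] `&` [set y | jF y <= 1]) `&` [set y | 0 < j y].
    by apply/seteqP; split => [y [/andP[h1 h2] h3]|y [[h1 h2] h3]]; split => //; apply/andP.
  apply: measurableI; first apply: measurableI.
  - by apply: borel_open; apply: (@open_comp _ _ jF [set t : R | 0 < t]); [move=> y _; exact: cjF|exact: open_gt].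
  - by apply: borel_closed; apply: (@closed_comp _ _ jF [set t : R | t <= 1]); [move=> y _; exact: cjF|exact: closed_le].
  - by apply: borel_open; apply: (@open_comp _ _ j [set t : R | 0 < t]); [move=> y _; exact: cj|exact: open_gt].
pose lF : {measure set B -> \bar R} := mrestr (@leb R m.+1) mSF.
pose mu : {measure set B -> \bar R} :=
  measure_function_pushforward__canonical__measure_function_Measure lF (measurable_radial jL).
pose nu : {measure set B -> \bar R} :=
  measure_function_pushforward__canonical__measure_function_Measure (@leb R m.+1) (measurable_radial jL).
have D0 A : A `<=` D -> ~ A 0 by move=> AD /AD; rewrite /D/= j0 => /eqP; rewrite eq_sym oner_eq0.
have muE A : A `<=` D -> mu A = lam m.+1 (jcone j A `&` SF).
  move=> AD; have -> : mu A = lam m.+1 (radial j @^-1` A `&` SF) by [].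
  by rewrite radial_preimage//; exact: D0.
have nuE A : A `<=` D -> nu A = lam m.+1 (jcone j A).
  move=> AD; have -> : nu A = lam m.+1 (radial j @^-1` A) by [].
  by rewrite radial_preimage//; exact: D0.
have jF1 y : D y -> 1 <= jF y by move=> <-; exact: jF_ge.
have jF0 y : D y -> 0 < jF y by move=> /jF1; exact: lt_le_trans.
pose w y := (jF y)^-1 ^+ m.+1.
have w0 y : D y -> 0 < w y by move=> Dy; rewrite exprn_gt0// invr_gt0 jF0.
have mjF : measurable_fun (D : set B) (fun y => (jF y)^-1).
  apply: (eq_measurable_fun ((fun y => jF y `^ (-1)) : B -> R)).
    by move=> y /set_mem Dy; rewrite powR_inv1// ltW// jF0.
  apply: measurable_funTS; apply: (measurableT_comp (measurable_powR (-1))).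
  exact: borel_continuousR.
have mw : measurable_fun (D : set B) w by apply: measurable_funX.
have mf : measurable_fun (D : set B) (cst (1%:E : \bar R)) by exact: measurable_cst.
have f0 y : D y -> (0 <= cst (1%:E : \bar R) y)%E by rewrite lee_fin.
have := @integral_density _ B R mu nu D w (cst 1%:E) mD w0 mw mf f0.
rewrite integral_cst// mul1e muE//.
have -> : jcone j D `&` SF = SF.
  apply/seteqP; split => [y []//|y Sy]; have [/andP[jFy jFy1] jy] := Sy; split => //; split.
    by rewrite jy (le_trans (jF_ge y)).
  by rewrite /D/= jZ ?invr_gt0// mulVf// gt_eqF.
have mfw : measurable_fun (D : set B) (fun y => (cst 1%:E y * (w y)%:E)%E).
  by apply: emeasurable_funM => //; exact/measurable_EFinP.
have fw0 : {in D, forall y, (0 <= cst 1%:E y * (w y)%:E)%E}.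
  by move=> y /set_mem Dy; rewrite mul1e lee_fin ltW// w0.
rewrite (@ge0_integral_pushforward _ _ _ _ _ _ (measurable_radial jL) (@leb R m.+1) D _ mD mfw fw0).
rewrite radial_preimage; last exact: (D0 D).
move=> ->.
  apply: eq_integral => y /set_mem[jy Dy] /=; rewrite mul1e radial_scale_in// /w; congr (_ ^+ _)%:E.
  by have /andP[jy0 _] := jy; rewrite jFZ ?invr_gt0// invfM invrK.
move=> rr /andP[rr0 rr1].
have [q [q0 q1 qr]] : exists q, [/\ 0 < q, q < 1 & rr <= q ^+ m.+1].
  pose t := (1 - rr) / m.+1%:R.
  have m0 : 0 < m.+1%:R :> R by rewrite ltr0n.
  have t0 : 0 < t by rewrite divr_gt0// subr_gt0.
  have t1 : t <= 1 - rr by rewrite /t ler_piMr ?subr_ge0 ?(ltW rr1)// invf_le1// ler1n.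
  exists (1 - t); split; [lra|lra|].
  have := @bernoulli_le R t m.+1; rewrite (ltW t0) (_ : t <= 1); last by lra.
  by rewrite mulrC divfK ?gt_eqF// => /(_ isT); lra.
have cqF c : continuous (fun y => c * jF y).
  by apply: (@lipschitz_enorm_continuous _ _ _ (`|c| * LF)) => x y; rewrite -mulrBr normrM -mulrA ler_wpM2l.
pose C i : set B := [set y | q ^+ i.+1 * jF y < 1] `&` [set y | 1 <= q ^+ i * jF y].
have CP i y : D y -> C i y -> (jF y)^-1 <= q ^+ i /\ q ^+ i.+1 <= (jF y)^-1.
  by move=> Dy [/= h1 h2]; have jy := jF0 _ Dy; rewrite -ler_pdivrMr// in h2;
     rewrite -ltr_pdivlMr// in h1; rewrite !div1r in h1 h2; split => //; exact: ltW.
exists C, (fun i => q ^+ i ^+ m.+1); split.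
- move=> y Dy; have jy := jF0 _ Dy.
  have [||i /andP[h1 h2]] := @power_bracket q (jF y)^-1 q0 q1; first by rewrite invr_gt0.
    by rewrite invf_le1// jF1.
  exists i => //; split => /=; first by rewrite -ltr_pdivlMr// div1r.
  by rewrite -ler_pdivrMr// div1r.
- move=> i; apply: measurableI.
    apply: borel_open; apply: (@open_comp _ _ (fun y => q ^+ i.+1 * jF y) [set t : R | t < 1]); last exact: open_lt.
    by move=> y _; exact: cqF.
  apply: borel_closed; apply: (@closed_comp _ _ (fun y => q ^+ i * jF y) [set t : R | 1 <= t]); last exact: closed_ge.
  by move=> y _; exact: cqF.
- by move=> i; rewrite !exprn_gt0.
- move=> i y Dy Cy; have [h1 h2] := CP i y Dy Cy; have iv : 0 <= (jF y)^-1 by rewrite invr_ge0 ltW// jF0.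
  split.
    apply: (@le_trans _ _ (w y)); first by rewrite ler_piMl ?(ltW rr1)// ltW// w0.
    by rewrite lerXn2r ?nnegrE// exprn_ge0// ltW.
  apply: (@le_trans _ _ (q ^+ m.+1 * q ^+ i ^+ m.+1)); first by rewrite ler_wpM2r// !exprn_ge0// ltW.
  by rewrite -exprMn -exprS lerXn2r ?nnegrE// exprn_ge0// ltW.
move=> i A mA AC AD; rewrite muE// nuE//.
have b0 : 0 < q ^+ i by rewrite exprn_gt0.
have qb0 : 0 < q * q ^+ i by rewrite mulr_gt0.
split.
  have : (lam m.+1 (jcone j A `&` SF) <= (q ^+ i ^+ m.+1)%:E * lam m.+1 (jcone j A))%E.
    rewrite -{1}(gtr0_norm b0) -lebesgueZ ?gt_eqF//; apply: le_outer_measure => y [[jy Ay] [/andP[_ jFy1] _]].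
    have [h1 h2] := CP _ _ (AD _ Ay) (AC _ Ay).
    exists ((q ^+ i)^-1 *: y); last by rewrite scalerA mulfV ?scale1r// gt_eqF.
    apply: jcone_scale => //; first by rewrite invr_gt0.
    have /andP[jy0 _] := jy.
    rewrite ler_pdivrMl// mulr1; apply: le_trans h1.
    by rewrite jFZ ?invr_gt0// invfM invrK ler_peMr ?(ltW jy0)// invf_ge1// (lt_le_trans jy0).
  apply: le_trans; rewrite -[leRHS]mul1e; apply: lee_wpmul2r; first exact: outer_measure_ge0.
  by rewrite lee_fin ltW.
have : (((q * q ^+ i) ^+ m.+1)%:E * lam m.+1 (jcone j A) <= lam m.+1 (jcone j A `&` SF))%E.
  rewrite -{1}(gtr0_norm qb0) -lebesgueZ ?gt_eqF//; apply: le_outer_measure => _ [y [jy Ay] <-].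
  have [h1 h2] := CP _ _ (AD _ Ay) (AC _ Ay); have /andP[jy0 jy1] := jy.
  have jFy0 : 0 < jF y by exact: lt_le_trans (jF_ge y).
  split.
    apply: jcone_scale => //; rewrite mulr_ile1// ?(ltW qb0) ?(ltW jy0)//.
    by rewrite -exprS exprn_ile1// ltW.
  split; last by rewrite jZ// mulr_gt0.
  rewrite jFZ// mulr_gt0//= -exprS -ler_pdivlMr// div1r; apply: le_trans h2 _.
  by rewrite jFZ ?invr_gt0// invfM invrK ler_piMl// invr_ge0 ltW.
apply: le_trans; apply: lee_wpmul2r; first exact: outer_measure_ge0.
by rewrite lee_fin exprMn ler_wpM2r// !exprn_ge0// ltW.
Qed.

End star_volume.

Section floating.
Context {R : realType} {n : nat}.
Variables (r : R) (K : set 'rV[R]_n) (f : 'rV[R]_n -> R) (cf : R).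
Hypotheses (r0 : 0 < r) (cK : closed K) (Kball : ball_convex r K)
  (fcont : {within K, continuous f}) (cf0 : 0 < cf) (f_ge : forall y, K y -> cf <= f y).

Notation F := (floating_body r K f).

Lemma floating_sub d : 0 <= d -> F d `<=` K.
Proof.
move=> d0 x Fx; rewrite Kball => z Kz; apply: Fx => /=.
have -> : K `\` eball z r = set0 by apply/seteqP; split => // y [Ky []]; exact: Kz.
by rewrite integral_set0 lee_fin.
Qed.

Lemma floating_closed d : closed (F d).
Proof. by apply: closed_bigI => z _; exact: closed_eball. Qed.

Lemma floating_convex d x y t : 0 <= t <= 1 -> F d x -> F d y -> F d ((1 - t) *: x + t *: y).
Proof.
move=> /andP[t0 t1] Fx Fy w Fw; have := Fx w Fw; have := Fy w Fw; rewrite /eball/= => hy hx.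
have -> : (1 - t) *: x + t *: y - w = (1 - t) *: (x - w) + t *: (y - w).
  by apply/rowP => i; rewrite !mxE; ring.
apply: le_trans (ler_enormD _ _) _; rewrite !enormZ !ger0_norm ?subr_ge0//.
have -> : r = (1 - t) * r + t * r by ring.
by apply: lerD; apply: ler_wpM2l => //; rewrite subr_ge0.
Qed.

(** By convexity a ball missing q cannot contain both q + h and q - h, so the ball that keeps q out
    of the floating body removes at least half of any symmetric set around q. *)
Lemma floating_symmetric d q (S : set 'rV[R]_n) : measurable (S : set (@borelRV R n)) ->
  (forall h, S h -> S (- h)) -> (forall h, S h -> K (q + h)) -> ~ F d q ->
  (cf%:E * lam n S <= (2 * d)%:E)%E.
Proof.
move=> mS SN SK /existsNP[w /not_implyP[/= wd nw]].
pose W := K `\` eball w r.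
have mW : measurable (W : set (@borelRV R n)).
  by apply: measurableD; [exact: borel_closed|exact: borel_eball].
have SW : S `<=` [set h | W (h + q)] `|` (fun h => - h) @` [set h | W (h + q)].
  move=> h Sh; have [hw|hw] := pselect (eball w r (q + h)); last first.
    by left; rewrite /= addrC; split => //; exact: SK.
  right; exists (- h); last by rewrite opprK.
  rewrite /= addrC; split; first by apply: SK; exact: SN.
  move=> hw'; apply: nw; move: hw hw'; rewrite /eball/= => hw hw'.
  have -> : q - w = 2^-1 *: (q + h - w) + 2^-1 *: (q - h - w).
    by apply/rowP => i; rewrite !mxE; field.
  by apply: le_trans (ler_enormD _ _) _; rewrite !enormZ gtr0_norm ?invr_gt0//; lra.
have lS : (lam n S <= lam n W + lam n W)%E.
  apply: le_trans (le_outer_measure _ _ _ SW) _.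
  apply: le_trans (outer_measureU2 _ _ _) _.
  apply: leeD; rewrite -[leRHS](lebesgue_preimageD W q)//.
  by rewrite -[leRHS]lebesgueN.
have WK : W `<=` K by move=> z [].
have h1 y : W y -> 0 <= f y by move=> [/f_ge fz _]; apply: le_trans fz; exact: ltW.
have h2 y : W y -> cf <= f y by move=> [/f_ge].
have := weight_ge fcont mW mW (@subset_refl _ W) WK (ltW cf0) h1 h2.
move=> /le_trans/(_ wd) h.
apply: (@le_trans _ _ (cf%:E * (lam n W + lam n W))%E); first by rewrite lee_wpmul2l// lee_fin ltW.
by rewrite ge0_muleDr ?outer_measure_ge0// (_ : 2 * d = d + d) ?EFinD ?leeD//; ring.
Qed.

End floating.

(** * A bound on the depth in terms of the opening *)

Section slab.
Context {R : realType} {m : nat}.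
Variables (p X : 'rV[R]_m.+1) (tau rho : R).
Hypotheses (pX : dotv p X = 1) (tau0 : 0 <= tau) (rho0 : 0 <= rho).

(** An oblique cylinder symmetric about 0, with axis along [X] and round cross-sections orthogonal
    to [p]: its axis follows the ray while its sections fit under the paraboloid at X. *)
Definition slab := [set h | `|dotv p h| <= tau /\ enorm (h - dotv p h *: X) <= rho].

Lemma closed_slab : closed slab.
Proof.
have -> : slab = (dotv p) @^-1` [set t | `|t| <= tau] `&`
    (fun h => enorm (h *m (1%:M - p^T *m X) - 0)) @^-1` [set t | t <= rho].
  have e h : h *m (1%:M - p^T *m X) - 0 = h - dotv p h *: X.
    by rewrite subr0 mulmxBr mulmx1 mulmxA [h *m p^T]mx11_scalar mul_scalar_mx dotvC.
  by apply/seteqP; split => h; rewrite /slab/= e.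
apply: closedI.
  apply: (@closed_comp _ _ (dotv p) [set t : R | `|t| <= tau]) => [y _|]; first exact: dotv_continuous.
  apply: (@closed_comp _ _ (@Num.norm R R) [set t : R | t <= tau]) => [y _|]; last exact: closed_le.
  exact: norm_continuous.
apply: (@closed_comp _ _ _ [set t : R | t <= rho]) => [y _|]; last exact: closed_le.
apply: (@continuous_comp _ _ _ (fun h : 'rV[R]_m.+1 => h *m (1%:M - p^T *m X)) (fun y => enorm (y - 0))).
  exact: mulmx_continuous.
exact: enormB_continuous.
Qed.

(** The slices orthogonal to [p] are balls of radius [rho] with shifted centres, over an interval of
    heights of length 2 tau / |p|. *)
Lemma lebesgue_slab : lam m.+1 slab = ((2 * tau / enorm p)%:E * lam m (@eball R m 0 rho))%E.
Proof.
have P0 : 0 < enorm p.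
  by rewrite enorm_gt0; apply: contra_eq_neq pX => ->; rewrite dot0v eq_sym oner_neq0.
have u1 : enorm ((enorm p)^-1 *: p) = 1 by rewrite enormZ gtr0_norm ?invr_gt0// mulVf// gt_eqF.
have [T TT uT] := orth_to_delta ord0 u1; have TT' := mulmx1C TT.
have TTt : T^T *m T^T^T = 1%:M by rewrite trmxK.
have pT : p *m T = ins ord0 0 (enorm p).
  have -> : p *m T = enorm p *: (((enorm p)^-1 *: p) *m T).
    by rewrite -scalemxAl scalerA mulfV ?scale1r// gt_eqF.
  rewrite uT; apply/rowP => i; rewrite !mxE eqxx/=; case: unliftP => [k ->|->].
    by rewrite mxE eq_sym (negbTE (neq_lift _ _)) mulr0.
  by rewrite eqxx mulr1.
pose X' := X *m T.
have X'0 : enorm p * X' 0 ord0 = 1.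
  rewrite -pX -(dotv_mulmx p X TT) -/X' pT -[X' in RHS](insE ord0) dotv_ins dot0v add0r.
  by [].
rewrite -(lebesgue_orth slab TT).
set A := [set x *m T | x in slab].
have AE y t : A (ins ord0 y t) <-> `|enorm p * t| <= tau /\ enorm (y - (enorm p * t) *: del ord0 X') <= rho.
  have eq h : dotv p h = enorm p * (h *m T) 0 ord0.
    rewrite -(dotv_mulmx p h TT) pT -[h *m T in LHS](insE ord0) dotv_ins dot0v add0r //.
  have eq2 h : enorm (h - dotv p h *: X) =
      enorm (del ord0 (h *m T) - (enorm p * (h *m T) 0 ord0) *: del ord0 X').
    rewrite -(enorm_mulmx _ TT) mulmxBl -scalemxAl -/X' eq.
    set z := h *m T; set s := enorm p * _.
    rewrite -[z in LHS](insE ord0) -[X' in LHS](insE ord0) insZ insB.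
    have -> : z 0 ord0 - s * X' 0 ord0 = 0 by rewrite /s mulrAC X'0 mul1r subrr.
    by rewrite enorm_ins.
  split=> [[h [h1 h2] hT]|[h1 h2]].
    by move: h1 h2; rewrite eq2 eq hT insK ins_i.
  exists (ins ord0 y t *m T^T); last by rewrite -mulmxA TT' mulmx1.
  by rewrite /slab/= eq2 eq -mulmxA TT' mulmx1 insK ins_i.
have mA : measurable (A : set (@borelRV R m.+1)).
  have -> : A = (fun x => x *m T^T) @^-1` slab.
    apply/seteqP; split => [_ [h hs <-]|x hs]; first by rewrite /= -mulmxA TT mulmx1.
    by exists (x *m T^T) => //; rewrite -mulmxA TT' mulmx1.
  apply: borel_closed; apply: (@closed_comp _ _ (fun x : 'rV[R]_m.+1 => x *m T^T) slab) => [y _|].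
    exact: mulmx_continuous.
  exact: closed_slab.
rewrite (lebesgue_fubini_ord ord0 mA).
pose b := tau / enorm p; have b0 : 0 <= b by rewrite divr_ge0// ltW.
have sl t : lam m [set y | A (ins ord0 y t)] =
    if t \in `[- b, b]%classic then lam m (@eball R m 0 rho) else 0%E.
  have tb : (t \in `[- b, b]%classic) = (`|enorm p * t| <= tau).
    by rewrite mem_setE in_itv/= -ler_norml normrM (gtr0_norm P0) mulrC -ler_pdivlMr.
  rewrite tb; case: ifPn => ht.
    have -> : [set y | A (ins ord0 y t)] = eball ((enorm p * t) *: del ord0 X') rho.
      by apply/seteqP; split => y; [move=> /AE[]|move=> yr; apply/AE].
    by rewrite lebesgue_eball// [RHS]lebesgue_eball.
  have -> : [set y | A (ins ord0 y t)] = set0.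
    by apply/seteqP; split => // y /AE[]; rewrite (negbTE ht).
  exact: outer_measure0.
transitivity (\int[@lebesgue_measure R]_(t in `[(- b)%R, b]%classic) (cst (lam m (@eball R m 0 rho)) t))%E.
  by rewrite [RHS]integral_mkcond; apply: eq_integral => t _; rewrite sl patchE.
rewrite integral_cst//.
have e := lebesgue_measure_itvcc (- b) b.
transitivity ((Num.max 0 (b - - b))%:E * lam m (@eball R m 0 rho))%E.
  by rewrite muleC; congr (_ * _)%E; exact: e.
congr (_%:E * _)%E.
rewrite opprK; have -> : b + b = 2 * tau / enorm p by rewrite /b; field; rewrite gt_eqF.
by rewrite max_r// divr_ge0 ?mulr_ge0// ltW.
Qed.

End slab.

Section domination.
Context {R : realType} {m : nat}.
Variables (r : R) (K : set 'rV[R]_m.+1) (f : 'rV[R]_m.+1 -> R) (cf L : R) (j : 'rV[R]_m.+1 -> R)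
  (x0 : 'rV[R]_m.+1).
Hypotheses (r0 : 0 < r) (cK : closed K) (Kball : ball_convex r K)
  (fcont : {within K, continuous f}) (cf0 : 0 < cf) (f_ge : forall y, K y -> cf <= f y)
  (L0 : 0 < L) (jL : forall x y, `|j x - j y| <= L * enorm (x - y))
  (jconv : forall x y t, 0 <= t <= 1 ->
    j ((1 - t) *: x + t *: y) <= (1 - t) * j x + t * j y)
  (jZ : forall a y, 0 < a -> j (a *: y) = a * j y) (j0 : j 0 = 0)
  (Kj : forall y, K (x0 + y) <-> j y <= 1).

Notation om := (vol (@eball R m 0 1)).

(** A slab of height t and radius of order sqrt (t / c) around the point at relative depth t fits
    into [K], by the paraboloid and homogeneity. That point is cut off, so the volume of order t (t
    / c)^(m / 2) is at most a multiple of d; squaring removes the root. *)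
Lemma floating_depth : exists2 C : R, 0 < C & forall X c p d T, 0 < c -> 0 < d -> j X = 1 ->
  good j c p X -> 0 <= T -> T <= 1 ->
  (forall s, 1 - T < s -> s < 1 -> ~ floating_body r K f d (x0 + s *: X)) ->
  T ^+ m.+2 <= C * (d ^+ 2 * c ^+ m).
Proof.
have om0 : 0 < om by exact: om_gt0.
pose C0 := 4 * L ^+ 2 * 16 ^+ m / (cf ^+ 2 * om ^+ 2).
have C00 : 0 < C0 by rewrite divr_gt0 ?mulr_gt0 ?exprn_gt0.
exists (3 ^+ m.+2 * C0) => [|X c p d T c0 d0 jX gX T0 T1 nF]; first by rewrite mulr_gt0// exprn_gt0.
have [->|TN0] := eqVneq T 0.
  have C30 : 0 < 3 ^+ m.+2 * C0 by rewrite mulr_gt0// exprn_gt0.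
  by rewrite expr0n/=; apply: (mulr_ge0 (ltW C30)); apply: mulr_ge0; apply: exprn_ge0; exact: ltW.
have {TN0}T0 : 0 < T by rewrite lt_neqAle eq_sym TN0.
pose t := T / 3; have t0 : 0 < t by rewrite divr_gt0.
have tT : T = 3 * t by rewrite /t; field.
have pX : dotv p X = 1 by rewrite (good_euler jconv jZ j0 (ltW c0) gX).
have P0 : 0 < enorm p.
  by rewrite enorm_gt0; apply: contra_eq_neq pX => ->; rewrite dot0v eq_sym oner_neq0.
have PL : enorm p <= L by apply: good_norm gX => //; exact: ltW.
(* Scaling by at least 1 / 4 leaves an opening of at most 4 c, and 4 c rho^2 = t / 4 fits, together
   with the axial deviation t / 2, into the depth t. *)
pose rho := Num.sqrt (t / (16 * c)).
have rho2 : rho ^+ 2 = t / (16 * c) by rewrite sqr_sqrtr// divr_ge0// ?mulr_ge0// ltW.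
have rho0 : 0 <= rho by exact: sqrtr_ge0.
pose s := 1 - t.
have sF : ~ floating_body r K f d (x0 + s *: X) by apply: nF; rewrite /s; lra.
pose A := slab p X (t / 2) rho.
have mA : measurable (A : set (@borelRV R m.+1)) by apply: borel_closed; exact: closed_slab.
have AN h : A h -> A (- h).
  by move=> [h1 h2]; split; rewrite dotvNr ?normrN// scaleNr -opprD enormN.
have AK h : A h -> K (x0 + s *: X + h).
  move=> [h1 h2]; rewrite -addrA; apply/Kj; set la := dotv p h in h1 h2; set w := h - la *: X in h2.
  have pw : dotv p w = 0 by rewrite /w dotvBr dotvZr pX mulr1 subrr.
  have -> : s *: X + h = (s + la) *: X + w.
    by rewrite /w; move: (la) => b; apply/rowP => i; rewrite !mxE; ring.
  have /ler_normlP[la1 la2] := h1.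
  have mu0 : 4^-1 <= s + la by rewrite /s; lra.
  have mu00 : 0 < s + la by lra.
  have := good_scale jZ mu00 gX w; rewrite jZ// jX pw addr0 mulr1 => /le_trans; apply.
  have w2 : dotv w w <= t / (16 * c).
    by rewrite -rho2 -sqr_enorm lerXn2r ?nnegrE ?enorm_ge0.
  have : c / (s + la) * dotv w w <= (4 * c) * (t / (16 * c)).
    apply: ler_pM; rewrite ?dotvv_ge0 ?divr_ge0 ?(ltW c0) ?(ltW mu00)//.
    rewrite mulrC ler_wpM2r ?(ltW c0)// -[leRHS]invrK lef_pV2 ?posrE//.
  have -> : 4 * c * (t / (16 * c)) = t / 4 by field; rewrite gt_eqF.
  by rewrite /s; lra.
have := floating_symmetric cK fcont cf0 f_ge mA AN AK sF.
have t2 : 0 <= t / 2 by apply: divr_ge0; [exact: ltW|].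
rewrite (lebesgue_slab pX t2 rho0).
rewrite lebesgue_eball// -vol_eballE -!EFinM lee_fin => h.
have h1 : cf * (t * om) * rho ^+ m <= 2 * d * L.
  have -> : cf * (t * om) * rho ^+ m = cf * (2 * (t / 2) / enorm p * (rho ^+ m * om)) * enorm p.
    by field; rewrite gt_eqF.
  apply: ler_pM; [|exact: ltW|exact: h|exact: PL].
  have a1 : 0 < 2 * (t / 2) / enorm p by rewrite divr_gt0// mulr_gt0// divr_gt0.
  exact: (mulr_ge0 (ltW cf0) (mulr_ge0 (ltW a1) (mulr_ge0 (exprn_ge0 _ rho0) (ltW om0)))).
have h2 : (cf * (t * om) * rho ^+ m) ^+ 2 <= (2 * d * L) ^+ 2.
  rewrite lerXn2r// nnegrE; last by rewrite mulr_ge0 ?mulr_ge0// ltW.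
  exact: (mulr_ge0 (mulr_ge0 (ltW cf0) (mulr_ge0 (ltW t0) (ltW om0))) (exprn_ge0 _ rho0)).
have h16 : 16 ^+ m != 0 :> R by rewrite gt_eqF// exprn_gt0.
have hc : c ^+ m != 0 by rewrite gt_eqF// exprn_gt0.
have h3 : (cf * (t * om) * rho ^+ m) ^+ 2 = cf ^+ 2 * om ^+ 2 / (16 ^+ m) * (t ^+ m.+2 / c ^+ m).
  rewrite exprMn -exprM mulnC exprM rho2 expr_div_n (exprMn m 16 c) (exprSr t m.+1) (exprSr t m).
  move: (16 ^+ m) (c ^+ m) (t ^+ m) h16 hc => x y z x0' y0'; field; by rewrite x0' y0'.
rewrite tT exprMn -mulrA ler_wpM2l ?exprn_ge0//.
have k0 : 0 < cf ^+ 2 * om ^+ 2 / 16 ^+ m / c ^+ m by rewrite !divr_gt0 ?mulr_gt0 ?exprn_gt0.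
rewrite -(ler_pM2l k0); apply: le_trans (_ : (2 * d * L) ^+ 2 <= _).
  by apply: le_trans h2; rewrite h3 le_eqVlt; apply/orP; left; apply/eqP; field; rewrite !gt_eqF ?exprn_gt0.
rewrite le_eqVlt; apply/orP; left; apply/eqP; rewrite /C0; field.
by rewrite !gt_eqF ?exprn_gt0.
Qed.

End domination.

(** * The limit *)

Lemma powR_divn (R : realType) (a s : R) (N : nat) : 0 <= a -> (a `^ (s / N.+1%:R)) ^+ N.+1 = a `^ s.
Proof. by move=> a0; rewrite -powR_mulrn ?powR_ge0// -powRrM divfK// pnatr_eq0. Qed.

Section shifted_gauge.
Context {R : realType} {n : nat}.
Variables (Q : set 'rV[R]_n) (x0 : 'rV[R]_n) (q0 r1 : R).
Hypotheses (q00 : 0 < q0) (cQ : closed Q)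
  (Qconv : forall x y t, 0 <= t <= 1 -> Q x -> Q y -> Q ((1 - t) *: x + t *: y))
  (Qin : eball x0 q0 `<=` Q) (Qout : Q `<=` eball x0 r1).

Definition gaugeat : 'rV[R]_n -> R := gauge [set y | Q (x0 + y)].

Let S_closed : closed [set y | Q (x0 + y)].
Proof.
have ca : continuous (fun y : 'rV[R]_n => x0 + y).
  by move=> y; apply: (@cvgD _ _ _ (nbhs y) (@nbhs_filter 'rV[R]_n y)); [exact: (@cvg_cst _ _ _ (nbhs y) (@nbhs_filter 'rV[R]_n y))|exact: cvg_id].
by apply: (@closed_comp _ _ (fun y : 'rV[R]_n => x0 + y) Q) => // y _; exact: ca.
Qed.

Let S_conv x y t : 0 <= t <= 1 -> [set y | Q (x0 + y)] x -> [set y | Q (x0 + y)] y ->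
  [set y | Q (x0 + y)] ((1 - t) *: x + t *: y).
Proof.
move=> t01 Qx Qy; have := Qconv t01 Qx Qy; rewrite /=.
by have -> : (1 - t) *: (x0 + x) + t *: (x0 + y) = x0 + ((1 - t) *: x + t *: y)
  by apply/rowP => i; rewrite !mxE; ring.
Qed.

Let S_in : eball 0 q0 `<=` [set y | Q (x0 + y)].
Proof. by move=> y; rewrite /eball/= subr0 => h; apply: Qin; rewrite /eball/= addrAC subrr add0r. Qed.

Let S_out : [set y | Q (x0 + y)] `<=` eball 0 r1.
Proof. by move=> y /= /Qout; rewrite /eball/= addrAC subrr add0r subr0. Qed.

Lemma gaugeat_lip x y : `|gaugeat x - gaugeat y| <= q0^-1 * enorm (x - y).
Proof. exact: gauge_lip q00 S_closed S_conv S_in x y. Qed.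

Lemma gaugeat_convex x y t : 0 <= t <= 1 ->
  gaugeat ((1 - t) *: x + t *: y) <= (1 - t) * gaugeat x + t * gaugeat y.
Proof. exact: gauge_convex q00 S_closed S_conv S_in x y t. Qed.

Lemma gaugeatZ a y : 0 < a -> gaugeat (a *: y) = a * gaugeat y.
Proof. exact: gaugeZ q00 S_closed S_conv S_in a y. Qed.

Lemma gaugeat0 : gaugeat 0 = 0.
Proof. exact: gauge0 q00 S_closed S_conv S_in. Qed.

Lemma enorm_gaugeat y : enorm y <= r1 * gaugeat y.
Proof. exact: enorm_gauge q00 S_closed S_conv S_in S_out y. Qed.

Lemma gaugeat_le y l : 0 < l -> gaugeat y <= l <-> Q (x0 + l^-1 *: y).
Proof. exact: gauge_le q00 S_closed S_conv S_in y l. Qed.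

Lemma gaugeat_le1 y : gaugeat y <= 1 <-> Q (x0 + y).
Proof. exact: gauge_le1 q00 S_closed S_conv S_in y. Qed.

End shifted_gauge.

Section body.
Context {R : realType} {m : nat}.
Variables (r : R) (K : set 'rV[R]_m.+1) (f : 'rV[R]_m.+1 -> R) (cf rb r1 : R) (x0 : 'rV[R]_m.+1).
Hypotheses (r0 : 0 < r) (cK : compact K)
  (Kconv : forall x y t, 0 <= t <= 1 -> K x -> K y -> K ((1 - t) *: x + t *: y))
  (Kball : ball_convex r K)
  (fcont : {within K, continuous f}) (cf0 : 0 < cf) (f_ge : forall y, K y -> cf <= f y)
  (rb0 : 0 < rb) (x0b : eball x0 rb `<=` K) (r10 : 0 < r1) (Kout : K `<=` eball x0 r1).

Notation F := (floating_body r K f).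
Notation om := (vol (@eball R m 0 1)).
Notation j := (gaugeat K x0).
Notation jF d := (gaugeat (F d) x0).

Let clK : closed K.
Proof. by apply: compact_closed cK; exact: norm_hausdorff. Qed.

Let rbV0 : 0 < rb^-1. Proof. by rewrite invr_gt0. Qed.
Let rb20 : 0 < rb / 2. Proof. by rewrite divr_gt0. Qed.
Let jL := gaugeat_lip rb0 clK Kconv x0b.
Let jconv := gaugeat_convex rb0 clK Kconv x0b.
Let jZ := gaugeatZ rb0 clK Kconv x0b.
Let j0 := gaugeat0 rb0 clK Kconv x0b.
Let jM := enorm_gaugeat rb0 clK Kconv x0b Kout.
Let jle := gaugeat_le rb0 clK Kconv x0b.
Let jle1 := gaugeat_le1 rb0 clK Kconv x0b.

(** For small d, half the weight of a ball of radius rb / 2 exceeds d, so by [floating_symmetric] no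
    point of the smaller ball is cut off. From there on the floating body has a gauge centred at
    [x0]. *)
Lemma floating_ball : exists2 ds, 0 < ds & forall d, 0 < d -> d < ds -> eball x0 (rb / 2) `<=` F d.
Proof.
pose V := lam m.+1 (@eball R m.+1 0 (rb / 2)).
have V0 : (0 < V)%E by exact: eball_gt0.
have Voo : (V < +oo)%E by exact: eball_lty.
have VE : V = (fine V)%:E by rewrite fineK// ge0_fin_numE// ltW.
have fV0 : 0 < fine V by rewrite -lte_fin -VE.
exists (cf * fine V / 2); first by rewrite divr_gt0// mulr_gt0.
move=> d d0 dlt q qb; apply: contrapT => nF.
have bN (h : 'rV[R]_m.+1) : eball 0 (rb / 2) h -> eball 0 (rb / 2) (- h) by rewrite /eball/= !subr0 enormN.
have bK h : eball 0 (rb / 2) h -> K (q + h).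
  move=> hb; apply: x0b; move: qb hb; rewrite /eball/= subr0 => qb hb.
  by rewrite addrAC; apply: le_trans (ler_enormD _ _) _; lra.
have := floating_symmetric clK fcont cf0 f_ge (borel_eball 0 (rb / 2)) bN bK nF.
rewrite (_ : lam _ _ = V)// VE -EFinM lee_fin leNgt => /negP; apply.
by rewrite mulrC -ltr_pdivlMr.
Qed.

Variable ds : R.
Hypotheses (ds0 : 0 < ds) (dsP : forall d, 0 < d -> d < ds -> eball x0 (rb / 2) `<=` F d).

Section one_delta.
Variable d : R.
Hypotheses (d0 : 0 < d) (dds : d < ds).

Let cF : closed (F d). Proof. exact: floating_closed. Qed.
Let Fconv x y t : 0 <= t <= 1 -> F d x -> F d y -> F d ((1 - t) *: x + t *: y).
Proof. exact: floating_convex. Qed.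
Let Fin := dsP d0 dds.
Let FK : F d `<=` K. Proof. by apply: floating_sub => //; exact: ltW. Qed.

Lemma floating_gauge_lip x y : `|jF d x - jF d y| <= (rb / 2)^-1 * enorm (x - y).
Proof. exact: gaugeat_lip rb20 cF Fconv Fin x y. Qed.

Lemma floating_gaugeZ a y : 0 < a -> jF d (a *: y) = a * jF d y.
Proof. exact: gaugeatZ rb20 cF Fconv Fin a y. Qed.

Lemma floating_gauge_le1 y : jF d y <= 1 <-> F d (x0 + y).
Proof. exact: gaugeat_le1 rb20 cF Fconv Fin y. Qed.

Lemma floating_gauge_ray y s : 0 < s -> jF d y <= s^-1 <-> F d (x0 + s *: y).
Proof.
move=> s0; have := gaugeat_le rb20 cF Fconv Fin y (l := s^-1); rewrite invrK; apply.
by rewrite invr_gt0.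
Qed.

Lemma floating_gauge_ge y : j y <= jF d y.
Proof.
apply/ler_addgt0Pr => e e0; have jFe : 0 < jF d y + e.
  rewrite ltr_wpDl//; apply: (gauge_ge0 rb20) => z zb.
  by apply: Fin; move: zb; rewrite /eball/= subr0 addrAC subrr add0r.
apply/(jle y jFe); apply: FK.
by apply/(gaugeat_le rb20 cF Fconv Fin y jFe); rewrite lerDl ltW.
Qed.

End one_delta.

Lemma floating_gauge_depth : exists2 C : R, 0 < C & forall X c p d, 0 < c -> 0 < d -> d < ds -> j X = 1 ->
  good j c p X -> (1 - (jF d X)^-1) ^+ m.+2 <= C * (d ^+ 2 * c ^+ m).
Proof.
have Kj y : K (x0 + y) <-> j y <= 1 by split => /jle1.
have [C C0 CP] := floating_depth r clK fcont cf0 f_ge rbV0 jL jconv jZ j0 Kj.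
exists C => // X c p d c0 d0 dds jX gX; have jF1 : 1 <= jF d X by rewrite -jX floating_gauge_ge.
have jF0 : 0 < jF d X by exact: lt_le_trans jF1.
apply: (CP X c p d) => //.
- by rewrite subr_ge0 invf_le1.
- by rewrite gerBl invr_ge0 ltW.
move=> s; rewrite subKr => js s1 Fs.
have s0 : 0 < s by apply: lt_trans js; rewrite invr_gt0.
have /(floating_gauge_ray d0 dds X s0) := Fs; rewrite leNgt => /negP; apply.
by rewrite -[ltRHS]invrK ltf_pV2 ?posrE// invr_gt0.
Qed.

(** [u] is the normal of some chart, [p] the gradient of the gauge. The paraboloid bounds the linear
    form p - u / [dotv u X] from below by - c |h|^2, which forces it to vanish, so the directions
    coincide. *)
Lemma support_gradient X p c u : 0 < c -> j X = 1 -> good j c p X -> dotv u u = 1 ->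
  (forall w, K w -> dotv u (w - (x0 + X)) <= 0) -> 0 < dotv u X -> enorm p * dotv u X = 1.
Proof.
move=> c0 jX gX uu Kh E0; set E := dotv u X in E0 *.
have jge y : dotv u y <= j y * E.
  have [->|y0] := eqVneq y 0; first by rewrite dotv0 j0 mul0r.
  have jy : 0 < j y by rewrite (radial_gt0 j0 r10 jM).
  have : K (x0 + (j y)^-1 *: y) by apply/(jle y jy).
  move=> /Kh; rewrite opprD addrACA subrr add0r dotvBr dotvZr -/E subr_le0.
  by rewrite ler_pdivrMl.
pose v := p - E^-1 *: u.
have lin h : 0 <= dotv v h + c * dotv h h.
  have := gX h; rewrite jX => h1; have := jge (X + h); rewrite dotvDr -/E => h2.
  rewrite /v dotvBl dotvZl; have h3 : E^-1 * dotv u h <= j (X + h) - 1.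
    by rewrite ler_pdivrMl// mulrBr mulr1 (mulrC E); lra.
  lra.
have v0 : v = 0.
  apply/eqP; rewrite -dotvv_eq0; have := lin (- (2 * c)^-1 *: v).
  rewrite !dotvZr dotvZl => h; apply/eqP/le_anti; rewrite dotvv_ge0 andbT.
  have -> : dotv v v = (4 * c) * ((4 * c)^-1 * dotv v v) by rewrite mulrA mulfV ?mul1r// gt_eqF// mulr_gt0.
  rewrite pmulr_rle0 ?mulr_gt0//; move: h.
  have -> : - (2 * c)^-1 * dotv v v + c * (- (2 * c)^-1 * (- (2 * c)^-1 * dotv v v)) = - ((4 * c)^-1 * dotv v v).
    by field; rewrite gt_eqF.
  by rewrite oppr_ge0.
have -> : p = E^-1 *: u by apply/eqP; rewrite -subr_eq0 -/v v0.
by rewrite enormZ gtr0_norm ?invr_gt0// enormE uu sqrtr1 mulr1 mulVf// gt_eqF.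
Qed.

(** The integrand of the theorem together with its constant: the limit of the normal depth divided
    by delta^(2 / (m + 2)). *)
Definition affine_density (x : 'rV[R]_m.+1) : R := 2^-1 * (m.+2%:R / om) `^ (2 / m.+2%:R) *
  (f x `^ (- (2 / m.+2%:R)) * \prod_(i < m) (principal_curvatures K x 0 i - r^-1) `^ (1 / m.+2%:R)).

Lemma affine_density_ge0 x : 0 <= affine_density x.
Proof.
rewrite /affine_density !mulr_ge0 ?invr_ge0 ?powR_ge0//.
by apply: prodr_ge0 => i _; exact: powR_ge0.
Qed.

Lemma affine_densityE x : 0 < f x -> (forall i, r^-1 <= principal_curvatures K x 0 i) ->
  (2 * affine_density x) ^+ m.+2 * (om * f x) ^+ 2 =
  m.+2%:R ^+ 2 * \prod_i (principal_curvatures K x 0 i - r^-1).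
Proof.
move=> f0 kr; have om0 : 0 < om by exact: om_gt0.
rewrite /affine_density (mulrA 2) (mulrA 2) mulfV ?mul1r ?pnatr_eq0// !exprMn.
have n0 : 0 <= m.+2%:R / om :> R by rewrite divr_ge0// ltW.
rewrite powR_divn// -mulNr powR_divn ?(ltW f0)// powRN.
rewrite -prodrXl (eq_bigr (fun i => principal_curvatures K x 0 i - r^-1)); last first.
  by move=> i _; rewrite -[m.+2%:R^-1]mul1r powR_divn ?subr_ge0// powRr1// subr_ge0.
rewrite (_ : (2 : R) = 2%:R)// !powR_mulrn ?(ltW f0)//.
by move: (\prod_i _) (m.+2%:R : R) => P N; field; rewrite !gt_eqF.
Qed.

(** The parameter d stands for delta = d^(m + 2), so that delta^(2 / (m + 2)) = d^2. Relative depth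
    on the ray is normal depth divided by [dotv u X], which is 1 / |p|; hence the factor |p|. *)
Lemma floating_gauge_limit X p c A (e : R) : j X = 1 -> 0 < c -> good j c p X -> exp2 j X p A -> 0 < e ->
  exists2 d0, 0 < d0 & forall d, 0 < d -> d < d0 -> d ^+ m.+2 < ds /\
    `|(1 - (jF (d ^+ m.+2) X)^-1) / d ^+ 2 - affine_density (x0 + X) * enorm p| <= e.
Proof.
move=> jX c0 gX eX e0; have pX : dotv p X = 1 by rewrite (good_euler jconv jZ j0 (ltW c0) gX).
have p0 : p != 0 by apply: contra_eq_neq pX => ->; rewrite dot0v eq_sym oner_neq0.
have P0 : 0 < enorm p by rewrite enorm_gt0.
have [|E EE Ep] := @orthonormal_complement R m ((enorm p)^-1 *: p).
  by rewrite enormZ gtr0_norm ?invr_gt0// mulVf// gt_eqF.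
have KE w : K w <-> j (w - x0) <= 1 by rewrite jle1 addrC subrK.
have pcE := chart_curvatures (ltW rbV0) jL jconv c0 jX gX eX p0 EE Ep KE.
have pc : is_principal_curvatures K (x0 + X) (principal_curvatures K (x0 + X)) := xgetPex 0 pcE.
have [u [uu kr Kh E0 UL]] := pointwise_floating r0 cK Kball fcont cf0 f_ge rb0 x0b pc.
have KX : K (x0 + X) by apply/jle1; rewrite jX.
have f0 : 0 < f (x0 + X) by apply: lt_le_trans (f_ge KX).
have [U Lw] := UL _ (affine_density_ge0 _) (affine_densityE f0 kr).
have XE : x0 + X - x0 = X by rewrite addrAC subrr add0r.
rewrite XE in E0 U Lw; have pE := support_gradient c0 jX gX uu Kh E0.
set W := affine_density _ in U Lw *; set E' := dotv u X in E0 U Lw pE.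
have W0 : 0 <= W by exact: affine_density_ge0.
set ka := W * enorm p; have ka0 : 0 <= ka by rewrite mulr_ge0// ltW.
have kaE : ka * E' = W by rewrite /ka -mulrA pE mulr1.
have Wk : W < (ka + e) * E' by rewrite mulrDl kaE ltrDl mulr_gt0.
have [d1 d10 d1P] := U _ Wk.
(* When [ka - e] is not positive the lower bound is trivial; [pointwise_floating] speaks of positive
   parameters. *)
have [d2 d20 d2P] : exists2 d2, 0 < d2 & forall d, 0 < d -> d < d2 -> ka - e <= 0 \/
    ~ F (d ^+ m.+2) (x0 + X - ((ka - e) * d ^+ 2) *: X).
  have [h|h] := lerP (ka - e) 0; first by exists 1 => // d _ _; left.
  have [|d2 d20 d2P] := Lw _ h; first by rewrite mulrBl kaE gtrBl mulr_gt0.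
  by exists d2 => // d dgt dlt; right; exact: d2P.
(* The last entry keeps (ka + e) d^2 below 1, so that the test points stay on the open ray from
   [x0]. *)
pose D := Num.min (Num.min d1 d2) (Num.min (Num.min 1 ds) (ka + e + 1)^-1).
have kae : 0 < ka + e + 1 by rewrite addr_gt0// ltr_wpDl.
exists D; first by rewrite !lt_min d10 d20 ltr01 ds0 invr_gt0.
move=> d dgt; rewrite !lt_min => /andP[/andP[dd1 dd2] /andP[/andP[d1' dds] dka]].
have dn : d ^+ m.+2 < ds.
  by apply: le_lt_trans dds; rewrite exprS ler_piMr ?(ltW dgt)// exprn_ile1// ltW.
split => //; have dn0 : 0 < d ^+ m.+2 by rewrite exprn_gt0.
have d20' : 0 < d ^+ 2 by rewrite exprn_gt0.
have small (b : R) : b <= ka + e -> b * d ^+ 2 < 1.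
  move=> bk; apply: le_lt_trans (_ : (ka + e + 1) * d < 1); last by rewrite -ltr_pdivlMl// mulr1.
  have bk' : b <= ka + e + 1 by apply: le_trans bk _; rewrite lerDl.
  apply: le_trans (ler_wpM2r (ltW d20') bk') _; rewrite ler_wpM2l ?(ltW kae)// expr2.
  by rewrite ler_piMr ?(ltW dgt)// ltW.
have jF1 : 1 <= jF (d ^+ m.+2) X by rewrite -jX floating_gauge_ge.
have jF0 : 0 < jF (d ^+ m.+2) X by exact: lt_le_trans jF1.
have line (s : R) : x0 + X - s *: X = x0 + (1 - s) *: X by rewrite scalerBl scale1r addrA.
set T := 1 - (jF (d ^+ m.+2) X)^-1.
have T0 : 0 <= T by rewrite subr_ge0 invf_le1.
have up : T / d ^+ 2 <= ka + e.
  have := d1P d dgt dd1; rewrite line; set s := (ka + e) * d ^+ 2.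
  have s1 : 0 < 1 - s by rewrite subr_gt0 small.
  move=> /(floating_gauge_ray dn0 dn X s1) h.
  rewrite ler_pdivrMr// -/s /T lerBlDr -lerBlDl.
  by rewrite -[leLHS]invrK lef_pV2 ?posrE// invr_gt0.
have lo : ka - e <= T / d ^+ 2.
  have [h|h] := d2P d dgt dd2; first by apply: le_trans h _; rewrite divr_ge0// ltW.
  have [h0|h0] := lerP (ka - e) 0; first by apply: le_trans h0 _; rewrite divr_ge0// ltW.
  move: h; rewrite line; set s := (ka - e) * d ^+ 2 => nF.
  have s1 : 0 < 1 - s by rewrite subr_gt0 small//; lra.
  rewrite ler_pdivlMr// -/s /T lerBrDr -lerBrDl leNgt; apply/negP => h; apply: nF.
  apply/(floating_gauge_ray dn0 dn X s1).
  by rewrite -[leLHS]invrK lef_pV2 ?posrE ?invr_gt0//; exact: ltW.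
by rewrite ler_norml; apply/andP; split; lra.
Qed.

End body.

Lemma bernoulli_ge (R : realDomainType) (e : R) (N : nat) : 0 <= e -> e <= 1 ->
  (1 - e) ^+ N <= 1 - N%:R * e + N%:R ^+ 2 * e ^+ 2.
Proof.
move=> e0 e1; elim: N => [|N IH]; first by rewrite mul0r subr0 expr0 expr0n/= mul0r addr0.
rewrite exprS; apply: le_trans (ler_wpM2l _ IH) _; first by rewrite subr_ge0.
rewrite -natr1 -subr_ge0; set k := N%:R.
have -> : 1 - (k + 1) * e + (k + 1) ^+ 2 * e ^+ 2 - (1 - e) * (1 - k * e + k ^+ 2 * e ^+ 2) =
  (k + 1) * e ^+ 2 + k ^+ 2 * (e ^+ 2 * e) by ring.
by rewrite addr_ge0 ?mulr_ge0 ?sqr_ge0 ?addr_ge0 ?ler0n.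
Qed.

Lemma lebesgue_point (R : realType) (m : nat) : lam m.+1 [set (0 : 'rV[R]_m.+1)] = 0%E.
Proof.
apply/eqP; rewrite eq_le outer_measure_ge0 andbT.
apply: (@le_trans _ _ (lam m.+1 (box (0 : 'rV[R]_m.+1) 0))).
  by apply: le_outer_measure => _ -> i; rewrite lexx.
by rewrite lebesgue_box// big_ord_recl subrr mul0r.
Qed.

Lemma lebesgue_up_to_point (R : realType) (m : nat) (A C : set 'rV[R]_m.+1) :
  A `<=` C -> C `<=` A `|` [set 0] -> lam m.+1 C = lam m.+1 A.
Proof.
move=> AC CA; apply/eqP; rewrite eq_le; apply/andP; split; last exact: le_outer_measure.
apply: le_trans (le_outer_measure _ _ _ CA) _; apply: le_trans (outer_measureU2 _ _ _) _.
by rewrite [X in (_ + X)%E](_ : _ = 0%E) ?adde0//; exact: lebesgue_point.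
Qed.

(** * The volume difference as an integral over the body *)

Section defect.
Context {R : realType} {m : nat}.
Variables (j jF : 'rV[R]_m.+1 -> R) (L LF M : R).
Hypotheses (jL : forall x y, `|j x - j y| <= L * enorm (x - y))
  (jFL : forall x y, `|jF x - jF y| <= LF * enorm (x - y))
  (jZ : forall a y, 0 < a -> j (a *: y) = a * j y) (j0 : j 0 = 0)
  (jFZ : forall a y, 0 < a -> jF (a *: y) = a * jF y)
  (jF_ge : forall y, j y <= jF y) (M0 : 0 < M) (jM : forall y, enorm y <= M * j y).

Notation B := (@borelRV R m.+1).
Notation n := m.+1.
Notation U := (jcone j [set y | j y = 1]).

Lemma jconeE y : U y <-> 0 < j y <= 1.
Proof.
split=> [[]//|jy]; split => //=; have /andP[j0' _] := jy.
by rewrite jZ ?invr_gt0// mulVf// gt_eqF.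
Qed.

Lemma measurable_junit : measurable (U : set B).
Proof.
apply: (measurable_jcone jL); apply: borel_closed.
have cj : continuous j by exact: lipschitz_enorm_continuous jL.
by apply: (@closed_comp _ _ j [set t : R | t = 1]) => [y _|]; [exact: cj|exact: closed_eq].
Qed.

Lemma junit_lty : (lam n U < +oo)%E.
Proof.
apply: (@bounded_lty _ _ _ M) => y /jconeE /andP[jy jy1].
by apply: le_trans (jM y) _; rewrite ler_piMr// ltW.
Qed.

Lemma lebesgue_unit_ball : lam n [set y | j y <= 1] = lam n U.
Proof.
apply: lebesgue_up_to_point => y; first by move=> /jconeE /andP[].
move=> /= jy; have [->|y0] := eqVneq y 0; [by right|left; apply/jconeE].
by rewrite jy andbT (radial_gt0 j0 M0 jM).
Qed.

Lemma lebesgue_unit_ballF : lam n [set y | jF y <= 1] = lam n [set y | 0 < jF y <= 1 /\ 0 < j y].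
Proof.
apply: lebesgue_up_to_point => y; first by case=> /andP[].
move=> /= jy; have [->|y0] := eqVneq y 0; [by right|left].
have jy0 : 0 < j y by rewrite (radial_gt0 j0 M0 jM).
by rewrite jy (lt_le_trans jy0).
Qed.

Lemma measurable_ratio : measurable_fun setT (fun y : B => 1 - (j y / jF y) ^+ n).
Proof.
have jge y : 0 <= j y by exact: radial_ge0 M0 jM y.
have -> : (fun y : B => 1 - (j y / jF y) ^+ n) = (fun y : B => 1 - (j y * jF y `^ (-1)) ^+ n).
  by apply/funext => y; rewrite powR_inv1// (le_trans (jge y)).
apply: measurable_funB; first exact: measurable_cst.
apply: measurable_funX; apply: measurable_funM.
  by apply: borel_continuousR; exact: lipschitz_enorm_continuous jL.
apply: (measurableT_comp (measurable_powR (-1))).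
by apply: borel_continuousR; exact: lipschitz_enorm_continuous jFL.
Qed.

Lemma ratio_itv y : U y -> 0 <= (j y / jF y) ^+ n <= 1.
Proof.
move=> /jconeE /andP[jy _]; have jFy : 0 < jF y by exact: lt_le_trans (jF_ge y).
rewrite exprn_ge0 ?divr_ge0 ?(ltW jy) ?(ltW jFy)//= exprn_ile1 ?divr_ge0 ?(ltW jy) ?(ltW jFy)//.
by rewrite ler_pdivrMr// mul1r.
Qed.

Lemma volume_defect : (\int[@leb R n]_(y in U) (1 - (j y / jF y) ^+ n)%:E =
  (fine (lam n [set y | j y <= 1]) - fine (lam n [set y | jF y <= 1]))%:E)%E.
Proof.
have sv := star_volume jL jFL jZ j0 jFZ jF_ge.
rewrite lebesgue_unit_ball lebesgue_unit_ballF sv.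
have mU := measurable_junit.
have mr : measurable_fun (U : set B) (fun y => (1 - (j y / jF y) ^+ n)%:E).
  apply/measurable_EFinP; apply: measurable_funTS; exact: measurable_ratio.
have mt : measurable_fun (U : set B) (fun y => ((j y / jF y) ^+ n)%:E).
  have -> : (fun y : B => ((j y / jF y) ^+ n)%:E) = (fun y : B => (1 - (1 - (j y / jF y) ^+ n))%:E).
    by apply/funext => y; rewrite subKr.
  apply/measurable_EFinP; apply: measurable_funB; first exact: measurable_cst.
  apply: measurable_funTS; exact: measurable_ratio.
have r0 y : U y -> (0 <= (1 - (j y / jF y) ^+ n)%:E)%E.
  by move=> /ratio_itv /andP[_ h]; rewrite lee_fin subr_ge0.
have t0 y : U y -> (0 <= ((j y / jF y) ^+ n)%:E)%E.
  by move=> /ratio_itv /andP[h _]; rewrite lee_fin.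
have sumU : (lam n U = \int[@leb R n]_(y in U) (1 - (j y / jF y) ^+ n)%:E +
    \int[@leb R n]_(y in U) ((j y / jF y) ^+ n)%:E)%E.
  rewrite -ge0_integralD//; transitivity (\int[@leb R n]_(y in U) cst 1%:E y)%E.
    by rewrite integral_cst// mul1e.
  by apply: eq_integral => y _; rewrite -EFinD subrK.
have Uoo := junit_lty.
set I1 := (\int[_]_(_ in _) (1 - _)%:E)%E in sumU *; set I2 := (\int[_]_(_ in _) _%:E)%E in sumU *.
have I10 : (0 <= I1)%E by exact: integral_ge0.
have I20 : (0 <= I2)%E by exact: integral_ge0.
have I1oo : (I1 < +oo)%E by apply: le_lt_trans Uoo; rewrite sumU leeDl.
have I2oo : (I2 < +oo)%E by apply: le_lt_trans Uoo; rewrite sumU leeDr.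
have f1 : I1 \is a fin_num by rewrite ge0_fin_numE.
have f2 : I2 \is a fin_num by rewrite ge0_fin_numE.
by rewrite sumU fineD// addrK fineK.
Qed.

End defect.

Section geometric.
Context {R : realType}.

Lemma geometric_le (a z : R) : 0 <= a -> 0 <= z -> z < 1 ->
  (\sum_(k <oo) (a * z ^+ k)%:E <= (a / (1 - z))%:E)%E.
Proof.
move=> a0 z0 z1; have z1' : 0 < 1 - z by rewrite subr_gt0.
apply: lime_le; first by apply: is_cvg_nneseries => k _ _; rewrite lee_fin mulr_ge0// exprn_ge0.
near=> N; rewrite sumEFin lee_fin -mulr_sumr ler_wpM2l// big_mkord.
rewrite -[leRHS]mul1r ler_pdivlMr// mulrC.
have := subrX1 z N; rewrite -(opprB 1 z) mulNr => /(congr1 -%R); rewrite opprK opprB => <-.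
by rewrite gerBl exprn_ge0.
Unshelve. all: by end_near.
Qed.

End geometric.

(** * Dominated convergence and the surface integral *)

Section limit_integral.
Context {R : realType} {m : nat}.
Variables (r : R) (K : set 'rV[R]_m.+1) (f : 'rV[R]_m.+1 -> R) (cf rb r1 : R) (x0 : 'rV[R]_m.+1).
Hypotheses (r0 : 0 < r) (cK : compact K)
  (Kconv : forall x y t, 0 <= t <= 1 -> K x -> K y -> K ((1 - t) *: x + t *: y))
  (Kball : ball_convex r K)
  (fcont : {within K, continuous f}) (cf0 : 0 < cf) (f_ge : forall y, K y -> cf <= f y)
  (rb0 : 0 < rb) (x0b : eball x0 rb `<=` K) (r10 : 0 < r1) (Kout : K `<=` eball x0 r1).

Notation F := (floating_body r K f).
Notation j := (gaugeat K x0).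
Notation jF d := (gaugeat (F d) x0).
Notation B := (@borelRV R m.+1).
Notation U := (jcone j [set y | j y = 1]).
Notation density := (affine_density r K f).

Let clK : closed K.
Proof. by apply: compact_closed cK; exact: norm_hausdorff. Qed.

Let rbV0 : 0 < rb^-1. Proof. by rewrite invr_gt0. Qed.
Let jL := gaugeat_lip rb0 clK Kconv x0b.
Let jconv := gaugeat_convex rb0 clK Kconv x0b.
Let jZ := gaugeatZ rb0 clK Kconv x0b.
Let j0 := gaugeat0 rb0 clK Kconv x0b.
Let jM := enorm_gaugeat rb0 clK Kconv x0b Kout.
Let jle1 := gaugeat_le1 rb0 clK Kconv x0b.

Variable ds : R.
Hypotheses (ds0 : 0 < ds) (dsP : forall d, 0 < d -> d < ds -> eball x0 (rb / 2) `<=` F d).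

Let jFL d (d0 : 0 < d) (dd : d < ds) := floating_gauge_lip rb0 dsP d0 dd.
Let jFZ d (d0 : 0 < d) (dd : d < ds) := floating_gaugeZ rb0 dsP d0 dd.
Let jFge d (d0 : 0 < d) (dd : d < ds) := floating_gauge_ge cK Kconv Kball rb0 x0b dsP d0 dd.
Let jFle1 d (d0 : 0 < d) (dd : d < ds) := floating_gauge_le1 rb0 dsP d0 dd.

(** The polar integrand divided by d^2, set to 0 while delta = d^(m + 2) is too large to guarantee a
    gauge of the floating body at [x0]. *)
Definition defect d y : R := if d ^+ m.+2 < ds then
  (d ^+ 2)^-1 * (1 - (j y / jF (d ^+ m.+2) y) ^+ m.+1) else 0.

Let mU : measurable (U : set B) := measurable_junit jL.

Lemma measurable_defect d : 0 < d -> measurable_fun setT (defect d : B -> R).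
Proof.
move=> d0; have dm := exprn_gt0 m.+2 d0; case: (boolP (d ^+ m.+2 < ds)) => dd; last first.
  by rewrite /defect (negbTE dd); exact: measurable_cst.
have -> : (defect d : B -> R) = fun y => (d ^+ 2)^-1 * (1 - (j y / jF (d ^+ m.+2) y) ^+ m.+1).
  by apply/funext => y; rewrite /defect dd.
apply: measurable_funM; first exact: measurable_cst.
exact: (measurable_ratio jL (jFL dm dd) (jFge dm dd) r10 jM).
Qed.

Lemma defect_ge0 d y : 0 < d -> U y -> 0 <= defect d y.
Proof.
move=> d0 Uy; rewrite /defect; case: ifPn => // dd; have dm := exprn_gt0 m.+2 d0.
have /andP[_ h] := ratio_itv jZ (jFge dm dd) Uy.
by rewrite mulr_ge0 ?invr_ge0 ?exprn_ge0 ?(ltW d0)// subr_ge0.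
Qed.

Lemma defect_ray d t y : 0 < d -> 0 < t -> defect d (t *: y) = defect d y.
Proof.
move=> d0 t0; have dm := exprn_gt0 m.+2 d0; case: (boolP (d ^+ m.+2 < ds)) => dd; last first.
  by rewrite /defect (negbTE dd).
rewrite /defect dd (jZ y t0) (jFZ dm dd y t0).
by rewrite -mulf_div mulfV ?gt_eqF// mul1r.
Qed.

Lemma defect_integral d : 0 < d -> d ^+ m.+2 < ds ->
  (\int[@leb R m.+1]_(y in U) (defect d y)%:E = ((vol K - vol (F (d ^+ m.+2))) / d ^+ 2)%:E)%E.
Proof.
move=> d0 dd; have dm := exprn_gt0 m.+2 d0.
have volE Q : vol Q = fine (lam m.+1 [set y | Q (x0 + y)]).
  rewrite /vol /lebesgue_n -[in LHS](lebesgue_preimageD Q x0); congr (fine (lam _ _)).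
  by apply/seteqP; split => y /=; rewrite addrC.
rewrite [RHS](_ : _ = ((d ^+ 2)^-1%:E * ((vol K - vol (F (d ^+ m.+2)))%:E))%E); last first.
  by rewrite -EFinM mulrC.
have KE : [set y | j y <= 1] = [set y | K (x0 + y)] by apply/seteqP; split => y /jle1.
have FE : [set y | jF (d ^+ m.+2) y <= 1] = [set y | F (d ^+ m.+2) (x0 + y)].
  by apply/seteqP; split => y /(jFle1 dm dd).
rewrite !volE -KE -FE -(volume_defect jL (jFL dm dd) jZ j0 _ (jFge dm dd) r10 jM); last first.
  by move=> a y a0; exact: jFZ.
rewrite -ge0_integralZl//.
- by apply: eq_integral => y _; rewrite /defect dd -EFinM.
- apply/measurable_EFinP; apply: measurable_funTS.
  exact: (measurable_ratio jL (jFL dm dd) (jFge dm dd) r10 jM).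
- by move=> y Uy; rewrite lee_fin subr_ge0; have /andP[] := ratio_itv jZ (jFge dm dd) Uy.
- by rewrite lee_fin invr_ge0 exprn_ge0// ltW.
Qed.

Let defectE d X : 0 < d -> j X = 1 -> d ^+ m.+2 < ds ->
  defect d X = (1 - (1 - (1 - (jF (d ^+ m.+2) X)^-1)) ^+ m.+1) / d ^+ 2.
Proof. by move=> d0 jX dd; rewrite /defect dd jX div1r subKr mulrC. Qed.

Let depth_itv d X : 0 < d -> j X = 1 -> d < ds -> 0 <= 1 - (jF d X)^-1 <= 1.
Proof.
move=> d0 jX dd; have jF1 : 1 <= jF d X by rewrite -jX jFge.
have jF0 : 0 < jF d X by exact: lt_le_trans jF1.
by rewrite subr_ge0 invf_le1// jF1 lerBlDr lerDl invr_ge0 ltW.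
Qed.

Lemma defect_le d X : 0 < d -> j X = 1 -> d ^+ m.+2 < ds ->
  defect d X <= m.+1%:R * ((1 - (jF (d ^+ m.+2) X)^-1) / d ^+ 2).
Proof.
move=> d0 jX dd; have dm := exprn_gt0 m.+2 d0; rewrite defectE// mulrA.
have := bernoulli_le m.+1 (depth_itv dm jX dd).
rewrite ler_pM2r ?invr_gt0 ?exprn_gt0//; lra.
Qed.

(** With T the relative depth, 1 - (1 - T)^(m + 1) lies between (m + 1) T - ((m + 1) T)^2 and (m +
    1) T; as T / d^2 converges, the quadratic term vanishes after division by d^2. *)
Lemma defect_limit X p c A (u : nat -> R) : j X = 1 -> 0 < c -> good j c p X -> exp2 j X p A ->
  (forall k, 0 < u k) -> u @ \oo --> 0 ->
  defect (u k) X @[k --> \oo] --> m.+1%:R * (density (x0 + X) * enorm p).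
Proof.
move=> jX c0 gX eX u0 u_0.
have lim e : 0 < e -> \forall k \near \oo, u k ^+ m.+2 < ds /\
    `|(1 - (jF (u k ^+ m.+2) X)^-1) / u k ^+ 2 - density (x0 + X) * enorm p| <= e.
  move=> e0; have [d0 d00 dP] := floating_gauge_limit r0 cK Kconv Kball fcont cf0 f_ge rb0 x0b
    r10 Kout ds0 dsP jX c0 gX eX e0.
  have /cvgrPdist_lt/(_ d0 d00) := u_0; apply: filterS => k.
  by rewrite sub0r normrN gtr0_norm// => /dP; apply.
pose T k := (1 - (jF (u k ^+ m.+2) X)^-1) / u k ^+ 2.
have Tl : T @ \oo --> density (x0 + X) * enorm p.
  apply/cvgrPdist_le => e e0; have := lim e e0; apply: filterS => k [_].
  by rewrite distrC.
apply: (@squeeze_cvgr _ _ _ _ (fun k => m.+1%:R * T k - (m.+1%:R * T k * u k) ^+ 2) (fun k => m.+1%:R * T k)).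
- have := lim 1 ltr01; apply: filterS => k [dd _]; have dm := exprn_gt0 m.+2 (u0 k).
  rewrite defect_le// andbT defectE//; have /andP[e0 e1] := depth_itv dm jX dd.
  have := bernoulli_ge m.+1 e0 e1; rewrite ler_pdivlMr ?exprn_gt0//.
  have u2 : u k ^+ 2 != 0 by rewrite gt_eqF// exprn_gt0.
  have -> : 1 - (jF (u k ^+ m.+2) X)^-1 = T k * u k ^+ 2 by rewrite /T divfK.
  set N := m.+1%:R; set t := T k; set w := u k; rewrite mulrBl.
  have -> : (N * t * w) ^+ 2 * w ^+ 2 = N ^+ 2 * (t * w ^+ 2) ^+ 2 by ring.
  rewrite -(mulrA N t); move: ((1 - _) ^+ m.+1) (N * _) (N ^+ 2 * _) => b y z; lra.
- rewrite -[X in _ --> X]subr0; apply: cvgB; first by apply: cvgM => //; exact: cvg_cst.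
  rewrite (_ : 0 = (m.+1%:R * (density (x0 + X) * enorm p) * 0) ^+ 2); last by rewrite mulr0 expr0n.
  have h : (fun k => m.+1%:R * T k * u k) @ \oo --> m.+1%:R * (density (x0 + X) * enorm p) * 0.
    by apply: cvgM => //; apply: cvgM => //; exact: cvg_cst.
  by rewrite expr2; apply: cvgM; exact: h.
- by apply: cvgM => //; exact: cvg_cst.
Qed.

Lemma exp2_scale X p A t : 0 < t -> exp2 j X p A -> exp2 j (t *: X) p (t^-1 *: A).
Proof.
move=> t0 H e e0; have [d d0 dP] := H (e * t) (mulr_gt0 e0 t0).
exists (t * d) => [|h ht]; first exact: mulr_gt0.
have tn : t != 0 by rewrite gt_eqF.
have hd : enorm (t^-1 *: h) < d.
  by rewrite enormZ ger0_norm ?invr_ge0 ?(ltW t0)// mulrC ltr_pdivrMr// mulrC.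
have := dP _ hd.
rewrite -scalemxAl -scalemxAr !dotvZl !dotvZr enormZ (@ger0_norm _ t^-1) ?invr_ge0 ?(ltW t0)//.
have -> : t *: X + h = t *: (X + t^-1 *: h) by rewrite scalerDr scalerA mulfV// scale1r.
rewrite !jZ//; set E1 := (_ - _) => H1.
rewrite (_ : _ - 2^-1 * _ = t * E1); last by rewrite /E1; field.
rewrite normrM (gtr0_norm t0); apply: le_trans (ler_wpM2l (ltW t0) H1) _.
by rewrite le_eqVlt; apply/orP; left; apply/eqP; field.
Qed.

(** b = 2^(m / (m + 2)) is the growth of the depth bound when the opening doubles; b < 2 makes the
    series in [defect_dominated] converge. *)
Let ratio2 : exists2 b : R, 0 <= b < 2 & b ^+ m.+2 = 2 ^+ m.
Proof.
have bE : ((2 : R) `^ (m%:R / m.+2%:R)) ^+ m.+2 = 2 ^+ m by rewrite powR_divn// powR_mulrn.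
exists (2 `^ (m%:R / m.+2%:R)); rewrite ?powR_ge0//=.
rewrite -(@ltr_pXn2r _ m.+2) ?nnegrE ?powR_ge0// bE ltr_eXn2l//.
by rewrite ltr1n.
Qed.

(** Dyadic layers: a point good for the opening 2^k has defect at most A b^k, and the points not
    good for 2^(k - 1) have measure O(2^-k). The majorant adds up these bounds over all k. *)
Lemma defect_dominated : exists G : B -> \bar R, (@leb R m.+1).-integrable U G /\
  forall d y, 0 < d -> U y -> (exists k, goods j k.+1%:R y) -> ((defect d y)%:E <= G y)%E.
Proof.
have [C C0 CP] := floating_gauge_depth cK Kconv Kball fcont cf0 f_ge rb0 x0b dsP.
have [C' C'0 C'P] := goods_volume (ltW rbV0) jL jconv r10.
have [b /andP[b0 b2] bE] := ratio2.
pose a := C `^ (1 / m.+2%:R); have a0 : 0 <= a by exact: powR_ge0.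
have aE : a ^+ m.+2 = C by rewrite powR_divn ?(ltW C0)// powRr1// ltW.
pose A := m.+1%:R * a; have A0 : 0 <= A by rewrite mulr_ge0.
have Ab0 k : 0 <= A * b ^+ k by rewrite mulr_ge0// exprn_ge0.
have p20 k : 0 < 2 ^+ k :> R by exact: exprn_gt0.
have bound k d y : 0 < d -> U y -> goods j (2 ^+ k) y -> defect d y <= A * b ^+ k.
  move=> d0 [/andP[jy jy1] /= jX] [p gp]; case: (boolP (d ^+ m.+2 < ds)) => dd; last first.
    by rewrite /defect (negbTE dd).
  have jy0 : 0 < (j y)^-1 by rewrite invr_gt0.
  rewrite -(defect_ray y d0 jy0); set X := _ *: y in jX *.
  have gX : good j (2 ^+ k) p X.
    apply: good_le (good_scale jZ jy0 gp).
    by rewrite invrK ler_piMr// ltW.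
  apply: le_trans (defect_le d0 jX dd) _; rewrite /A -mulrA ler_wpM2l//.
  have dm := exprn_gt0 m.+2 d0; have := CP X _ p _ (p20 k) dm dd jX gX.
  have /andP[e0 _] := depth_itv dm jX dd; set e := 1 - _ in e0 * => H.
  rewrite -(@ler_pXn2r _ m.+2) ?nnegrE ?mulr_ge0 ?exprn_ge0 ?invr_ge0 ?exprn_ge0 ?(ltW d0)//.
  rewrite !exprMn aE -exprM mulnC exprM bE exprVn ler_pdivrMr ?exprn_gt0//.
  have dE : (d ^+ m.+2) ^+ 2 = (d ^+ 2) ^+ m.+2 by rewrite -!exprM mulnC.
  have kE : (2 ^+ k) ^+ m = (2 ^+ m) ^+ k :> R by rewrite -!exprM mulnC.
  by apply: le_trans H _; rewrite dE kE (mulrC (_ ^+ m.+2)) mulrA.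
have UB : U `<=` eball 0 r1.
  move=> y [/andP[jy jy1] _]; rewrite /eball/= subr0; apply: le_trans (jM y) _.
  by rewrite ler_piMr// ltW.
have mg k : measurable (goods j (2 ^+ k) : set B) by apply: borel_closed; exact: closed_goods (ltW rbV0) jL jconv _ (p20 k).
pose g k (y : B) : \bar R := ((A * b ^+ k.+1)%:E * (\1_(U `\` goods j (2 ^+ k)) y)%:E)%E.
have g0 k y : (0 <= g k y)%E by rewrite mule_ge0// lee_fin.
have mg' k : measurable_fun (U : set B) (g k).
  apply: emeasurable_funM; first exact: measurable_cst.
  by apply/measurable_EFinP; apply: measurable_funTS; apply: measurable_indic; exact: measurableD.
pose G y := (A%:E + \sum_(k <oo) g k y)%E.
have s0 y : (0 <= \sum_(k <oo) g k y)%E by exact: nneseries_ge0.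
have mS : measurable_fun (U : set B) (fun y => \sum_(k <oo) g k y)%E.
  by apply: ge0_emeasurable_sum => // k y _ _; exact: g0.
have mG : measurable_fun (U : set B) G by apply: emeasurable_funD.
have G0 y : (0 <= G y)%E by rewrite adde_ge0// lee_fin.
exists G; split.
  apply/integrableP; split => //.
  under eq_integral do rewrite gee0_abs//.
  rewrite ge0_integralD//.
  rewrite integral_cst//= integral_nneseries//.
  apply: lte_add_pinfty; first by rewrite lte_mul_pinfty// ?lee_fin//; exact: junit_lty jZ r10 jM.
  apply: le_lt_trans (_ : (_ <= \sum_(k <oo) ((A * b * C') * (b / 2) ^+ k)%:E)%E) _; last first.
    apply: le_lt_trans (geometric_le _ _ _) _; rewrite ?ltry//.
    - by rewrite !mulr_ge0.
    - by rewrite divr_ge0.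
    - by rewrite ltr_pdivrMr// mul1r.
  apply: lee_nneseries => [k _ _|k _]; first by apply: integral_ge0.
  rewrite /g ge0_integralZl//; last 2 first.
  - by apply/measurable_EFinP; apply: measurable_funTS; apply: measurable_indic; exact: measurableD.
  - by rewrite lee_fin.
  rewrite integral_indic//; last exact: measurableD.
  rewrite (setIidl (@subDsetl _ _ _)).
  have le1 : (@leb R m.+1 (U `\` goods j (2 ^+ k)) <= (C' / 2 ^+ k)%:E)%E.
    by apply: le_trans (C'P _ (p20 k)); apply: le_outer_measure => y [Uy ny]; split => //; exact: UB.
  apply: le_trans (lee_wpmul2l _ le1) _; first by rewrite lee_fin.
  rewrite -EFinM lee_fin le_eqVlt; apply/orP; left; apply/eqP.
  by rewrite exprS expr_div_n; ring.
move=> d y d0 Uy [k0 gk0].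
have [k gk] : exists k, goods j (2 ^+ k) y.
  exists k0.+1; have [p gp] := gk0; exists p; apply: good_le gp.
  by rewrite -natrX ler_nat ltnW// ltn_expl.
have [k' [gk' ng]] : exists k', goods j (2 ^+ k') y /\ (k' = 0%N \/ ~ goods j (2 ^+ k'.-1) y).
  elim: k gk => [|k IH] gk; first by exists 0%N; split => //; left.
  have [/IH//|ng] := pselect (goods j (2 ^+ k) y).
  by exists k.+1; split => //; right.
apply: le_trans (_ : ((A * b ^+ k')%:E <= _)%E); first by rewrite lee_fin; exact: bound.
case: ng => [->|]; first by rewrite expr0 mulr1 leeDl.
case: k' gk' => [|k'] gk' ng; first by rewrite expr0 mulr1 leeDl.
apply: le_trans (_ : (_ <= \sum_(k <oo) g k y)%E) _; last by rewrite leeDr// lee_fin.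
apply: le_trans (nneseries_lim_ge k'.+1 _); last by move=> i _ _; exact: g0.
rewrite big_nat_recr//= [X in (_ + X)%E](_ : _ = (A * b ^+ k'.+1)%:E).
  by rewrite leeDr// sume_ge0.
by rewrite /g indicE mem_set// mule1.
Qed.

Definition smooth_point y := exists c p A, [/\ 0 < c, good j c p y & exp2 j y p A].

Lemma ae_smooth_point (P : B -> Prop) : (forall y, smooth_point y -> P y) -> {ae @leb R m.+1, forall y, P y}.
Proof.
move=> H; have [Z [mZ bZ Z0]] := null_hull (alexandrov (ltW rbV0) jL jconv).
by exists Z; split => // y ny; apply: bZ => sy; apply: ny; exact: H.
Qed.

Lemma smooth_pointZ t y : 0 < t -> smooth_point y -> smooth_point (t *: y).
Proof.
move=> t0 [c [p [A [c0 gy ey]]]]; exists (c / t), p, (t^-1 *: A); split; first exact: divr_gt0.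
  exact: good_scale.
exact: exp2_scale.
Qed.

Lemma smooth_point_goods y : smooth_point y -> exists k, goods j k.+1%:R y.
Proof.
move=> [c [p [A [c0 gy _]]]]; exists (Num.truncn c), p; apply: good_le gy.
exact/ltW/truncnS_gt.
Qed.

(** An upper limit along one particular sequence is Borel and defined everywhere; at smooth points
    it is the limit along every positive null sequence. *)
Definition limit_defect y : \bar R := limn_esup (fun k => (defect k.+1%:R^-1 y)%:E).

Lemma measurable_limit_defect : measurable_fun setT (limit_defect : B -> \bar R).
Proof.
apply: measurable_fun_limn_esup => k; apply/measurable_EFinP.
by apply: measurable_defect; rewrite invr_gt0.
Qed.

Lemma limit_defect_ge0 y : U y -> (0 <= limit_defect y)%E.
Proof.
move=> Uy; rewrite /limit_defect limn_esup_lim; apply: lime_ge; first exact: is_cvg_esups.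
apply: nearW => k; apply: ereal_sup_ge.
exists (defect k.+1%:R^-1 y)%:E; first by exists k => /=.
by rewrite lee_fin; apply: defect_ge0 => //; rewrite invr_gt0.
Qed.

Lemma limit_defectZ t y : 0 < t -> limit_defect (t *: y) = limit_defect y.
Proof.
by move=> t0; congr limn_esup; apply/funext => k; rewrite defect_ray// invr_gt0.
Qed.

Let inv_cvg0 : (fun k => k.+1%:R^-1 : R) @ \oo --> (0 : R).
Proof. exact: cvg_harmonic. Qed.

(** Two paraboloids touching at one point share their gradient, by [good_lip] at distance 0, so the
    given [p] is the one of the expansion. *)
Lemma limit_defectE X p c : j X = 1 -> 0 < c -> good j c p X -> smooth_point X ->
  limit_defect X = (m.+1%:R * (density (x0 + X) * enorm p))%:E.
Proof.
move=> jX c0 gX [c' [p' [A [c'0 gX' eX]]]].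
have -> : p = p'.
  have cc0 : 0 < c + c' by exact: addr_gt0.
  have := good_lip jconv cc0 (good_le (_ : c <= c + c') gX) (good_le (_ : c' <= c + c') gX').
  rewrite subrr enorm0 mulr0 lerDl lerDr => /(_ (ltW c'0) (ltW c0)) h.
  by apply/eqP; rewrite -subr_eq0 -enorm_eq0 eq_le h enorm_ge0.
have L : (fun k => (defect k.+1%:R^-1 X)%:E) @ \oo --> (m.+1%:R * (density (x0 + X) * enorm p'))%:E.
  by apply: cvg_EFin; [exact: nearW|apply: defect_limit jX c'0 gX' eX _ inv_cvg0 => k; rewrite invr_gt0].
by have := cvg_limn_einf_sup L; case.
Qed.

Lemma defect_cvg (u : nat -> R) y : (forall k, 0 < u k) -> u @ \oo --> 0 -> U y -> smooth_point y ->
  (defect (u k) y)%:E @[k --> \oo] --> limit_defect y.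
Proof.
move=> u0 u_0 [/andP[jy jy1] /= jX] sy; have jy0 : 0 < (j y)^-1 by rewrite invr_gt0.
have := smooth_pointZ jy0 sy; rewrite -(limit_defectZ y jy0); set X := _ *: y in jX *.
move=> sX; have [c [p [A [c0 gX eX]]]] := sX; rewrite (limit_defectE jX c0 gX sX).
have -> : (fun k => (defect (u k) y)%:E) = (fun k => (defect (u k) X)%:E).
  by apply/funext => k; rewrite -(defect_ray y (u0 k) jy0).
by apply: cvg_EFin; [exact: nearW|exact: defect_limit jX c0 gX eX u0 u_0].
Qed.

Lemma integral_defect_cvg (u : nat -> R) : (forall k, 0 < u k) -> u @ \oo --> 0 ->
  (@leb R m.+1).-integrable (U : set B) limit_defect /\
  (\int[@leb R m.+1]_(y in U) (defect (u k) y)%:E)%E @[k --> \oo] --> (\int[@leb R m.+1]_(y in U) limit_defect y)%E.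
Proof.
move=> u0 u_0; have [G [iG GP]] := defect_dominated.
have [] := @dominated_convergence _ _ _ (@leb R m.+1) U mU (fun k y => (defect (u k) y)%:E) limit_defect G.
- by move=> k; apply/measurable_EFinP; apply: measurable_funTS; exact: measurable_defect.
- by apply: measurable_funTS; exact: measurable_limit_defect.
- by apply: ae_smooth_point => y sy Uy; exact: defect_cvg.
- exact: iG.
- apply: ae_smooth_point => y /smooth_point_goods sy k Uy.
  by rewrite gee0_abs ?lee_fin ?defect_ge0//; exact: GP.
by move=> i1 _ i3; split.
Qed.

Let powR_inv_cvg0 (u : nat -> R) : (forall k, 0 < u k) -> u @ \oo --> 0 ->
  (fun k => u k `^ (1 / m.+2%:R)) @ \oo --> (0 : R).
Proof.
move=> u0 u_0; apply/cvgrPdist_lt => e e0.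
have /cvgrPdist_lt/(_ _ (exprn_gt0 m.+2 e0)) := u_0; apply: filterS => k.
rewrite !sub0r !normrN !ger0_norm ?powR_ge0 ?(ltW (u0 k))// => h.
by rewrite -(@ltr_pXn2r _ m.+2) ?nnegrE ?powR_ge0 ?(ltW e0)// powR_divn ?(ltW (u0 k))// powRr1// ltW.
Qed.

(** The right limit is tested on positive null sequences u, rewritten as d^(m + 2) by taking roots;
    eventually u is below [ds], where [defect_integral] applies. *)
Lemma volume_derivative : ((vol K - vol (F d)) / d `^ (2 / m.+2%:R))%:E @[d --> 0^'+] -->
  (\int[@leb R m.+1]_(y in U) limit_defect y)%E.
Proof.
have [iL _] := @integral_defect_cvg (fun k => k.+1%:R^-1) ltac:(by move=> k; rewrite invr_gt0) inv_cvg0.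
rewrite -(fineK (integrable_fin_num mU iL)); apply: cvg_EFin; first exact: nearW.
apply/cvg_at_rightP => u [u0 u_0].
have v0 k : 0 < u k `^ (1 / m.+2%:R) by exact: powR_gt0.
have [_] := integral_defect_cvg v0 (powR_inv_cvg0 u0 u_0).
rewrite -(fineK (integrable_fin_num mU iL)) => /fine_cvgP[_]; apply: cvg_trans.
apply: near_eq_cvg; have /cvgrPdist_lt/(_ _ ds0) := u_0; apply: filterS => k.
rewrite sub0r normrN gtr0_norm// => ud.
have uE : (u k `^ (1 / m.+2%:R)) ^+ m.+2 = u k by rewrite powR_divn ?(ltW (u0 k))// powRr1// ltW.
rewrite /= defect_integral ?uE//=; congr (_ / _).
by rewrite -powR_mulrn ?powR_ge0// -powRrM mulrAC mul1r.
Qed.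

(** One vector serves all openings k, since touching gradients are unique. *)
Let gradient : exists a, forall k y, goods j k.+1%:R y -> good j k.+1%:R (a y) y.
Proof.
have /choice[a aP] : forall y, exists p, forall k, goods j k.+1%:R y -> good j k.+1%:R p y.
  move=> y; have [[k [p gp]]|ng] := pselect (exists k, goods j k.+1%:R y); last first.
    by exists 0 => k gk; exfalso; apply: ng; exists k.
  exists p => l [q gq]; have -> // : p = q.
  have k0 : 0 < k.+1%:R + l.+1%:R :> R by rewrite addr_gt0.
  have := good_lip jconv k0 (good_le (_ : k.+1%:R <= k.+1%:R + l.+1%:R) gp)
    (good_le (_ : l.+1%:R <= k.+1%:R + l.+1%:R) gq).
  rewrite subrr enorm0 mulr0 lerDl lerDr !ler0n => /(_ isT isT) h.
  by apply/eqP; rewrite -subr_eq0 -enorm_eq0 eq_le h enorm_ge0.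
by exists a => k y; exact: aP.
Qed.

Lemma boundary_gauge : boundary K = [set x | j (x - x0) = 1].
Proof.
have KE x : K x <-> j (x - x0) <= 1 by rewrite jle1 addrC subrK.
rewrite /boundary (_ : closure K = K); last by apply/esym/closure_id.
apply/seteqP; split => x /=.
- move=> [Kx nKx]; apply/eqP; rewrite eq_le; apply/andP; split; first exact/KE.
  rewrite leNgt; apply/negP => jx; apply: nKx; rewrite /interior/=.
  apply/near_enorm; exists (rb * (1 - j (x - x0))); first by rewrite mulr_gt0// subr_gt0.
  move=> y; rewrite -ltr_pdivrMl// => yx; apply/KE.
  have := jL (y - x0) (x - x0); rewrite opprB addrA subrK => /ler_normlP[_]; lra.
- move=> jx; split; first by apply/KE; rewrite jx.
  rewrite /interior/= => /near_enorm[e e0 eK].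
  have n0 : 0 < enorm (x - x0).
    by rewrite enorm_gt0; apply: contra_eq_neq jx => ->; rewrite j0 eq_sym oner_neq0.
  pose t := e / 2 / enorm (x - x0); have t0 : 0 < t by rewrite !divr_gt0.
  have /eK/KE : enorm (x + t *: (x - x0) - x) < e.
    by rewrite addrAC subrr add0r enormZ gtr0_norm// divfK ?gt_eqF//; lra.
  rewrite (_ : _ - x0 = (1 + t) *: (x - x0)); last by rewrite scalerDl scale1r addrAC.
  by rewrite jZ ?addr_gt0// jx mulr1 gerDl leNgt t0.
Qed.

Lemma measurable_boundary : measurable (boundary K : set (caratheodory_type (@hausdorff_outer R m.+1 m))).
Proof.
rewrite boundary_gauge; have cj : continuous j by exact: lipschitz_enorm_continuous jL.
have mj : measurable ([set y | j y = 1] : set B).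
  apply: borel_closed.
  by apply: (@closed_comp _ _ j [set t : R | t = 1]) => [y _|]; [exact: cj|exact: closed_eq].
by have := measurable_translation x0 measurableT mj; rewrite setTI.
Qed.

(** The density contains curvatures picked by choice, so its measurability is not visible. Almost
    everywhere on the boundary it equals [g], which is [psi] at x - x0 extended by 0, and Hausdorff
    measure is complete on its Caratheodory sets. Dividing by n |a| in [psi] compensates the factor
    of the cone formula. *)
Lemma measurable_density : measurable_fun (boundary K : set (caratheodory_type (@hausdorff_outer R m.+1 m)))
  (fun x => (density x)%:E) /\
  (\int[@hausdorff R m.+1 m]_(x in boundary K) (density x)%:E =
   \int[@leb R m.+1]_(y in U) limit_defect y)%E.
Proof.
have [a aP] := gradient; pose S := smooth_sphere j.
have mS : measurable (S : set B) := measurable_smooth_sphere rbV0 jL jconv.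
have Sa y : S y -> 0 < m.+1%:R * enorm (a y).
  move=> [jy [k gy]]; rewrite mulr_gt0// enorm_gt0.
  have : dotv (a y) y = 1 by rewrite (good_euler jconv jZ j0 _ (aP k y gy)).
  by apply: contra_eq_neq => ->; rewrite dot0v eq_sym oner_neq0.
(* The inverse is written as a real power, a measurable function on the whole line. *)
pose psi y : \bar R := (limit_defect y * ((m.+1%:R * enorm (a y)) `^ (-1))%:E)%E.
have S1 y : S y -> U y.
  by move=> [jy _]; split; rewrite /= jy ?ltr01 ?lexx// invr1 scale1r.
have psi0 y : S y -> (0 <= psi y)%E.
  by move=> /S1 Uy; rewrite mule_ge0 ?limit_defect_ge0// lee_fin powR_ge0.
have mpsi : measurable_fun (S : set B) psi.
  apply: emeasurable_funM; first by apply: measurable_funTS; exact: measurable_limit_defect.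
  apply/measurable_EFinP; apply: (measurableT_comp (measurable_powR (-1))).
  by apply: measurable_funM; [exact: measurable_cst|exact: measurable_gradient_norm rbV0 jL jconv a aP].
have CU : jcone j S `<=` U.
  by move=> y [jy [jX _]]; split.
have mC : measurable (jcone j S : set B) by exact: measurable_jcone.
(* Openings do not grow when a good point is moved outwards to the surface, so points off the cone
   over the smooth sphere lie outside all [goods]. *)
have UC0 : lam m.+1 (U `\` jcone j S) = 0%E.
  apply: (@lnullS _ _ _ (~` \bigcup_k goods j k.+1%:R)); last exact: goods_ae (ltW rbV0) jL jconv.
  move=> y [[/andP[jy jy1] jX] nC] [k _ gk]; apply: nC; split; first by rewrite jy.
  split => //; exists k; have h1 : 1 <= (j y)^-1 by rewrite invf_ge1.
  exact: goods_scale jZ k y _ h1 gk.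
have IU : (\int[@leb R m.+1]_(y in U) limit_defect y = \int[@leb R m.+1]_(y in jcone j S) limit_defect y)%E.
  have mN : measurable (U `\` jcone j S : set B) by exact: measurableD.
  have mL : measurable_fun (U : set B) limit_defect by apply: measurable_funTS; exact: measurable_limit_defect.
  rewrite (@ge0_negligible_integral _ _ _ (@leb R m.+1) _ _ _ mN mU mL limit_defect_ge0 UC0).
  by rewrite setDD (setIidr CU).
have := cone_formula rbV0 jL jconv jZ j0 r10 jM aP x0 mpsi psi0.
rewrite [RHS](_ : _ = \int[@leb R m.+1]_(y in jcone j S) limit_defect y)%E; last first.
  apply: eq_integral => y /set_mem [/andP[jy _] SX].
  rewrite /psi -muleA -EFinM limit_defectZ ?invr_gt0// powR_inv1 ?(ltW (Sa _ SX))//.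
  by rewrite mulVf ?gt_eqF ?(Sa _ SX)// mule1.
rewrite -IU => {IU} <-.
have SKE : [set x | S (x - x0)] = boundary K `&` [set x | S (x - x0)].
  by apply/esym/setIidr => x [jx _]; rewrite boundary_gauge.
pose CT := caratheodory_type (@hausdorff_outer R m.+1 m).
pose g (x : CT) := (((fun x => psi (x - x0)) : CT -> \bar R) \_ [set x | S (x - x0)]) x.
have -> : (\int[@hausdorff R m.+1 m]_(x in [set x | S (x - x0)%R]) psi (x - x0)%R =
    \int[@hausdorff R m.+1 m]_(x in boundary K) g x)%E.
  by rewrite [in LHS]SKE; exact: integral_mkcondr.
have gE : g = (psi \_ S) \o (fun x => x - x0).
  by apply/funext => x; rewrite /g /patch /=.
have mg : measurable_fun setT g.
  have mr := iffLR (measurable_restrictT (psi : B -> \bar R) mS) mpsi.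
  by rewrite gE; exact: (measurableT_comp mr (measurable_translation x0)).
have mb : measurable (boundary K : set CT) := measurable_boundary.
have gae : ae_eq (@hausdorff R m.+1 m) (boundary K : set CT) g (fun x => (density x)%:E).
  (* The exceptional boundary points are null because the cone over them consists of points that are
     not smooth either. *)
  pose N := [set y | j y = 1 /\ ~ smooth_point y].
  have N0 : hausdorff_outer m N = 0%E.
    apply: (hausdorff_radial_null rbV0 jL jZ j0 r10 jM) => [y []//|].
    apply: (lnullS _ (alexandrov (ltW rbV0) jL jconv)) => y [/andP[jy _] [_ nX]] sy; apply: nX.
    by apply: smooth_pointZ; rewrite ?invr_gt0.
  have N0' : hausdorff_outer m [set x | N (x - x0)] = 0%E by rewrite (hausdorff_translation x0 N).
  exists [set x | N (x - x0)]; split => //.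
    apply: le_caratheodory_measurable => X.
    rewrite [X in (X + _)%E](_ : _ = 0%E) ?add0e; first exact: le_outer_measure.
    by apply/eqP; rewrite eq_le outer_measure_ge0 andbT -N0'; exact: le_outer_measure.
  move=> x /= nx; apply: contrapT => nN; apply: nx; rewrite boundary_gauge => /= jx.
  have sX : smooth_point (x - x0) by apply: contrapT => ?; apply: nN.
  have [k gk] := smooth_point_goods sX.
  have SX : S (x - x0) by split => //; exists k.
  rewrite gE /= /patch mem_set// /psi (limit_defectE jx _ (aP k _ gk) sX)//.
  rewrite addrC subrK -EFinM powR_inv1 ?(ltW (Sa _ SX))//; congr (_%:E).
  by rewrite mulrCA mulfK// gt_eqF// Sa.
have md : measurable_fun (boundary K : set CT) (fun x => (density x)%:E).
  apply: (ae_measurable_fun _ gae); last exact: measurable_funTS.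
  exact: measure_is_complete_caratheodory.
split => //; apply: ge0_ae_eq_integral => //.
- exact: measurable_funTS.
- by move=> x _; rewrite lee_fin affine_density_ge0.
- move=> x _; rewrite gE /= /patch; case: ifPn => // /set_mem Sx.
  exact: psi0.
- exact: ae_eq_sym.
Qed.

End limit_integral.

Theorem theorem10 (R : realType) (n : nat) (n_gt0 : (0 < n)%N)
    (r : R) (r_gt0 : 0 < r)
    (K : set 'rV[R]_n) (Kbody : convex_body K) (Kball : ball_convex r K)
    (f : 'rV[R]_n -> R) (fcont : {within K, continuous f})
    (c : R) (c_gt0 : 0 < c) (f_ge : forall x, K x -> c <= f x) :
  ((vol K - vol (floating_body r K f delta)) / delta `^ (2 / n.+1%:R))%:E
    @[delta --> 0^'+] -->
  ((2^-1 * (n.+1%:R / vol (@eball R n.-1 0 1)) `^ (2 / n.+1%:R))%:E *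
   \int[@hausdorff R n n.-1]_(x in boundary K)
     (f x `^ (- (2 / n.+1%:R)) *
      \prod_(i < n.-1)
        (principal_curvatures K x 0 i - r^-1) `^ (1 / n.+1%:R))%:E)%E.
Proof.
case: n n_gt0 K Kbody Kball f fcont f_ge => [//|m] _ K [cK convK [x0 Kx0]] Kball f fcont f_ge.
have Kconv x y t : 0 <= t <= 1 -> K x -> K y -> K ((1 - t) *: x + t *: y).
  move=> /andP[t0 t1] Kx Ky; have s0 : 0 <= 1 - t by rewrite subr_ge0.
  have s1 : 1 - t <= 1 by rewrite lerBlDr lerDl.
  have /set_mem := convK x y (Itv01 s0 s1) (mem_set Kx) (mem_set Ky).
  by move=> h; rewrite -[X in _ + X *: y](subKr 1); exact: h.
have [rb rb0 x0b] : exists2 rb : R, 0 < rb & eball x0 rb `<=` K.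
  have [e e0 eK] := iffRL (near_enorm K x0) Kx0; exists (e / 2); first exact: divr_gt0.
  by move=> y; rewrite /eball/= => yx; apply: eK; lra.
have [r1 r10 Kout] : exists2 r1 : R, 0 < r1 & K `<=` eball x0 r1.
  have cn : continuous (fun x : 'rV[R]_m.+1 => enorm (x - x0)).
    apply: (@lipschitz_enorm_continuous _ _ _ 1) => x y; rewrite mul1r.
    by apply: le_trans (ler_dist_enorm _ _) _; rewrite opprB addrA subrK.
  have [v _ vP] := EVT_max_rV (ex_intro _ x0 (interior_subset Kx0)) cK (continuous_subspaceT cn).
  exists (enorm (v - x0) + 1); first by rewrite ltr_wpDl ?enorm_ge0.
  by move=> x /mem_set /vP h; apply: le_trans h _; rewrite lerDl.
have [ds ds0 dsP] := floating_ball r cK fcont c_gt0 f_ge rb0 x0b.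
have [md dE] := measurable_density r_gt0 cK Kconv Kball fcont c_gt0 f_ge rb0 x0b r10 Kout ds0 dsP.
have := volume_derivative r_gt0 cK Kconv Kball fcont c_gt0 f_ge rb0 x0b r10 Kout ds0 dsP.
rewrite -dE; pose C : R := 2^-1 * (m.+2%:R / vol (@eball R m 0 1)) `^ (2 / m.+2%:R).
pose g x : R := f x `^ (- (2 / m.+2%:R)) * \prod_(i < m) (principal_curvatures K x 0 i - r^-1) `^ (1 / m.+2%:R).
have C0 : 0 < C by rewrite mulr_gt0 ?invr_gt0// powR_gt0// divr_gt0// om_gt0.
have gE x : affine_density r K f x = C * g x by [].
(* [affine_density] carries the constant of the theorem; it remains to take it out of the
   integral. *)
suff -> : (\int[@hausdorff R m.+1 m]_(x in boundary K) (affine_density r K f x)%:E =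
  C%:E * \int[@hausdorff R m.+1 m]_(x in boundary K) (g x)%:E)%E by [].
have gE' x : g x = C^-1 * affine_density r K f x by rewrite gE mulKf// gt_eqF.
have mb := measurable_boundary cK Kconv rb0 x0b.
have mg : measurable_fun (boundary K : set (caratheodory_type (@hausdorff_outer R m.+1 m))) (fun x => (g x)%:E).
  have -> : (fun x => (g x)%:E) = (fun x => (C^-1 * affine_density r K f x)%:E) by apply/funext => x; rewrite gE'.
  by apply/measurable_EFinP; apply: measurable_funM; [exact: measurable_cst|exact/measurable_EFinP].
have g0 x : boundary K x -> (0 <= (g x)%:E)%E.
  by move=> _; rewrite lee_fin gE' mulr_ge0 ?invr_ge0 ?(ltW C0)// affine_density_ge0.
have C0' : (0 <= C%:E)%E by rewrite lee_fin ltW.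
by rewrite -(@ge0_integralZl _ _ _ (@hausdorff R m.+1 m) _ mb _ mg _ g0 C0').
Qed.
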